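(* Let $p$ be a prime with $p\equiv 1\pmod 3$. For $k\in\mathbb{Z}\setminus\{0\}$ put $$\chi_k=\frac{2k\pi i}{\log p},\qquad c_k=\frac{(1-2^{1+\chi_k}+3^{\chi_k})\,\zeta(\chi_k)}{\chi_k(1+\chi_k)\log p},$$ $$d_{k,j}=\frac{\zeta(\chi_k,j/3)}{\chi_k(1+\chi_k)\log p}\ \text{ for } j\in\{1,-1\},\qquad d_{k,0}=d_{k,1}+d_{k,-1}=\frac{(3^{\chi_k}-1)\,\zeta(\chi_k)}{\chi_k(1+\chi_k)\log p}.$$ Then for every positive integer $N$ the following exact formula holds: $$v_p(T(N))=N\log_p\frac{2}{\sqrt3}+N\,\Phi(\log_p N)+\Psi(N)+\frac19\log_p N+f_0(N),$$ where: (i) the function $\Phi(x)=\sum_{k\in\mathbb{Z}\setminus\{0\}}c_k e^{2k\pi i x}$ is $1$-periodic and continuous on $\mathbb{R}$; (ii) the function $$\Psi(N)=\Bigl(N+\frac13\Bigr)\psi_{1}\Bigl(\log_p\Bigl(N+\frac13\Bigr)\Bigr)+\Bigl(N-\frac13\Bigr)\psi_{-1}\Bigl(\log_p\Bigl(N-\frac13\Bigr)\Bigr)-N\,\psi_0(\log_p N)$$ is expressed in terms of the continuous $1$-periodic functions $\psi_j(x)=\sum_{k\in\mathbb{Z}\setminus\{0\}}d_{k,j}e^{2k\pi i x}$, $j\in\{-1,0,1\}$, and satisfies $\Psi(N)=O(N^{1/2}\log N)$ as $N\to\infty$; (iii) the term $f_0(N)$ is $$f_0(N)=\frac13\log_p\biggl(\frac{\Gamma(\frac13)}{\Gamma(\frac23)}\biggr)+\frac{g_1(N)-g_{-1}(N)}{6}-\frac{1}{9\log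 p}+\frac{p+1}{6(p-1)},$$ where, for $j\in\{1,-1\}$, $$g_j(N)=\Bigl(1+\frac{j}{3N}\Bigr)N\log_p\Bigl(1+\frac{j}{3N}\Bigr)=\frac{j}{3\log p}+O\Bigl(\frac1N\Bigr)\qquad(N\to\infty),$$ and thus $$\lim_{N\to\infty}f_0(N)=\frac13\log_p\biggl(\frac{\Gamma(\frac13)}{\Gamma(\frac23)}\biggr)+\frac{p+1}{6(p-1)}.$$
   Context: For a positive integer $N$, $T(N)=\prod_{j=0}^{N-1}\frac{(3j+1)!}{(N+j)!}$ (the number of $N\times N$ alternating sign matrices, a positive integer). For a positive integer $m$, $v_p(m)$ is the $p$-adic valuation, i.e. the largest $k$ such that $p^k$ divides $m$. $\log$ is the natural logarithm, $\log_p x=\log x/\log p$, and $a^{z}=e^{z\log a}$ for real $a>0$. The prime $p$ is fixed and implied constants in $O$-terms may depend on $p$. The Hurwitz zeta function is used with arbitrary real second argument: for $\alpha\in\mathbb{R}$, $\zeta(s,\alpha)=\sum_{n\in\mathbb{Z},\,n>-\alpha}(n+\alpha)^{-s}$ for $\operatorname{Re}s>1$, extended to all other $s\neq1$ by analytic continuation. For $0<\alpha\le1$ this is the usual Hurwitz zeta function; it is $1$-periodic in $\alpha$ (so $\zeta(s,-1/3)=\zeta(s,2/3)$), and for $\alpha\in\mathbb{Z}$ it equals the Riemann zeta function $\zeta(s)$. *)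

(* Defs.v *)
From mathcomp Require Import all_boot.
From Stdlib Require Import Reals ZArith ClassicalEpsilon.
From Coquelicot Require Import Coquelicot.

Open Scope R_scope.

(* The division is exact, although the individual factors
   (3j+1)!/(N+j)! need not be integers. *)
Definition T (N : nat) : nat :=
  ((\prod_(j < N) (3 * j + 1)`!) %/ (\prod_(j < N) (N + j)`!))%nat.

Definition logb (p : nat) (x : R) : R := ln x / ln (INR p).

Definition Gamma (x : R) : R :=
  RInt_gen (fun t => Rpower t (x - 1) * exp (- t))
    (at_right 0) (Rbar_locally p_infty).

Definition Cexp (z : C) : C :=
  (exp (Re z) * cos (Im z), exp (Re z) * sin (Im z)).

(* a^z with the real logarithm of a; meaningful for a > 0. *)
Definition Rcpow (a : R) (z : C) : C := Cexp (z * ln a)%C.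

Definition analytic_at (f : C -> C) (z0 : C) : Prop :=
  exists (a : nat -> C) (r : R), 0 < r /\
    forall z : C, Cmod (z - z0) < r ->
      is_pseries (K := C_AbsRing) (V := C_NormedModule) a (z - z0)%C (f z).

(* [up (- alpha)] is the least integer n with n > - alpha. *)
Definition is_hurwitz_zeta (alpha : R) (f : C -> C) : Prop :=
  (forall s : C, 1 < Re s ->
     is_series (K := C_AbsRing) (V := C_NormedModule)
       (fun n : nat => Rcpow (IZR (up (- alpha) + Z.of_nat n) + alpha) (- s)%C)
       (f s)) /\
  (forall s : C, s <> RtoC 1 -> analytic_at f s).

(* [is_hurwitz_zeta alpha] determines f on the connected set C \ {1}; the value
   at s = 1 is unspecified. *)
Definition hurwitz_zeta (s : C) (alpha : R) : C :=
  epsilon (inhabits (fun _ : C => RtoC 0)) (is_hurwitz_zeta alpha) s.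

Definition riemann_zeta (s : C) : C := hurwitz_zeta s 1.

(* Sums over Z \ {0} carry no order of summation, hence mean absolutely
   convergent sums; for these, [Zstar_sum] is the sum. *)
Definition Zstar_summable (a : Z -> C) : Prop :=
  ex_series (fun n : nat => Cmod (a (Z.of_nat n.+1))) /\
  ex_series (fun n : nat => Cmod (a (- Z.of_nat n.+1)%Z)).

Definition Cseries (b : nat -> C) : C :=
  (Series (fun n => Re (b n)), Series (fun n => Im (b n))).

Definition Zstar_sum (a : Z -> C) : C :=
  (Cseries (fun n => a (Z.of_nat n.+1)) +
   Cseries (fun n => a (- Z.of_nat n.+1)%Z))%C.

Definition fourier_term (a : Z -> C) (x : R) (k : Z) : C :=
  (a k * Cexp (2 * IZR k * PI * Ci * x))%C.

Definition fourier (a : Z -> C) (x : R) : C := Zstar_sum (fourier_term a x).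

Definition chi (p : nat) (k : Z) : C := (2 * IZR k * PI * Ci / ln (INR p))%C.

Definition den (p : nat) (k : Z) : C :=
  (chi p k * (1 + chi p k) * ln (INR p))%C.

Definition c (p : nat) (k : Z) : C :=
  ((1 - Rcpow 2 (1 + chi p k) + Rcpow 3 (chi p k)) * riemann_zeta (chi p k)
     / den p k)%C.

Definition d_shift (p : nat) (j k : Z) : C :=
  (hurwitz_zeta (chi p k) (IZR j / 3) / den p k)%C.

(* Used for j in {-1, 0, 1} only. *)
Definition d (p : nat) (j k : Z) : C :=
  if (j =? 0)%Z then (d_shift p 1 k + d_shift p (-1) k)%C else d_shift p j k.

Definition Phi (p : nat) (x : R) : C := fourier (c p) x.

Definition psi (p : nat) (j : Z) (x : R) : C := fourier (d p j) x.

Definition Psi (p N : nat) : C :=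
  ((INR N + 1 / 3)%R * psi p 1 (logb p (INR N + 1 / 3))
   + (INR N - 1 / 3)%R * psi p (-1) (logb p (INR N - 1 / 3))
   - INR N * psi p 0 (logb p (INR N)))%C.

Definition g (p : nat) (j : Z) (N : nat) : R :=
  (1 + IZR j / (3 * INR N)) * INR N * logb p (1 + IZR j / (3 * INR N)).

Definition f0 (p N : nat) : R :=
  1 / 3 * logb p (Gamma (1 / 3) / Gamma (2 / 3))
  + (g p 1 N - g p (-1) N) / 6
  - 1 / (9 * ln (INR p))
  + (INR p + 1) / (6 * (INR p - 1)).

Definition bigO (u v : nat -> R) : Prop :=
  exists K : R, eventually (fun N => Rabs (u N) <= K * Rabs (v N)).

(* Main.v *)
(* Put L = log p and P_alpha(u) = sum_{k <> 0} zeta(chi_k, alpha) e^{2 k pi i u}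
   / (chi_k (1 + chi_k) L).  The 1-periodic function B with Fourier coefficients
   1 / (chi_k (1 + chi_k) L) is elementary, and the translates B(u - log_p (n + alpha)),
   n < p^J, add up to a function whose coefficients carry the partial sums of
   zeta(chi_k, alpha).  Combining the levels J and J + 1 removes the divergent
   part m^{1-s} / (1 - s), and at m = p^J, s = chi_k, m^{-s} = 1, so that in the limit
   the coefficients of P_alpha appear.  The sums have Hoelder exponent 3/4 uniformly
   in J, so Bernstein's theorem gives absolute convergence and P_alpha is continuous.
   On the other side the sums are evaluated in closed form: for all X > 0,
   X P_alpha(log_p X) equals the sum of p^k rho_alpha(X / p^k) over k >= 1, up to
   elementary terms, where rho_alpha(y) = sum_{n >= 0} max(0, y - n - alpha).

   By Legendre's formula v_p(T(N)) is the sum over m = p^k of a function of N mod m,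
   which for m = 1 mod 6 is m times rho_{1/3}((N + 1/3) / m) + rho_{2/3}((N - 1/3) / m)
   - 2 rho_{1/2}(N / m).  Three instances of the closed form give the theorem, since
   zeta(s, 1/3) + zeta(s, 2/3) = (3^s - 1) zeta(s) and zeta(s, 1/2) = (2^s - 1) zeta(s).
   The constants are Stirling constants; Gamma enters through Wendel's inequality. *)

From mathcomp Require Import zify.
Require Import Defs.
From mathcomp Require Import all_boot.
From Stdlib Require Import Reals ZArith Lra Lia Psatz Classical.
From Coquelicot Require Import Coquelicot.
From HB Require Import structures.

Open Scope R_scope.

(** The points [chi p k] lie on Re s = 0, where the Dirichlet series diverges. Growth bounds for
    zeta on that line are avoided: absolute convergence is drawn from the smoothness of the limit
    function, which contains a Takagi-type sum of P^-i h(x P^i) with h bounded and Lipschitz. From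
    min(2^-i, d) <= 2^(-i/4) d^(3/4) this sum has exponent 3/4, and a factor 2^(-i/4) is left for
    summing over i; hence the number r with r^4 = 1/2 throughout. Bernstein's argument costs 2^(j/2)
    on the j-th dyadic block of frequencies and turns r^(3j) into the summable r^j. The hypothesis p
    = 1 mod 3 enters twice. It makes every p^k equal to 1 mod 6, which is what places the kinks at
    the arguments N + 1/3, N - 1/3 and N; and at these arguments it makes the Takagi-type sums
    constant ([Hinf_values]), so that no further oscillating term survives. Integrals over a period
    are replaced by sums over 2m + 1 equidistant points, where inversion and Parseval are exact
    identities between finite sums. *)

HB.instance Definition _ := Monoid.isComLaw.Build R 0 Rplus
  (fun x y z => esym (Rplus_assoc x y z)) Rplus_comm Rplus_0_l.
HB.instance Definition _ := Monoid.isMulLaw.Build R 0 Rmult Rmult_0_l Rmult_0_r.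
HB.instance Definition _ := Monoid.isAddLaw.Build R Rmult Rplus
  (fun x y z => Rmult_plus_distr_r x y z) (fun x y z => Rmult_plus_distr_l x y z).
HB.instance Definition _ := Monoid.isComLaw.Build C (RtoC 0) Cplus
  Cplus_assoc Cplus_comm Cplus_0_l.
HB.instance Definition _ := Monoid.isMulLaw.Build C (RtoC 0) Cmult Cmult_0_l Cmult_0_r.
HB.instance Definition _ := Monoid.isAddLaw.Build C Cmult Cplus
  (fun x y z => Cmult_plus_distr_r x y z) (fun x y z => Cmult_plus_distr_l x y z).

(** * Finite sums of real and complex numbers *)

Notation "\rsum_ ( i < n ) F" := (\big[Rplus/0%R]_(0%nat <= i < n%nat) F%R)
  (at level 41, F at level 41, i, n at level 50, format "\rsum_ ( i  <  n )  F").
Notation "\csum_ ( i < n ) F" := (\big[Cplus/RtoC 0%R]_(0%nat <= i < n%nat) F%C)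
  (at level 41, F at level 41, i, n at level 50, format "\csum_ ( i  <  n )  F").

Lemma rsum0 (a : nat -> R) : \rsum_(i < 0) a i = 0.
Proof. by rewrite big_geq. Qed.

Lemma rsumS (a : nat -> R) n : \rsum_(i < n.+1) a i = \rsum_(i < n) a i + a n.
Proof. by rewrite big_nat_recr. Qed.

Lemma csum0 (a : nat -> C) : \csum_(i < 0) a i = RtoC 0.
Proof. by rewrite big_geq. Qed.

Lemma csumS (a : nat -> C) n : \csum_(i < n.+1) a i = (\csum_(i < n) a i + a n)%C.
Proof. by rewrite big_nat_recr. Qed.

Lemma rsum_ext n (a b : nat -> R) : (forall i, (i < n)%nat -> a i = b i) ->
  \rsum_(i < n) a i = \rsum_(i < n) b i.
Proof. by move=> H; apply: eq_big_nat => i /andP[_ Hi]; apply: H. Qed.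

Lemma csum_ext n (a b : nat -> C) : (forall i, (i < n)%nat -> a i = b i) ->
  \csum_(i < n) a i = \csum_(i < n) b i.
Proof. by move=> H; apply: eq_big_nat => i /andP[_ Hi]; apply: H. Qed.

Lemma rsum_plus n (a b : nat -> R) :
  \rsum_(i < n) (a i + b i) = \rsum_(i < n) a i + \rsum_(i < n) b i.
Proof. exact: big_split. Qed.

Lemma csum_plus n (a b : nat -> C) :
  \csum_(i < n) (a i + b i) = (\csum_(i < n) a i + \csum_(i < n) b i)%C.
Proof. exact: big_split. Qed.

Lemma rsum_scal n c (a : nat -> R) : \rsum_(i < n) (c * a i) = c * \rsum_(i < n) a i.
Proof. by rewrite big_distrr. Qed.

Lemma csum_scal n c (a : nat -> C) : \csum_(i < n) (c * a i) = (c * \csum_(i < n) a i)%C.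
Proof. by rewrite big_distrr. Qed.

Lemma csum_scalr n c (a : nat -> C) : \csum_(i < n) (a i * c) = ((\csum_(i < n) a i) * c)%C.
Proof. by rewrite big_distrl. Qed.

Lemma rsum_minus n (a b : nat -> R) :
  \rsum_(i < n) (a i - b i) = \rsum_(i < n) a i - \rsum_(i < n) b i.
Proof. by elim: n => [|n IH]; rewrite ?rsum0 ?rsumS ?IH; ring. Qed.

Lemma csum_minus n (a b : nat -> C) :
  \csum_(i < n) (a i - b i) = (\csum_(i < n) a i - \csum_(i < n) b i)%C.
Proof. by elim: n => [|n IH]; rewrite ?csum0 ?csumS ?IH; ring. Qed.

Lemma rsum_switch n m (a : nat -> nat -> R) :
  \rsum_(i < n) \rsum_(j < m) a i j = \rsum_(j < m) \rsum_(i < n) a i j.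
Proof. exact: exchange_big. Qed.

Lemma csum_switch n m (a : nat -> nat -> C) :
  \csum_(i < n) \csum_(j < m) a i j = \csum_(j < m) \csum_(i < n) a i j.
Proof. exact: exchange_big. Qed.

Lemma rsum_le n (a b : nat -> R) : (forall i, (i < n)%nat -> a i <= b i) ->
  \rsum_(i < n) a i <= \rsum_(i < n) b i.
Proof.
elim: n => [|n IH] H; first by rewrite !rsum0; lra.
rewrite !rsumS; apply: Rplus_le_compat; last exact: H.
by apply: IH => i Hi; apply: H; lia.
Qed.

Lemma rsum_const n c : \rsum_(i < n) c = INR n * c.
Proof. by elim: n => [|n IH]; rewrite ?rsum0 ?rsumS ?IH ?S_INR /=; ring. Qed.

Lemma rsum_ge0 n (a : nat -> R) : (forall i, (i < n)%nat -> 0 <= a i) ->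
  0 <= \rsum_(i < n) a i.
Proof.
move=> H; apply: Rle_trans (rsum_le _ (fun=> 0) _ H).
by rewrite rsum_const; lra.
Qed.

Lemma rsum_le_len n m (a : nat -> R) : (forall i, 0 <= a i) -> (n <= m)%nat ->
  \rsum_(i < n) a i <= \rsum_(i < m) a i.
Proof.
move=> H /subnKC <-; elim: (m - n)%nat => [|k IH]; first by rewrite addn0; lra.
by rewrite addnS rsumS; have := H (n + k)%nat; lra.
Qed.

Lemma rsum_cat n m (a : nat -> R) :
  \rsum_(i < n + m) a i = \rsum_(i < n) a i + \rsum_(i < m) a (n + i)%nat.
Proof.
by elim: m => [|m IH]; rewrite ?addn0 ?rsum0 ?addnS ?rsumS ?IH; ring.
Qed.

Lemma csum_cat n m (a : nat -> C) :
  \csum_(i < n + m) a i = (\csum_(i < n) a i + \csum_(i < m) a (n + i)%nat)%C.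
Proof.
by elim: m => [|m IH]; rewrite ?addn0 ?csum0 ?addnS ?csumS ?IH; ring.
Qed.

Lemma rsum_block n d (a : nat -> R) :
  \rsum_(i < n * d) a i = \rsum_(i < n) \rsum_(j < d) a (i * d + j)%nat.
Proof.
elim: n => [|n IH]; first by rewrite mul0n !rsum0.
by rewrite mulSn addnC rsum_cat rsumS IH.
Qed.

Lemma csum_block n d (a : nat -> C) :
  \csum_(i < n * d) a i = \csum_(i < n) \csum_(j < d) a (i * d + j)%nat.
Proof.
elim: n => [|n IH]; first by rewrite mul0n !csum0.
by rewrite mulSn addnC csum_cat csumS IH.
Qed.

Lemma csum_const n c : \csum_(i < n) c = (INR n * c)%C.
Proof.
elim: n => [|n IH]; rewrite ?csum0 ?csumS ?IH ?S_INR /= ?RtoC_plus; ring.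
Qed.

Lemma csum_tele n (a : nat -> C) : \csum_(i < n) (a i - a i.+1) = (a 0%nat - a n)%C.
Proof. by elim: n => [|n IH]; rewrite ?csum0 ?csumS ?IH; ring. Qed.

Lemma rsum_tele n (a : nat -> R) : \rsum_(i < n) (a i - a i.+1) = a 0%nat - a n.
Proof. by elim: n => [|n IH]; rewrite ?rsum0 ?rsumS ?IH; ring. Qed.

Lemma Rabs_rsum n (a : nat -> R) : Rabs (\rsum_(i < n) a i) <= \rsum_(i < n) Rabs (a i).
Proof.
elim: n => [|n IH]; first by rewrite !rsum0 Rabs_R0; lra.
by rewrite !rsumS; apply: Rle_trans (Rabs_triang _ _) _; lra.
Qed.

Lemma Cmod_csum n (a : nat -> C) : Cmod (\csum_(i < n) a i) <= \rsum_(i < n) Cmod (a i).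
Proof.
elim: n => [|n IH]; first by rewrite csum0 rsum0 Cmod_0; lra.
by rewrite csumS rsumS; apply: Rle_trans (Cmod_triangle _ _) _; lra.
Qed.

Lemma RtoC_rsum n (a : nat -> R) : RtoC (\rsum_(i < n) a i) = \csum_(i < n) RtoC (a i).
Proof. by elim: n => [|n IH]; rewrite ?rsum0 ?csum0 // rsumS csumS RtoC_plus IH. Qed.

Lemma Re_csum n (a : nat -> C) : Re (\csum_(i < n) a i) = \rsum_(i < n) Re (a i).
Proof. by elim: n => [|n IH]; rewrite ?rsum0 ?csum0 // rsumS csumS re_plus IH. Qed.

Lemma Im_csum n (a : nat -> C) : Im (\csum_(i < n) a i) = \rsum_(i < n) Im (a i).
Proof. by elim: n => [|n IH]; rewrite ?rsum0 ?csum0 // rsumS csumS im_plus IH. Qed.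

Lemma sum_n_rsum (a : nat -> R) n : sum_n a n = \rsum_(i < n.+1) a i.
Proof.
elim: n => [|n IH]; first by rewrite sum_O rsumS rsum0 Rplus_0_l.
by rewrite sum_Sn IH [RHS]rsumS.
Qed.

Lemma sum_n_csum (a : nat -> C_NormedModule) n : sum_n a n = \csum_(i < n.+1) a i.
Proof.
elim: n => [|n IH]; first by rewrite sum_O csumS csum0 Cplus_0_l.
by rewrite sum_Sn IH [RHS]csumS.
Qed.

Lemma is_series_rsum (a : nat -> R) (l : R) :
  is_series a l <-> is_lim_seq (fun n => \rsum_(i < n) a i) l.
Proof.
have E : forall n, sum_n a n = \rsum_(i < n.+1) a i by move=> n; exact: sum_n_rsum.
split=> [H|/is_lim_seq_incr_1 H].
  by apply/is_lim_seq_incr_1; apply: (is_lim_seq_ext _ _ (Finite l) E H).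
exact: (is_lim_seq_ext _ _ (Finite l) (fun n => esym (E n)) H).
Qed.

(** * Limits and absolutely convergent series of complex numbers *)

(** Expressed through the modulus, so that squeezing and limit algebra reduce to real sequences. *)
Definition Clim (u : nat -> C) (l : C) := is_lim_seq (fun n => Cmod (u n - l)) 0.

Definition csums (a : nat -> C) (l : C) := Clim (fun n => \csum_(i < n) a i) l.

Lemma is_lim_seq_squeeze0 (u v : nat -> R) :
  (forall n, 0 <= u n <= v n) -> is_lim_seq v 0 -> is_lim_seq u 0.
Proof.
by move=> H Hv; apply: (is_lim_seq_le_le (fun=> 0) _ v) => //; apply: is_lim_seq_const.
Qed.

Lemma is_lim_seq_0_eps (u : nat -> R) : is_lim_seq u 0 <->
  forall e, 0 < e -> exists N : nat, forall n, (N <= n)%nat -> Rabs (u n) < e.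
Proof.
split=> [/is_lim_seq_spec H e He|H].
  case: (H (mkposreal e He)) => N /= HN; exists N => n Hn.
  by rewrite -(Rminus_0_r (u n)); apply: HN; apply/leP.
apply/is_lim_seq_spec => e; case: (H e (cond_pos e)) => N HN.
by exists N => n /leP Hn; rewrite Rminus_0_r; apply: HN.
Qed.

Lemma Clim_eps (u : nat -> C) l : Clim u l <->
  forall e, 0 < e -> exists N : nat, forall n, (N <= n)%nat -> Cmod (u n - l) < e.
Proof.
split=> [/is_lim_seq_0_eps H e /H[N HN]|H].
  by exists N => n /HN; rewrite Rabs_pos_eq //; apply: Cmod_ge_0.
apply/is_lim_seq_0_eps => e /H[N HN]; exists N => n /HN.
by rewrite Rabs_pos_eq //; apply: Cmod_ge_0.
Qed.

Lemma Clim_ext u v l : (forall n, u n = v n) -> Clim u l -> Clim v l.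
Proof. by move=> H; apply: is_lim_seq_ext => n; rewrite H. Qed.

Lemma Clim_ext_loc u v l (N : nat) :
  (forall n, (N <= n)%nat -> u n = v n) -> Clim u l -> Clim v l.
Proof.
by move=> H; apply: is_lim_seq_ext_loc; exists N => n /leP Hn; rewrite H.
Qed.

Lemma Clim_const l : Clim (fun=> l) l.
Proof.
apply: (is_lim_seq_ext (fun=> 0)); last exact: is_lim_seq_const.
by move=> n; rewrite /Cminus Cplus_opp_r Cmod_0.
Qed.

Lemma Clim_plus u v l m : Clim u l -> Clim v m -> Clim (fun n => (u n + v n)%C) (l + m).
Proof.
move=> Hu Hv; apply: is_lim_seq_squeeze0 (_ : is_lim_seq (fun n => Cmod (u n - l) + Cmod (v n - m)) 0).
  move=> n; split; first exact: Cmod_ge_0.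
  have -> : (u n + v n - (l + m) = (u n - l) + (v n - m))%C by ring.
  exact: Cmod_triangle.
have := is_lim_seq_plus' _ _ _ _ Hu Hv; by rewrite Rplus_0_r.
Qed.

Lemma Clim_scal c u l : Clim u l -> Clim (fun n => (c * u n)%C) (c * l).
Proof.
move=> Hu; apply: (is_lim_seq_ext (fun n => Cmod c * Cmod (u n - l))).
  by move=> n; rewrite -Cmod_mult; congr Cmod; ring.
have := is_lim_seq_scal_l _ (Cmod c) _ Hu; rewrite /= Rmult_0_r //.
Qed.

Lemma Clim_minus u v l m : Clim u l -> Clim v m -> Clim (fun n => (u n - v n)%C) (l - m).
Proof.
move=> Hu Hv; have := Clim_plus _ _ _ _ Hu (Clim_scal (-1)%R _ _ Hv).
have -> : (l + (-1)%R * m = l - m)%C by rewrite -(Cmult_1_l m) /Cminus; ring.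
by apply: Clim_ext => n; ring.
Qed.

Lemma Clim_bounded u l : Clim u l -> exists M, forall n, Cmod (u n) <= M.
Proof.
move=> Hu; have [M HM] : exists M, forall n, Rabs (Cmod (u n - l)) <= M.
  have [M HM] := filterlim_bounded (K := R_AbsRing) (V := R_NormedModule)
    (fun n => Cmod (u n - l)) (ex_intro _ 0 Hu).
  by exists M => n; apply: HM.
exists (M + Cmod l) => n; have -> : u n = (u n - l + l)%C by ring.
apply: Rle_trans (Cmod_triangle _ _) _.
by have := HM n; rewrite Rabs_pos_eq; [lra|exact: Cmod_ge_0].
Qed.

Lemma Clim_0_squeeze (u : nat -> C) (v : nat -> R) :
  (forall n, Cmod (u n) <= v n) -> is_lim_seq v 0 -> Clim u 0.
Proof.
move=> H; apply: is_lim_seq_squeeze0 => n; split; first exact: Cmod_ge_0.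
by have -> : (u n - 0 = u n)%C by ring.
Qed.

Lemma Clim_squeeze (u : nat -> C) l (v : nat -> R) :
  (forall n, Cmod (u n - l) <= v n) -> is_lim_seq v 0 -> Clim u l.
Proof. by move=> H; apply: is_lim_seq_squeeze0 => n; split; first exact: Cmod_ge_0. Qed.

Lemma Clim_mult u v l m : Clim u l -> Clim v m -> Clim (fun n => (u n * v n)%C) (l * m).
Proof.
move=> Hu Hv; have [M HM] := Clim_bounded _ _ Hv.
apply: (Clim_squeeze _ _ (fun n => M * Cmod (u n - l) + Cmod l * Cmod (v n - m))).
  move=> n.
  have -> : (u n * v n - l * m = v n * (u n - l) + l * (v n - m))%C by ring.
  apply: Rle_trans (Cmod_triangle _ _) _; rewrite !Cmod_mult.
  apply: Rplus_le_compat_r; apply: Rmult_le_compat_r => //; exact: Cmod_ge_0.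
have H1 := is_lim_seq_scal_l _ M _ Hu; have H2 := is_lim_seq_scal_l _ (Cmod l) _ Hv.
have := is_lim_seq_plus' _ _ _ _ H1 H2; by rewrite /= !Rmult_0_r Rplus_0_r.
Qed.

Lemma Clim_unique u l m : Clim u l -> Clim u m -> l = m.
Proof.
move=> Hl Hm; apply/Ceq_minus.
have H0 := Clim_minus _ _ _ _ Hl Hm.
have H1 : is_lim_seq (fun=> Cmod (l - m)) 0.
  apply: is_lim_seq_ext H0 => n.
  by rewrite -Cmod_opp; congr Cmod; ring.
have := is_lim_seq_unique _ _ H1; rewrite Lim_seq_const => -[H].
exact: Cmod_eq_0.
Qed.

Lemma Clim_subseq u l (phi : nat -> nat) :
  (forall n, (n <= phi n)%nat) -> Clim u l -> Clim (fun n => u (phi n)) l.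
Proof.
move=> Hphi /Clim_eps H; apply/Clim_eps => e /H[N HN].
by exists N => n Hn; apply: HN; apply: leq_trans Hn _.
Qed.

Lemma Clim_Re u l : Clim u l -> is_lim_seq (fun n => Re (u n)) (Re l).
Proof.
move=> H; apply: (is_lim_seq_ext (fun n => Re (u n - l) + Re l)).
  by move=> n; rewrite /Cminus re_plus re_opp; ring.
have -> : Finite (Re l) = Finite (0 + Re l) by rewrite Rplus_0_l.
apply: is_lim_seq_plus'; last exact: is_lim_seq_const.
apply/is_lim_seq_abs_0; apply: is_lim_seq_squeeze0 H => n.
split; [exact: Rabs_pos|exact: re_le_Cmod].
Qed.

Lemma im_le_Cmod c : Rabs (Im c) <= Cmod c.
Proof. by have := Rmax_Cmod c; apply: Rle_trans; exact: Rmax_r. Qed.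

Lemma Clim_Im u l : Clim u l -> is_lim_seq (fun n => Im (u n)) (Im l).
Proof.
move=> H; apply: (is_lim_seq_ext (fun n => Im (u n - l) + Im l)).
  by move=> n; rewrite /Cminus im_plus im_opp; ring.
have -> : Finite (Im l) = Finite (0 + Im l) by rewrite Rplus_0_l.
apply: is_lim_seq_plus'; last exact: is_lim_seq_const.
apply/is_lim_seq_abs_0; apply: is_lim_seq_squeeze0 H => n.
split; [exact: Rabs_pos|exact: im_le_Cmod].
Qed.

Lemma Cmod_le_ReIm c : Cmod c <= Rabs (Re c) + Rabs (Im c).
Proof.
have E : c = (RtoC (Re c) + Ci * RtoC (Im c))%C.
  by case: c => x y; rewrite /Cplus /Cmult /RtoC /Ci /Re /Im /=; f_equal; ring.
rewrite {1}E; apply: Rle_trans (Cmod_triangle _ _) _.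
by rewrite Cmod_mult Cmod_Ci Rmult_1_l !Cmod_R; lra.
Qed.

Lemma Clim_ReIm u (x y : R) : is_lim_seq (fun n => Re (u n)) x ->
  is_lim_seq (fun n => Im (u n)) y -> Clim u (x, y).
Proof.
move=> Hx Hy; apply: (Clim_squeeze _ _ (fun n => Rabs (Re (u n) - x) + Rabs (Im (u n) - y))).
  by move=> n; apply: Rle_trans (Cmod_le_ReIm _) _; apply: Req_le.
rewrite -(Rplus_0_r 0); apply: is_lim_seq_plus'.
  apply/(is_lim_seq_abs_0 (fun n => Re (u n) - x)); rewrite -(Rminus_diag x).
  by apply: is_lim_seq_minus' => //; apply: is_lim_seq_const.
apply/(is_lim_seq_abs_0 (fun n => Im (u n) - y)); rewrite -(Rminus_diag y).
by apply: is_lim_seq_minus' => //; apply: is_lim_seq_const.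
Qed.

Lemma Clim_RtoC (u : nat -> R) (l : R) : is_lim_seq u l -> Clim (fun n => RtoC (u n)) l.
Proof. by move=> H; apply: Clim_ReIm => //; apply: is_lim_seq_const. Qed.

Lemma Clim_le u l M : Clim u l -> (forall n, Cmod (u n) <= M) -> Cmod l <= M.
Proof.
move=> Hu HM; apply: le_epsilon => e He.
have /Clim_eps/(_ e He)[N /(_ _ (leqnn N)) HN] := Hu.
have -> : l = (u N - (u N - l))%C by ring.
by apply: Rle_trans (Cmod_triangle _ _) _; rewrite Cmod_opp; have := HM N; lra.
Qed.

Lemma csums_ext a b l : (forall n, a n = b n) -> csums a l -> csums b l.
Proof. by move=> H; apply: Clim_ext => n; apply: csum_ext => i _. Qed.

Lemma csums_plus a b l m : csums a l -> csums b m -> csums (fun n => a n + b n)%C (l + m).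
Proof.
by move=> Ha Hb; apply: Clim_ext (Clim_plus _ _ _ _ Ha Hb) => n; rewrite csum_plus.
Qed.

Lemma csums_minus a b l m : csums a l -> csums b m -> csums (fun n => a n - b n)%C (l - m).
Proof.
by move=> Ha Hb; apply: Clim_ext (Clim_minus _ _ _ _ Ha Hb) => n; rewrite csum_minus.
Qed.

Lemma csums_scal c a l : csums a l -> csums (fun n => c * a n)%C (c * l).
Proof. by move=> Ha; apply: Clim_ext (Clim_scal c _ _ Ha) => n; rewrite csum_scal. Qed.

Lemma csums_unique a l m : csums a l -> csums a m -> l = m.
Proof. exact: Clim_unique. Qed.

Lemma csums_0 : csums (fun=> RtoC 0) 0.
Proof. apply: Clim_ext (Clim_const 0) => n; rewrite csum_const; ring. Qed.

Lemma csums_csum (n : nat) (a : nat -> nat -> C) (l : nat -> C) :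
  (forall i, (i < n)%nat -> csums (a i) (l i)) ->
  csums (fun k => \csum_(i < n) a i k) (\csum_(i < n) l i).
Proof.
elim: n => [|n IH] H.
  rewrite csum0; apply: csums_ext csums_0 => k; by rewrite csum0.
rewrite csumS; have := csums_plus _ _ _ _ (IH (fun i Hi => H i (ltnW Hi))) (H n (leqnn _)).
by apply: csums_ext => k; rewrite csumS.
Qed.

Lemma csums_ge (n : nat) a l : csums a (l + \csum_(i < n) a i) <-> csums (fun k => a (n + k)%nat) l.
Proof.
split=> H.
  have H1 := Clim_subseq _ _ (fun k => (n + k)%nat) (fun k => leq_addl n k) H.
  have := Clim_minus _ _ _ _ H1 (Clim_const (\csum_(i < n) a i)).
  have -> : (l + \csum_(i < n) a i - \csum_(i < n) a i = l)%C by ring.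
  by apply: Clim_ext => k; rewrite csum_cat; ring.
apply/Clim_eps => e He; have /Clim_eps/(_ e He)[N HN] := H.
exists (n + N)%nat => k Hk; have -> : k = (n + (k - n))%nat by lia.
rewrite csum_cat.
have -> : (\csum_(i < n) a i + \csum_(i < k - n) a (n + i)%nat - (l + \csum_(i < n) a i) =
  \csum_(i < k - n) a (n + i)%nat - l)%C by ring.
apply: HN; lia.
Qed.

Lemma is_series_csums (a : nat -> C_NormedModule) (l : C) :
  is_series (K := C_AbsRing) (V := C_NormedModule) a l <-> csums a l.
Proof.
split=> H.
  have H1 : is_lim_seq (fun n => Cmod (sum_n a n - l)) 0.
    apply/is_lim_seq_0_eps => e He.
    have [N HN] : eventually (fun n => ball_norm (K := C_AbsRing) (V := C_NormedModule) l (mkposreal e He) (sum_n a n)).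
      by apply: H; apply: locally_le_locally_norm; apply: locally_norm_ball_norm.
    exists N => n /leP /HN Hn; rewrite Rabs_pos_eq; last exact: Cmod_ge_0.
    exact: Hn.
  apply/is_lim_seq_incr_1; apply: is_lim_seq_ext H1 => n.
  by rewrite sum_n_csum.
move/is_lim_seq_incr_1: H => H P HP.
case/locally_norm_le_locally: HP => e He.
have /is_lim_seq_0_eps/(_ _ (cond_pos e))[N HN] := H.
exists N => n /leP Hn; apply: He; rewrite /ball_norm sum_n_csum.
have := HN n Hn; rewrite Rabs_pos_eq //; exact: Cmod_ge_0.
Qed.

Lemma is_lim_seq_rsum (a : nat -> R) : ex_series a ->
  is_lim_seq (fun n => \rsum_(i < n) a i) (Series a).
Proof. by move/Series_correct/is_series_rsum. Qed.

Lemma rsum_le_Series (a : nat -> R) n : (forall i, 0 <= a i) -> ex_series a ->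
  \rsum_(i < n) a i <= Series a.
Proof.
move=> H /is_lim_seq_rsum Ha.
have := is_lim_seq_le_loc (fun=> \rsum_(i < n) a i) _ (\rsum_(i < n) a i) (Series a) _ _ Ha.
apply; last exact: is_lim_seq_const.
by exists n => k /leP Hk; apply: rsum_le_len.
Qed.

Lemma ex_series_bounded (a : nat -> R) M : (forall i, 0 <= a i) ->
  (forall n, \rsum_(i < n) a i <= M) -> ex_series a /\ Series a <= M.
Proof.
move=> H HM.
have [l Hl] : ex_finite_lim_seq (fun n => \rsum_(i < n) a i).
  by apply: (ex_finite_lim_seq_incr _ M) => // n; rewrite rsumS; have := H n; lra.
have Hs : is_series a l by apply/is_series_rsum.
split; first by exists l.
rewrite (is_series_unique _ _ Hs).
exact: (is_lim_seq_le _ _ l M HM Hl (is_lim_seq_const _)).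
Qed.

Lemma ex_series_le_pos (a b : nat -> R) : (forall n, 0 <= a n <= b n) ->
  ex_series b -> ex_series a.
Proof.
move=> H; apply: ex_series_le => n; rewrite /norm /= /abs /=.
by rewrite Rabs_pos_eq; [case: (H n)|case: (H n)].
Qed.

Lemma csums_abs (a : nat -> C) (b : nat -> R) :
  (forall n, Cmod (a n) <= b n) -> ex_series b -> exists l, csums a l.
Proof.
move=> H Hb.
have HR : ex_series (fun n => Re (a n)).
  apply: ex_series_le Hb => n; apply: Rle_trans (H n); exact: re_le_Cmod.
have HI : ex_series (fun n => Im (a n)).
  apply: ex_series_le Hb => n; apply: Rle_trans (H n); exact: im_le_Cmod.
exists (Series (fun n => Re (a n)), Series (fun n => Im (a n))).
apply: Clim_ReIm.
  apply: is_lim_seq_ext (is_lim_seq_rsum _ HR) => n; by rewrite Re_csum.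
apply: is_lim_seq_ext (is_lim_seq_rsum _ HI) => n; by rewrite Im_csum.
Qed.

Lemma csums_Cseries (a : nat -> C) l : csums a l -> Cseries a = l.
Proof.
move=> H; rewrite /Cseries; apply: injective_projections => /=.
  apply: is_series_unique; apply/is_series_rsum.
  by apply: is_lim_seq_ext (Clim_Re _ _ H) => n; rewrite Re_csum.
apply: is_series_unique; apply/is_series_rsum.
by apply: is_lim_seq_ext (Clim_Im _ _ H) => n; rewrite Im_csum.
Qed.

Lemma csums_tail (a : nat -> C) (b : nat -> R) l n : csums a l ->
  (forall n, Cmod (a n) <= b n) -> ex_series b ->
  Cmod (l - \csum_(i < n) a i) <= Series b - \rsum_(i < n) b i.
Proof.
move=> Ha H Hb.
have Hb0 i : 0 <= b i by apply: Rle_trans (H i); apply: Cmod_ge_0.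
have Hl := Clim_subseq _ _ (fun k => (n + k)%nat) (fun k => leq_addl n k) Ha.
apply: (Clim_le _ _ _ (Clim_minus _ _ _ _ Hl (Clim_const (\csum_(i < n) a i)))) => k.
rewrite csum_cat.
have -> : (\csum_(i < n) a i + \csum_(i < k) a (n + i)%nat - \csum_(i < n) a i =
  \csum_(i < k) a (n + i)%nat)%C by ring.
apply: Rle_trans (Cmod_csum _ _) _.
have := rsum_le_Series b (n + k) Hb0 Hb; rewrite rsum_cat.
have := rsum_le k (fun i => Cmod (a (n + i)%nat)) (fun i => b (n + i)%nat) (fun i _ => H _).
lra.
Qed.

Lemma csums_le (a : nat -> C) (b : nat -> R) l : csums a l ->
  (forall n, Cmod (a n) <= b n) -> ex_series b -> Cmod l <= Series b.
Proof.
move=> Ha H Hb; have := csums_tail _ _ _ 0 Ha H Hb.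
rewrite csum0 rsum0; have -> : (l - 0 = l)%C by ring.
lra.
Qed.

Lemma Clim_csum (n : nat) (u : nat -> nat -> C) (l : nat -> C) :
  (forall i, Clim (fun k => u k i) (l i)) ->
  Clim (fun k => \csum_(i < n) u k i) (\csum_(i < n) l i).
Proof.
move=> H; elim: n => [|n IH].
  by rewrite csum0; apply: Clim_ext (Clim_const 0) => k; rewrite csum0.
rewrite csumS; apply: Clim_ext (Clim_plus _ _ _ _ IH (H n)) => k.
by rewrite csumS.
Qed.

(** Dominated convergence for series (Tannery): the tails of all series lie below the tail of [b],
    which is less than e/3 from some K on, and the K leading terms converge one by one. *)
Lemma tannery (a : nat -> nat -> C) (a' l : nat -> C) (b : nat -> R) :
  (forall n k, Cmod (a n k) <= b k) -> ex_series b ->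
  (forall k, Clim (fun n => a n k) (a' k)) -> (forall n, csums (a n) (l n)) ->
  exists l', csums a' l' /\ Clim l l'.
Proof.
move=> H Hb Ha Hl.
have H' k : Cmod (a' k) <= b k by apply: Clim_le (Ha k) _ => n; apply: H.
have [l' Hl'] := csums_abs _ _ H' Hb.
exists l'; split=> //; apply/Clim_eps => e He.
have [K HK] : exists K, Series b - \rsum_(i < K) b i < e / 3.
  have /is_lim_seq_spec/(_ (mkposreal (e / 3) ltac:(lra))) [K /(_ K (le_n _)) HK] := is_lim_seq_rsum _ Hb.
  by exists K; move/Rabs_def2: HK => /=; lra.
have /Clim_eps/(_ (e / 3) ltac:(lra)) [N HN] := Clim_csum K _ _ Ha.
exists N => n Hn.
have -> : (l n - l' = (l n - \csum_(i < K) a n i) + (\csum_(i < K) a n i - \csum_(i < K) a' i)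
   + - (l' - \csum_(i < K) a' i))%C by ring.
apply: Rle_lt_trans (Cmod_triangle _ _) _.
apply: Rle_lt_trans (Rplus_le_compat_r _ _ _ (Cmod_triangle _ _)) _.
rewrite Cmod_opp.
have := csums_tail _ _ _ K (Hl n) (H n) Hb.
have := csums_tail _ _ _ K Hl' H' Hb.
have := HN n Hn; lra.
Qed.

Lemma Series_rsum_switch K (A : nat -> nat -> R) :
  (forall n, ex_series (fun m => A m n)) ->
  is_series (fun m => \rsum_(n < K) A m n) (\rsum_(n < K) Series (fun m => A m n)).
Proof.
move=> H; elim: K => [|K IH].
  rewrite rsum0; apply/is_series_rsum; apply: is_lim_seq_ext (is_lim_seq_const 0) => n.
  by rewrite rsum_switch rsum0.
rewrite rsumS; apply: is_series_ext (is_series_plus _ _ _ _ IH (Series_correct _ (H K))) => n.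
by rewrite rsumS.
Qed.

Lemma fubini_pos (A : nat -> nat -> R) (Rm : nat -> R) :
  (forall m n, 0 <= A m n) -> (forall m, is_series (A m) (Rm m)) -> ex_series Rm ->
  (forall n, ex_series (fun m => A m n)) /\
  ex_series (fun n => Series (fun m => A m n)) /\
  Series (fun n => Series (fun m => A m n)) <= Series Rm.
Proof.
move=> HA HR HRs.
have HAR K m : \rsum_(n < K) A m n <= Rm m.
  rewrite -(is_series_unique _ _ (HR m)); apply: rsum_le_Series => //; by exists (Rm m).
have Hcol n : ex_series (fun m => A m n).
  apply: ex_series_le_pos HRs => m; split=> //.
  apply: Rle_trans (HAR n.+1 m); rewrite rsumS.
  have := rsum_ge0 n (A m) (fun i _ => HA m i); lra.
split=> //; apply: ex_series_bounded => [n|K].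
  have := rsum_le_Series (fun m => A m n) 0 (fun m => HA m n) (Hcol n); by rewrite rsum0.
rewrite -(is_series_unique _ _ (Series_rsum_switch K A Hcol)).
apply: Series_le HRs => m; split=> //; apply: rsum_ge0 => i _; exact: HA.
Qed.

(** Follows from Tannery's theorem: the sum of the first M rows is, as a series over n, dominated by
    the column sums of [A], and M tends to infinity. *)
Lemma fubini (a : nat -> nat -> C) (r : nat -> C) (A : nat -> nat -> R) (Rm : nat -> R) :
  (forall m n, Cmod (a m n) <= A m n) -> (forall m, is_series (A m) (Rm m)) ->
  ex_series Rm -> (forall m, csums (a m) (r m)) ->
  exists l, csums r l /\ exists c, (forall n, csums (fun m => a m n) (c n)) /\ csums c l /\
    (forall n, Cmod (c n) <= Series (fun m => A m n)).
Proof.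
move=> Ha HA HR Hr.
have HA0 m n : 0 <= A m n by apply: Rle_trans (Ha m n); apply: Cmod_ge_0.
have [Hcol [HB _]] := fubini_pos A Rm HA0 HA HR.
pose c n := Cseries (fun m => a m n).
have Hc n : csums (fun m => a m n) (c n).
  have [l Hl] := csums_abs (fun m => a m n) _ (fun m => Ha m n) (Hcol n).
  by rewrite /c (csums_Cseries _ _ Hl).
have [l [Hl1 Hl2]] : exists l, csums c l /\ Clim (fun M => \csum_(m < M) r m) l.
  apply: (tannery (fun M n => \csum_(m < M) a m n) c _ (fun n => Series (fun m => A m n))) => //.
    move=> M n; apply: Rle_trans (Cmod_csum _ _) _.
    apply: Rle_trans (rsum_le _ _ (fun m => A m n) (fun m _ => Ha m n)) _.
    by apply: rsum_le_Series.
  by move=> M; apply: csums_csum => i _.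
exists l; split=> //; exists c; split=> //; split=> // n.
by apply: csums_le (Hc n) _ (Hcol n).
Qed.

Lemma csums_finite n (a : nat -> C) : (forall k, (n <= k)%nat -> a k = RtoC 0) ->
  csums a (\csum_(i < n) a i).
Proof.
move=> H; have -> : \csum_(i < n) a i = (0 + \csum_(i < n) a i)%C by ring.
apply/csums_ge; apply: csums_ext csums_0 => k; rewrite H //; lia.
Qed.

Lemma csums_shift m (a : nat -> C) l : csums a l ->
  csums (fun n => if (m <= n)%nat then a (n - m)%nat else RtoC 0) l.
Proof.
move=> H; set f := fun n => _.
have E : \csum_(i < m) f i = RtoC 0.
  rewrite (csum_ext _ _ (fun=> RtoC 0)) ?csum_const; first by ring.
  by move=> i Hi; rewrite /f leqNgt Hi.
have -> : l = (l + \csum_(i < m) f i)%C by rewrite E; ring.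
apply/csums_ge; apply: csums_ext H => k; by rewrite /f leq_addr addKn.
Qed.

Lemma is_series_shift m (a : nat -> R) (l : R) : is_series a l ->
  is_series (fun n => if (m <= n)%nat then a (n - m)%nat else 0) l.
Proof.
move=> /is_series_rsum H; apply/is_series_rsum.
apply/(is_lim_seq_incr_n _ m).
apply: is_lim_seq_ext H => n.
have -> : (n + m)%coq_nat = (m + n)%nat by lia.
rewrite rsum_cat [X in X + _](rsum_ext _ _ (fun=> 0)).
  rewrite rsum_const Rmult_0_r Rplus_0_l; apply: rsum_ext => i _.
  by rewrite leq_addr addKn.
by move=> i Hi; rewrite leqNgt Hi.
Qed.

(** Row m is the series of [b] multiplied by [a m] and moved m places to the right, so that the
    columns are the convolution and [fubini] applies. The bound on the sum of moduli is what makes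
    the norm in [maj_mult] submultiplicative. *)
Lemma cauchy_product (a b : nat -> C) (A B : nat -> R) la lb :
  (forall n, Cmod (a n) <= A n) -> (forall n, Cmod (b n) <= B n) ->
  ex_series A -> ex_series B -> csums a la -> csums b lb ->
  csums (fun n => \csum_(i < n.+1) (a i * b (n - i)%nat)) (la * lb) /\
  ex_series (fun n => Cmod (\csum_(i < n.+1) (a i * b (n - i)%nat))) /\
  Series (fun n => Cmod (\csum_(i < n.+1) (a i * b (n - i)%nat))) <= Series A * Series B.
Proof.
move=> HA HB HsA HsB Ha Hb.
have HA0 n : 0 <= A n by apply: Rle_trans (HA n); apply: Cmod_ge_0.
have HB0 n : 0 <= B n by apply: Rle_trans (HB n); apply: Cmod_ge_0.
pose X m n := if (m <= n)%nat then (a m * b (n - m)%nat)%C else RtoC 0.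
pose Y m n := if (m <= n)%nat then A m * B (n - m)%nat else 0.
have HXY m n : Cmod (X m n) <= Y m n.
  rewrite /X /Y; case: leqP => _; last by rewrite Cmod_0; lra.
  rewrite Cmod_mult; apply: Rmult_le_compat => //; exact: Cmod_ge_0.
have HY m : is_series (Y m) (A m * Series B).
  by apply: (is_series_shift m (fun k => A m * B k)); apply: is_series_scal_l; apply: Series_correct.
have HR : ex_series (fun m => A m * Series B) by apply: ex_series_scal_r.
have HX m : csums (X m) (a m * lb).
  by apply: (csums_shift m (fun k => a m * b k)%C); apply: csums_scal.
have [l [Hl [c [Hc [Hcl Hcb]]]]] := fubini X _ Y _ HXY HY HR HX.
have Ec n : c n = \csum_(i < n.+1) (a i * b (n - i)%nat).
  have HXn : csums (fun m => X m n) (\csum_(i < n.+1) X i n).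
    by apply: csums_finite => k Hk; rewrite /X leqNgt Hk.
  rewrite (csums_unique _ _ _ (Hc n) HXn); apply: csum_ext => i Hi.
  by rewrite /X -ltnS Hi.
have El : l = (la * lb)%C.
  apply: csums_unique Hl _; have := csums_scal lb _ _ Ha.
  rewrite Cmult_comm; by apply: csums_ext => n; rewrite Cmult_comm.
have HYs m n : 0 <= Y m n by apply: Rle_trans (HXY m n); apply: Cmod_ge_0.
have [Hcol [H1 H2]] := fubini_pos Y _ HYs HY HR.
split; first by rewrite -El; apply: csums_ext Hcl => n; rewrite Ec.
have H3 n : 0 <= Cmod (\csum_(i < n.+1) (a i * b (n - i)%nat)) <= Series (fun m => Y m n).
  by split; [exact: Cmod_ge_0|rewrite -Ec].
split; first by apply: ex_series_le_pos H1.
apply: Rle_trans (Series_le _ _ H3 H1) _.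
by move: H2; rewrite Series_scal_r.
Qed.

(** * The complex exponential *)

Lemma Cexp_plus z w : Cexp (z + w) = (Cexp z * Cexp w)%C.
Proof.
case: z => a b; case: w => c d; rewrite /Cexp /Cmult /Cplus /Re /Im /=.
by rewrite exp_plus cos_plus sin_plus; f_equal; ring.
Qed.

Lemma Cexp_0 : Cexp 0 = RtoC 1.
Proof. by rewrite /Cexp /= exp_0 cos_0 sin_0 !Rmult_1_l. Qed.

Lemma Cmod_Cexp z : Cmod (Cexp z) = exp (Re z).
Proof.
rewrite /Cmod /Cexp /=; set e := exp _; set x := Im z.
have -> : e * cos x * (e * cos x * 1) + e * sin x * (e * sin x * 1) = e * e.
  have := sin2_cos2 x; rewrite /Rsqr => H.
  have -> : e * cos x * (e * cos x * 1) + e * sin x * (e * sin x * 1) =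
    e * e * (sin x * sin x + cos x * cos x) by ring.
  by rewrite H; ring.
by apply: sqrt_square; apply: Rlt_le; apply: exp_pos.
Qed.

Lemma Cexp_neq0 z : Cexp z <> RtoC 0.
Proof. by apply/Cmod_gt_0; rewrite Cmod_Cexp; apply: exp_pos. Qed.

Lemma Cexp_opp z : Cexp (- z) = (/ Cexp z)%C.
Proof.
have H := Cexp_neq0 z.
have E : (Cexp (- z) * Cexp z = 1)%C.
  by rewrite -Cexp_plus -Cexp_0; congr Cexp; ring.
by rewrite -(Cmult_1_r (Cexp (- z))) -(Cinv_r _ H) Cmult_assoc E; ring.
Qed.

Lemma Cexp_RtoC (x : R) : Cexp x = RtoC (exp x).
Proof. by rewrite /Cexp /= cos_0 sin_0 Rmult_1_r Rmult_0_r. Qed.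

Lemma Cexp_nat n z : Cexp (INR n * z) = (Cexp z ^ n)%C.
Proof.
elim: n => [|n IH]; first by rewrite Cmult_0_l Cexp_0.
rewrite Cpow_S -IH -Cexp_plus; congr Cexp.
by rewrite S_INR RtoC_plus; ring.
Qed.

Lemma Cexp_2PI_Z k : Cexp (2 * IZR k * PI * Ci) = RtoC 1.
Proof.
have E (n : nat) : Cexp (2 * INR n * PI * Ci) = RtoC 1.
  have -> : (2 * INR n * PI * Ci = INR n * (2 * PI * Ci))%C by ring.
  rewrite Cexp_nat; have -> : Cexp (2 * PI * Ci) = RtoC 1.
    have -> : (2 * PI * Ci = (0%R, (2 * PI)%R))%C.
      by rewrite /Cmult /RtoC /Ci /=; f_equal; ring.
    by rewrite /Cexp /= exp_0 cos_2PI sin_2PI; rewrite !Rmult_1_l.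
  exact: Cpow_1_l.
have H : (0 <= k \/ 0 <= - k)%Z by lia.
case: H => H.
  by have := E (Z.to_nat k); rewrite INR_IZR_INZ Z2Nat.id.
have := E (Z.to_nat (- k)); rewrite INR_IZR_INZ Z2Nat.id // opp_IZR RtoC_opp => H1.
have -> : (2 * IZR k * PI * Ci = - (2 * - IZR k * PI * Ci))%C by ring.
rewrite Cexp_opp H1; field; exact: C1_nz.
Qed.

Definition expc (z : C) (n : nat) : C := (z ^ n / INR (fact n))%C.

Lemma INR_fact_C n : RtoC (INR (fact n)) <> RtoC 0.
Proof. by move=> H; apply: (INR_fact_neq_0 n); apply: RtoC_inj. Qed.

Lemma INR_C n : RtoC (INR n.+1) <> RtoC 0.
Proof. by move=> /RtoC_inj; apply: not_0_INR. Qed.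

Lemma expcS z n : (INR n.+1 * expc z n.+1 = z * expc z n)%C.
Proof.
rewrite /expc Cpow_S [fact _]/= -/(fact n).
have -> : (fact n + n * fact n)%coq_nat = (n.+1 * fact n)%nat by [].
rewrite mult_INR RtoC_mult; field; split; [exact: INR_fact_C|exact: INR_C].
Qed.

Lemma Cmod_expc z n : Cmod (expc z n) = Cmod z ^ n / INR (fact n).
Proof.
rewrite /expc Cmod_div ?Cmod_pow ?Cmod_R ?Rabs_pos_eq //; first exact: pos_INR.
exact: INR_fact_C.
Qed.

Lemma is_series_exp x : is_series (fun n => x ^ n / INR (fact n)) (exp x).
Proof.
have := is_exp_Reals x; rewrite /is_pseries; apply: is_series_ext => n.
by rewrite pow_n_pow /scal /= /mult /=.
Qed.

Lemma expc_ex z : exists l, csums (expc z) l.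
Proof.
apply: (csums_abs _ (fun n => Cmod z ^ n / INR (fact n))) => [n|].
  by rewrite Cmod_expc; lra.
by exists (exp (Cmod z)); apply: is_series_exp.
Qed.

(** Induction without binomial coefficients: multiply by n + 1, split it as i + (n + 1 - i), and let
    each part lower one of the two indices by [expcS]. *)
Lemma expc_binomial z w n :
  \csum_(i < n.+1) (expc z i * expc w (n - i)%nat) = expc (z + w) n.
Proof.
elim: n => [|n IH].
  rewrite csumS csum0 /expc /=; field; exact: C1_nz.
have H := INR_C n.
suff E : (INR n.+1 * (\csum_(i < n.+2) (expc z i * expc w (n.+1 - i)%nat)) =
          INR n.+1 * expc (z + w) n.+1)%C.
  set s := \csum_(i < _) _ in E *.
  by rewrite -(Cmult_1_l s) -(Cinv_l _ H) -Cmult_assoc E Cmult_assoc Cinv_l // Cmult_1_l.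
rewrite expcS -IH -csum_scal.
rewrite (csum_ext _ _ (fun i => (INR i * expc z i) * expc w (n.+1 - i)%nat +
   expc z i * (INR (n.+1 - i)%nat * expc w (n.+1 - i)%nat))%C); last first.
  move=> i Hi; have -> : RtoC (INR n.+1) = (INR i + INR (n.+1 - i)%nat)%C.
    by rewrite -RtoC_plus -plus_INR; congr (RtoC (INR _)); lia.
  ring.
rewrite csum_plus; set s1 := \csum_(i < _) _; set s2 := \csum_(i < _) _.
have -> : s1 = (z * \csum_(i < n.+1) (expc z i * expc w (n - i)%nat))%C.
  rewrite /s1 big_nat_recl // subn0 /= -csum_scal.
  rewrite (csum_ext _ _ (fun i => z * (expc z i * expc w (n - i)%nat))%C).
    by ring.
  by move=> i Hi; rewrite expcS subSS; ring.
have -> : s2 = (w * \csum_(i < n.+1) (expc z i * expc w (n - i)%nat))%C.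
  rewrite /s2 csumS subnn /= -csum_scal.
  rewrite (csum_ext n.+1 _ (fun i => w * (expc z i * expc w (n - i)%nat))%C).
    by ring.
  by move=> i Hi; rewrite subSn // expcS; ring.
by ring.
Qed.

Lemma Ci_sqr : (Ci * Ci = - (1))%C.
Proof. by rewrite /Ci /Cmult /Copp /RtoC /=; f_equal; ring. Qed.

Lemma expc_Ci_even (y : R) j :
  expc (Ci * y) (j * 2) = RtoC ((-1) ^ j / INR (fact (2 * j)) * (Rsqr y) ^ j).
Proof.
rewrite /expc mulnC Cpow_mult_r RtoC_mult RtoC_div; last exact: INR_fact_neq_0.
have -> : ((Ci * y) ^ 2 = RtoC (-1 * Rsqr y))%C.
  have -> : ((Ci * y) ^ 2 = (Ci * Ci) * (y * y))%C by rewrite /=; ring.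
  by rewrite Ci_sqr RtoC_mult /Rsqr RtoC_mult; congr Cmult; rewrite RtoC_opp.
rewrite -RtoC_pow Rpow_mult_distr RtoC_mult; field; exact: INR_fact_C.
Qed.

Lemma expc_Ci_odd (y : R) j :
  expc (Ci * y) (j * 2 + 1) = (Ci * RtoC (y * ((-1) ^ j / INR (fact (2 * j + 1)) * (Rsqr y) ^ j)))%C.
Proof.
rewrite /expc Cpow_add_r mulnC Cpow_mult_r RtoC_mult [RtoC (_ * _ ^ j)]RtoC_mult RtoC_div; last exact: INR_fact_neq_0.
have -> : ((Ci * y) ^ 2 = RtoC (-1 * Rsqr y))%C.
  have -> : ((Ci * y) ^ 2 = (Ci * Ci) * (y * y))%C by rewrite /=; ring.
  by rewrite Ci_sqr RtoC_mult /Rsqr RtoC_mult; congr Cmult; rewrite RtoC_opp.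
rewrite -RtoC_pow Rpow_mult_distr RtoC_mult Cpow_1_r; field; exact: INR_fact_C.
Qed.

(** For imaginary arguments, even and odd terms are matched with the defining series of cos and sin;
    the general case is the Cauchy product of the real and the imaginary one. *)
Lemma csums_expc z : csums (expc z) (Cexp z).
Proof.
have Hy (y : R) : csums (expc (Ci * y)) (Cexp (Ci * y)).
  have [l Hl] := expc_ex (Ci * y).
  suff E : l = Cexp (Ci * y) by rewrite -E.
  (* A limit exists already, so it suffices to follow the partial sums of even length, which pair
     each even term with the next odd one. *)
  have Hphi n : (n <= n * 2)%nat by lia.
  have H2 := Clim_subseq _ _ _ Hphi Hl.
  apply: Clim_unique H2 _.
  have -> : Cexp (Ci * y) = (cos y, sin y).
    rewrite /Cexp re_mult im_mult /= /Re /Im /=.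
    have -> : 0 * y - 1 * 0 = 0 by ring.
    have -> : 0 * 0 + 1 * y = y by ring.
    by rewrite exp_0 !Rmult_1_l.
  apply: (Clim_ext (fun m => (\rsum_(j < m) (cos_n j * (Rsqr y) ^ j),
     y * \rsum_(j < m) (sin_n j * (Rsqr y) ^ j)))).
    move=> m; rewrite csum_block -rsum_scal.
    have E u v : (u, v) = (RtoC u + Ci * RtoC v)%C.
      by rewrite /Cplus /Cmult /RtoC /Ci /=; f_equal; ring.
    rewrite E !RtoC_rsum -csum_scal -csum_plus; apply: csum_ext => j _.
    rewrite !csumS csum0 addn0 expc_Ci_even expc_Ci_odd Cplus_0_l.
    by rewrite /cos_n /sin_n.
  apply: Clim_ReIm; rewrite /=.
    apply/is_series_rsum/is_series_Reals.
    by rewrite /cos; case: exist_cos.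
  rewrite /sin; case: exist_sin => a Ha.
  apply: (is_lim_seq_scal_l _ y a).
  by apply/is_series_rsum/is_series_Reals.
have [x y Ez] : exists2 x : R, True & exists y : R, z = (x + Ci * y)%C.
  exists (Re z) => //; exists (Im z).
  by case: (z) => a b; rewrite /Cplus /Cmult /RtoC /Ci /Re /Im /=; f_equal; ring.
case: Ez => v ->.
have Hx : csums (expc x) (Cexp x).
  rewrite Cexp_RtoC; apply: (Clim_ext (fun n => RtoC (\rsum_(i < n) (x ^ i / INR (fact i))))).
    move=> n; rewrite RtoC_rsum; apply: csum_ext => i _.
    by rewrite /expc RtoC_div ?RtoC_pow //; exact: INR_fact_neq_0.
  by apply: Clim_RtoC; apply/is_series_rsum; apply: is_series_exp.
have Hb w n : Cmod (expc w n) <= Cmod w ^ n / INR (fact n) by rewrite Cmod_expc; lra.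
have Hs w : ex_series (fun n => Cmod w ^ n / INR (fact n)).
  by exists (exp (Cmod w)); apply: is_series_exp.
have [H _] := cauchy_product _ _ _ _ _ _ (Hb x) (Hb (Ci * v)%C) (Hs _) (Hs _) Hx (Hy v).
rewrite Cexp_plus; apply: csums_ext H => n; exact: expc_binomial.
Qed.

Lemma Cexp_2_bound z : Cmod (Cexp z - 1 - z) <= exp (Cmod z) - 1 - Cmod z.
Proof.
have Hb n : Cmod (expc z n) <= Cmod z ^ n / INR (fact n) by rewrite Cmod_expc; lra.
have Hs : ex_series (fun n => Cmod z ^ n / INR (fact n)).
  by exists (exp (Cmod z)); apply: is_series_exp.
have := csums_tail _ _ _ 2 (csums_expc z) Hb Hs.
rewrite (is_series_unique _ _ (is_series_exp _)) !csumS csum0 !rsumS rsum0 /expc /=.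
have -> : (Cexp z - 1 - z = Cexp z - (0 + 1 / 1 + z * 1 / 1))%C by field; exact: C1_nz.
by have -> : exp (Cmod z) - (0 + 1 / 1 + Cmod z * 1 / 1) = exp (Cmod z) - 1 - Cmod z by field.
Qed.

Lemma exp_1_le x : 0 <= x <= 1 -> exp x - 1 <= 3 * x.
Proof.
move=> Hx; have [-> |Hx0] : x = 0 \/ 0 < x by lra.
  by rewrite exp_0; lra.
have [c [H1 H2]] := MVT_cor2 exp exp 0 x Hx0 (fun c _ => derivable_pt_lim_exp c).
rewrite exp_0 Rminus_0_r in H1; rewrite H1; apply: Rmult_le_compat_r; first lra.
apply: Rle_trans exp_le_3; apply: Rlt_le; apply: exp_increasing; lra.
Qed.

Lemma exp_2_le x : 0 <= x <= 1 -> exp x - 1 - x <= 3 * x ^ 2.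
Proof.
move=> Hx; have [-> |Hx0] : x = 0 \/ 0 < x by lra.
  by rewrite exp_0; lra.
have [c [H1 H2]] := MVT_cor2 exp exp 0 x Hx0 (fun c _ => derivable_pt_lim_exp c).
have := exp_1_le c ltac:(lra); rewrite exp_0 Rminus_0_r in H1; rewrite H1 => H3.
nra.
Qed.

(** * Powers of positive reals with complex exponent *)

Lemma Rcpow_plus a z w : Rcpow a (z + w) = (Rcpow a z * Rcpow a w)%C.
Proof. by rewrite /Rcpow -Cexp_plus; congr Cexp; ring. Qed.

Lemma Rcpow_0 a : Rcpow a 0 = RtoC 1.
Proof. by rewrite /Rcpow Cmult_0_l Cexp_0. Qed.

Lemma Rcpow_opp a z : Rcpow a (- z) = (/ Rcpow a z)%C.
Proof. by rewrite /Rcpow -Cexp_opp; congr Cexp; ring. Qed.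

Lemma Rcpow_mult a b z : 0 < a -> 0 < b -> Rcpow (a * b) z = (Rcpow a z * Rcpow b z)%C.
Proof.
by move=> Ha Hb; rewrite /Rcpow ln_mult // RtoC_plus -Cexp_plus; congr Cexp; ring.
Qed.

Lemma Rcpow_neq0 a z : Rcpow a z <> RtoC 0.
Proof. exact: Cexp_neq0. Qed.

Lemma Cmod_Rcpow a z : Cmod (Rcpow a z) = exp (Re z * ln a).
Proof. by rewrite /Rcpow Cmod_Cexp re_scal_r. Qed.

Lemma Rcpow_1 a : 0 < a -> Rcpow a 1 = RtoC a.
Proof. by move=> Ha; rewrite /Rcpow Cmult_1_l Cexp_RtoC exp_ln. Qed.

Lemma Re_im_Cmod0 z : Re z = 0 -> Cmod (Cexp z) = 1.
Proof. by move=> H; rewrite Cmod_Cexp H exp_0. Qed.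

(** * The Fourier series of the basic periodic function *)

Definition ee (x : R) : C := Cexp (2 * PI * Ci * x).

Lemma ee_plus x y : ee (x + y) = (ee x * ee y)%C.
Proof. by rewrite /ee -Cexp_plus RtoC_plus; congr Cexp; ring. Qed.

Lemma ee_Z k : ee (IZR k) = RtoC 1.
Proof. by rewrite -(Cexp_2PI_Z k) /ee; congr Cexp; ring. Qed.

Lemma ee_0 : ee 0 = RtoC 1.
Proof. exact: (ee_Z 0). Qed.

Lemma ee_nat n x : ee (INR n * x) = (ee x ^ n)%C.
Proof. by rewrite /ee -Cexp_nat RtoC_mult; congr Cexp; ring. Qed.

Lemma ee_form x : ee x = (cos (2 * PI * x), sin (2 * PI * x)).
Proof.
rewrite /ee; have -> : (2 * PI * Ci * x = (0%R, (2 * PI * x)%R))%C.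
  by rewrite /Cmult /RtoC /Ci /=; f_equal; ring.
by rewrite /Cexp /= exp_0 !Rmult_1_l.
Qed.

Lemma Cmod_ee x : Cmod (ee x) = 1.
Proof.
rewrite /ee Re_im_Cmod0 // /Cmult /RtoC /Ci /=; ring.
Qed.

Lemma Cmod_1_ee x : Cmod (1 - ee x) = 2 * Rabs (sin (PI * x)).
Proof.
rewrite ee_form /Cmod /=.
have -> : 2 * PI * x = 2 * (PI * x) by ring.
rewrite cos_2a_sin sin_2a; set s := sin _; set c := cos _.
have H : s * s + c * c = 1 by apply: sin2_cos2.
have -> : (1 + - (1 - 2 * s * s)) * ((1 + - (1 - 2 * s * s)) * 1) +
   (0 + - (2 * s * c)) * ((0 + - (2 * s * c)) * 1) = Rsqr (2 * s).
  rewrite /Rsqr; have -> : 2 * s * (2 * s) = 4 * (s * s) * (s * s + c * c) by rewrite H; ring.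
  ring.
by rewrite sqrt_Rsqr_abs Rabs_mult Rabs_pos_eq //; lra.
Qed.

(** From sin x >= x - x^3 / 6 and x <= 2, the latter because pi <= 4. The constant 1/3 is good
    enough because it is later multiplied by pi >= 3. *)
Lemma sin_ge_third x : 0 <= x <= PI / 2 -> x / 3 <= sin x.
Proof.
move=> [H1 H2]; have HPI := PI_4; have HP := PI_RGT_0.
have [H _] := sin_bound x 0 H1 ltac:(lra).
apply: Rle_trans H; rewrite /sin_approx /= /sin_term /=.
have : x * x <= 4 by nra.
nra.
Qed.

Lemma Cmod_1_ee_ge x : Rabs x <= 1 / 2 -> 2 * Rabs x <= Cmod (1 - ee x).
Proof.
move=> H; rewrite Cmod_1_ee; apply: Rmult_le_compat_l; first lra.
have HP := PI_RGT_0; have HP3 := PI2_3_2.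
have E : Rabs (sin (PI * x)) = Rabs (sin (PI * Rabs x)).
  by rewrite /Rabs; case: (Rcase_abs x) => // _; rewrite Ropp_mult_distr_r_reverse sin_neg -/(Rabs _) -/(Rabs _) Rabs_Ropp.
have H0 := Rabs_pos x.
have := sin_ge_third (PI * Rabs x) ltac:(split; nra); rewrite E => H1.
apply: Rle_trans (Rle_abs _); nra.
Qed.

Lemma ee_eq1 x : Rabs x < 1 -> ee x = RtoC 1 -> x = 0.
Proof.
move=> Hx E; have := Cmod_1_ee x; rewrite E /Cminus Cplus_opp_r Cmod_0 => H.
have {}H : sin (PI * x) = 0.
  by apply: Rabs_eq_0; lra.
have HP := PI_RGT_0; case/Rabs_def2: Hx => Hx1 Hx2.
have [//|[H1|H1]] : x = 0 \/ 0 < x \/ x < 0 by lra.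
  have := sin_gt_0 (PI * x) ltac:(nra) ltac:(nra); lra.
have := sin_gt_0 (PI * - x) ltac:(nra) ltac:(nra).
rewrite Ropp_mult_distr_r_reverse sin_neg; lra.
Qed.

Lemma geom_sum z n : ((1 - z) * (\csum_(i < n) (z ^ i)) = 1 - z ^ n)%C.
Proof.
elim: n => [|n IH]; first by rewrite csum0 /=; ring.
by rewrite csumS Cmult_plus_distr_l IH Cpow_S; ring.
Qed.

Lemma arith_geom_sum z n :
  ((1 - z) * (\csum_(i < n) (INR i * z ^ i)) = (\csum_(i < n) (z ^ i)) - 1 - (INR n - 1) * z ^ n)%C.
Proof.
elim: n => [|n IH]; first by rewrite !csum0 /=; ring.
by rewrite !csumS Cmult_plus_distr_l IH Cpow_S S_INR RtoC_plus; ring.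
Qed.

Lemma geom_sum_neq1 z n : z <> RtoC 1 -> \csum_(i < n) (z ^ i)%C = ((1 - z ^ n) / (1 - z))%C.
Proof.
move=> Hz; rewrite -geom_sum; field.
by apply: Cminus_eq_contra => E; apply: Hz.
Qed.

Lemma csum_sym m (f : Z -> C) :
  \csum_(i < 2 * m + 1) f (Z.of_nat i - Z.of_nat m)%Z =
  (f 0%Z + \csum_(i < m) (f (Z.of_nat i.+1) + f (- Z.of_nat i.+1)%Z))%C.
Proof.
have -> : (2 * m + 1 = m + m.+1)%nat by lia.
rewrite csum_cat [X in (_ + X)%C]big_nat_recl // addn0 Z.sub_diag csum_plus.
rewrite (csum_ext m (fun i => f (Z.of_nat (m + i.+1) - Z.of_nat m)%Z) (fun i => f (Z.of_nat i.+1))); last first.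
  by move=> i _; congr f; lia.
have -> : \csum_(i < m) f (Z.of_nat i - Z.of_nat m)%Z = \csum_(i < m) f (- Z.of_nat i.+1)%Z.
  rewrite big_nat_rev /=; apply: csum_ext => i Hi; congr f; lia.
ring.
Qed.

Lemma ee_orth n (d : Z) : (Z.abs d < Z.of_nat n)%Z -> d <> 0%Z ->
  \csum_(i < n) (ee (IZR d / INR n) ^ i)%C = RtoC 0.
Proof.
move=> Hd Hd0.
have Hn : 0 < INR n by apply: lt_0_INR; lia.
rewrite geom_sum_neq1.
  rewrite -ee_nat; have -> : INR n * (IZR d / INR n) = IZR d by field; lra.
  by rewrite ee_Z /Cminus Cplus_opp_r /Cdiv Cmult_0_l.
move=> E; apply: Hd0; apply: eq_IZR.
have : IZR d / INR n = 0.
  apply: ee_eq1 E; rewrite Rabs_div; last lra.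
  rewrite (Rabs_pos_eq (INR n)); last lra.
  apply/Rlt_div_l => //; rewrite Rmult_1_l -abs_IZR INR_IZR_INZ; exact: IZR_lt.
move/(Rmult_eq_compat_r (INR n)); rewrite /Rdiv Rmult_assoc Rinv_l; lra.
Qed.

(** A Riemann sum for the k-th Fourier coefficient. Inversion is exact on the grid, so a Fourier
    expansion is obtained by refining the grid under a summable majorant. *)
Definition dft (n : nat) (f : R -> R) (k : Z) : C :=
  (/ INR n * \csum_(j < n) (f (INR j / INR n)%R * ee (- IZR k / INR n)%R ^ j))%C.

Lemma csum_delta n j c : (j < n)%nat ->
  \csum_(i < n) (if i == j then c else RtoC 0) = c.
Proof.
move=> Hj; have -> : n = (j + (n - j).-1.+1)%nat by lia.
rewrite csum_cat big_nat_recl // addn0 eqxx.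
rewrite (csum_ext j _ (fun=> RtoC 0)); last first.
  by move=> i Hi; case: eqP => // ?; lia.
rewrite (csum_ext _ (fun i => if (j + i.+1)%nat == j then _ else _) (fun=> RtoC 0)); last first.
  by move=> i _; case: eqP => // ?; lia.
rewrite !csum_const; ring.
Qed.

(** The odd length makes the frequencies -m, ..., m symmetric, as needed for sums over pairs k,
    -k. *)
Lemma dft_inversion m f j : (j < 2 * m + 1)%nat ->
  \csum_(i < 2 * m + 1) (dft (2 * m + 1) f (Z.of_nat i - Z.of_nat m)%Z *
     ee (IZR (Z.of_nat i - Z.of_nat m) * (INR j / INR (2 * m + 1)%nat))%R)%C =
  RtoC (f (INR j / INR (2 * m + 1)%nat)).
Proof.
set n := (2 * m + 1)%nat => Hj.
have Hn : 0 < INR n by apply: lt_0_INR; lia.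
have HnC : RtoC (INR n) <> RtoC 0 by move=> /RtoC_inj; lra.
pose F j' := (/ INR n * f (INR j' / INR n)%R * ee (- INR m * ((INR j - INR j') / INR n))%R)%C.
rewrite (csum_ext _ _ (fun i => \csum_(j' < n) (F j' * ee (IZR (Z.of_nat j - Z.of_nat j') / INR n)%R ^ i))%C); last first.
  move=> i Hi; rewrite /dft [in LHS]Cmult_comm Cmult_assoc -csum_scal; apply: csum_ext => j' _.
  rewrite -!ee_nat /F !minus_IZR -!INR_IZR_INZ.
  have -> : INR j' * (- (INR i - INR m) / INR n) =
    (- INR m * ((INR j - INR j') / INR n)) + (INR i * ((INR j - INR j') / INR n)) +
    - ((INR i - INR m) * (INR j / INR n)) by field; lra.
  rewrite !ee_plus; set x := ((INR i - INR m) * _).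
  have H : (ee x * ee (- x)%R = 1)%C by rewrite -ee_plus Rplus_opp_r ee_0.
  transitivity (/ INR n * f (INR j' / INR n)%R * ee (- INR m * ((INR j - INR j') / INR n))%R *
    ee (INR i * ((INR j - INR j') / INR n))%R * (ee x * ee (- x)%R))%C; first by ring.
  by rewrite H; ring.
rewrite csum_switch (csum_ext _ _ (fun j' => if j' == j then RtoC (f (INR j / INR n)) else RtoC 0)); last first.
  move=> j' Hj'; rewrite csum_scal; case: eqP => [->|Hne].
    rewrite Z.sub_diag /Rdiv Rmult_0_l ee_0 (csum_ext _ _ (fun=> RtoC 1)); last by move=> i _; exact: Cpow_1_l.
    rewrite csum_const /F Rminus_diag /Rdiv Rmult_0_l Rmult_0_r ee_0.
    by field.
  by rewrite ee_orth; [ring|lia|lia].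
exact: csum_delta.
Qed.

(** It takes equal values at 0 and 1 and has mean zero on [0, 1]. Its origin is [trunc_sum], where
    it is the error made in replacing a truncated sum over the powers of p by a logarithm. *)
Definition beta (p : nat) (t : R) : R :=
  1 / 2 + 1 / ln (INR p) - t - INR p / (INR p - 1) * exp (- (ln (INR p) * t)).

(* Its Fourier coefficients are [1 / den p k] for k <> 0, and 0 for k = 0. *)
Definition Bper (p : nat) (u : R) : R := beta p (frac_part u).

Lemma ln_p_pos p : (1 < p)%nat -> 0 < ln (INR p).
Proof.
by move=> Hp; rewrite -ln_1; apply: ln_increasing; [lra|apply: (lt_INR 1); lia].
Qed.

Lemma Clim_inv u l : l <> RtoC 0 -> Clim u l -> Clim (fun n => / u n)%C (/ l).
Proof.
move=> Hl Hu; have Hl' := (Cmod_gt_0 _).1 Hl.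
have [N HN] := (Clim_eps _ _).1 Hu (Cmod l / 2) ltac:(lra).
apply/Clim_eps => e He.
have He' : 0 < e * (Cmod l * Cmod l / 2).
  by apply: Rmult_lt_0_compat => //; apply: Rdiv_lt_0_compat; [nra|lra].
have [N' HN'] := (Clim_eps _ _).1 Hu _ He'.
exists (maxn N N') => n; rewrite geq_max => /andP[Hn Hn'].
have Hun : Cmod l / 2 <= Cmod (u n).
  have := Cmod_triangle (u n) (- (u n - l))%C; rewrite Cmod_opp.
  have -> : (u n + - (u n - l) = l)%C by ring.
  by have := HN n Hn; lra.
have Hu0 : u n <> RtoC 0 by apply/Cmod_gt_0; lra.
have -> : (/ u n - / l = - ((u n - l) * (/ u n * / l)))%C by field.
rewrite Cmod_opp !Cmod_mult !Cmod_inv //.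
have H1 := HN' n Hn'.
rewrite -Rinv_mult; apply/Rlt_div_l; first by nra.
apply: Rlt_le_trans H1 _; apply: Rmult_le_compat_l; nra.
Qed.

Lemma Clim_squeeze_loc (u : nat -> C) l (v : nat -> R) (N : nat) :
  (forall n, (N <= n)%nat -> Cmod (u n - l) <= v n) -> is_lim_seq v 0 -> Clim u l.
Proof.
move=> H /is_lim_seq_0_eps Hv; apply/Clim_eps => e /Hv[N' HN'].
exists (maxn N N') => n; rewrite geq_max => /andP[/H H1 /HN' H2].
by apply: Rle_lt_trans H1 _; apply: Rle_lt_trans (Rle_abs _) H2.
Qed.

Lemma is_lim_seq_inv_S c : is_lim_seq (fun n => c / INR n.+1) 0.
Proof.
have := is_lim_seq_scal_l (fun n => / INR n.+1) c 0.
rewrite /= Rmult_0_r; apply.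
apply: (is_lim_seq_ext (fun n => / INR n.+1)) => //.
apply/(is_lim_seq_incr_1 (fun n => / INR n)).
have -> : Finite 0 = Rbar_inv p_infty by [].
by apply: is_lim_seq_inv => //; exact: is_lim_seq_INR.
Qed.

(** Turns the closed form of the discrete coefficients into the continuous one; with L = ln p it is
    used at 2 pi i k, at L + 2 pi i k and at L. *)
Lemma Clim_nexp z : Clim (fun n => INR n.+1 * (1 - Cexp (- z / INR n.+1)))%C z.
Proof.
have [N HN] := nfloor_ex (Cmod z) (Cmod_ge_0 z).
apply: (Clim_squeeze_loc _ _ (fun n => 3 * Cmod z ^ 2 / INR n.+1) N.+1); last exact: is_lim_seq_inv_S.
move=> n Hn; have HC := INR_C n.
have Hp : 0 < INR n.+1 by apply: lt_0_INR; lia.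
have -> : (INR n.+1 * (1 - Cexp (- z / INR n.+1)) - z =
  - (INR n.+1 * (Cexp (- z / INR n.+1) - 1 - - z / INR n.+1)))%C by field.
rewrite Cmod_opp Cmod_mult Cmod_R Rabs_pos_eq; last lra.
have E : Cmod (- z / INR n.+1) = Cmod z / INR n.+1.
  by rewrite Cmod_div // Cmod_opp Cmod_R Rabs_pos_eq //; lra.
have Hz : Cmod z <= INR n.+1.
  have : INR N + 1 <= INR n.+1 by rewrite -S_INR; apply: le_INR; lia.
  lra.
have H0 := Cmod_ge_0 z.
have H01 : 0 <= Cmod z / INR n.+1 <= 1.
  split; first by apply: Rdiv_le_0_compat.
  by apply/Rle_div_l => //; lra.
have := Cexp_2_bound (- z / INR n.+1); rewrite E => H1.
have := exp_2_le _ H01 => H2.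
have -> : 3 * Cmod z ^ 2 / INR n.+1 = INR n.+1 * (3 * (Cmod z / INR n.+1) ^ 2) by field; lra.
apply: Rmult_le_compat_l; lra.
Qed.

Lemma exp_nat n x : exp (INR n * x) = exp x ^ n.
Proof.
elim: n => [|n IH]; first by rewrite Rmult_0_l exp_0.
by rewrite S_INR Rmult_plus_distr_r exp_plus IH Rmult_1_l /= Rmult_comm.
Qed.

(** With w the k-th root of unity factor and q = p^(-1/n), the samples are combinations of w^j, j
    w^j and (q w)^j, whose sums are elementary. The two fractions combine to (1 - q) w / (n (1 - w)
    (1 - q w)), and the bound uniform in n follows from 1 - q <= L / n, |1 - w| >= 2 |k| / n and |1
    - q w| >= |1 - w| / 2. The condition on n gives |k / n| <= 1/2. *)
Lemma dft_beta p n k : (1 < p)%nat -> k <> 0%Z -> (2 * Z.abs k < Z.of_nat n)%Z ->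
  dft n (beta p) k = (/ (INR n * (1 - Cexp (- (2 * PI * Ci * IZR k) / INR n))) -
    / (INR n * (1 - Cexp (- (ln (INR p) + 2 * PI * Ci * IZR k) / INR n))))%C /\
  Cmod (dft n (beta p) k) <= ln (INR p) / (2 * IZR k ^ 2).
Proof.
move=> Hp Hk Hkn; have HL := ln_p_pos p Hp; set L := ln (INR p) in HL *.
have Hn : 0 < INR n by apply: lt_0_INR; lia.
have HnC : RtoC (INR n) <> RtoC 0 by move=> /RtoC_inj; lra.
have Hp1 : 1 < INR p by apply: (lt_INR 1); lia.
set w := ee (- IZR k / INR n); set q := exp (- (L / INR n)).
have Ew : Cexp (- (2 * PI * Ci * IZR k) / INR n) = w.
  rewrite /w /ee; congr Cexp; rewrite RtoC_div; last lra.
  by rewrite RtoC_opp; field.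
have Eqw : Cexp (- (L + 2 * PI * Ci * IZR k) / INR n) = (q * w)%C.
  rewrite -Ew /q -Cexp_RtoC -Cexp_plus; congr Cexp.
  by rewrite RtoC_opp RtoC_div; [field|lra].
have Hw1 : 2 * (Rabs (IZR k) / INR n) <= Cmod (1 - w).
  have -> : Rabs (IZR k) / INR n = Rabs (- IZR k / INR n).
    by rewrite Rabs_div ?Rabs_Ropp ?(Rabs_pos_eq (INR n)); lra.
  apply: Cmod_1_ee_ge; rewrite Rabs_div ?Rabs_Ropp ?(Rabs_pos_eq (INR n)); try lra.
  apply/Rle_div_l => //; rewrite -abs_IZR INR_IZR_INZ.
  have : IZR (2 * Z.abs k) <= IZR (Z.of_nat n) by apply: IZR_le; lia.
  rewrite mult_IZR; lra.
have Hk1 : 1 <= Rabs (IZR k) by rewrite -abs_IZR; apply: IZR_le; lia.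
have Hkn0 : 0 < Rabs (IZR k) / INR n by apply: Rdiv_lt_0_compat; lra.
have Hw0 : (1 - w)%C <> RtoC 0 by apply/Cmod_gt_0; lra.
have Hq0 : 0 < q by apply: exp_pos.
have HLn : 0 < L / INR n by apply: Rdiv_lt_0_compat.
have Hq1 : q < 1 by rewrite -exp_0; apply: exp_increasing; lra.
have Hq2 : 1 - q <= L / INR n by have := exp_ineq1_le (- (L / INR n)); rewrite -/q; lra.
have Hqw : 1 - q <= Cmod (1 - q * w).
  have := Cmod_triangle (1 - q * w) (q * w); have -> : (1 - q * w + q * w = 1)%C by ring.
  by rewrite Cmod_1 Cmod_mult Cmod_ee Cmod_R Rabs_pos_eq; lra.
(* 1 - w differs from 1 - q w by a number of modulus 1 - q, which is itself at most |1 - q w|. *)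
have Hqw' : Cmod (1 - w) <= 2 * Cmod (1 - q * w).
  have := Cmod_triangle (1 - q * w) ((q - 1) * w).
  have -> : (1 - q * w + (q - 1) * w = 1 - w)%C by ring.
  have -> : (RtoC q - 1)%C = RtoC (- (1 - q)) by rewrite RtoC_opp RtoC_minus; ring.
  by rewrite Cmod_mult Cmod_ee Cmod_R Rabs_Ropp Rabs_pos_eq; lra.
have Hqw0 : (1 - q * w)%C <> RtoC 0 by apply/Cmod_gt_0; lra.
have Hwn : (w ^ n = 1)%C.
  rewrite -ee_nat; have -> : INR n * (- IZR k / INR n) = IZR (- k).
    by rewrite opp_IZR; field; lra.
  exact: ee_Z.
have Hqn : (q ^ n)%R = / INR p.
  rewrite /q -exp_nat; have -> : INR n * - (L / INR n) = - L by field; lra.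
  by rewrite exp_Ropp exp_ln; lra.
have E : dft n (beta p) k = (/ (INR n * (1 - w)) - / (INR n * (1 - q * w)))%C.
  have S0 : \csum_(j < n) (w ^ j)%C = RtoC 0.
    rewrite geom_sum_neq1; last by move=> H; apply: Hw0; rewrite H; ring.
    by rewrite Hwn /Cminus Cplus_opp_r /Cdiv Cmult_0_l.
  have S1 : \csum_(j < n) (INR j * w ^ j)%C = (- INR n / (1 - w))%C.
    have := arith_geom_sum w n; rewrite S0 Hwn => H.
    have -> : (- INR n = 0 - 1 - (INR n - 1) * 1)%C by ring.
    by rewrite -H; field.
  have S2 : \csum_(j < n) ((q * w) ^ j)%C = ((1 - / INR p) / (1 - q * w))%C.
    rewrite geom_sum_neq1; last by move=> H; apply: Hqw0; rewrite H; ring.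
    by rewrite Cpow_mult_l Hwn -RtoC_pow Hqn RtoC_inv ?Cmult_1_r //; lra.
  rewrite /dft -/w.
  rewrite (csum_ext _ _ (fun j => (1 / 2 + 1 / L)%R * w ^ j - / INR n * (INR j * w ^ j) -
     (INR p / (INR p - 1))%R * (q * w) ^ j)%C); last first.
    move=> j Hj; rewrite /beta -/L.
    have -> : exp (- (L * (INR j / INR n))) = q ^ j.
      rewrite /q -exp_nat; congr exp; field; lra.
    rewrite Cpow_mult_l -RtoC_pow; set c1 := 1 / 2 + 1 / L; set c2 := INR p / _.
    rewrite !RtoC_minus RtoC_div; last lra.
    by rewrite RtoC_mult; field.
  rewrite !csum_minus !csum_scal S0 S1 S2.
  have HpC : RtoC (INR p) <> RtoC 0 by move=> /RtoC_inj; lra.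
  have HpC' : (INR p - 1)%C <> RtoC 0 by rewrite -RtoC_minus => /RtoC_inj; lra.
  rewrite RtoC_div; last lra.
  rewrite RtoC_minus; field; do ?split => //.
rewrite Ew Eqw; split=> //; rewrite E.
have -> : (/ (INR n * (1 - w)) - / (INR n * (1 - q * w)) =
   (1 - q)%R * w / (INR n * ((1 - w) * (1 - q * w))))%C.
  by rewrite RtoC_minus; field.
have H0 : (INR n * ((1 - w) * (1 - q * w)))%C <> RtoC 0.
  by apply: Cmult_neq_0 => //; apply: Cmult_neq_0.
rewrite Cmod_div // !Cmod_mult Cmod_ee !Cmod_R !Rabs_pos_eq; [|lra|lra].
set A := Cmod (1 - w) in Hw1 Hqw' *; set D := Cmod (1 - q * w) in Hqw Hqw' *.
have Hk2 : (IZR k ^ 2)%R = Rabs (IZR k) ^ 2 by rewrite pow2_abs.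
rewrite Hk2; set K := Rabs (IZR k) in Hk1 Hkn0 Hw1 *.
have H1 : 0 < INR n * (A * D) by apply: Rmult_lt_0_compat => //; apply: Rmult_lt_0_compat; lra.
apply/Rle_div_l => //.
have H2 : 2 * K ^ 2 / INR n ^ 2 <= A * D.
  apply: (Rle_trans _ ((2 * (K / INR n)) * (2 * (K / INR n) / 2))).
    by apply: Req_le; field; lra.
  by apply: Rmult_le_compat; lra.
have -> : L / (2 * K ^ 2) * (INR n * (A * D)) = (L / (2 * K ^ 2) * INR n) * (A * D) by ring.
apply: (Rle_trans _ (L / (2 * K ^ 2) * INR n * (2 * K ^ 2 / INR n ^ 2))).
  by have -> : L / (2 * K ^ 2) * INR n * (2 * K ^ 2 / INR n ^ 2) = L / INR n; [field; lra|lra].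
apply: Rmult_le_compat_l => //; apply: Rmult_le_pos; last lra.
apply: Rdiv_le_0_compat; nra.
Qed.

Lemma den_form p k : (1 < p)%nat ->
  den p k = (2 * PI * Ci * IZR k * (ln (INR p) + 2 * PI * Ci * IZR k) / ln (INR p))%C.
Proof.
move=> Hp; have HL := ln_p_pos p Hp; rewrite /den /chi; field.
by move=> /RtoC_inj; lra.
Qed.

Lemma PICi_neq0 k : k <> 0%Z -> (2 * PI * Ci * IZR k)%C <> RtoC 0.
Proof.
move=> Hk; have HP := PI_RGT_0.
apply: Cmult_neq_0; last by move=> /RtoC_inj; apply: eq_IZR_contrapositive.
apply: Cmult_neq_0; last exact: Ci_nz.
rewrite -RtoC_mult => /RtoC_inj; lra.
Qed.

Lemma LPICi_neq0 L k : 0 < L -> (L + 2 * PI * Ci * IZR k)%C <> RtoC 0.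
Proof.
move=> HL H; have : Re (L + 2 * PI * Ci * IZR k)%C = 0 by rewrite H.
by rewrite re_plus !re_scal_r !re_RtoC re_mult /= /Im /=; lra.
Qed.

Lemma den_neq0 p k : (1 < p)%nat -> k <> 0%Z -> den p k <> RtoC 0.
Proof.
move=> Hp Hk; have HL := ln_p_pos p Hp; rewrite den_form // /Cdiv.
apply: Cmult_neq_0.
  by apply: Cmult_neq_0; [exact: PICi_neq0|exact: LPICi_neq0].
by rewrite -RtoC_inv; [move=> /RtoC_inj; apply: Rinv_neq_0_compat; lra|lra].
Qed.

Lemma chi_neq0 p k : (1 < p)%nat -> k <> 0%Z -> chi p k <> RtoC 0.
Proof.
move=> Hp Hk H; apply: (den_neq0 p k Hp Hk); rewrite /den H; ring.
Qed.

(** Partial fractions: 1 / (2 pi i k) - 1 / (L + 2 pi i k) = L / (2 pi i k (L + 2 pi i k)), which is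
    the inverse of [den p k]. *)
Lemma dft_beta_lim p k : (1 < p)%nat -> k <> 0%Z ->
  Clim (fun m => dft (2 * m + 1) (beta p) k) (/ den p k).
Proof.
move=> Hp Hk; have HL := ln_p_pos p Hp; set L := ln (INR p) in HL *.
have HLC : RtoC L <> RtoC 0 by move=> /RtoC_inj; lra.
have H0 := PICi_neq0 k Hk; have H1 := LPICi_neq0 L k HL.
have -> : (/ den p k = / (2 * PI * Ci * IZR k) - / (L + 2 * PI * Ci * IZR k))%C.
  rewrite den_form // -/L; field; do ?split => //; try exact: Ci_nz.
  - by move=> /RtoC_inj; apply: eq_IZR_contrapositive.
  - by move=> /RtoC_inj; have := PI_RGT_0; lra.
have Hphi n : (n <= n * 2)%nat by lia.
have L1 := Clim_subseq _ _ _ Hphi (Clim_inv _ _ H0 (Clim_nexp (2 * PI * Ci * IZR k))).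
have L2 := Clim_subseq _ _ _ Hphi (Clim_inv _ _ H1 (Clim_nexp (L + 2 * PI * Ci * IZR k))).
apply: (Clim_ext_loc _ _ _ (Z.to_nat (Z.abs k))) (Clim_minus _ _ _ _ L1 L2) => m Hm.
have -> : (m * 2).+1 = (2 * m + 1)%nat by lia.
by have [-> _] := dft_beta p (2 * m + 1) k Hp Hk ltac:(lia).
Qed.

Definition zpair (a : Z -> C) (n : nat) : C :=
  (a (Z.of_nat n.+1) + a (- Z.of_nat n.+1)%Z)%C.

Lemma Clim_Cmod_le (u : nat -> C) l M N : Clim u l ->
  (forall n, (N <= n)%nat -> Cmod (u n) <= M) -> Cmod l <= M.
Proof.
move=> Hu H; have := Clim_subseq _ _ (fun n => (N + n)%nat) (fun n => leq_addl N n) Hu.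
by move=> Hu'; apply: Clim_le Hu' _ => n; apply: H; apply: leq_addr.
Qed.

Lemma inv_den_bound p k : (1 < p)%nat -> k <> 0%Z ->
  Cmod (/ den p k) <= ln (INR p) / (2 * IZR k ^ 2).
Proof.
move=> Hp Hk; apply: (Clim_Cmod_le _ _ _ (Z.to_nat (Z.abs k)) (dft_beta_lim p k Hp Hk)) => m Hm.
by have [_ H] := dft_beta p (2 * m + 1) k Hp Hk ltac:(lia).
Qed.

Lemma rsum_inv_sqr n : \rsum_(i < n.+1) (/ INR i.+1 ^ 2) <= 2 - / INR n.+1.
Proof.
elim: n => [|n IH]; first by rewrite rsumS rsum0 /=; lra.
rewrite rsumS; apply: Rle_trans (Rplus_le_compat_r _ _ _ IH) _.
have H : 0 < INR n.+1 by apply: lt_0_INR; lia.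
rewrite (S_INR n.+1); set x := INR n.+1 in H *.
have : / x - / (x + 1) - / (x + 1) ^ 2 = / (x * (x + 1) ^ 2) by field; lra.
have : 0 < / (x * (x + 1) ^ 2) by apply: Rinv_0_lt_compat; nra.
lra.
Qed.

Lemma ex_series_inv_sqr c : 0 <= c -> ex_series (fun n => c / INR n.+1 ^ 2).
Proof.
move=> Hc; apply: ex_series_scal_l.
have H n : 0 < / INR n.+1 ^ 2.
  by apply: Rinv_0_lt_compat; apply: pow_lt; apply: lt_0_INR; lia.
apply: (proj1 (ex_series_bounded (fun n => / INR n.+1 ^ 2) 2 (fun n => Rlt_le _ _ (H n)) _)).
case=> [|n]; first by rewrite rsum0; lra.
apply: Rle_trans (rsum_inv_sqr n) _.
have : 0 < / INR n.+1 by apply: Rinv_0_lt_compat; apply: lt_0_INR; lia.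
lra.
Qed.

Lemma Rabs_sin_le x : Rabs (sin x) <= Rabs x.
Proof.
have H y : 0 <= y -> Rabs (sin y) <= y.
  move=> Hy; have [->|Hy0] : y = 0 \/ 0 < y by lra.
    by rewrite sin_0 Rabs_R0; lra.
  apply: Rabs_le; have := sin_lt_x y Hy0; split; last lra.
  have [Hy1|Hy1] : y < 1 \/ 1 <= y by lra.
    have := sin_ge_0 y Hy; have := PI2_3_2; lra.
  have := SIN_bound y; lra.
case: (Rle_dec 0 x) => Hx; first by rewrite (Rabs_pos_eq x) //; exact: H.
have := H (- x) ltac:(lra); rewrite sin_neg Rabs_Ropp (Rabs_left x); lra.
Qed.

(** The constant is 2 pi rounded up by pi <= 4. *)
Lemma Cmod_ee_minus x y : Cmod (ee x - ee y) <= 8 * Rabs (x - y).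
Proof.
have -> : (ee x - ee y = ee x * (1 - ee (y - x)%R))%C.
  have -> : ee y = (ee x * ee (y - x)%R)%C by rewrite -ee_plus; congr ee; ring.
  ring.
rewrite Cmod_mult Cmod_ee Rmult_1_l Cmod_1_ee.
have := Rabs_sin_le (PI * (y - x)); rewrite Rabs_mult (Rabs_minus_sym y x).
have := PI_4; have := PI_RGT_0; rewrite (Rabs_pos_eq PI); last by have := PI_RGT_0; lra.
have := Rabs_pos (x - y); nra.
Qed.

Lemma Cmod_mul_ee z x : Cmod (z * ee x) = Cmod z.
Proof. by rewrite Cmod_mult Cmod_ee Rmult_1_r. Qed.

Lemma Clim_ee (u : nat -> R) l : is_lim_seq (fun n => Rabs (u n - l)) 0 ->
  Clim (fun n => ee (u n)) (ee l).
Proof.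
move=> H; apply: (Clim_squeeze _ _ (fun n => 8 * Rabs (u n - l))).
  by move=> n; apply: Cmod_ee_minus.
by have := is_lim_seq_scal_l _ 8 _ H; rewrite /= Rmult_0_r.
Qed.

Lemma rsum_INR n : \rsum_(i < n) INR i = INR n * (INR n - 1) / 2.
Proof.
by elim: n => [|n IH]; rewrite ?rsum0 ?rsumS ?IH ?S_INR /=; field.
Qed.

Lemma dft_beta_0 p : (1 < p)%nat -> Clim (fun m => dft (2 * m + 1) (beta p) 0) 0.
Proof.
move=> Hp; have HL := ln_p_pos p Hp; set L := ln (INR p) in HL *.
have Hp1 : 1 < INR p by apply: (lt_INR 1); lia.
have HLC : RtoC L <> RtoC 0 by move=> /RtoC_inj; lra.
have Hphi n : (n <= n * 2)%nat by lia.
have L1 := Clim_subseq _ _ _ Hphi (Clim_inv _ _ HLC (Clim_nexp L)).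
have L2 := Clim_RtoC _ 0 (is_lim_seq_inv_S (1 / 2)).
have {}L2 := Clim_subseq _ _ _ Hphi L2.
have L3 := Clim_minus _ _ _ _ (Clim_plus _ _ _ _ (Clim_const (1 / L)%R) L2) L1.
have E0 : ((1 / L)%R + 0 - / L = 0)%C by rewrite /Rdiv Rmult_1_l RtoC_inv; [ring|lra].
rewrite E0 in L3; apply: Clim_ext L3 => m.
have -> : (m * 2).+1 = (2 * m + 1)%nat by lia.
set n := (2 * m + 1)%nat.
have Hn : 0 < INR n by apply: lt_0_INR; lia.
set q := exp (- (L / INR n)).
have Eq : Cexp (- L / INR n) = RtoC q.
  by rewrite /q -Cexp_RtoC; congr Cexp; rewrite RtoC_opp RtoC_div; [field; move=> /RtoC_inj; lra|lra].
have HLn : 0 < L / INR n by apply: Rdiv_lt_0_compat.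
have Hq1 : q < 1 by rewrite -exp_0; apply: exp_increasing; lra.
have Hqn : (q ^ n)%R = / INR p.
  rewrite /q -exp_nat; have -> : INR n * - (L / INR n) = - L by field; lra.
  by rewrite exp_Ropp exp_ln; lra.
have S2 : \rsum_(j < n) q ^ j = (1 - / INR p) / (1 - q).
  have : RtoC (\rsum_(j < n) q ^ j) = RtoC ((1 - / INR p) / (1 - q)).
    rewrite RtoC_rsum (csum_ext _ _ (fun j => RtoC q ^ j)%C); last by move=> j _; exact: RtoC_pow.
    rewrite geom_sum_neq1; last by move=> /RtoC_inj; lra.
    by rewrite -RtoC_pow Hqn -!RtoC_minus -RtoC_div //; lra.
  by move/RtoC_inj.
have S : \rsum_(j < n) beta p (INR j / INR n) =
   INR n * (1 / 2 + 1 / L) - (INR n - 1) / 2 - 1 / (1 - q).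
  rewrite (rsum_ext _ _ (fun j => (1 / 2 + 1 / L) - / INR n * INR j - INR p / (INR p - 1) * q ^ j)); last first.
    move=> j _; rewrite /beta -/L.
    have -> : exp (- (L * (INR j / INR n))) = q ^ j.
      by rewrite /q -exp_nat; congr exp; field; lra.
    by field; lra.
  rewrite !rsum_minus !rsum_scal rsum_const rsum_INR S2; field; lra.
rewrite /dft Eq -RtoC_minus -RtoC_mult -RtoC_inv; last by nra.
rewrite (csum_ext _ _ (fun j => RtoC (beta p (INR j / INR n)))); last first.
  by move=> j _; rewrite Ropp_0 /Rdiv Rmult_0_l ee_0 Cpow_1_l Cmult_1_r.
rewrite -RtoC_rsum S -RtoC_inv; last lra.
rewrite -RtoC_plus -RtoC_minus -RtoC_mult; congr RtoC; field; lra.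
Qed.

Lemma beta_lim p (u : nat -> R) (t : R) : is_lim_seq u t ->
  is_lim_seq (fun n => beta p (u n)) (beta p t).
Proof.
move=> Hu; apply: (is_lim_seq_continuous (beta p)) => //.
by rewrite /beta; reg.
Qed.

(** The point t is approximated by grid points [x m], at which the discrete inversion is exact. The
    coefficients converge under the majorant of [dft_beta], so Tannery's theorem applies, and the
    zero frequency disappears by [dft_beta_0]. *)
Lemma beta_fourier p t : (1 < p)%nat -> 0 <= t < 1 ->
  csums (zpair (fun k => / den p k * ee (IZR k * t))%C) (RtoC (beta p t)).
Proof.
move=> Hp Ht; have HL := ln_p_pos p Hp; set L := ln (INR p) in HL *.
pose nn m := (2 * m + 1)%nat.
have Hn m : 0 < INR (nn m) by apply: lt_0_INR; rewrite /nn; lia.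
pose jj m := Z.to_nat (Int_part (t * INR (nn m))).
have Hj m : INR (jj m) <= t * INR (nn m) < INR (jj m) + 1.
  have [H1 H2] := base_Int_part (t * INR (nn m)).
  have H0 : 0 <= t * INR (nn m) by have := Hn m; nra.
  have H3 : (0 <= Int_part (t * INR (nn m)))%Z.
    have : (-1 < Int_part (t * INR (nn m)))%Z by apply: lt_IZR; lra.
    lia.
  rewrite /jj INR_IZR_INZ Z2Nat.id //; lra.
have Hjn m : (jj m < nn m)%nat.
  by apply/ltP; apply: INR_lt; have := Hj m; have := Hn m; nra.
pose x m := INR (jj m) / INR (nn m).
have Hx m : Rabs (x m - t) <= / INR (nn m).
  have [H1 H2] := Hj m; have H3 := Hn m.
  have -> : x m - t = - ((t * INR (nn m) - INR (jj m)) * / INR (nn m)) by rewrite /x; field; lra.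
  have H4 : 0 < / INR (nn m) by apply: Rinv_0_lt_compat.
  rewrite Rabs_Ropp Rabs_pos_eq; nra.
have Hxl : is_lim_seq (fun m => Rabs (x m - t)) 0.
  apply: is_lim_seq_squeeze0 (is_lim_seq_inv_S 1) => m; split; first exact: Rabs_pos.
  apply: Rle_trans (Hx m) _; rewrite /Rdiv Rmult_1_l; apply: Rinv_le_contravar.
    by apply: lt_0_INR; lia.
  by apply: le_INR; rewrite /nn; lia.
pose a m k := if (k < m)%nat then zpair (fun k => dft (nn m) (beta p) k * ee (IZR k * x m))%C k else RtoC 0.
have [|||l' [H1 H2]] := tannery a (zpair (fun k => / den p k * ee (IZR k * t))%C) 
   (fun m => RtoC (beta p (x m)) - dft (nn m) (beta p) 0)%C (fun k => L / INR k.+1 ^ 2) _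
   (ex_series_inv_sqr L ltac:(lra)).
- move=> m k; rewrite /a; case: ltnP => Hk; last first.
    by rewrite Cmod_0; apply: Rdiv_le_0_compat; [lra|apply: pow_lt; apply: lt_0_INR; lia].
  rewrite /zpair; apply: Rle_trans (Cmod_triangle _ _) _; rewrite !Cmod_mul_ee.
  have [_ B1] := dft_beta p (nn m) (Z.of_nat k.+1) Hp ltac:(lia) ltac:(rewrite /nn; lia).
  have [_ B2] := dft_beta p (nn m) (- Z.of_nat k.+1) Hp ltac:(lia) ltac:(rewrite /nn; lia).
  apply: Rle_trans (Rplus_le_compat _ _ _ _ B1 B2) _.
  rewrite opp_IZR -INR_IZR_INZ -/L; apply: Req_le; field.
  by apply: not_0_INR.
- move=> k; apply: (Clim_ext_loc (fun m => zpair (fun k => dft (nn m) (beta p) k * ee (IZR k * x m)%R)%C k) _ _ k.+1).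
    by move=> m Hm; rewrite /a Hm.
  have Hlim z : z <> 0%Z -> Clim (fun m => dft (nn m) (beta p) z * ee (IZR z * x m)%R)%C (/ den p z * ee (IZR z * t)%R).
    move=> Hz; apply: Clim_mult; first exact: dft_beta_lim.
    apply: Clim_ee.
    have := is_lim_seq_scal_l _ (Rabs (IZR z)) _ Hxl; rewrite /= Rmult_0_r.
    by apply: is_lim_seq_ext => m; rewrite -Rmult_minus_distr_l Rabs_mult.
  by apply: Clim_plus; apply: Hlim; lia.
- move=> m.
  have -> : (beta p (x m) - dft (nn m) (beta p) 0)%C = \csum_(i < m) a m i.
    rewrite -(dft_inversion m (beta p) (jj m) (Hjn m)) -/(nn m) -/(x m).
    rewrite (csum_sym m (fun k => dft (nn m) (beta p) k * ee (IZR k * x m)%R)%C).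
    rewrite Rmult_0_l ee_0 Cmult_1_r.
    set s1 := \csum_(i < m) _; set s2 := \csum_(i < m) _.
    have -> : s1 = s2 by apply: csum_ext => i Hi; rewrite /a Hi.
    ring.
  apply: csums_finite => k Hk; by rewrite /a ltnNge Hk.
have H3 : Clim (fun m => beta p (x m) - dft (nn m) (beta p) 0)%C (beta p t - 0).
  apply: Clim_minus; last exact: dft_beta_0.
  apply: Clim_RtoC; apply: beta_lim.
  apply: (is_lim_seq_ext (fun m => (x m - t) + t)); first by move=> m; ring.
  have -> : Finite t = Finite (0 + t) by rewrite Rplus_0_l.
  by apply: is_lim_seq_plus' => //; [apply/is_lim_seq_abs_0|exact: is_lim_seq_const].
have E : l' = RtoC (beta p t).
  by rewrite (Clim_unique _ _ _ H2 H3); ring.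
by rewrite -E.
Qed.

Lemma zpair_ext a b n : (forall k, k <> 0%Z -> a k = b k) -> zpair a n = zpair b n.
Proof. by move=> H; rewrite /zpair !H //; lia. Qed.

Lemma ee_frac k u : ee (IZR k * frac_part u) = ee (IZR k * u).
Proof.
rewrite /frac_part Rmult_minus_distr_l -mult_IZR.
have -> : IZR k * u = IZR k * u - IZR (k * Int_part u) + IZR (k * Int_part u) by ring.
rewrite ee_plus ee_Z Cmult_1_r; congr ee; ring.
Qed.

Lemma Bper_fourier p u : (1 < p)%nat ->
  csums (zpair (fun k => / den p k * ee (IZR k * u))%C) (RtoC (Bper p u)).
Proof.
move=> Hp; have [H1 H2] := base_fp u.
apply: csums_ext (beta_fourier p (frac_part u) Hp ltac:(lra)) => n.
by apply: zpair_ext => k _; rewrite ee_frac.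
Qed.

(** * Bernstein's theorem on absolute convergence *)

Definition zmod (c : Z -> C) (n : nat) : R :=
  Cmod (c (Z.of_nat n.+1)) + Cmod (c (- Z.of_nat n.+1)%Z).

Lemma zmod_ge0 c n : 0 <= zmod c n.
Proof. by apply: Rplus_le_le_0_compat; exact: Cmod_ge_0. Qed.

Lemma zpair_zmod c n : Cmod (zpair c n) <= zmod c n.
Proof. exact: Cmod_triangle. Qed.

Lemma Cconj_csum n (a : nat -> C) : Cconj (\csum_(i < n) a i) = \csum_(i < n) Cconj (a i).
Proof.
elim: n => [|n IH]; last by rewrite !csumS Cplus_conj IH.
by rewrite !csum0 /Cconj /= Ropp_0.
Qed.

Lemma Cconj_ee x : Cconj (ee x) = ee (- x).
Proof.
by rewrite !ee_form /Cconj /= Ropp_mult_distr_r_reverse cos_neg sin_neg.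
Qed.

(** The shift s only contributes a factor of modulus one; it lets the frequencies run from -n to n
    while the index starts at 0. *)
Lemma parseval_fin n (a : nat -> C) (s : R) : (0 < n)%nat ->
  \rsum_(t < n) (Cmod (\csum_(i < n) (a i * ee ((INR i - s) * (INR t / INR n)))) ^ 2) =
  INR n * \rsum_(i < n) (Cmod (a i) ^ 2).
Proof.
move=> Hn0; have Hn : 0 < INR n by apply: lt_0_INR; lia.
apply: RtoC_inj; rewrite RtoC_mult !RtoC_rsum.
pose F i j := (a i * Cconj (a j))%C.
rewrite (csum_ext _ _ (fun t => \csum_(i < n) \csum_(j < n) (F i j * ee (IZR (Z.of_nat i - Z.of_nat j) / INR n) ^ t)%C)); last first.
  move=> t _; rewrite Cmod2_conj Cconj_csum -csum_scalr.
  apply: csum_ext => i _; rewrite -csum_scal; apply: csum_ext => j _.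
  rewrite Cmult_conj Cconj_ee -ee_nat minus_IZR -!INR_IZR_INZ /F.
  have -> : INR t * ((INR i - INR j) / INR n) =
    ((INR i - s) * (INR t / INR n)) + - ((INR j - s) * (INR t / INR n)) by field; lra.
  by rewrite ee_plus; ring.
rewrite csum_switch -csum_scal; apply: csum_ext => i Hi.
rewrite csum_switch (csum_ext _ _ (fun j => if j == i then (INR n * Cmod (a i) ^ 2)%C else RtoC 0)).
  by rewrite csum_delta // RtoC_pow.
move=> j Hj; rewrite csum_scal; case: eqP => [->|Hne].
  rewrite Z.sub_diag /Rdiv Rmult_0_l ee_0 (csum_ext _ _ (fun=> RtoC 1)); last by move=> t _; exact: Cpow_1_l.
  rewrite csum_const /F -Cmod2_conj RtoC_pow; ring.
by rewrite ee_orth; [ring|lia|lia].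
Qed.

(** At all 2n + 1 sample points the partial sum over |k| <= n is bounded by G plus the tail of the
    coefficients; discrete Parseval bounds the sum of squares by the square of that, and the tail
    vanishes as n grows. *)
Lemma bessel (c : Z -> C) (g : R -> C) G K : ex_series (zmod c) ->
  (forall u, csums (zpair (fun k => c k * ee (IZR k * u))%C) (g u)) ->
  (forall u, Cmod (g u) <= G) ->
  \rsum_(i < K) (Cmod (c (Z.of_nat i.+1)) ^ 2 + Cmod (c (- Z.of_nat i.+1)%Z) ^ 2) <= G ^ 2.
Proof.
move=> Hc Hg HG.
have HG0 : 0 <= G by apply: Rle_trans (HG 0); exact: Cmod_ge_0.
have Htail : is_lim_seq (fun n => Series (zmod c) - \rsum_(i < n) zmod c i) 0.
  have -> : Finite 0 = Finite (Series (zmod c) - Series (zmod c)) by rewrite Rminus_diag.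
  apply: is_lim_seq_minus'; first exact: is_lim_seq_const.
  exact: is_lim_seq_rsum.
set S := \rsum_(i < K) _.
have Hn n : (K <= n)%nat -> S <= (G + (Series (zmod c) - \rsum_(i < n) zmod c i)) ^ 2.
  move=> HKn; set e := Series _ - _.
  pose c0 k := if (k =? 0)%Z then RtoC 0 else c k.
  pose N := (2 * n + 1)%nat; have HN0 : (0 < N)%nat by rewrite /N; lia.
  have HN : 0 < INR N by apply: lt_0_INR; lia.
  pose a i := c0 (Z.of_nat i - Z.of_nat n)%Z.
  have Hf u : Cmod (\csum_(i < N) (a i * ee ((INR i - INR n) * u))) <= G + e.
    have -> : \csum_(i < N) (a i * ee ((INR i - INR n) * u)) =
       \csum_(i < n) zpair (fun k => c k * ee (IZR k * u))%C i.
      rewrite (csum_ext _ _ (fun i => (fun k => c0 k * ee (IZR k * u))%C (Z.of_nat i - Z.of_nat n)%Z)).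
        rewrite /N (csum_sym n (fun k => c0 k * ee (IZR k * u))%C) {1}/c0 Z.eqb_refl.
        rewrite Cmult_0_l Cplus_0_l; exact: csum_ext.
      by move=> i _; rewrite minus_IZR -!INR_IZR_INZ.
    have -> : \csum_(i < n) zpair (fun k => c k * ee (IZR k * u))%C i =
       (g u - (g u - \csum_(i < n) zpair (fun k => c k * ee (IZR k * u)) i))%C by ring.
    apply: Rle_trans (Cmod_triangle _ _) _; rewrite Cmod_opp.
    apply: Rplus_le_compat => //; apply: csums_tail => // k.
    by apply: Rle_trans (Cmod_triangle _ _) _; rewrite !Cmod_mul_ee; apply: Rle_refl.
  have HP := parseval_fin N a (INR n) HN0.
  have HS : S <= \rsum_(i < N) (Cmod (a i) ^ 2).
    apply: (Rle_trans _ (\rsum_(i < n) (Cmod (c (Z.of_nat i.+1)) ^ 2 + Cmod (c (- Z.of_nat i.+1)%Z) ^ 2))).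
      apply: rsum_le_len => // i; have := pow2_ge_0 (Cmod (c (Z.of_nat i.+1))).
      have := pow2_ge_0 (Cmod (c (- Z.of_nat i.+1)%Z)); lra.
    apply: Req_le; apply: RtoC_inj; rewrite !RtoC_rsum.
    rewrite /N /a (csum_sym n (fun k => RtoC (Cmod (c0 k) ^ 2))) {1}/c0 [(0 =? 0)%Z]/= Cmod_0.
    rewrite pow_i; last lia.
    rewrite Cplus_0_l; apply: csum_ext => i _; by rewrite RtoC_plus.
  have He : 0 <= G + e by apply: Rle_trans (Hf 0); exact: Cmod_ge_0.
  have H1 : \rsum_(t < N) (Cmod (\csum_(i < N) (a i * ee ((INR i - INR n) * (INR t / INR N)))) ^ 2) <= INR N * (G + e) ^ 2.
    rewrite -rsum_const; apply: rsum_le => t _; apply: pow_incr; split => //; exact: Cmod_ge_0.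
  rewrite HP in H1; apply: Rle_trans HS _; exact: Rmult_le_reg_l H1.
apply: (is_lim_seq_le_loc (fun=> S) (fun n => (G + (Series (zmod c) - \rsum_(i < n) zmod c i)) ^ 2) S (G ^ 2)).
- by exists K => n /leP; exact: Hn.
- exact: is_lim_seq_const.
- have H1 : is_lim_seq (fun n => G + (Series (zmod c) - \rsum_(i < n) zmod c i)) G.
    have -> : Finite G = Finite (G + 0) by rewrite Rplus_0_r.
    by apply: is_lim_seq_plus' => //; exact: is_lim_seq_const.
  have := is_lim_seq_mult' _ _ _ _ H1 H1.
  have -> : G ^ 2 = G * G by ring.
  by apply: is_lim_seq_ext => n; ring.
Qed.

(** Cauchy-Schwarz against a constant sequence; in the induction the cross term is absorbed by (s -
    N x_n)^2 >= 0. *)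
Lemma rsum_sqr_le n (x : nat -> R) :
  (\rsum_(i < n) x i) ^ 2 <= INR n * \rsum_(i < n) (x i ^ 2).
Proof.
elim: n => [|n IH]; first by rewrite !rsum0 /=; lra.
rewrite !rsumS S_INR; set s := \rsum_(i < n) _ in IH *; set q := \rsum_(i < n) _ in IH *.
have Hn := pos_INR n; set N := INR n in IH Hn *.
have [HN0|HN0] : N = 0 \/ 0 < N by lra.
  have Hs : s = 0 by rewrite HN0 in IH; nra.
  have Hq : 0 <= q by apply: rsum_ge0 => i _; exact: pow2_ge_0.
  by rewrite HN0 Hs; nra.
suff : 2 * s * x n <= q + N * x n ^ 2 by nra.
apply: (Rmult_le_reg_l N) => //.
have := pow2_ge_0 (s - N * x n); nra.
Qed.

(** Index i of [zmod] stands for the frequencies i + 1 and -(i + 1), so this is the dyadic block 2^j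
    <= |k| < 2^(j+1). *)
Definition block (c : Z -> C) (j : nat) : R :=
  \rsum_(i < 2 ^ j) zmod c (2 ^ j - 1 + i).

(** The step h = 2^-(j+2) puts |k h| into [1/4, 1/2] on this block, where |e(k h) - 1| >= 1/2; so
    the coefficients of g are at most twice those of the difference g(u + h) - g(u). Bessel bounds
    the latter in square sum, and Cauchy-Schwarz over 2^j indices costs 2^(j/2) = r^(-2j), leaving
    r^(3j) r^(-2j) = r^j. *)
Lemma bernstein_block (c : Z -> C) (g : R -> C) C0 r j : 0 < r -> r ^ 4 = 1 / 2 ->
  0 <= C0 -> ex_series (zmod c) ->
  (forall u, csums (zpair (fun k => c k * ee (IZR k * u))%C) (g u)) ->
  (forall u, Cmod (g (u + (/ 2) ^ (j + 2)) - g u) <= C0 * (r ^ 3) ^ j) ->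
  block c j <= 4 * C0 * r ^ j.
Proof.
move=> Hr Hr4 HC0 Hc Hg Hh.
set h := (/ 2) ^ (j + 2) in Hh.
pose b k := (c k * (ee (IZR k * h) - 1))%C.
have Hb1 k : Cmod (b k) <= 2 * Cmod (c k).
  rewrite /b Cmod_mult Rmult_comm; apply: Rmult_le_compat_r; first exact: Cmod_ge_0.
  apply: Rle_trans (Cmod_triangle _ _) _; rewrite Cmod_ee Cmod_opp Cmod_1; lra.
have Hbs : ex_series (zmod b).
  apply: (ex_series_le_pos _ (fun n => 2 * zmod c n)); last exact: ex_series_scal_l.
  move=> n; split; first exact: zmod_ge0.
  have := Hb1 (Z.of_nat n.+1); have := Hb1 (- Z.of_nat n.+1)%Z; rewrite /zmod; lra.
have Hbg u : csums (zpair (fun k => b k * ee (IZR k * u))%C) (g (u + h) - g u).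
  apply: csums_ext (csums_minus _ _ _ _ (Hg (u + h)) (Hg u)) => n.
  by rewrite /zpair /b !Rmult_plus_distr_l !ee_plus; ring.
have HB K := bessel b _ _ K Hbs Hbg Hh.
pose x i := Cmod (b (Z.of_nat i.+1)) + Cmod (b (- Z.of_nat i.+1)%Z).
have H2j : INR (2 ^ j) = 2 ^ j.
  by rewrite pow_INR.
have H2j0 : (0 < 2 ^ j)%nat by apply/ltP; have := Nat.pow_nonzero 2 j ltac:(lia); lia.
have Hcx : block c j <= 2 * \rsum_(i < 2 ^ j) x (2 ^ j - 1 + i)%nat.
  rewrite -rsum_scal; apply: rsum_le => i Hi.
  have Hbb k : (Z.of_nat (2 ^ j) <= Z.abs k < Z.of_nat (2 * 2 ^ j))%Z -> Cmod (c k) <= 2 * Cmod (b k).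
    move=> [Hk1 Hk2]; rewrite /b Cmod_mult.
    have Hh0 : 0 < h by apply: pow_lt; lra.
    have Eh : INR (2 ^ j) * h = 1 / 4.
      rewrite H2j /h pow_add -Rmult_assoc -Rpow_mult_distr Rinv_r; last lra.
      by rewrite pow1; field.
    have Ea : Rabs (IZR k * h) = IZR (Z.abs k) * h.
      by rewrite Rabs_mult (Rabs_pos_eq h) ?abs_IZR //; lra.
    have Hlo : 1 / 4 <= Rabs (IZR k * h).
      rewrite Ea -Eh INR_IZR_INZ; apply: Rmult_le_compat_r; [lra|exact: IZR_le].
    have Hhi : Rabs (IZR k * h) <= 1 / 2.
      have -> : 1 / 2 = INR (2 * 2 ^ j) * h by rewrite mult_INR Rmult_assoc Eh /=; field.
      rewrite Ea INR_IZR_INZ; apply: Rmult_le_compat_r; [lra|apply: IZR_le; lia].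
    have := Cmod_1_ee_ge _ Hhi; have -> : (1 - ee (IZR k * h) = - (ee (IZR k * h) - 1))%C by ring.
    rewrite Cmod_opp; have := Cmod_ge_0 (c k); nra.
  rewrite /zmod /x.
  have := Hbb (Z.of_nat (2 ^ j - 1 + i).+1) ltac:(lia).
  have := Hbb (- Z.of_nat (2 ^ j - 1 + i).+1)%Z ltac:(lia).
  lra.
apply: Rle_trans Hcx _.
set s := \rsum_(i < 2 ^ j) _.
have Hs0 : 0 <= s.
  by apply: rsum_ge0 => i _; apply: Rplus_le_le_0_compat; exact: Cmod_ge_0.
suff Hs : s ^ 2 <= (2 * C0 * r ^ j) ^ 2.
  have H0 : 0 <= 2 * C0 * r ^ j by apply: Rmult_le_pos; [lra|apply: pow_le; lra].
  set y := 2 * C0 * r ^ j in H0 Hs *; have -> : 4 * C0 * r ^ j = 2 * y by rewrite /y; ring.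
  by case: (Rle_lt_dec s y) => Hsy; nra.
apply: Rle_trans (rsum_sqr_le _ _) _; rewrite H2j.
have HxB : \rsum_(i < 2 ^ j) (x (2 ^ j - 1 + i)%nat ^ 2) <= 2 * (C0 * (r ^ 3) ^ j) ^ 2.
  apply: Rle_trans (Rmult_le_compat_l 2 _ _ ltac:(lra) (HB (2 ^ j - 1 + 2 ^ j)%nat)).
  rewrite rsum_cat Rmult_plus_distr_l -!rsum_scal.
  have H1 := rsum_ge0 (2 ^ j - 1) (fun i => 2 * (Cmod (b (Z.of_nat i.+1)) ^ 2 + Cmod (b (- Z.of_nat i.+1)%Z) ^ 2)).
  have H2 := rsum_le (2 ^ j) (fun i => x (2 ^ j - 1 + i)%nat ^ 2) (fun i => 2 * (Cmod (b (Z.of_nat (2 ^ j - 1 + i).+1)) ^ 2 + Cmod (b (- Z.of_nat (2 ^ j - 1 + i).+1)%Z) ^ 2)).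
  apply: Rle_trans (H2 _) _; first by move=> i _; rewrite /x; set A := Cmod _; set B := Cmod _; have := pow2_ge_0 (A - B); nra.
  rewrite -{1}[X in X <= _]Rplus_0_l; apply: Rplus_le_compat_r; apply: H1 => i _.
  set A := Cmod _; set B := Cmod _; have := pow2_ge_0 A; have := pow2_ge_0 B; lra.
apply: Rle_trans (Rmult_le_compat_l (2 ^ j) _ _ _ HxB) _; first by apply: pow_le; lra.
have E : 2 ^ j * ((r ^ 3) ^ j) ^ 2 = (r ^ j) ^ 2.
  have -> : ((r ^ 3) ^ j) ^ 2 = (r ^ 4) ^ j * (r ^ j) ^ 2.
    rewrite -!pow_mult -pow_add; congr pow; lia.
  rewrite Hr4 -Rmult_assoc -Rpow_mult_distr.
  have -> : 2 * (1 / 2) = 1 by field.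
  by rewrite pow1 Rmult_1_l.
have H0 := pow2_ge_0 (C0 * r ^ j).
apply: (Rle_trans _ (2 * (C0 * r ^ j) ^ 2)); last by nra.
apply: Req_le; rewrite [in RHS]Rpow_mult_distr -E; ring.
Qed.

Lemma rsum_blocks (z : nat -> R) J :
  \rsum_(n < 2 ^ J - 1) z n = \rsum_(j < J) \rsum_(i < 2 ^ j) z (2 ^ j - 1 + i)%nat.
Proof.
elim: J => [|J IH]; first by rewrite !rsum0.
rewrite rsumS -IH -rsum_cat; congr bigop; congr index_iota.
have := Nat.pow_nonzero 2 J ltac:(lia); rewrite Nat.pow_succ_r'; lia.
Qed.

Lemma csum_blocks (z : nat -> C) J :
  \csum_(n < 2 ^ J - 1) z n = \csum_(j < J) \csum_(i < 2 ^ j) z (2 ^ j - 1 + i)%nat.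
Proof.
elim: J => [|J IH]; first by rewrite !csum0.
rewrite csumS -IH -csum_cat; congr bigop; congr index_iota.
have := Nat.pow_nonzero 2 J ltac:(lia); rewrite Nat.pow_succ_r'; lia.
Qed.

Lemma le_pow2_sub1 n : (n <= 2 ^ n - 1)%nat.
Proof. by have := Nat.pow_gt_lin_r 2 n ltac:(lia); lia. Qed.

Lemma ex_series_geom_scal D r : 0 <= r < 1 -> ex_series (fun j => D * r ^ j).
Proof.
by move=> Hr; apply: ex_series_scal_l; apply: ex_series_geom; rewrite Rabs_pos_eq; lra.
Qed.

(** The available bounds uniform in M concern dyadic blocks, so Tannery's theorem is applied to the
    series of blocks. Absolute convergence of the limit series then removes the grouping. *)
Lemma block_limit (c : nat -> Z -> C) (c' : Z -> C) D r : 0 <= r < 1 ->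
  (forall M j, block (c M) j <= D * r ^ j) ->
  (forall k, k <> 0%Z -> Clim (fun M => c M k) (c' k)) ->
  ex_series (zmod c') /\
  forall (e : Z -> C) (l : nat -> C), (forall k, Cmod (e k) <= 1) ->
    (forall M, csums (zpair (fun k => c M k * e k)%C) (l M)) ->
    exists l', csums (zpair (fun k => c' k * e k)%C) l' /\ Clim l l'.
Proof.
move=> Hr Hb Hc; have Hgeom := ex_series_geom_scal D r Hr.
have Hz n : is_lim_seq (fun M => zmod (c M) n) (zmod c' n).
  have H z w : Clim z w -> is_lim_seq (fun M => Cmod (z M)) (Cmod w).
    move=> Hzw; apply: (is_lim_seq_ext (fun M => (Cmod (z M) - Cmod w) + Cmod w)); first by move=> M; ring.
    have -> : Finite (Cmod w) = Finite (0 + Cmod w) by rewrite Rplus_0_l.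
    apply: is_lim_seq_plus'; last exact: is_lim_seq_const.
    apply/is_lim_seq_abs_0; apply: is_lim_seq_squeeze0 Hzw => M; split; first exact: Rabs_pos.
    apply: Rabs_le; split.
      have := Cmod_triangle (w - z M) (z M); have -> : (w - z M + z M = w)%C by ring.
      have -> : (w - z M = - (z M - w))%C by ring.
      rewrite Cmod_opp; lra.
    have := Cmod_triangle (z M - w) w; have -> : (z M - w + w = z M)%C by ring.
    lra.
  by apply: is_lim_seq_plus'; apply: H; apply: Hc; lia.
have Hb' j : block c' j <= D * r ^ j.
  have Hl : is_lim_seq (fun M => block (c M) j) (block c' j).
    rewrite /block; move: (2 ^ j - 1)%nat => s; elim: (2 ^ j)%nat => [|n IH].
      by rewrite rsum0; apply: is_lim_seq_ext (is_lim_seq_const 0) => M; rewrite rsum0.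
    rewrite rsumS; apply: (is_lim_seq_ext _ _ _ _ (is_lim_seq_plus' _ _ _ _ IH (Hz (s + n)%nat))) => M.
    by rewrite rsumS.
  exact: (is_lim_seq_le _ _ _ _ (fun M => Hb M j) Hl (is_lim_seq_const _)).
have Hpos j : 0 <= D * r ^ j.
  by apply: Rle_trans (Hb' j); apply: rsum_ge0 => i _; exact: zmod_ge0.
have Hs : ex_series (zmod c').
  apply: (proj1 (ex_series_bounded _ (Series (fun j => D * r ^ j)) (zmod_ge0 c') _)) => n.
  apply: Rle_trans (rsum_le_len _ _ _ (zmod_ge0 c') (le_pow2_sub1 n)) _.
  rewrite rsum_blocks; apply: Rle_trans (rsum_le _ _ _ (fun j _ => Hb' j)) _.
  exact: rsum_le_Series.
split=> // e l He Hl.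
have Hze d n : Cmod (zpair (fun k => d k * e k)%C n) <= zmod d n.
  apply: Rle_trans (Cmod_triangle _ _) _; rewrite !Cmod_mult.
  have H1 := He (Z.of_nat n.+1); have H2 := He (- Z.of_nat n.+1)%Z.
  have := Cmod_ge_0 (d (Z.of_nat n.+1)); have := Cmod_ge_0 (d (- Z.of_nat n.+1)%Z).
  rewrite /zmod; nra.
pose A d j := \csum_(i < 2 ^ j) zpair (fun k => d k * e k)%C (2 ^ j - 1 + i)%nat.
have Hgroup d m : csums (zpair (fun k => d k * e k)%C) m -> csums (A d) m.
  move=> H; have := Clim_subseq _ _ _ le_pow2_sub1 H.
  by apply: Clim_ext => J; rewrite csum_blocks.
have [l' [H1 H2]] : exists l', csums (A c') l' /\ Clim l l'.
  apply: (tannery (fun M => A (c M)) (A c') l (fun j => D * r ^ j)) => //.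
  - move=> M j; apply: Rle_trans (Cmod_csum _ _) _; apply: Rle_trans (Hb M j).
    by apply: rsum_le => i _; exact: Hze.
  - move=> j; apply: (Clim_csum (2 ^ j) (fun M i => zpair (fun k => c M k * e k)%C (2 ^ j - 1 + i)%nat)) => i.
    by apply: Clim_plus; apply: Clim_mult (Clim_const _); apply: Hc; lia.
  - by move=> M; apply: Hgroup.
exists l'; split=> //.
have [l2 Hl2] := csums_abs _ _ (Hze c') Hs.
by rewrite (csums_unique _ _ _ H1 (Hgroup _ _ Hl2)).
Qed.

(** * Counting kinks *)

Lemma frac_part_eq k t : 0 <= t < 1 -> frac_part (IZR k + t) = t.
Proof.
move=> Ht; rewrite /frac_part; have <- : k = Int_part (IZR k + t) by apply: Int_part_spec; lra.
ring.
Qed.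

Lemma frac_part_shift k x : frac_part (IZR k + x) = frac_part x.
Proof.
have [H1 H2] := base_fp x.
have -> : IZR k + x = IZR (k + Int_part x) + frac_part x.
  by rewrite plus_IZR /frac_part; ring.
by rewrite frac_part_eq //; lra.
Qed.

Lemma Bper_shift p k x : Bper p (IZR k + x) = Bper p x.
Proof. by rewrite /Bper frac_part_shift. Qed.

Lemma INR_p_gt1 p : (1 < p)%nat -> 1 < INR p.
Proof. by move=> Hp; apply: (lt_INR 1); lia. Qed.

Lemma logb_pow p J x : (1 < p)%nat -> 0 < x -> logb p (INR p ^ J * x) = INR J + logb p x.
Proof.
move=> Hp Hx; have HL := ln_p_pos p Hp; have HP := INR_p_gt1 p Hp.
rewrite /logb ln_mult ?ln_pow; [field|..]; try lra.
by apply: pow_lt; lra.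
Qed.

Lemma exp_mono x y : x <= y -> exp x <= exp y.
Proof. by case=> [H|->]; [apply: Rlt_le; exact: exp_increasing|exact: Rle_refl]. Qed.

Lemma rsum_geom P M : P <> 1 -> \rsum_(k < M) (P ^ k) = (P ^ M - 1) / (P - 1).
Proof.
move=> HP; elim: M => [|M IH]; first by rewrite rsum0 /=; field; lra.
by rewrite rsumS IH /=; field; lra.
Qed.

(** With v = log_p(X / lam), only the terms with k + 1 <= floor v can be nonzero, so the sum is
    floor v minus a geometric sum, and floor v = v - {v} produces [Bper]. The upper bound on X says
    that K levels reach floor v. *)
Lemma trunc_sum p X lam K : (1 < p)%nat -> 0 < lam <= X -> X < INR p ^ K.+1 * lam ->
  \rsum_(k < K) Rmax 0 (1 - INR p ^ k.+1 * lam / X) =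
  logb p (X / lam) + Bper p (logb p (X / lam)) - 1 / 2 - 1 / ln (INR p)
  + lam / X * (INR p / (INR p - 1)).
Proof.
move=> Hp [Hl HlX] HXK; have HL := ln_p_pos p Hp; have HP := INR_p_gt1 p Hp.
set P := INR p in HP HXK *; set L := ln P in HL *; set v := logb p _.
have HX : 0 < X by lra.
have HXl : 1 <= X / lam by apply/Rle_div_r => //; lra.
have Ev : exp (L * v) = X / lam.
  rewrite /v /logb -/P -/L; have -> : L * (ln (X / lam) / L) = ln (X / lam) by field; lra.
  by rewrite exp_ln; lra.
have Hv0 : 0 <= v.
  apply: Rmult_le_pos; last by apply: Rlt_le; apply: Rinv_0_lt_compat.
  by rewrite -ln_1; apply: ln_le; lra.
have [Hf1 Hf2] := base_fp v; have [Hi1 Hi2] := base_Int_part v.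
set th := frac_part v in Hf1 Hf2 *.
have HM : (0 <= Int_part v)%Z.
  have : (-1 < Int_part v)%Z by apply: lt_IZR; lra.
  lia.
pose M := Z.to_nat (Int_part v).
have EM : INR M = v - th.
  by rewrite /M INR_IZR_INZ Z2Nat.id // /th /frac_part; ring.
have EPk k : P ^ k = exp (L * INR k) by rewrite Rmult_comm exp_nat exp_ln //; lra.
have EPM : P ^ M = X / lam * exp (- (L * th)).
  rewrite EPk EM -Ev -exp_plus; congr exp; ring.
have HMK : (M <= K)%nat.
  have H : P ^ M < P ^ K.+1.
    rewrite EPM; apply: (Rle_lt_trans _ (X / lam * 1)).
      apply: Rmult_le_compat_l; first lra.
      rewrite -exp_0; apply: exp_mono; nra.
    by rewrite Rmult_1_r; apply/Rlt_div_l.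
  rewrite !EPk in H; have := exp_lt_inv _ _ H => H1.
  have : INR M < INR K.+1 by apply: (Rmult_lt_reg_l L).
  by move/INR_lt; lia.
rewrite -(subnKC HMK) rsum_cat.
rewrite (rsum_ext M _ (fun k => 1 - lam / X * P * P ^ k)); last first.
  move=> k Hk; rewrite Rmax_right; first by rewrite /=; field; lra.
  have H : P ^ k.+1 <= X / lam.
    rewrite EPk -Ev; apply: exp_mono; apply: Rmult_le_compat_l; first lra.
    have : INR k.+1 <= INR M by apply: le_INR; lia.
    lra.
  have : P ^ k.+1 * lam / X <= 1.
    apply/Rle_div_l => //; move: (Rmult_le_compat_r lam _ _ ltac:(lra) H).
    have -> : X / lam * lam = X by field; lra.
    lra.
  rewrite -/(pow P k.+1); lra.
rewrite (rsum_ext (K - M) _ (fun=> 0)); last first.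
  move=> k Hk; rewrite Rmax_left //.
  have H : X / lam <= P ^ (M + k).+1.
    rewrite EPk -Ev; apply: exp_mono; apply: Rmult_le_compat_l; first lra.
    have : INR M + 1 <= INR (M + k).+1 by rewrite -S_INR; apply: le_INR; lia.
    lra.
  have : 1 <= P ^ (M + k).+1 * lam / X.
    apply/Rle_div_r => //; move: (Rmult_le_compat_r lam _ _ ltac:(lra) H).
    have -> : X / lam * lam = X by field; lra.
    lra.
  lra.
rewrite rsum_const Rmult_0_r Rplus_0_r rsum_minus rsum_scal rsum_const rsum_geom; last lra.
rewrite EPM EM /Bper /beta -/P -/L -/th; field; lra.
Qed.

Definition bern (t : R) : R := frac_part t * (1 - frac_part t) / 2.

Definition be (al : R) : R := (al ^ 2 - al) / 2.

Definition hh (al y : R) : R := be al + bern (y - al).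

(* For y >= 0 this is the sum of [Rmax 0 (y - (n + al))] over n >= 0, see [kink_sum]. *)
Definition rho (al y : R) : R := y ^ 2 / 2 + (1 / 2 - al) * y + hh al y.

Lemma bern_shift k x : bern (IZR k + x) = bern x.
Proof. by rewrite /bern frac_part_shift. Qed.

(** Peeling off n = 0 replaces s by s - 1 and leaves [bern] unchanged. On [-1, 0] both sides vanish;
    this range is included so that [kink_sum] covers 0 <= y < al. *)
Lemma kink_sum0 m s : -1 <= s <= INR m ->
  \rsum_(n < m) Rmax 0 (s - INR n) = (s ^ 2 + s) / 2 + bern s.
Proof.
have Hneg k s' : -1 <= s' <= 0 -> \rsum_(n < k) Rmax 0 (s' - INR n) = (s' ^ 2 + s') / 2 + bern s'.
  move=> Hs; rewrite (rsum_ext _ _ (fun=> 0)); last first.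
    by move=> n _; rewrite Rmax_left //; have := pos_INR n; lra.
  rewrite rsum_const Rmult_0_r /bern.
  have [->|Hs0] : s' = 0 \/ s' < 0 by lra.
    have -> : frac_part 0 = 0 by have := frac_part_eq 0 0; rewrite Rplus_0_l; apply; lra.
    by field.
  have -> : frac_part s' = s' + 1 by have := frac_part_eq (-1) (s' + 1) ltac:(lra); have -> : IZR (-1) + (s' + 1) = s' by ring.
  by field.
elim: m s => [|m IH] s Hs; first by apply: Hneg; rewrite /= in Hs; lra.
have [Hs0|Hs0] : s <= 0 \/ 0 < s by lra.
  by apply: Hneg; lra.
rewrite big_nat_recl // [INR 0]/= (rsum_ext _ _ (fun n => Rmax 0 ((s - 1) - INR n))); last first.
  by move=> n _; rewrite S_INR; congr Rmax; ring.
rewrite IH; last by rewrite S_INR in Hs; lra.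
have -> : bern (s - 1) = bern s by have := bern_shift (-1) s; have -> : IZR (-1) + s = s - 1 by ring.
rewrite Rmax_right; last lra.
by rewrite Rminus_0_r; field.
Qed.

Lemma kink_sum al m y : 0 < al <= 1 -> 0 <= y <= INR m + al ->
  \rsum_(n < m) Rmax 0 (y - (INR n + al)) = rho al y.
Proof.
move=> Hal Hy; rewrite (rsum_ext _ _ (fun n => Rmax 0 ((y - al) - INR n))); last first.
  by move=> n _; congr Rmax; ring.
by rewrite kink_sum0; [rewrite /rho /hh /be; field|lra].
Qed.

Definition fsum (p : nat) (al x : R) (m : nat) : R :=
  \rsum_(n < m) Bper p (logb p (x / (INR n + al))).

Definition Lam (al : R) (m : nat) : R := \rsum_(n < m) ln (INR n + al).

(* By Stirling's formula the limit is [ln (2 * PI) / 2 - ln (Gamma al)]. *)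
Definition wst (al : R) (m : nat) : R :=
  Lam al m - (INR m * ln (INR m) - INR m + (al - 1 / 2) * ln (INR m)).

(** [trunc_sum] is used at X = p^J x, where [Bper] has the same value by periodicity, with J + 1
    levels: 1 < p al ensures X < p^(J+2) (n + al) already at n = 0. After exchanging the sums over n
    and over the levels, each level is a kink sum. *)
Lemma fsum_rho p al x J : (1 < p)%nat -> 0 < al <= 1 -> 1 < INR p * al -> 1 <= x <= INR p ->
  fsum p al x (p ^ J) =
  / x * (INR p * rho al (x / INR p) + \rsum_(i < J) (/ INR p ^ i * rho al (x * INR p ^ i)))
  - \rsum_(n < p ^ J) logb p (INR p ^ J * x / (INR n + al))
  + INR p ^ J * (1 / 2 + 1 / ln (INR p))
  - INR p / (INR p - 1) / (INR p ^ J * x) * \rsum_(n < p ^ J) (INR n + al).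
Proof.
move=> Hp Hal Hpal Hx; have HL := ln_p_pos p Hp; have HP := INR_p_gt1 p Hp.
have EmJ : INR (p ^ J) = INR p ^ J by rewrite pow_INR.
set P := INR p in HP Hx Hpal EmJ *; set L := ln P in HL *; set m := (p ^ J)%nat.
have HPJ k : 0 < P ^ k by apply: pow_lt; lra.
have HPJ1 k : 1 <= P ^ k by apply: pow_R1_Rle; lra.
have HPle a b : (a <= b)%nat -> P ^ a <= P ^ b by move=> Hab; apply: Rle_pow; [lra|lia].
set X := P ^ J * x.
have HX : 0 < X by apply: Rmult_lt_0_compat; [exact: HPJ|lra].
have H n : (n < m)%nat -> Bper p (logb p (x / (INR n + al))) =
    \rsum_(k < J.+1) Rmax 0 (1 - P ^ k.+1 * (INR n + al) / X)
    - logb p (X / (INR n + al)) + (1 / 2 + 1 / L) - P / (P - 1) / X * (INR n + al).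
  move=> Hn; have Hn0 := pos_INR n.
  have Hnm : INR n + 1 <= P ^ J by rewrite -EmJ -S_INR; apply: le_INR; lia.
  rewrite (trunc_sum p X (INR n + al) J.+1 Hp); first last.
  - rewrite /X -/P; apply: (Rle_lt_trans _ (P ^ J.+1)).
      by rewrite /= Rmult_comm; apply: Rmult_le_compat_r; [have := HPJ J; lra|lra].
    rewrite -/(pow P J.+1) [P ^ J.+2]/= -/(pow P J.+1) -{1}(Rmult_1_r (P ^ J.+1)).
    have -> : P * P ^ J.+1 * (INR n + al) = P ^ J.+1 * (P * (INR n + al)) by ring.
    by apply: Rmult_lt_compat_l; [exact: HPJ|nra].
  - by split; [lra|]; rewrite /X; have := HPJ1 J; nra.
  have -> : logb p (X / (INR n + al)) = IZR (Z.of_nat J) + logb p (x / (INR n + al)).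
    rewrite -INR_IZR_INZ -logb_pow //; last by apply: Rdiv_lt_0_compat; lra.
    by congr logb; rewrite /X /P; field; lra.
  rewrite Bper_shift -/P -/L; field; lra.
rewrite /fsum (rsum_ext _ _ _ H) rsum_minus rsum_plus rsum_minus rsum_scal rsum_const EmJ.
congr (_ - _ + _ - _).
rewrite rsum_switch.
rewrite (rsum_ext _ _ (fun k => P ^ k.+1 / X * rho al (X / P ^ k.+1))); last first.
  move=> k Hk; have HPk := HPJ k.+1.
  rewrite -(kink_sum al m); [|done|].
    rewrite -rsum_scal; apply: rsum_ext => n _.
    have -> : 1 - P ^ k.+1 * (INR n + al) / X = P ^ k.+1 / X * (X / P ^ k.+1 - (INR n + al)) by field; lra.
    rewrite -RmaxRmult ?Rmult_0_r //; apply: Rlt_le; exact: Rdiv_lt_0_compat.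
  split; first by apply: Rlt_le; apply: Rdiv_lt_0_compat.
  rewrite EmJ; apply/Rle_div_l => //; rewrite /X /=.
  have H1 := HPJ1 k; have H2 := HPJ J.
  apply: (Rle_trans _ (P ^ J * P)); first by apply: Rmult_le_compat_l; lra.
  apply: (Rle_trans _ (P ^ J * (P * P ^ k))); first by apply: Rmult_le_compat_l; nra.
  apply: Rmult_le_compat_r; first by nra.
  lra.
(* The top level sees the argument x / p; the others, read backwards, see x p^i. *)
rewrite rsumS Rplus_comm Rmult_plus_distr_l; congr (_ + _).
  have -> : X / P ^ J.+1 = x / P by rewrite /X /=; field; have := HPJ J; lra.
  by rewrite /X /=; field; have := HPJ J; lra.
rewrite big_nat_rev -rsum_scal; apply: rsum_ext => i Hi.
rewrite add0n.
have -> : (J - i.+1).+1 = (J - i)%nat by lia.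
have EJ : P ^ J = P ^ i * P ^ (J - i) by rewrite -pow_add; congr pow; lia.
have -> : X / P ^ (J - i) = x * P ^ i.
  by rewrite /X EJ; field; have := HPJ (J - i)%nat; lra.
by rewrite /X EJ; field; have := HPJ (J - i)%nat; have := HPJ i; lra.
Qed.

Lemma rho_tail P al x J : 1 < P -> 
  \rsum_(i < J) (/ P ^ i * rho al (x * P ^ i)) =
  x ^ 2 / 2 * ((P ^ J - 1) / (P - 1)) + (1 / 2 - al) * x * INR J
  + \rsum_(i < J) (/ P ^ i * hh al (x * P ^ i)).
Proof.
move=> HP; rewrite -rsum_geom; last lra.
rewrite (rsum_ext _ _ (fun i => (x ^ 2 / 2 * P ^ i + (1 / 2 - al) * x) + / P ^ i * hh al (x * P ^ i))).
  by rewrite !rsum_plus rsum_scal rsum_const; ring.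
move=> i _; rewrite /rho; have : 0 < P ^ i by apply: pow_lt; lra.
move=> Hi; field; lra.
Qed.

Definition hsum (P al x : R) (J : nat) : R := \rsum_(i < J) (/ P ^ i * hh al (x * P ^ i)).

Lemma fsum_explicit p al x J : (1 < p)%nat -> 0 < al <= 1 -> 1 < INR p * al -> 1 <= x <= INR p ->
  fsum p al x (p ^ J) =
  / x * (INR p * rho al (x / INR p) + hsum (INR p) al x J)
  + x * (INR p ^ J - 1) / (2 * (INR p - 1)) + (1 / 2 - al) * INR J - INR p ^ J * INR J
  - INR p ^ J * logb p x + Lam al (p ^ J) / ln (INR p) + INR p ^ J / 2 + INR p ^ J / ln (INR p)
  - INR p * ((INR p ^ J - 1) / 2 + al) / ((INR p - 1) * x).
Proof.
move=> Hp Hal Hpal Hx; have HL := ln_p_pos p Hp; have HP := INR_p_gt1 p Hp.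
have EmJ : INR (p ^ J) = INR p ^ J by rewrite pow_INR.
rewrite fsum_rho // rho_tail // -/(hsum (INR p) al x J).
have HPJ : 0 < INR p ^ J by apply: pow_lt; lra.
rewrite (rsum_ext _ (fun n => logb p (INR p ^ J * x / (INR n + al)))
  (fun n => (INR J + logb p x) - / ln (INR p) * ln (INR n + al))); last first.
  move=> n _; have Hn := pos_INR n.
  have -> : INR p ^ J * x / (INR n + al) = INR p ^ J * (x / (INR n + al)) by field; lra.
  rewrite logb_pow //; last by apply: Rdiv_lt_0_compat; lra.
  rewrite /logb ln_div; [field; lra|lra|lra].
rewrite rsum_minus rsum_const rsum_scal rsum_plus rsum_const rsum_INR EmJ -/(Lam al (p ^ J)).
by field; lra.
Qed.

(* The part of [qu] that depends on the argument, at x = p^u. *)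
Definition GJ (P al x : R) (J : nat) : R :=
  / x * ((1 - P) * (P * rho al (x / P) + hsum P al x J) + / P ^ J * hh al (x * P ^ J)
         - P * (1 / 2 - al)) + x / 2.

(** The terms of [fsum_explicit] that grow with p^J either cancel in this combination or are
    absorbed, through [Lam], into the Stirling normalisation [wst]. What remains depends on J only
    through quantities that converge. *)
Lemma qJ_explicit p al x J : (1 < p)%nat -> 0 < al <= 1 -> 1 < INR p * al -> 1 <= x <= INR p ->
  fsum p al x (p ^ J.+1) - INR p * fsum p al x (p ^ J) =
  (wst al (p ^ J.+1) - INR p * wst al (p ^ J)) / ln (INR p) + GJ (INR p) al x J.
Proof.
move=> Hp Hal Hpal Hx; have HL := ln_p_pos p Hp; have HP := INR_p_gt1 p Hp.
have HPJ : 0 < INR p ^ J by apply: pow_lt; lra.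
have Eln k : ln (INR (p ^ k)) = INR k * ln (INR p) by rewrite pow_INR ln_pow //; lra.
rewrite !fsum_explicit // /wst !Eln !pow_INR /GJ /hsum rsumS S_INR.
rewrite [INR p ^ J.+1]/=; set A := rho _ _; set B := \rsum_(i < J) _; set D := hh _ _.
by field; lra.
Qed.

(** * Hoelder estimates uniform in the level J *)

Lemma Rabs_def2_le x a : Rabs x <= a -> - a <= x <= a.
Proof. by move=> H; have := Rle_abs x; have := Rle_abs (- x); rewrite Rabs_Ropp; lra. Qed.

Lemma frac_part_bounds x : 0 <= frac_part x < 1.
Proof. by have [H1 H2] := base_fp x; lra. Qed.

Lemma frac_part_eq0 x : 0 <= x < 1 -> frac_part x = x.
Proof. by move=> H; have := frac_part_eq 0 x H; rewrite Rplus_0_l. Qed.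

Lemma bern_bounds t : 0 <= bern t <= 1 / 8.
Proof.
have H := frac_part_bounds t; rewrite /bern; set f := frac_part t in H *.
have := pow2_ge_0 (f - 1 / 2); nra.
Qed.

(** The slope of t (1 - t) / 2 on [0, 1] lies between -1/2 and 1/2. If an integer is crossed, both
    pieces are evaluated; if b - a >= 1, the bound 1/8 suffices. *)
Lemma bern_Lip_le a b : a <= b -> Rabs (bern b - bern a) <= (b - a) / 2.
Proof.
move=> Hab; have Ha := bern_bounds a; have Hb := bern_bounds b.
have [H1|H1] : 1 <= b - a \/ b - a < 1 by lra.
  by apply: Rabs_le; lra.
have Ht := frac_part_bounds a; set t := frac_part a in Ht.
have Ea : a = IZR (Int_part a) + t by rewrite /t /frac_part; ring.
have Eb : b = IZR (Int_part a) + (t + (b - a)) by lra.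
have -> : bern a = t * (1 - t) / 2 by rewrite /bern -/t.
have [H2|H2] : t + (b - a) < 1 \/ 1 <= t + (b - a) by lra.
  have -> : bern b = (t + (b - a)) * (1 - (t + (b - a))) / 2.
    by rewrite {1}Eb bern_shift /bern frac_part_eq0 //; lra.
  by apply: Rabs_le; nra.
have -> : bern b = (t + (b - a) - 1) * (2 - (t + (b - a))) / 2.
  have Eb' : b = IZR (Int_part a + 1) + (t + (b - a) - 1) by rewrite plus_IZR; lra.
  by rewrite {1}Eb' bern_shift /bern frac_part_eq0; [field|lra].
by apply: Rabs_le; nra.
Qed.

Lemma hh_Lip al a b : a <= b -> Rabs (hh al b - hh al a) <= Rmin 1 (b - a).
Proof.
move=> Hab; have -> : hh al b - hh al a = bern (b - al) - bern (a - al) by rewrite /hh; ring.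
apply: Rmin_glb.
  by have := bern_bounds (b - al); have := bern_bounds (a - al) => H1 H2; apply: Rabs_le; lra.
apply: Rle_trans (bern_Lip_le _ _ _) _; lra.
Qed.

Lemma hh_bound al y : 0 < al <= 1 -> Rabs (hh al y) <= 1 / 4.
Proof.
move=> Hal; have := bern_bounds (y - al) => H; apply: Rabs_le; rewrite /hh /be.
have := pow2_ge_0 (al - 1 / 2); nra.
Qed.

Lemma pow_dec q a b : 0 < q <= 1 -> (a <= b)%nat -> q ^ b <= q ^ a.
Proof.
move=> Hq Hab; have -> : b = (a + (b - a))%nat by lia.
rewrite pow_add -{2}(Rmult_1_r (q ^ a)); apply: Rmult_le_compat_l.
  by apply: pow_le; lra.
by rewrite -(pow1 (b - a)); apply: pow_incr; lra.
Qed.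

(** The interpolation min(A, B) <= A^(1/4) B^(3/4) on dyadic scales, with 2^-i = r^(3i) r^i. For i
    <= j the second argument of the minimum is used, otherwise the first. *)
Lemma dyadic_min r i j D d : 0 < r -> r ^ 4 = 1 / 2 -> 1 <= D ->
  d <= D * (/ 2) ^ j -> Rmin ((/ 2) ^ i) d <= D * ((r ^ 3) ^ j * r ^ i).
Proof.
move=> Hr Hr4 HD Hd.
have Hr1 : r < 1 by apply: Rnot_le_lt => H; have := pow_R1_Rle r 4 H; lra.
have E k : (/ 2) ^ k = (r ^ 3) ^ k * r ^ k.
  rewrite -Rpow_mult_distr; congr pow; have -> : / 2 = r ^ 4 by lra.
  ring.
have Hr3 : 0 < r ^ 3 < 1 by split; [apply: pow_lt; lra|have : r ^ 2 < 1 by nra]; move=> ?; nra.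
have Hdec q a b : 0 < q < 1 -> (a <= b)%nat -> q ^ b <= q ^ a.
  by move=> Hq Hab; apply: pow_dec => //; lra.
have Hp q k : 0 < q -> 0 < q ^ k by move=> Hq; apply: pow_lt.
case: (leqP i j) => Hij.
  apply: Rle_trans (Rmin_r _ _) _; apply: Rle_trans Hd _; apply: Rmult_le_compat_l; first lra.
  rewrite E; apply: Rmult_le_compat_l; first by apply: Rlt_le; apply: Hp; lra.
  by apply: Hdec.
apply: Rle_trans (Rmin_l _ _) _; rewrite E.
have H1 : (r ^ 3) ^ i <= (r ^ 3) ^ j by apply: Hdec => //; lia.
have H2 := Hp r i Hr; have H3 := Hp (r ^ 3) j ltac:(lra).
apply: (Rle_trans _ ((r ^ 3) ^ j * r ^ i)); first by apply: Rmult_le_compat_r; lra.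
have : 0 < (r ^ 3) ^ j * r ^ i by apply: Rmult_lt_0_compat.
nra.
Qed.

Lemma rsum_geom_le r J : 0 < r < 1 -> \rsum_(i < J) r ^ i <= / (1 - r).
Proof.
move=> Hr; rewrite rsum_geom; last lra.
have H : 0 < r ^ J by apply: pow_lt; lra.
have -> : (r ^ J - 1) / (r - 1) = / (1 - r) - r ^ J * / (1 - r) by field; lra.
have : 0 < / (1 - r) by apply: Rinv_0_lt_compat; lra.
nra.
Qed.

(** The i-th term of the Takagi-type sum [hsum] changes by at most min(P^-i, y - x), since [hh] has
    bounded oscillation and Lipschitz constant 1 and the dilation by P^i cancels its weight.
    [dyadic_min] and a geometric series then give a bound free of J; the numerical constant is
    rounded up generously. *)
Lemma GJ_Holder P al r j D x y J : 2 <= P -> 0 < al <= 1 -> 0 < r -> r ^ 4 = 1 / 2 -> 1 <= D ->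
  1 <= x -> x <= y -> y <= P -> y - x <= D * (/ 2) ^ j ->
  Rabs (GJ P al y J - GJ P al x J) <= D * (P + 1) * (10 * P + 3 / (1 - r)) * (r ^ 3) ^ j.
Proof.
move=> HP Hal Hr Hr4 HD Hx Hxy Hy Hd.
have Hr1 : r < 1 by apply: Rnot_le_lt => H; have := pow_R1_Rle r 4 H; lra.
have H1r : 0 < / (1 - r) by apply: Rinv_0_lt_compat; lra.
set R3 := (r ^ 3) ^ j.
have HR3 : 0 < R3 by apply: pow_lt; apply: pow_lt.
have Hmin i : Rmin ((/ 2) ^ i) (y - x) <= D * (R3 * r ^ i) by apply: dyadic_min.
have Hd0 : y - x <= D * R3.
  have := dyadic_min r 0 j D (Rmin 1 (y - x)) Hr Hr4 HD.
  have := dyadic_min r j j D (y - x) Hr Hr4 HD Hd.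
  move=> _ _; apply: Rle_trans Hd _; apply: Rmult_le_compat_l; first lra.
  have -> : / 2 = r ^ 3 * r by have -> : r ^ 3 * r = r ^ 4; [ring|lra].
  rewrite Rpow_mult_distr -/R3 -{2}(Rmult_1_r R3); apply: Rmult_le_compat_l; first lra.
  by rewrite -(pow1 j); apply: pow_incr; lra.
have HPi i : 0 < / P ^ i <= (/ 2) ^ i.
  split; first by apply: Rinv_0_lt_compat; apply: pow_lt; lra.
  rewrite -pow_inv; apply: pow_incr; split; first by apply: Rlt_le; apply: Rinv_0_lt_compat; lra.
  by apply: Rinv_le_contravar; lra.
have Hhd i : Rabs (/ P ^ i * hh al (y * P ^ i) - / P ^ i * hh al (x * P ^ i)) <= D * (R3 * r ^ i).
  apply: Rle_trans (Hmin i); have [H1 H2] := HPi i.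
  have Hpi : 0 < P ^ i by apply: pow_lt; lra.
  rewrite -Rmult_minus_distr_l Rabs_mult (Rabs_pos_eq (/ P ^ i)); last lra.
  have H3 := hh_Lip al (x * P ^ i) (y * P ^ i) ltac:(apply: Rmult_le_compat_r; lra).
  apply: Rle_trans (Rmult_le_compat_l _ _ _ (Rlt_le _ _ H1) H3) _.
  apply: Rmin_glb.
    apply: (Rle_trans _ (/ P ^ i * 1)); last lra.
    by apply: Rmult_le_compat_l; [lra|exact: Rmin_l].
  apply: (Rle_trans _ (/ P ^ i * (y * P ^ i - x * P ^ i))).
    by apply: Rmult_le_compat_l; [lra|exact: Rmin_r].
  by apply: Req_le; field; lra.
have Hri i : 0 < r ^ i by apply: pow_lt.
have HhsumL : Rabs (hsum P al y J - hsum P al x J) <= D * R3 * / (1 - r).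
  rewrite /hsum -rsum_minus; apply: Rle_trans (Rabs_rsum _ _) _.
  apply: Rle_trans (rsum_le _ _ _ (fun i _ => Hhd i)) _.
  rewrite (rsum_ext _ _ (fun i => D * R3 * r ^ i)); last by move=> i _; ring.
  rewrite rsum_scal; apply: Rmult_le_compat_l; first by nra.
  by apply: rsum_geom_le.
have HhJ : Rabs (/ P ^ J * hh al (y * P ^ J) - / P ^ J * hh al (x * P ^ J)) <= D * R3 * / (1 - r).
  apply: Rle_trans (Hhd J) _; rewrite Rmult_assoc.
  apply: Rmult_le_compat_l; first lra; apply: Rmult_le_compat_l; first lra.
  have : r ^ J <= 1 by rewrite -(pow1 J); apply: pow_incr; lra.
  have : 1 <= / (1 - r) by rewrite -{1}Rinv_1; apply: Rinv_le_contravar; lra.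
  lra.
have HrhoL : Rabs (P * rho al (y / P) - P * rho al (x / P)) <= 3 * (y - x).
  have Hxy' : x / P <= y / P by apply: Rmult_le_compat_r; [apply: Rlt_le; apply: Rinv_0_lt_compat; lra|lra].
  have Hy1 : y / P <= 1 by apply/Rle_div_l; lra.
  have Hx0 : 0 < x / P by apply: Rdiv_lt_0_compat; lra.
  have H := Rle_trans _ _ _ (hh_Lip al _ _ Hxy') (Rmin_r _ _).
  have E : y - x = P * (y / P - x / P) by field; lra.
  rewrite -Rmult_minus_distr_l Rabs_mult (Rabs_pos_eq P); last lra.
  have -> : 3 * (y - x) = P * (3 * (y / P - x / P)) by rewrite E; ring.
  apply: Rmult_le_compat_l; first lra.
  rewrite /rho; set a := x / P in Hxy' Hx0 H *; set b := y / P in Hxy' Hy1 H *.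
  move/Rabs_def2_le: H => H.
  have H1 : 0 <= (b - a) * (a + b) <= (b - a) * 2 by split; [apply: Rmult_le_pos|apply: Rmult_le_compat_l]; lra.
  have H2 : (b - a) * - (1 / 2) <= (b - a) * (1 / 2 - al) <= (b - a) * (1 / 2) by split; apply: Rmult_le_compat_l; lra.
  apply: Rabs_le; lra.
have Hrho : Rabs (P * rho al (x / P)) <= 2 * P.
  have Hx1 : x / P <= 1 by apply/Rle_div_l; lra.
  have Hx0 : 0 < x / P by apply: Rdiv_lt_0_compat; lra.
  rewrite Rabs_mult (Rabs_pos_eq P); last lra.
  rewrite Rmult_comm; apply: Rmult_le_compat_r; first lra.
  have /Rabs_def2_le H := hh_bound al (x / P) Hal.
  rewrite /rho; set a := x / P in Hx1 Hx0 H *; apply: Rabs_le; nra.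
have Hhsum : Rabs (hsum P al x J) <= 1.
  apply: Rle_trans (Rabs_rsum _ _) _.
  apply: (Rle_trans _ (\rsum_(i < J) (1 / 4 * (/ 2) ^ i))).
    apply: rsum_le => i _; have [H1 H2] := HPi i.
    rewrite Rabs_mult (Rabs_pos_eq (/ P ^ i)); last lra.
    have := hh_bound al (x * P ^ i) Hal; have := Rabs_pos (hh al (x * P ^ i)); nra.
  rewrite rsum_scal; have := rsum_geom_le (/ 2) J ltac:(lra).
  have -> : / (1 - / 2) = 2 by field.
  lra.
have HhJ1 : Rabs (/ P ^ J * hh al (x * P ^ J)) <= 1.
  have [H1 H2] := HPi J; rewrite Rabs_mult (Rabs_pos_eq (/ P ^ J)); last lra.
  have := hh_bound al (x * P ^ J) Hal; have := Rabs_pos (hh al (x * P ^ J)).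
  have : (/ 2) ^ J <= 1 by rewrite -(pow1 J); apply: pow_incr; lra.
  nra.
rewrite /GJ.
set ry := P * rho al (y / P) in HrhoL *; set rx := P * rho al (x / P) in HrhoL Hrho *.
set sy := hsum P al y J in HhsumL *; set sx := hsum P al x J in HhsumL Hhsum *.
set ty := / P ^ J * hh al (y * P ^ J) in HhJ *; set tx := / P ^ J * hh al (x * P ^ J) in HhJ HhJ1 *.
have Hiy : 0 < / y <= 1 by split; [apply: Rinv_0_lt_compat; lra|rewrite -Rinv_1; apply: Rinv_le_contravar; lra].
have Hiyx : Rabs (/ y - / x) <= y - x.
  have -> : / y - / x = - ((y - x) * (/ y * / x)) by field; lra.
  rewrite Rabs_Ropp Rabs_pos_eq.
    have : 0 < / x <= 1 by split; [apply: Rinv_0_lt_compat; lra|rewrite -Rinv_1; apply: Rinv_le_contravar; lra].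
    move=> H; have : / y * / x <= 1 by nra.
    nra.
  apply: Rmult_le_pos; first lra.
  by apply: Rmult_le_pos; apply: Rlt_le; apply: Rinv_0_lt_compat; lra.
set Ax := (1 - P) * (rx + sx) + tx - P * (1 / 2 - al).
set Ay := (1 - P) * (ry + sy) + ty - P * (1 / 2 - al).
have HAx : Rabs Ax <= P * (2 * P + 1) + 1 + P.
  move/Rabs_def2_le: Hrho => Hrho; move/Rabs_def2_le: Hhsum => Hhsum; move/Rabs_def2_le: HhJ1 => HhJ1.
  apply: Rabs_le; rewrite /Ax; nra.
set Q := D * R3 * / (1 - r) in HhsumL HhJ.
have HA : Rabs (Ay - Ax) <= P * (3 * (y - x) + Q) + Q.
  move/Rabs_def2_le: HrhoL => HrhoL; move/Rabs_def2_le: HhsumL => HhsumL; move/Rabs_def2_le: HhJ => HhJ.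
  apply: Rabs_le; rewrite /Ax /Ay; nra.
move: Ax Ay HAx HA => Ax Ay HAx HA.
have -> : / y * Ay + y / 2 - (/ x * Ax + x / 2) = / y * (Ay - Ax) + Ax * (/ y - / x) + (y - x) / 2 by rewrite /Rdiv; ring.
apply: Rle_trans (Rabs_triang _ _) _.
apply: Rle_trans (Rplus_le_compat_r _ _ _ (Rabs_triang _ _)) _.
rewrite !Rabs_mult (Rabs_pos_eq (/ y)); last lra.
rewrite (Rabs_pos_eq (y - x)); last lra.
have -> : Rabs (/ 2) = / 2 by apply: Rabs_pos_eq; lra.
have H1 : / y * Rabs (Ay - Ax) <= P * (3 * (y - x) + Q) + Q.
  have := Rabs_pos (Ay - Ax); nra.
have H2 : Rabs Ax * Rabs (/ y - / x) <= (P * (2 * P + 1) + 1 + P) * (y - x).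
  by apply: Rmult_le_compat => //; exact: Rabs_pos.
have -> : D * (P + 1) * (10 * P + 3 / (1 - r)) * R3 = (P + 1) * (10 * P * (D * R3) + 3 * Q).
  by rewrite /Q; field; lra.
have HQ : 0 <= Q by apply: Rmult_le_pos; nra.
nra.
Qed.

(** * Stirling-type constants *)

Lemma nonneg_of_derive (f f' : R -> R) x : 0 <= x -> f 0 = 0 ->
  (forall c, 0 <= c <= x -> is_derive f c (f' c)) -> (forall c, 0 <= c <= x -> 0 <= f' c) -> 0 <= f x.
Proof.
move=> Hx H0 Hd Hpos; have [->|Hx0] : x = 0 \/ 0 < x by lra.
  by rewrite H0; lra.
have [c [E Hc]] := MVT_cor2 f f' 0 x Hx0 (fun c Hc => proj1 (is_derive_Reals f c (f' c)) (Hd c Hc)).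
have := Hpos c ltac:(lra); nra.
Qed.

Lemma ln_1p_bounds x : 0 <= x ->
  x - x ^ 2 / 2 <= ln (1 + x) <= x - x ^ 2 / 2 + x ^ 3 / 3.
Proof.
move=> Hx; split.
  suff : 0 <= ln (1 + x) - (x - x ^ 2 / 2) by lra.
  apply: (nonneg_of_derive (fun x => ln (1 + x) - (x - x ^ 2 / 2)) (fun x => x ^ 2 / (1 + x)) x Hx).
  - by rewrite Rplus_0_r ln_1; field.
  - move=> c Hc; auto_derive; first lra.
    by field; lra.
  - move=> c Hc; apply: Rdiv_le_0_compat; [exact: pow2_ge_0|lra].
suff : 0 <= (x - x ^ 2 / 2 + x ^ 3 / 3) - ln (1 + x) by lra.
apply: (nonneg_of_derive (fun x => (x - x ^ 2 / 2 + x ^ 3 / 3) - ln (1 + x)) (fun x => x ^ 3 / (1 + x)) x Hx).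
- by rewrite Rplus_0_r ln_1; field.
- move=> c Hc; auto_derive; first lra.
  by field; lra.
- move=> c Hc; apply: Rdiv_le_0_compat; [apply: pow_le; lra|lra].
Qed.

(** With t = 1 / (m + 1), the terms of order 0 and 1 in t cancel; the coefficient al - 1/2 in [wst]
    is chosen for that. The rest is of order t^2, hence summable. *)
Lemma wst_step al m : 0 < al <= 1 ->
  Rabs (wst al m.+2 - wst al m.+1) <= 3 / INR m.+1 ^ 2.
Proof.
move=> Hal; have HM : 1 <= INR m.+1 by apply: (le_INR 1); lia.
rewrite /wst /Lam rsumS (S_INR m.+1); set M := INR m.+1 in HM *; set S := \rsum_(i < _) _.
set t := / M.
have Ht : 0 < t <= 1.
  by split; [apply: Rinv_0_lt_compat; lra|rewrite -Rinv_1; apply: Rinv_le_contravar; lra].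
have E1 : ln (M + al) = ln M + ln (1 + al * t).
  rewrite -ln_mult; [|lra|nra]; congr ln; rewrite /t; field; lra.
have E2 : ln (M + 1) = ln M + ln (1 + t).
  rewrite -ln_mult; [|lra|lra]; congr ln; rewrite /t; field; lra.
have -> : 3 / M ^ 2 = 3 * t ^ 2 by rewrite /t; field; lra.
rewrite E1 E2.
have -> : S + (ln M + ln (1 + al * t)) - ((M + 1) * (ln M + ln (1 + t)) - (M + 1) + (al - 1 / 2) * (ln M + ln (1 + t))) -
   (S - (M * ln M - M + (al - 1 / 2) * ln M)) = ln (1 + al * t) - (M + (al + 1 / 2)) * ln (1 + t) + 1 by field.
have [H1 H2] := ln_1p_bounds t ltac:(lra).
have [H3 H4] := ln_1p_bounds (al * t) ltac:(nra).
have EM : M = / t by rewrite /t Rinv_inv.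
set A := ln (1 + al * t) in H3 H4 *; set B := ln (1 + t) in H1 H2 *.
set c := al + 1 / 2.
have Hc : 1 / 2 <= c <= 3 / 2 by rewrite /c; lra.
have HMt : M * t = 1 by rewrite EM Rinv_l; lra.
have B1 : (M + c) * (t - t ^ 2 / 2) <= (M + c) * B by apply: Rmult_le_compat_l; lra.
have B2 : (M + c) * B <= (M + c) * (t - t ^ 2 / 2 + t ^ 3 / 3) by apply: Rmult_le_compat_l; lra.
have E3 : (M + c) * (t - t ^ 2 / 2) = 1 - t / 2 + c * t - c * t ^ 2 / 2.
  by transitivity (M * t - (M * t) * t / 2 + c * t - c * t ^ 2 / 2); [field|rewrite HMt; field].
have E4 : (M + c) * (t - t ^ 2 / 2 + t ^ 3 / 3) = 1 - t / 2 + c * t - c * t ^ 2 / 2 + t ^ 2 / 3 + c * t ^ 3 / 3.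
  transitivity ((M + c) * (t - t ^ 2 / 2) + (M * t) * t ^ 2 / 3 + c * t ^ 3 / 3); first by field.
  by rewrite E3 HMt; field.
have Ec : c * t = al * t + t / 2 by rewrite /c; field.
have T2 : 0 <= t ^ 2 by apply: pow2_ge_0.
have T3 : 0 <= t ^ 3 <= t ^ 2 by rewrite /=; nra.
have C2 : 0 <= c * t ^ 2 <= 3 / 2 * t ^ 2 by nra.
have C3 : 0 <= c * t ^ 3 <= 3 / 2 * t ^ 2 by nra.
have A2 : 0 <= (al * t) ^ 2 <= t ^ 2 by rewrite Rpow_mult_distr; nra.
have A3 : 0 <= (al * t) ^ 3 <= t ^ 2.
  rewrite Rpow_mult_distr; have : 0 <= al ^ 3 <= 1 by split; [apply: pow_le; lra|rewrite -(pow1 3); apply: pow_incr; lra].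
  nra.
apply: Rabs_le; lra.
Qed.

Lemma wst_cv al : 0 < al <= 1 -> exists kap : R, is_lim_seq (wst al) kap.
Proof.
move=> Hal.
have Hs : ex_series (fun m => wst al m.+2 - wst al m.+1).
  by apply: ex_series_le (ex_series_inv_sqr 3 ltac:(lra)) => m; exact: wst_step.
case: Hs => l /is_series_rsum Hl.
exists (l + wst al 1); apply/is_lim_seq_incr_1.
apply: (is_lim_seq_ext (fun n => \rsum_(i < n) (wst al i.+2 - wst al i.+1) + wst al 1)).
  by move=> n; elim: n => [|n IH]; rewrite ?rsum0 ?rsumS; [ring|lra].
by apply: is_lim_seq_plus' => //; exact: is_lim_seq_const.
Qed.

Lemma is_lim_seq_subseq' (u : nat -> R) (l : R) (phi : nat -> nat) :
  (forall n, (n <= phi n)%nat) -> is_lim_seq u l -> is_lim_seq (fun n => u (phi n)) l.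
Proof.
move=> Hphi /is_lim_seq_spec H; apply/is_lim_seq_spec => e.
case: (H e) => N HN; exists N => n /leP Hn; apply: HN; apply/leP.
exact: leq_trans Hn (Hphi n).
Qed.

Lemma Lam_split q m : (0 < q)%nat ->
  \rsum_(j < q) Lam (INR j.+1 / INR q) m = Lam 1 (m * q) - INR (m * q) * ln (INR q).
Proof.
move=> Hq; have HQ : 0 < INR q by apply: lt_0_INR; lia.
rewrite /Lam rsum_block rsum_switch mult_INR Rmult_assoc -!rsum_const -rsum_minus.
apply: rsum_ext => n _; rewrite -rsum_minus; apply: rsum_ext => j _.
have Hj := pos_INR j; have Hn := pos_INR n.
rewrite -ln_div; [|by have := pos_INR (n * q + j); lra|lra].
congr ln; rewrite plus_INR mult_INR S_INR; field; lra.
Qed.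

(** Gauss's multiplication formula on the level of Stirling constants. [Lam_split] is an exact
    identity, and (ln q) / 2 is the difference of (ln (m q)) / 2 and (ln m) / 2, as the numbers
    (j+1)/q - 1/2 for j < q add up to 1/2. *)
Lemma wst_split q : (0 < q)%nat -> forall (kap : nat -> R) (kap1 : R), (forall j, (j < q)%nat -> is_lim_seq (wst (INR j.+1 / INR q)) (kap j)) ->
  is_lim_seq (wst 1) kap1 -> \rsum_(j < q) kap j = kap1 + ln (INR q) / 2.
Proof.
move=> Hq kap kap1 Hkap Hk1; have HQ : 0 < INR q by apply: lt_0_INR; lia.
have L1 : is_lim_seq (fun m => \rsum_(j < q) wst (INR j.+1 / INR q) m) (\rsum_(j < q) kap j).
  have : forall r, (r <= q)%nat -> is_lim_seq (fun m => \rsum_(j < r) wst (INR j.+1 / INR q) m) (\rsum_(j < r) kap j).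
    elim=> [_|r IH Hr].
      by rewrite rsum0; apply: is_lim_seq_ext (is_lim_seq_const 0) => m; rewrite rsum0.
    rewrite rsumS; apply: (is_lim_seq_ext _ _ _ _ (is_lim_seq_plus' _ _ _ _ (IH (ltnW Hr)) (Hkap r Hr))) => m.
    by rewrite rsumS.
  by apply.
have Hphi m : (m <= m.+1 * q)%nat by nia.
have Hphi1 m : (m <= m.+1)%nat by [].
have L2 := is_lim_seq_plus' _ _ _ _ (is_lim_seq_subseq' _ _ _ Hphi Hk1) (is_lim_seq_const (ln (INR q) / 2)).
have {}L1 := is_lim_seq_subseq' _ _ _ Hphi1 L1.
have : is_lim_seq (fun m => \rsum_(j < q) wst (INR j.+1 / INR q) m.+1) (kap1 + ln (INR q) / 2).
  apply: is_lim_seq_ext L2 => m.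
  have HM : 0 < INR m.+1 by apply: lt_0_INR; lia.
  have E : \rsum_(j < q) INR j.+1 / INR q = (INR q + 1) / 2.
    rewrite (rsum_ext _ _ (fun j => / INR q * INR j + / INR q)); last by move=> j _; rewrite S_INR; field; lra.
    by rewrite rsum_plus rsum_scal rsum_const rsum_INR; field; lra.
  rewrite /wst rsum_minus Lam_split //.
  rewrite (rsum_ext q (fun j => INR m.+1 * ln (INR m.+1) - INR m.+1 + (INR j.+1 / INR q - 1 / 2) * ln (INR m.+1))
    (fun j => (INR m.+1 * ln (INR m.+1) - INR m.+1 - 1 / 2 * ln (INR m.+1)) + ln (INR m.+1) * (INR j.+1 / INR q))); last first.
    by move=> j _; ring.
  rewrite rsum_plus rsum_const rsum_scal E mult_INR ln_mult //; field.
move=> L3; have := is_lim_seq_unique _ _ L1; rewrite (is_lim_seq_unique _ _ L3).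
by case.
Qed.

(** * The Fourier series with Hurwitz zeta coefficients *)

(* The k-th Fourier coefficient in u is [Sz al m (chi p k) / den p k]. *)
Definition fu (p : nat) (al u : R) (m : nat) : R :=
  \rsum_(n < m) Bper p (u - logb p (INR n + al)).

(* Removes the divergent part m^{1-s} / (1 - s) of the partial zeta sums. *)
Definition qu (p : nat) (al u : R) (J : nat) : R :=
  fu p al u (p ^ J.+1) - INR p * fu p al u (p ^ J).

Lemma fu_fsum p al u m : (1 < p)%nat -> 0 < al -> fu p al u m = fsum p al (exp (ln (INR p) * u)) m.
Proof.
move=> Hp Hal; have HL := ln_p_pos p Hp; apply: rsum_ext => n _; congr Bper.
have Hn := pos_INR n.
rewrite /logb ln_div; [|exact: exp_pos|lra].
by rewrite ln_exp; field; lra.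
Qed.

Lemma fu_shift p al u k m : fu p al (IZR k + u) m = fu p al u m.
Proof. by apply: rsum_ext => n _; rewrite -(Bper_shift p k (u - _)); congr Bper; ring. Qed.

Lemma qu_shift p al u k J : qu p al (IZR k + u) J = qu p al u J.
Proof. by rewrite /qu !fu_shift. Qed.

Lemma qu_explicit p al u J : (1 < p)%nat -> 0 < al <= 1 -> 1 < INR p * al -> 0 <= u <= 1 ->
  qu p al u J = (wst al (p ^ J.+1) - INR p * wst al (p ^ J)) / ln (INR p) + GJ (INR p) al (exp (ln (INR p) * u)) J.
Proof.
move=> Hp Hal Hpal Hu; have HL := ln_p_pos p Hp; have HP := INR_p_gt1 p Hp.
rewrite /qu !fu_fsum ?qJ_explicit //; try lra.
split; first by rewrite -exp_0; apply: exp_mono; nra.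
rewrite -{2}(exp_ln (INR p)); last lra.
by apply: exp_mono; nra.
Qed.

(** The closed form is available on one period, so an interval crossing an integer is cut there,
    which doubles the constant. The factor L P in [D] bounds the derivative of u -> p^u on [0, 1];
    the summand 1 secures the condition D >= 1 of [dyadic_min]. *)
Lemma qu_Holder p al r : (1 < p)%nat -> 0 < al <= 1 -> 1 < INR p * al -> 0 < r -> r ^ 4 = 1 / 2 ->
  exists C0, 0 <= C0 /\ forall J j u h, 0 <= h <= (/ 2) ^ (j + 2) ->
    Rabs (qu p al (u + h) J - qu p al u J) <= C0 * (r ^ 3) ^ j.
Proof.
move=> Hp Hal Hpal Hr Hr4; have HL := ln_p_pos p Hp; have HP := INR_p_gt1 p Hp.
have HP2 : 2 <= INR p by apply: (le_INR 2); lia.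
set P := INR p in HL HP HP2 *; set L := ln P in HL *.
have Hr1 : r < 1 by apply: Rnot_le_lt => H; have := pow_R1_Rle r 4 H; lra.
pose D := 1 + L * P.
have HD : 1 <= D by rewrite /D; nra.
pose C1 := D * (P + 1) * (10 * P + 3 / (1 - r)).
have HC1 : 0 <= C1.
  have : 0 < 3 / (1 - r) by apply: Rdiv_lt_0_compat; lra.
  by move=> ?; apply: Rmult_le_pos; [apply: Rmult_le_pos|]; nra.
have Hdir J j u h : 0 <= u -> 0 <= h <= (/ 2) ^ (j + 2) -> u + h <= 1 ->
  Rabs (qu p al (u + h) J - qu p al u J) <= C1 * (r ^ 3) ^ j.
  move=> Hu Hh Huh.
  rewrite !qu_explicit //; try lra.
  set x := exp (ln (INR p) * u); set y := exp (ln (INR p) * (u + h)); set c := _ / _.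
  have -> : c + GJ (INR p) al y J - (c + GJ (INR p) al x J) = GJ P al y J - GJ P al x J by rewrite -/P; ring.
  have Hx1 : 1 <= x by rewrite -exp_0; apply: exp_mono; rewrite -/P -/L; nra.
  have Hxy : x <= y by apply: exp_mono; rewrite -/P -/L; nra.
  have HyP : y <= P by rewrite -(exp_ln P); [apply: exp_mono; rewrite -/P -/L; nra|lra].
  apply: GJ_Holder => //; try lra.
  have Hyx : y - x <= L * P * h.
    have -> : x = y * exp (- (L * h)) by rewrite /x /y -exp_plus -/P -/L; congr exp; ring.
    have := exp_ineq1_le (- (L * h)) => H.
    have : y * (1 + - (L * h)) <= y * exp (- (L * h)) by apply: Rmult_le_compat_l; lra.
    have : y * (L * h) <= P * (L * h) by apply: Rmult_le_compat_r; nra.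
    lra.
  apply: Rle_trans Hyx _.
  have : (/ 2) ^ (j + 2) <= (/ 2) ^ j by apply: pow_dec; [lra|lia].
  have : 0 < (/ 2) ^ j by apply: pow_lt; lra.
  move=> H1 H2; apply: (Rle_trans _ (L * P * (/ 2) ^ j)).
    by apply: Rmult_le_compat_l; nra.
  by apply: Rmult_le_compat_r; rewrite /D; lra.
exists (2 * C1); split; first lra.
move=> J j u h Hh.
have H3 : 0 <= (r ^ 3) ^ j by apply: pow_le; apply: pow_le; lra.
have Hf := frac_part_bounds u.
have Eu : u = IZR (Int_part u) + frac_part u by rewrite /frac_part; ring.
set t := frac_part u in Hf Eu.
have -> : qu p al u J = qu p al t J by rewrite Eu qu_shift.
have -> : qu p al (u + h) J = qu p al (t + h) J by rewrite Eu Rplus_assoc qu_shift.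
have [H1|H1] : t + h <= 1 \/ 1 < t + h by lra.
  by apply: Rle_trans (Hdir J j t h _ Hh H1) _; nra.
have Hh1 : h <= 1.
  by apply: Rle_trans (proj2 Hh) _; rewrite -(pow1 (j + 2)); apply: pow_incr; lra.
have E1 : qu p al (t + h) J = qu p al (0 + (t + h - 1)) J.
  by rewrite -(qu_shift p al (0 + (t + h - 1)) 1); congr qu; ring.
have E0 : qu p al (t + (1 - t)) J = qu p al 0 J.
  by rewrite -(qu_shift p al 0 1); congr qu; ring.
have A1 := Hdir J j 0 (t + h - 1) ltac:(lra) ltac:(lra) ltac:(lra).
have A2 := Hdir J j t (1 - t) ltac:(lra) ltac:(lra) ltac:(lra).
rewrite E1; rewrite E0 in A2.
set a := qu p al (0 + _) J in A1 *; set b := qu p al 0 J in A1 A2; set c := qu p al t J in A2 *.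
have -> : a - c = (a - b) + (b - c) by ring.
apply: Rle_trans (Rabs_triang _ _) _; lra.
Qed.

Definition Sz (al : R) (m : nat) (s : C) : C := \csum_(n < m) Rcpow (INR n + al) (- s).

(** This is why translates by logarithms produce Dirichlet series: shifting u by log_p lam
    multiplies the k-th Fourier coefficient by lam^(-chi_k). *)
Lemma Rcpow_chi p k lam : (1 < p)%nat -> Rcpow lam (- chi p k) = ee (- (IZR k * logb p lam)).
Proof.
move=> Hp; have HL := ln_p_pos p Hp; rewrite /Rcpow /ee /chi /logb; congr Cexp.
rewrite RtoC_opp RtoC_mult RtoC_div; last lra.
by field; move=> /RtoC_inj; lra.
Qed.

Lemma fu_fourier p al u m : (1 < p)%nat ->
  csums (zpair (fun k => / den p k * Sz al m (chi p k) * ee (IZR k * u))%C) (RtoC (fu p al u m)).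
Proof.
move=> Hp; rewrite /fu RtoC_rsum.
have := csums_csum m _ _ (fun n _ => Bper_fourier p (u - logb p (INR n + al)) Hp).
apply: csums_ext => k; rewrite /zpair csum_plus.
have E z : \csum_(i < m) (/ den p z * ee (IZR z * (u - logb p (INR i + al))%R))%C =
   (/ den p z * Sz al m (chi p z) * ee (IZR z * u)%R)%C.
  rewrite csum_scal -Cmult_assoc; congr Cmult; rewrite /Sz -csum_scalr; apply: csum_ext => i _.
  by rewrite Rcpow_chi // -ee_plus; congr ee; ring.
by rewrite !E.
Qed.

Definition DJ (p : nat) (al : R) (J : nat) (k : Z) : C :=
  (/ den p k * (Sz al (p ^ J.+1) (chi p k) - INR p * Sz al (p ^ J) (chi p k)))%C.

Lemma qu_fourier p al u J : (1 < p)%nat ->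
  csums (zpair (fun k => DJ p al J k * ee (IZR k * u))%C) (RtoC (qu p al u J)).
Proof.
move=> Hp; rewrite /qu RtoC_minus RtoC_mult.
have := csums_minus _ _ _ _ (fu_fourier p al u (p ^ J.+1) Hp) (csums_scal (INR p) _ _ (fu_fourier p al u (p ^ J) Hp)).
by apply: csums_ext => n; rewrite /zpair /DJ; ring.
Qed.

Lemma Re_chi p k : (1 < p)%nat -> Re (chi p k) = 0.
Proof.
move=> Hp; have HL := ln_p_pos p Hp; rewrite /chi.
have -> : (2 * IZR k * PI * Ci / ln (INR p) = Ci * (2 * IZR k * PI / ln (INR p))%R)%C.
  by rewrite RtoC_div; [rewrite !RtoC_mult; field; move=> /RtoC_inj; lra|lra].
rewrite re_scal_r /=; exact: Rmult_0_l.
Qed.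

Lemma Cmod_Sz p al m k : (1 < p)%nat -> Cmod (Sz al m (chi p k)) <= INR m.
Proof.
move=> Hp; apply: Rle_trans (Cmod_csum _ _) _.
rewrite (rsum_ext _ _ (fun=> 1)) ?rsum_const; first lra.
by move=> n _; rewrite Rcpow_chi // Cmod_ee.
Qed.

(** The trivial bound m for [Sz] is far from uniform in J, but [bernstein_block] asks for
    summability at each single J only; its conclusion is what becomes uniform. *)
Lemma DJ_summable p al J : (1 < p)%nat -> ex_series (zmod (DJ p al J)).
Proof.
move=> Hp; have HL := ln_p_pos p Hp; have HP := INR_p_gt1 p Hp.
set M := INR (p ^ J.+1) + INR p * INR (p ^ J).
have HM : 0 <= M.
  by apply: Rplus_le_le_0_compat; [exact: pos_INR|apply: Rmult_le_pos; exact: pos_INR].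
have Hk k : k <> 0%Z -> Cmod (DJ p al J k) <= ln (INR p) / (2 * IZR k ^ 2) * M.
  move=> Hk0; rewrite /DJ Cmod_mult; apply: Rmult_le_compat; try exact: Cmod_ge_0.
    exact: inv_den_bound.
  apply: Rle_trans (Cmod_triangle _ _) _; rewrite Cmod_opp Cmod_mult Cmod_R Rabs_pos_eq; last lra.
  apply: Rplus_le_compat; first exact: Cmod_Sz.
  apply: Rmult_le_compat_l; [lra|exact: Cmod_Sz].
apply: (ex_series_le_pos _ (fun n => ln (INR p) * M / INR n.+1 ^ 2)).
  move=> n; split; first exact: zmod_ge0.
  apply: Rle_trans (Rplus_le_compat _ _ _ _ (Hk (Z.of_nat n.+1) ltac:(lia)) (Hk (- Z.of_nat n.+1)%Z ltac:(lia))) _.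
  rewrite opp_IZR -INR_IZR_INZ; apply: Req_le; field; exact: not_0_INR.
by apply: ex_series_inv_sqr; apply: Rmult_le_pos; lra.
Qed.

Lemma DJ_block p al r : (1 < p)%nat -> 0 < al <= 1 -> 1 < INR p * al -> 0 < r -> r ^ 4 = 1 / 2 ->
  exists D, forall J j, block (DJ p al J) j <= D * r ^ j.
Proof.
move=> Hp Hal Hpal Hr Hr4; have [C0 [HC0 HH]] := qu_Holder p al r Hp Hal Hpal Hr Hr4.
exists (4 * C0) => J j; apply: (bernstein_block _ (fun u => RtoC (qu p al u J))) => //.
- exact: DJ_summable.
- by move=> u; apply: qu_fourier.
- move=> u; rewrite -RtoC_minus Cmod_R; apply: HH; split; last lra.
  by apply: pow_le; lra.
Qed.

(** * The limit of the closed form and its scaling under x -> P x *)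

Definition Hinf (P al x : R) : R := Series (fun i => / P ^ i * hh al (x * P ^ i)).

Lemma Hinf_ex P al x : 1 < P -> 0 < al <= 1 -> ex_series (fun i => / P ^ i * hh al (x * P ^ i)).
Proof.
move=> HP Hal; apply: (ex_series_le _ (fun i => 1 / 4 * (/ P) ^ i)).
  move=> i; rewrite /norm /= /abs /= Rabs_mult pow_inv Rmult_comm.
  have Hi : 0 < / P ^ i by apply: Rinv_0_lt_compat; apply: pow_lt; lra.
  rewrite (Rabs_pos_eq (/ P ^ i)); last lra.
  by apply: Rmult_le_compat_r; [lra|exact: hh_bound].
apply: ex_series_geom_scal; split; first by apply: Rlt_le; apply: Rinv_0_lt_compat; lra.
by rewrite -Rinv_1; apply: Rinv_lt_contravar; lra.
Qed.

Lemma Hinf_mulP P al x : 1 < P -> 0 < al <= 1 -> Hinf P al (P * x) = P * (Hinf P al x - hh al x).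
Proof.
move=> HP Hal; rewrite /Hinf [X in _ = P * (X - _)]Series_incr_1; last exact: Hinf_ex.
rewrite /= Rinv_1 Rmult_1_l Rmult_1_r.
rewrite (Series_ext (fun k => / (P * P ^ k) * hh al (x * (P * P ^ k))) (fun k => / P * (/ P ^ k * hh al (P * x * P ^ k)))).
  by rewrite Series_scal_l; field; lra.
move=> k; have : 0 < P ^ k by apply: pow_lt; lra.
move=> Hk; have -> : x * (P * P ^ k) = P * x * P ^ k by ring.
by field; lra.
Qed.

Lemma hsum_lim P al x : 1 < P -> 0 < al <= 1 -> is_lim_seq (hsum P al x) (Hinf P al x).
Proof. by move=> HP Hal; apply: is_lim_seq_rsum; apply: Hinf_ex. Qed.

Lemma GJ_lim P al x : 1 < P -> 0 < al <= 1 ->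
  is_lim_seq (GJ P al x) (/ x * ((1 - P) * (P * rho al (x / P) + Hinf P al x) - P * (1 / 2 - al)) + x / 2).
Proof.
move=> HP Hal.
have L1 : is_lim_seq (fun J => / P ^ J * hh al (x * P ^ J)) 0.
  exact: ex_series_lim_0 (Hinf_ex P al x HP Hal).
have L2 := is_lim_seq_plus' _ _ _ _ (is_lim_seq_const (P * rho al (x / P))) (hsum_lim P al x HP Hal).
have L3 := is_lim_seq_scal_l _ (1 - P) _ L2.
have L4 := is_lim_seq_minus' _ _ _ _ (is_lim_seq_plus' _ _ _ _ L3 L1) (is_lim_seq_const (P * (1 / 2 - al))).
have L5 := is_lim_seq_plus' _ _ _ _ (is_lim_seq_scal_l _ (/ x) _ L4) (is_lim_seq_const (x / 2)).
rewrite /= Rplus_0_r in L5; exact: L5.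
Qed.

Lemma rho_small al y : 0 < al <= 1 -> 0 <= y <= al -> rho al y = 0.
Proof.
by move=> Hal Hy; rewrite -(kink_sum al 0 y) ?rsum0 //=; lra.
Qed.

(** For x > 0 and 0 < al <= 1 this is a finite sum, since [rho] vanishes on [0, al]. *)
Definition Rinf (P al x : R) : R := Series (fun k => P ^ k.+1 * rho al (x / P ^ k.+1)).

Lemma rho_zero_ev P al x : 1 < P -> 0 < al <= 1 -> 0 < x ->
  exists K, forall k, (K <= k)%nat -> rho al (x / P ^ k) = 0.
Proof.
move=> HP Hal Hx.
have [K HK] := Pow_x_infinity P ltac:(rewrite Rabs_pos_eq; lra) (x / al).
exists K => k Hk; have Hk0 : 0 < P ^ k by apply: pow_lt; lra.
apply: rho_small => //; split; first by apply: Rlt_le; apply: Rdiv_lt_0_compat.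
have := HK k ltac:(lia); rewrite Rabs_pos_eq; last lra.
move=> H; apply/Rle_div_l => //; move/Rge_le: H => H.
have := Rmult_le_compat_r al _ _ ltac:(lra) H; have -> : x / al * al = x by field; lra.
lra.
Qed.

Lemma is_series_finite K (a : nat -> R) : (forall k, (K <= k)%nat -> a k = 0) ->
  is_series a (\rsum_(k < K) a k).
Proof.
move=> H; apply/is_series_rsum; apply: (is_lim_seq_ext_loc (fun=> \rsum_(k < K) a k)).
  exists K => n /leP Hn; rewrite -(subnKC Hn) rsum_cat (rsum_ext (n - K) _ (fun=> 0)).
    by rewrite rsum_const; ring.
  by move=> i _; apply: H; lia.
exact: is_lim_seq_const.
Qed.

Lemma Rinf_ex P al x : 1 < P -> 0 < al <= 1 -> 0 < x ->
  ex_series (fun k => P ^ k.+1 * rho al (x / P ^ k.+1)).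
Proof.
move=> HP Hal Hx; have [K HK] := rho_zero_ev P al x HP Hal Hx.
exists (\rsum_(k < K) (P ^ k.+1 * rho al (x / P ^ k.+1))); apply: is_series_finite => k Hk.
by rewrite HK ?Rmult_0_r //; lia.
Qed.

(** Together with [Hinf_mulP]: passing from x to P x moves the term of scale 1 from [Hinf] to
    [Rinf], so that their sum is multiplied by P up to the polynomial part of [rho]. *)
Lemma Rinf_mulP P al x : 1 < P -> 0 < al <= 1 -> 0 < x ->
  Rinf P al (P * x) = P * (rho al x + Rinf P al x).
Proof.
move=> HP Hal Hx; rewrite /Rinf Series_incr_1; last by apply: Rinf_ex => //; nra.
rewrite Rmult_plus_distr_l -Series_scal_l; congr (_ + _).
  by rewrite pow_1; congr (_ * rho _ _); field; lra.
apply: Series_ext => k; have : 0 < P ^ k.+1 by apply: pow_lt; lra.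
move=> Hk; rewrite [P ^ k.+2]/= -/(P ^ k.+1).
have -> : P * x / (P * P ^ k.+1) = x / P ^ k.+1 by field; lra.
ring.
Qed.

Lemma mulP_ind (P : R) (Q : R -> Prop) : 1 < P ->
  (forall x, 0 < x -> Q x <-> Q (P * x)) -> (forall x, 1 <= x < P -> Q x) ->
  forall x, 0 < x -> Q x.
Proof.
move=> HP HQ H1 x Hx.
have HL : 0 < ln P by rewrite -ln_1; apply: ln_increasing; lra.
have Hpow n y : 0 < y -> Q y <-> Q (P ^ n * y).
  move=> Hy; elim: n => [|n IH]; first by rewrite Rmult_1_l.
  rewrite IH /= Rmult_assoc; apply: HQ; apply: Rmult_lt_0_compat => //; apply: pow_lt; lra.
set v := ln x / ln P; have Hf := frac_part_bounds v; set t := frac_part v in Hf.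
pose y := exp (ln P * t).
have Hy : 1 <= y < P.
  split; first by rewrite -exp_0; apply: exp_mono; nra.
  rewrite -[X in _ < X](exp_ln P); last lra.
  apply: exp_increasing; nra.
have EP n : P ^ n = exp (ln P * INR n) by rewrite Rmult_comm exp_nat exp_ln; lra.
have Ev : ln P * v = ln x by rewrite /v; field; lra.
have [Hn|Hn] : (0 <= Int_part v \/ 0 <= - Int_part v)%Z by lia.
  have -> : x = P ^ (Z.to_nat (Int_part v)) * y.
    rewrite EP /y -exp_plus INR_IZR_INZ Z2Nat.id // -(exp_ln x) // -Ev; congr exp.
    rewrite /t /frac_part; ring.
  by apply/(Hpow _ y); [lra|apply: H1].
apply/(Hpow (Z.to_nat (- Int_part v))) => //.
have -> : P ^ (Z.to_nat (- Int_part v)) * x = y; last by apply: H1.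
rewrite EP /y -{1}(exp_ln x) // -exp_plus INR_IZR_INZ Z2Nat.id // -Ev opp_IZR; congr exp.
rewrite /t /frac_part; ring.
Qed.

Lemma quarter_root : exists r, 0 < r /\ r ^ 4 = 1 / 2.
Proof.
exists (sqrt (sqrt (1 / 2))); split; first by apply: sqrt_lt_R0; apply: sqrt_lt_R0; lra.
have -> : forall s, s ^ 4 = (s * s) * (s * s) by move=> s; ring.
by rewrite !sqrt_sqrt; [|lra|exact: sqrt_pos].
Qed.

Lemma Bper_Holder p r j u h : (1 < p)%nat -> 0 < r -> r ^ 4 = 1 / 2 -> 0 <= h <= (/ 2) ^ j ->
  Rabs (Bper p (u + h) - Bper p u) <= 2 * (1 + ln (INR p) * (INR p / (INR p - 1))) * (r ^ 3) ^ j.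
Proof.
move=> Hp Hr Hr4 Hh; have HL := ln_p_pos p Hp; have HP := INR_p_gt1 p Hp.
set P := INR p in HP HL *; set L := ln P in HL *; set C := P / (P - 1).
have HC : 0 < C by apply: Rdiv_lt_0_compat; lra.
have Hr1 : r < 1 by apply: Rnot_le_lt => H; have := pow_R1_Rle r 4 H; lra.
have Hh3 : h <= (r ^ 3) ^ j.
  apply: Rle_trans (proj2 Hh) _; apply: pow_incr; split; first lra.
  have -> : / 2 = r ^ 3 * r by have -> : r ^ 3 * r = r ^ 4; [ring|lra].
  have : 0 < r ^ 3 by apply: pow_lt.
  nra.
have Hdir t s : 0 <= t -> t <= s -> Rabs (beta p s - beta p t) <= (1 + L * C) * (s - t).
  move=> Ht Hts.
  have -> : beta p s - beta p t = - (s - t) + C * (exp (- (L * t)) - exp (- (L * s))).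
    by rewrite /beta -/P -/L -/C; ring.
  have E : exp (- (L * s)) = exp (- (L * t)) * exp (- (L * (s - t))) by rewrite -exp_plus; congr exp; ring.
  have H1 := exp_ineq1_le (- (L * (s - t))).
  have H2 : exp (- (L * t)) <= 1 by rewrite -exp_0; apply: exp_mono; nra.
  have H3 := exp_pos (- (L * t)).
  have H4 : exp (- (L * s)) <= exp (- (L * t)) by apply: exp_mono; nra.
  have H5 : exp (- (L * t)) - exp (- (L * s)) <= L * (s - t) by rewrite E; nra.
  have H6 : C * (exp (- (L * t)) - exp (- (L * s))) <= C * (L * (s - t)) by apply: Rmult_le_compat_l; lra.
  have H7 : 0 <= C * (exp (- (L * t)) - exp (- (L * s))) by apply: Rmult_le_pos; lra.
  have H8 : 0 <= C * (L * (s - t)) by apply: Rmult_le_pos; [lra|apply: Rmult_le_pos; lra].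
  have -> : (1 + L * C) * (s - t) = (s - t) + C * (L * (s - t)) by ring.
  by apply: Rabs_le; lra.
have E10 : beta p 1 = beta p 0.
  rewrite /beta -/P -/L Rmult_1_r Rmult_0_r Ropp_0 exp_0 exp_Ropp /L exp_ln; last lra.
  by rewrite -/L; field; lra.
have HLC : 0 < L * C by apply: Rmult_lt_0_compat.
set A := 1 + L * C in Hdir *.
suff H : Rabs (Bper p (u + h) - Bper p u) <= 2 * A * h.
  by apply: Rle_trans H _; apply: Rmult_le_compat_l; rewrite /A; lra.
have Hf := frac_part_bounds u; rewrite {2}/Bper.
have Eu : u + h = IZR (Int_part u) + (frac_part u + h) by rewrite /frac_part; ring.
rewrite Eu Bper_shift; set t := frac_part u in Hf *.
have Hh1 : h <= 1.
  by apply: Rle_trans (proj2 Hh) _; rewrite -(pow1 j); apply: pow_incr; lra.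
rewrite /Bper; have [H1|H1] : t + h < 1 \/ 1 <= t + h by lra.
  rewrite frac_part_eq0; last lra.
  by apply: Rle_trans (Hdir _ _ _ _) _; rewrite /A in HLC *; nra.
have [H2|H2] : t + h < 2 \/ 2 <= t + h by lra.
  have -> : frac_part (t + h) = t + h - 1.
    have -> : t + h = IZR 1 + (t + h - 1) by ring.
    by rewrite frac_part_eq; [ring|lra].
  have D1 := Hdir 0 (t + h - 1) ltac:(lra) ltac:(lra).
  have D2 := Hdir t 1 ltac:(lra) ltac:(lra).
  rewrite E10 in D2.
  have -> : beta p (t + h - 1) - beta p t = (beta p (t + h - 1) - beta p 0) + (beta p 0 - beta p t) by ring.
  apply: Rle_trans (Rabs_triang _ _) _; rewrite /A in D1 D2 HLC *; nra.
lra.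
Qed.

(** The coefficients z stay abstract, which separates this theorem from the analytic continuation;
    [zlim_pJ] supplies the limit hypothesis. The limit of [qu] has coefficients (1 - P) (z_k - (1/2
    - al)) / den, so F is obtained by dividing by 1 - P and adding 1/2 - al times [Bper]. The closed
    form is checked for 1 <= X < P and carried to all X > 0 by scaling. *)
Theorem zeta_fourier p al kap (z : Z -> C) : (1 < p)%nat -> 0 < al <= 1 -> 1 < INR p * al ->
  is_lim_seq (wst al) (Finite kap) ->
  (forall k, k <> 0%Z -> Clim (fun J => Sz al (p ^ J.+1) (chi p k) - INR p * Sz al (p ^ J) (chi p k))%C
     ((1 - INR p) * (z k - (1 / 2 - al)%R))) ->
  ex_series (zmod (fun k => z k / den p k)%C) /\
  exists F : R -> R,
    (forall u, csums (zpair (fun k => z k / den p k * ee (IZR k * u))%C) (RtoC (F u))) /\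
    (exists r C0, 0 < r /\ r ^ 4 = 1 / 2 /\ 0 <= C0 /\ forall j u h, 0 <= h <= (/ 2) ^ (j + 2) ->
        Rabs (F (u + h) - F u) <= C0 * (r ^ 3) ^ j) /\
    (forall X, 0 < X -> Rinf (INR p) al X + Hinf (INR p) al X =
       X * (F (logb p X) + X / (2 * (INR p - 1)) + (1 / 2 - al) * logb p X
            - kap / ln (INR p) - (1 / 2 - al) * (1 / 2 + 1 / ln (INR p)))).
Proof.
move=> Hp Hal Hpal Hkap Hz; have HL := ln_p_pos p Hp; have HP := INR_p_gt1 p Hp.
have [r [Hr Hr4]] := quarter_root.
have Hr1 : r < 1 by apply: Rnot_le_lt => H; have := pow_R1_Rle r 4 H; lra.
have [D HD] := DJ_block p al r Hp Hal Hpal Hr Hr4.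
set P := INR p in HL HP Hpal Hz *; set L := ln P in HL *.
pose c' k := (/ den p k * ((1 - P) * (z k - (1 / 2 - al)%R)))%C.
have Hc k : k <> 0%Z -> Clim (fun J => DJ p al J k) (c' k).
  by move=> Hk; apply: Clim_scal; apply: Hz.
have [Hs Hlim] := block_limit (DJ p al) c' D r ltac:(lra) HD Hc.
have HPC : (1 - P)%C <> RtoC 0 by rewrite -RtoC_minus => /RtoC_inj; lra.
have Ez k : k <> 0%Z -> (z k / den p k = / (1 - P) * c' k + (1 / 2 - al)%R * / den p k)%C.
  by move=> Hk; rewrite /c'; field; split => //; exact: den_neq0.
have Hg u : exists g : R, csums (zpair (fun k => c' k * ee (IZR k * u))%C) (RtoC g) /\ is_lim_seq (fun J => qu p al u J) g.
  have [l' [H1 H2]] := Hlim (fun k => ee (IZR k * u)) (fun J => RtoC (qu p al u J))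
     (fun k => Req_le _ _ (Cmod_ee _)) (fun J => qu_fourier p al u J Hp).
  exists (Re l'); have H3 := Clim_Re _ _ H2; split; last exact: H3.
  by rewrite -(Clim_unique _ _ _ H2 (Clim_RtoC _ _ H3)).
have {Hlim} [gq Hgq] : exists gq : R -> R, forall u, csums (zpair (fun k => c' k * ee (IZR k * u))%C) (RtoC (gq u)) /\ is_lim_seq (fun J => qu p al u J) (gq u).
  exists (fun u => Re (Cseries (zpair (fun k => c' k * ee (IZR k * u))%C))) => u.
  by have [g [H1 H2]] := Hg u; rewrite (csums_Cseries _ _ H1).
pose F u := / (1 - P) * gq u + (1 / 2 - al) * Bper p u.
have HF u : csums (zpair (fun k => z k / den p k * ee (IZR k * u))%C) (RtoC (F u)).
  have [H1 _] := Hgq u.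
  have := csums_plus _ _ _ _ (csums_scal (/ (1 - P)) _ _ H1) (csums_scal (1 / 2 - al)%R _ _ (Bper_fourier p u Hp)).
  have -> : RtoC (F u) = (/ (1 - P) * RtoC (gq u) + (1 / 2 - al)%R * RtoC (Bper p u))%C.
    by rewrite /F RtoC_plus !RtoC_mult -RtoC_minus -RtoC_inv //; lra.
  apply: csums_ext => n; rewrite /zpair !Ez; [ring|lia|lia].
have Hmult : 0 < / (P - 1) by apply: Rinv_0_lt_compat; lra.
split.
  apply: (ex_series_le_pos _ (fun n => / (P - 1) * zmod c' n + Rabs (1 / 2 - al) * (L / INR n.+1 ^ 2))).
    move=> n; split; first exact: zmod_ge0.
    have Hk k : k <> 0%Z -> Cmod (z k / den p k) <= / (P - 1) * Cmod (c' k) + Rabs (1 / 2 - al) * (L / (2 * IZR k ^ 2)).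
      move=> Hk0; rewrite Ez //; apply: Rle_trans (Cmod_triangle _ _) _.
      rewrite (Cmod_mult (/ (1 - P))) (Cmod_mult (1 / 2 - al)%R) Cmod_R Cmod_inv //.
      have -> : Cmod (1 - P) = P - 1.
        by rewrite -RtoC_minus Cmod_R Rabs_left; lra.
      apply: Rplus_le_compat_l; apply: Rmult_le_compat_l; first exact: Rabs_pos.
      exact: inv_den_bound.
    apply: Rle_trans (Rplus_le_compat _ _ _ _ (Hk (Z.of_nat n.+1) ltac:(lia)) (Hk (- Z.of_nat n.+1)%Z ltac:(lia))) _.
    rewrite opp_IZR -INR_IZR_INZ /zmod; apply: Req_le; field; split; [exact: not_0_INR|lra].
  apply: (ex_series_plus (V := R_NormedModule)); first exact: ex_series_scal_l.
  by apply: (ex_series_scal_l (V := R_NormedModule)); apply: ex_series_inv_sqr; lra.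
exists F; split=> //; split.
  have [C0 [HC0 HH]] := qu_Holder p al r Hp Hal Hpal Hr Hr4.
  pose CB := 2 * (1 + L * (P / (P - 1))).
  have HCB : 0 <= CB.
    have : 0 < P / (P - 1) by apply: Rdiv_lt_0_compat; lra.
    by move=> HPP; rewrite /CB; have := Rmult_lt_0_compat _ _ HL HPP; lra.
  exists r, (/ (P - 1) * C0 + Rabs (1 / 2 - al) * CB); split=> //; split=> //; split.
    by apply: Rplus_le_le_0_compat; apply: Rmult_le_pos => //; try lra; exact: Rabs_pos.
  move=> j u h Hh.
  have H3 : 0 < (r ^ 3) ^ j by apply: pow_lt; apply: pow_lt.
  have Hq : Rabs (gq (u + h) - gq u) <= C0 * (r ^ 3) ^ j.
    have [_ L1] := Hgq (u + h); have [_ L2] := Hgq u.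
    have L3 := is_lim_seq_abs _ _ (is_lim_seq_minus' _ _ _ _ L1 L2).
    exact: (is_lim_seq_le _ _ _ _ (fun J => HH J j u h Hh) L3 (is_lim_seq_const _)).
  have HB : Rabs (Bper p (u + h) - Bper p u) <= CB * (r ^ 3) ^ j.
    apply: Bper_Holder => //; split; first lra.
    by apply: Rle_trans (proj2 Hh) _; apply: pow_dec; [lra|lia].
  have -> : F (u + h) - F u = - / (P - 1) * (gq (u + h) - gq u) + (1 / 2 - al) * (Bper p (u + h) - Bper p u).
    by rewrite /F; field; lra.
  apply: Rle_trans (Rabs_triang _ _) _; rewrite !Rabs_mult Rabs_Ropp (Rabs_pos_eq (/ (P - 1))); last lra.
  have := Rmult_le_compat_l (/ (P - 1)) _ _ ltac:(lra) Hq.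
  have := Rmult_le_compat_l _ _ _ (Rabs_pos (1 / 2 - al)) HB; lra.
have Fper u : F (1 + u) = F u.
  apply: RtoC_inj; apply: csums_unique (HF (1 + u)) _.
  apply: csums_ext (HF u) => n; apply: zpair_ext => k _.
  by rewrite Rmult_plus_distr_l ee_plus Rmult_1_r ee_Z Cmult_1_l.
apply: (mulP_ind P) => //.
  move=> x Hx.
  have -> : logb p (P * x) = 1 + logb p x by have := logb_pow p 1 x Hp Hx; rewrite pow_1 /= => ->.
  rewrite Fper Rinf_mulP // Hinf_mulP //; set H := Hinf _ _ _; set Rf := Rinf _ _ _.
  have -> : rho al x = x ^ 2 / 2 + (1 / 2 - al) * x + hh al x by [].
  set Fx := F _; set Lx := logb p x; set h := hh al x; set k1 := kap / _; set k2 := 1 / 2 + _.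
  (* Both sides scale by P up to the same polynomial, so the defect at P x is P times the defect at
     x. *)
  have E : P * (x ^ 2 / 2 + (1 / 2 - al) * x + h + Rf) + P * (H - h) -
    P * x * (Fx + P * x / (2 * (P - 1)) + (1 / 2 - al) * (1 + Lx) - k1 - (1 / 2 - al) * k2) =
    P * (Rf + H - x * (Fx + x / (2 * (P - 1)) + (1 / 2 - al) * Lx - k1 - (1 / 2 - al) * k2)) by field; lra.
  split=> H0; first by apply: Rminus_diag_uniq; rewrite E H0; ring.
  apply: Rminus_diag_uniq; apply: (Rmult_eq_reg_l P); last lra.
  by rewrite -E H0; ring.
move=> x Hx; set u := logb p x.
have Eu : exp (L * u) = x.
  by rewrite /u /logb -/P -/L; have -> : L * (ln x / L) = ln x; [field; lra|rewrite exp_ln; lra].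
have Hu : 0 <= u < 1.
  rewrite /u /logb -/P -/L; split.
    by apply: Rdiv_le_0_compat => //; rewrite -ln_1; apply: ln_le; lra.
  by apply/Rlt_div_l => //; rewrite Rmult_1_l; apply: ln_increasing; lra.
have [_ L1] := Hgq u.
have HphiJ J : (J <= p ^ J)%nat by have := Nat.pow_gt_lin_r p J ltac:(lia); lia.
have K0 := is_lim_seq_subseq' _ _ _ HphiJ Hkap.
have K1 : is_lim_seq (fun J => wst al (p ^ J.+1)) kap by apply/(is_lim_seq_incr_1 (fun J => wst al (p ^ J))).
have K2 := is_lim_seq_scal_r _ (/ L) _ (is_lim_seq_minus' _ _ _ _ K1 (is_lim_seq_scal_l _ P _ K0)).
have K3 := is_lim_seq_plus' _ _ _ _ K2 (GJ_lim P al x HP Hal).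
have Eg : gq u = (kap - P * kap) * / L + (/ x * ((1 - P) * (P * rho al (x / P) + Hinf P al x) - P * (1 / 2 - al)) + x / 2).
  have K4 : is_lim_seq (fun J => qu p al u J) ((kap - P * kap) * / L + (/ x * ((1 - P) * (P * rho al (x / P) + Hinf P al x) - P * (1 / 2 - al)) + x / 2)).
    apply: is_lim_seq_ext K3 => J; rewrite qu_explicit //; last lra.
    by rewrite -/P -/L Eu.
  have := is_lim_seq_unique _ _ K4; rewrite (is_lim_seq_unique _ _ L1); by case.
have EB : Bper p u = 1 / 2 + 1 / L - u - P / (P - 1) * / x.
  by rewrite /Bper frac_part_eq0 // /beta -/P -/L exp_Ropp Eu.
(* Only the first term survives for x < P, because x / P^2 < 1 / P < al. *)
have ER : Rinf P al x = P * rho al (x / P).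
  rewrite /Rinf; have := is_series_finite 1 (fun k => P ^ k.+1 * rho al (x / P ^ k.+1)).
  rewrite rsumS rsum0 Rplus_0_l pow_1 => H; apply: is_series_unique; apply: H => k Hk.
  have Hk0 : 0 < P ^ k.+1 by apply: pow_lt; lra.
  rewrite rho_small ?Rmult_0_r //; split; first by apply: Rdiv_le_0_compat; lra.
  apply/Rle_div_l => //.
  have : P * P <= P ^ k.+1.
    have -> : k.+1 = (2 + (k - 1))%nat by lia.
    rewrite pow_add; have : 1 <= P ^ (k - 1) by apply: pow_R1_Rle; lra.
    nra.
  nra.
rewrite ER /F Eg EB; field; lra.
Qed.

(** * Analytic functions with majorants *)

(* The sum of the absolute values of the Taylor terms on a closed disc is a
   submultiplicative norm, so analyticity of products and of infinite sums
   reduces to numerical estimates. *)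

Definition maj (f : C -> C) (s0 : C) (r B : R) : Prop :=
  exists a : nat -> C,
    (forall w, Cmod w <= r -> csums (fun n => a n * w ^ n)%C (f (s0 + w)%C)) /\
    ex_series (fun n => Cmod (a n) * r ^ n) /\ Series (fun n => Cmod (a n) * r ^ n) <= B.

Lemma maj_ext f g s0 r B : (forall w, Cmod w <= r -> f (s0 + w)%C = g (s0 + w)%C) ->
  maj f s0 r B -> maj g s0 r B.
Proof.
by move=> H [a [H1 H2]]; exists a; split=> // w Hw; rewrite -H //; apply: H1.
Qed.

Lemma maj_le f s0 r B B' : B <= B' -> maj f s0 r B -> maj f s0 r B'.
Proof. by move=> H [a [H1 [H2 H3]]]; exists a; split=> //; split=> //; lra. Qed.

Lemma maj_term_le (a : nat -> C) r w n : Cmod w <= r ->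
  Cmod (a n * w ^ n) <= Cmod (a n) * r ^ n.
Proof.
move=> Hw; rewrite Cmod_mult Cmod_pow; apply: Rmult_le_compat_l; first exact: Cmod_ge_0.
by apply: pow_incr; split => //; exact: Cmod_ge_0.
Qed.

Lemma maj_analytic f s0 r B : 0 < r -> maj f s0 r B -> analytic_at f s0.
Proof.
move=> Hr [a [H1 _]]; exists a, r; split=> // z Hz; apply/is_series_csums.
have -> : f z = f (s0 + (z - s0))%C by congr f; ring.
apply: csums_ext (H1 (z - s0)%C (Rlt_le _ _ Hz)) => n.
have E (w : C) k : pow_n (K := C_AbsRing) w k = (w ^ k)%C.
  by elim: k => [//|k IH]; rewrite /= IH.
by rewrite E Cmult_comm.
Qed.

Lemma maj_const c s0 r : 0 <= r -> maj (fun=> c) s0 r (Cmod c).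
Proof.
move=> Hr; exists (fun n => if n is 0%nat then c else RtoC 0).
have Hser : is_series (fun n => Cmod (if n is 0%nat then c else RtoC 0) * r ^ n) (Cmod c).
  have := is_series_finite 1 (fun n => Cmod (if n is 0%nat then c else RtoC 0) * r ^ n).
  rewrite rsumS rsum0 /= Rplus_0_l Rmult_1_r; apply => -[//|k] _.
  by rewrite Cmod_0 Rmult_0_l.
split; last by split; [exists (Cmod c)|rewrite (is_series_unique _ _ Hser); lra].
move=> w Hw; have := csums_finite 1 (fun n => (if n is 0%nat then c else RtoC 0) * w ^ n)%C.
rewrite csumS csum0 /= Cplus_0_l Cmult_1_r; apply => -[//|k] _; exact: Cmult_0_l.
Qed.

Lemma maj_addc c s0 r : 0 <= r -> maj (fun s => s + c)%C s0 r (Cmod (s0 + c) + r).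
Proof.
move=> Hr; pose a n := if n is 0%nat then (s0 + c)%C else if n is 1%nat then RtoC 1 else RtoC 0.
exists a.
have Hser : is_series (fun n => Cmod (a n) * r ^ n) (Cmod (s0 + c) + r).
  have := is_series_finite 2 (fun n => Cmod (a n) * r ^ n).
  rewrite !rsumS rsum0 /= Cmod_1 !Rmult_1_r Rplus_0_l Rmult_1_l; apply => -[//|[//|k]] _.
  by rewrite Cmod_0 Rmult_0_l.
split; last by split; [exists (Cmod (s0 + c) + r)|rewrite (is_series_unique _ _ Hser); lra].
move=> w Hw; have := csums_finite 2 (fun n => a n * w ^ n)%C.
rewrite !csumS csum0 /=.
have -> : (0 + (s0 + c) * 1 + 1 * (w * 1) = s0 + w + c)%C by ring.
apply => -[//|[//|k]] _; exact: Cmult_0_l.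
Qed.

Lemma maj_plus f g s0 r B B' : 0 <= r -> maj f s0 r B -> maj g s0 r B' ->
  maj (fun s => f s + g s)%C s0 r (B + B').
Proof.
move=> Hr [a [H1 [H2 H3]]] [b [H4 [H5 H6]]]; exists (fun n => a n + b n)%C.
have Hs := ex_series_plus (V := R_NormedModule) _ _ H2 H5.
have Hle n : 0 <= Cmod (a n + b n) * r ^ n <= plus (Cmod (a n) * r ^ n) (Cmod (b n) * r ^ n).
  have Hrn : 0 <= r ^ n by apply: pow_le.
  split; first by apply: Rmult_le_pos => //; exact: Cmod_ge_0.
  rewrite /plus /= -Rmult_plus_distr_r; apply: Rmult_le_compat_r => //; exact: Cmod_triangle.
split.
  move=> w Hw; apply: csums_ext (csums_plus _ _ _ _ (H1 w Hw) (H4 w Hw)) => n; ring.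
split; first by apply: ex_series_le_pos Hs.
apply: Rle_trans (Series_le _ _ Hle Hs) _.
rewrite Series_plus //; lra.
Qed.

Lemma maj_mult f g s0 r B B' : 0 <= r -> maj f s0 r B -> maj g s0 r B' ->
  maj (fun s => f s * g s)%C s0 r (B * B').
Proof.
move=> Hr [a [H1 [H2 H3]]] [b [H4 [H5 H6]]].
pose c n := \csum_(i < n.+1) (a i * b (n - i)%nat).
exists c.
have E (w : C) n : \csum_(i < n.+1) ((a i * w ^ i) * (b (n - i)%nat * w ^ (n - i)%nat))%C = (c n * w ^ n)%C.
  rewrite /c -csum_scalr; apply: csum_ext => i Hi.
  have -> : (w ^ n = w ^ i * w ^ (n - i)%nat)%C by rewrite -Cpow_add_r; congr Cpow; lia.
  ring.
have Hpos (d : nat -> C) n : 0 <= Cmod (d n) * r ^ n.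
  by apply: Rmult_le_pos; [exact: Cmod_ge_0|exact: pow_le].
have HC w : Cmod w <= r -> _ := fun Hw => cauchy_product _ _ _ _ _ _
  (fun n => maj_term_le a r w n Hw) (fun n => maj_term_le b r w n Hw) H2 H5 (H1 w Hw) (H4 w Hw).
split.
  by move=> w Hw; have [Hc _] := HC w Hw; apply: csums_ext Hc => n; rewrite E.
(* At w = r the terms of the product series have moduli |c_n| r^n, so the bound of [cauchy_product]
   there is the required majorant. *)
have Hrr : Cmod r <= r by rewrite Cmod_R Rabs_pos_eq; lra.
have [_ [Hex Hle]] := HC r Hrr.
have Ec n : Cmod (\csum_(i < n.+1) ((a i * r ^ i) * (b (n - i)%nat * r ^ (n - i)%nat))%C) = Cmod (c n) * r ^ n.
  by rewrite E Cmod_mult Cmod_pow Cmod_R Rabs_pos_eq.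
split; first by apply: ex_series_ext Hex => n; exact: Ec.
rewrite -(Series_ext _ _ Ec); apply: Rle_trans Hle _.
apply: Rmult_le_compat => //.
  by have := rsum_le_Series _ 0 (Hpos a) H2; rewrite rsum0.
by have := rsum_le_Series _ 0 (Hpos b) H5; rewrite rsum0.
Qed.

Lemma maj_shift f c s0 r B : maj f (s0 + c) r B -> maj (fun s => f (s + c)%C) s0 r B.
Proof.
move=> [a [H1 H2]]; exists a; split=> // w Hw.
have -> : (s0 + w + c = s0 + c + w)%C by ring.
exact: H1.
Qed.

Lemma maj_Rcpow x s0 r : 0 < x -> 0 <= r ->
  maj (fun s => Rcpow x (- s)) s0 r (exp (- Re s0 * ln x + r * Rabs (ln x))).
Proof.
move=> Hx Hr; exists (fun n => Rcpow x (- s0) * ((- ln x) ^ n / INR (fact n)))%C.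
have Hser : is_series (fun n => Cmod (Rcpow x (- s0) * ((- ln x) ^ n / INR (fact n))) * r ^ n)
    (exp (- Re s0 * ln x + r * Rabs (ln x))).
  rewrite exp_plus; apply: is_series_ext (is_series_scal_l (exp (- Re s0 * ln x)) _ _ (is_series_exp (r * Rabs (ln x)))) => n.
  rewrite Cmod_mult Cmod_Rcpow re_opp Cmod_div; last exact: INR_fact_C.
  rewrite Cmod_pow Cmod_opp !Cmod_R (Rabs_pos_eq (INR _)); last exact: pos_INR.
  rewrite Rpow_mult_distr /scal /= /mult /=; field; exact: INR_fact_neq_0.
split; last by split; [eexists; exact: Hser|rewrite (is_series_unique _ _ Hser); lra].
move=> w Hw; have -> : Rcpow x (- (s0 + w)) = (Rcpow x (- s0) * Cexp (- ln x * w))%C.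
  by rewrite /Rcpow -Cexp_plus; congr Cexp; ring.
apply: csums_ext (csums_scal (Rcpow x (- s0)) _ _ (csums_expc (- ln x * w))) => n.
rewrite /expc Cpow_mult_l; field; exact: INR_fact_C.
Qed.

Lemma maj_inv c s0 r : 0 <= r -> r < Cmod (s0 + c) -> exists B, maj (fun s => / (s + c))%C s0 r B.
Proof.
move=> Hr Hrc; set d := (s0 + c)%C in Hrc.
have Hd0 : d <> RtoC 0 by apply/Cmod_gt_0; lra.
have Hd : 0 < Cmod d by lra.
have Hq : 0 <= r / Cmod d < 1.
  by split; [exact: Rdiv_le_0_compat|apply/Rlt_div_l; lra].
have Hser : ex_series (fun n => Cmod (/ d * (- / d) ^ n) * r ^ n).
  have E n : / Cmod d * (r / Cmod d) ^ n = Cmod (/ d * (- / d) ^ n) * r ^ n.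
    rewrite Cmod_mult Cmod_pow Cmod_opp !Cmod_inv // /Rdiv Rpow_mult_distr; ring.
  exact: ex_series_ext E (ex_series_geom_scal (/ Cmod d) _ Hq).
exists (Series (fun n => Cmod (/ d * (- / d) ^ n) * r ^ n)), (fun n => / d * (- / d) ^ n)%C.
split; last by split=> //; lra.
move=> w Hw.
have Hs := csums_abs _ _ (fun n => maj_term_le (fun n => / d * (- / d) ^ n)%C r w n Hw) Hser.
case: Hs => l Hl.
set q := (- / d * w)%C.
have E n : (/ d * (- / d) ^ n * w ^ n = / d * q ^ n)%C by rewrite /q Cpow_mult_l; ring.
have Hl' : csums (fun n => / d * q ^ n)%C l by apply: csums_ext Hl => n; rewrite E.
have Hqm : Cmod q < 1.
  rewrite /q Cmod_mult Cmod_opp Cmod_inv // Rmult_comm; apply/Rlt_div_l => //; lra.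
have Hq1 : (1 - q)%C <> RtoC 0.
  apply: Cminus_eq_contra => H; move: Hqm; rewrite -H Cmod_1; lra.
have Hlim : Clim (fun n => / d * ((1 - q ^ n) / (1 - q)))%C (/ d * ((1 - 0) / (1 - q))).
  apply: Clim_scal; rewrite /Cdiv.
  apply: Clim_ext (_ : Clim (fun n => / (1 - q) * (1 - q ^ n))%C _); first by move=> n; rewrite Cmult_comm.
  rewrite Cmult_comm; apply: Clim_scal; apply: Clim_minus (Clim_const _) _.
  apply: (Clim_0_squeeze _ (fun n => Cmod q ^ n)); first by move=> n; rewrite Cmod_pow; lra.
  by apply: is_lim_seq_geom; rewrite Rabs_pos_eq //; exact: Cmod_ge_0.
have El : l = (/ d * ((1 - 0) / (1 - q)))%C.
  apply: Clim_unique Hl' _; apply: Clim_ext Hlim => n.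
  rewrite csum_scal geom_sum_neq1 // => H; apply: Hq1; rewrite H; ring.
have Ew : (s0 + w + c = d + w)%C by rewrite /d; ring.
have Hdw : (d + w)%C <> RtoC 0.
  move=> H; apply: Hq1; have E2 : w = (- d)%C by rewrite -(Cplus_0_r (- d)) -H; ring.
  by rewrite /q E2; field.
have Hq1' : (d * (1 - q) = d + w)%C by rewrite /q; field.
by rewrite Ew; have -> : (/ (d + w) = l)%C by rewrite El -Hq1'; field.
Qed.

(** Weierstrass's theorem in majorant form: the double series of Taylor terms is absolutely
    summable, so [fubini] collects it by powers of w. A choice principle selects the Taylor
    coefficients of all [f k] at once. *)
Lemma maj_sum (f : nat -> C -> C) s0 r (b : nat -> R) : 0 < r ->
  (forall k, maj (f k) s0 r (b k)) -> ex_series b ->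
  maj (fun s => Cseries (fun k => f k s)) s0 r (Series b) /\
  (forall w, Cmod w <= r -> csums (fun k => f k (s0 + w)%C) (Cseries (fun k => f k (s0 + w)%C))).
Proof.
move=> Hr Hf Hb.
have [a Ha] : exists a : nat -> nat -> C, forall k,
    (forall w, Cmod w <= r -> csums (fun n => a k n * w ^ n)%C (f k (s0 + w)%C)) /\
    ex_series (fun n => Cmod (a k n) * r ^ n) /\ Series (fun n => Cmod (a k n) * r ^ n) <= b k.
  exists (fun k => proj1_sig (ClassicalEpsilon.constructive_indefinite_description _ (Hf k))) => k.
  exact: (proj2_sig (ClassicalEpsilon.constructive_indefinite_description _ (Hf k))).
pose A k n := Cmod (a k n) * r ^ n.
have HA0 k n : 0 <= A k n by apply: Rmult_le_pos; [exact: Cmod_ge_0|apply: pow_le; lra].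
pose Rk k := Series (A k).
have HR k : is_series (A k) (Rk k) by apply: Series_correct; case: (Ha k) => _ [].
have HRb k : 0 <= Rk k <= b k.
  split; last by case: (Ha k) => _ [].
  by have := rsum_le_Series (A k) 0 (HA0 k) (ex_intro _ _ (HR k)); rewrite rsum0.
have HRs : ex_series Rk by apply: ex_series_le_pos Hb.
have [Hcol [HB1 HB2]] := fubini_pos A Rk HA0 HR HRs.
have Hrn n : 0 < r ^ n by apply: pow_lt.
have Hcola n : exists l, csums (fun k => a k n) l.
  apply: (csums_abs _ (fun k => / r ^ n * A k n)); last exact: ex_series_scal_l.
  by move=> k; rewrite /A; apply: Req_le; field; have := Hrn n; lra.
pose c n := Cseries (fun k => a k n).
have Hc n : csums (fun k => a k n) (c n) by have [l Hl] := Hcola n; rewrite /c (csums_Cseries _ _ Hl).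
have Hfub w : Cmod w <= r -> exists l, csums (fun k => f k (s0 + w)%C) l /\ csums (fun n => c n * w ^ n)%C l.
  move=> Hw.
  have [l [H1 [d [H2 [H3 _]]]]] := fubini (fun k n => a k n * w ^ n)%C (fun k => f k (s0 + w)%C) A Rk
     (fun k n => maj_term_le (a k) r w n Hw) HR HRs (fun k => proj1 (Ha k) w Hw).
  exists l; split=> //; apply: csums_ext H3 => n.
  apply: csums_unique (H2 n) _; rewrite Cmult_comm.
  by apply: csums_ext (csums_scal (w ^ n) _ _ (Hc n)) => k; rewrite Cmult_comm.
have Hcn n : 0 <= Cmod (c n) * r ^ n <= Series (fun k => A k n).
  split; first by apply: Rmult_le_pos; [exact: Cmod_ge_0|apply: pow_le; lra].
  have := csums_le _ (fun k => / r ^ n * A k n) _ (Hc n) _ (ex_series_scal_l _ _ (Hcol n)).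
  rewrite Series_scal_l => H; have : Cmod (c n) <= / r ^ n * Series (fun k => A k n).
    by apply: H => k; rewrite /A; apply: Req_le; field; have := Hrn n; lra.
  move/(Rmult_le_compat_r (r ^ n) _ _ (Rlt_le _ _ (Hrn n))).
  have -> : / r ^ n * Series (fun k => A k n) * r ^ n = Series (fun k => A k n) by field; have := Hrn n; lra.
  by [].
split.
  exists c; split.
    by move=> w Hw; have [l [H1 H2]] := Hfub w Hw; rewrite (csums_Cseries _ _ H1).
  split; first by apply: ex_series_le_pos HB1.
  apply: Rle_trans (Series_le _ _ Hcn HB1) _.
  by apply: Rle_trans HB2 _; apply: Series_le.
by move=> w Hw; have [l [H1 _]] := Hfub w Hw; rewrite (csums_Cseries _ _ H1).
Qed.

(** Integral test: by the mean value theorem the terms are dominated by differences of x^(1 - tau) /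
    (tau - 1), which telescope. *)
Lemma ex_series_power x0 tau : 0 < x0 -> 1 < tau ->
  ex_series (fun n => exp (- tau * ln (INR n + x0))) .
Proof.
move=> Hx0 Ht; apply/(ex_series_incr_1 (fun n => exp (- tau * ln (INR n + x0)))).
pose g n := exp ((1 - tau) * ln (INR n + x0)) / (tau - 1).
have Hg n : 0 < g n by apply: Rdiv_lt_0_compat; [exact: exp_pos|lra].
have Hn n : 0 < INR n + x0 by have := pos_INR n; lra.
have Hstep n : exp (- tau * ln (INR n.+1 + x0)) <= g n - g n.+1.
  have Hder c : INR n + x0 <= c <= INR n.+1 + x0 ->
     derivable_pt_lim (fun x => - (exp ((1 - tau) * ln x) / (tau - 1))) c (exp (- tau * ln c)).
    move=> Hc; have Hc0 : 0 < c by have := Hn n; lra.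
    apply/is_derive_Reals; auto_derive; first done.
    have -> : exp (- tau * ln c) = exp ((1 - tau) * ln c) * / c.
      have -> : / c = exp (- ln c) by rewrite exp_Ropp exp_ln.
      by rewrite -exp_plus; congr exp; ring.
    by field; lra.
  have [c [E Hc]] := MVT_cor2 _ (fun x => exp (- tau * ln x)) (INR n + x0) (INR n.+1 + x0) ltac:(rewrite S_INR; lra) Hder.
  have E1 : INR n.+1 + x0 - (INR n + x0) = 1 by rewrite S_INR; ring.
  have -> : g n - g n.+1 = exp (- tau * ln c) by rewrite /g; rewrite E1 in E; lra.
  apply: exp_mono; have : ln c <= ln (INR n.+1 + x0) by apply: ln_le; have := Hn n; lra.
  nra.
apply: (proj1 (ex_series_bounded _ (g 0%nat) _ _)).
  by move=> n; apply: Rlt_le; exact: exp_pos.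
move=> n; apply: Rle_trans (rsum_le _ _ _ (fun i _ => Hstep i)) _.
rewrite (rsum_tele n g); have := Hg n; lra.
Qed.

(** * The binomial series *)

Fixpoint bn (k : nat) (w : C) : C :=
  if k is k'.+1 then (bn k' w * (w + - INR k') / INR k)%C else RtoC 1.

(** The coefficients of (1 - t)^(-A); they dominate the binomial coefficients [bn k w] for |w| <=
    A. *)
Fixpoint bnB (k : nat) (A : R) : R :=
  if k is k'.+1 then bnB k' A * (A + INR k') / INR k else 1.

Lemma bnS k w : bn k.+1 w = (bn k w * (w + - INR k) / INR k.+1)%C.
Proof. by []. Qed.

Lemma bnBS k A : bnB k.+1 A = bnB k A * (A + INR k) / INR k.+1.
Proof. by []. Qed.

Lemma bnB_pos k A : 0 < A -> 0 < bnB k A.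
Proof.
move=> HA; elim: k => [|k IH]; first by rewrite /=; lra.
rewrite bnBS; apply: Rdiv_lt_0_compat; last by apply: lt_0_INR; lia.
by apply: Rmult_lt_0_compat => //; have := pos_INR k; lra.
Qed.

Lemma Cmod_bn k w A : Cmod w <= A -> Cmod (bn k w) <= bnB k A.
Proof.
move=> HA; have HA0 : 0 <= A by apply: Rle_trans HA; exact: Cmod_ge_0.
elim: k => [|k IH]; first by rewrite /= Cmod_1; lra.
have Hk : 0 < INR k.+1 by apply: lt_0_INR; lia.
rewrite bnS bnBS Cmod_div; last exact: INR_C.
rewrite Cmod_mult Cmod_R (Rabs_pos_eq (INR _)); last lra.
apply: Rmult_le_compat_r; first by apply: Rlt_le; apply: Rinv_0_lt_compat.
apply: Rmult_le_compat => //; try exact: Cmod_ge_0.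
apply: Rle_trans (Cmod_triangle _ _) _; rewrite Cmod_opp Cmod_R Rabs_pos_eq; last exact: pos_INR.
lra.
Qed.

Lemma bnB_series A t : 0 < A -> 0 < t < 1 -> ex_series (fun k => bnB k A * t ^ k).
Proof.
move=> HA Ht; have Hpos k : 0 < bnB k A * t ^ k.
  by apply: Rmult_lt_0_compat; [exact: bnB_pos|apply: pow_lt; lra].
apply: (ex_series_ext (fun k => Rabs (bnB k A * t ^ k))); first by move=> k; apply: Rabs_pos_eq; apply: Rlt_le.
apply: (ex_series_DAlembert _ t); first lra.
  by move=> n; have := Hpos n; lra.
have L1 : is_lim_seq (fun n => t + t * ((A - 1) / INR n.+1)) (t + t * 0).
  apply: is_lim_seq_plus'; first exact: is_lim_seq_const.
  exact: (is_lim_seq_scal_l _ t 0 (is_lim_seq_inv_S (A - 1))).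
rewrite Rmult_0_r Rplus_0_r in L1; apply: is_lim_seq_ext L1 => n.
have Hn : 0 < INR n.+1 by apply: lt_0_INR; lia.
rewrite Rabs_pos_eq; last by apply: Rlt_le; apply: Rdiv_lt_0_compat.
have H1 := bnB_pos n A HA; have H2 : 0 < t ^ n by apply: pow_lt; lra.
rewrite bnBS S_INR [t ^ n.+1]/=; field; rewrite -?S_INR; lra.
Qed.

Lemma bn_majorant w t : 0 < t < 1 -> ex_series (fun k => Cmod (bn k w) * t ^ k).
Proof.
move=> Ht; have HA : 0 < Cmod w + 1 by have := Cmod_ge_0 w; lra.
apply: ex_series_le_pos (bnB_series _ t HA Ht) => k.
have Htk : 0 < t ^ k by apply: pow_lt; lra.
split; first by apply: Rmult_le_pos; [exact: Cmod_ge_0|lra].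
apply: Rmult_le_compat_r; [lra|apply: Cmod_bn; lra].
Qed.

Lemma bn_CV_radius (u : nat -> R) w : (forall k, Rabs (u k) <= Cmod (bn k w)) ->
  forall t, 0 <= t < 1 -> Rbar_lt (Rabs t) (CV_radius u).
Proof.
move=> Hu t Ht; set s := (t + 1) / 2; have Hs : 0 < s < 1 by rewrite /s; lra.
have HD : CV_disk u s.
  apply: (ex_series_le_pos _ (fun k => Cmod (bn k w) * s ^ k)); last exact: bn_majorant.
  move=> k; split; first exact: Rabs_pos.
  rewrite Rabs_mult (Rabs_pos_eq (s ^ k)); last by apply: pow_le; lra.
  by apply: Rmult_le_compat_r => //; apply: pow_le; lra.
apply: (Rbar_lt_le_trans _ s).
  by rewrite /= Rabs_pos_eq /s; lra.
by apply: (proj1 (Lub_Rbar_correct (CV_disk u))).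
Qed.

(** Both sides solve (1 + t) f' = w f with f(0) = 1. The series is differentiated as two real power
    series, and its product with (1 + t)^(-w), whose real and imaginary parts are [e1] and [e2], is
    shown to be constant. *)
Lemma binom_series w t : 0 <= t < 1 ->
  csums (fun k => bn k w * t ^ k)%C (Rcpow (1 + t) w).
Proof.
move=> Ht.
pose u1 k := Re (bn k w); pose u2 k := Im (bn k w).
have R1 := bn_CV_radius u1 w (fun k => re_le_Cmod _).
have R2 := bn_CV_radius u2 w (fun k => im_le_Cmod _).
have CS x : 0 <= x < 1 -> csums (fun k => bn k w * x ^ k)%C (PSeries u1 x, PSeries u2 x).
  move=> Hx; have E1 : is_series (fun k => u1 k * x ^ k) (PSeries u1 x).
    have := PSeries_correct u1 x (CV_radius_inside _ _ (R1 x Hx)); rewrite /is_pseries.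
    by apply: is_series_ext => k; rewrite pow_n_pow /scal /= /mult /=; ring.
  have E2 : is_series (fun k => u2 k * x ^ k) (PSeries u2 x).
    have := PSeries_correct u2 x (CV_radius_inside _ _ (R2 x Hx)); rewrite /is_pseries.
    by apply: is_series_ext => k; rewrite pow_n_pow /scal /= /mult /=; ring.
  apply: Clim_ReIm.
    move/is_series_rsum: E1; apply: is_lim_seq_ext => n; rewrite Re_csum; apply: rsum_ext => k _.
    by rewrite -RtoC_pow re_scal_r.
  move/is_series_rsum: E2; apply: is_lim_seq_ext => n; rewrite Im_csum; apply: rsum_ext => k _.
  by rewrite -RtoC_pow im_scal_r.
have := CS t Ht; suff -> : (PSeries u1 t, PSeries u2 t) = Rcpow (1 + t) w by [].
set w1 := Re w; set w2 := Im w.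
have HD x : 0 <= x < 1 ->
   is_derive (PSeries u1) x ((w1 * PSeries u1 x - w2 * PSeries u2 x) / (1 + x)) /\
   is_derive (PSeries u2) x ((w1 * PSeries u2 x + w2 * PSeries u1 x) / (1 + x)).
  move=> Hx.
  (* The relation (k + 1) b_{k+1} + k b_k = w b_k is the differential equation read coefficient by
     coefficient. *)
  have Hrec k : (INR k.+1 * u1 k.+1 + INR k * u1 k = w1 * u1 k - w2 * u2 k) /\
      (INR k.+1 * u2 k.+1 + INR k * u2 k = w1 * u2 k + w2 * u1 k).
    have E : (INR k.+1 * bn k.+1 w + INR k * bn k w = w * bn k w)%C.
      rewrite bnS; field; exact: INR_C.
    have := f_equal Re E; have := f_equal Im E.
    rewrite !re_plus !im_plus !re_scal_l !im_scal_l re_mult im_mult -/w1 -/w2 -/(u1 k) -/(u2 k) -/(u1 k.+1) -/(u2 k.+1).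
    by move=> H1 H2; split; lra.
  have D1 := is_derive_PSeries u1 x (R1 x Hx); have D2 := is_derive_PSeries u2 x (R2 x Hx).
  have X1 : ex_pseries u1 x := CV_radius_inside _ _ (R1 x Hx).
  have X2 : ex_pseries u2 x := CV_radius_inside _ _ (R2 x Hx).
  have Y1 : ex_pseries (PS_derive u1) x by apply: CV_radius_inside; rewrite CV_radius_derive; exact: R1.
  have Y2 : ex_pseries (PS_derive u2) x by apply: CV_radius_inside; rewrite CV_radius_derive; exact: R2.
  have Hmul (v : nat -> R) : ex_pseries (PS_derive v) x ->
     (1 + x) * PSeries (PS_derive v) x = PSeries (fun k => INR k.+1 * v k.+1 + INR k * v k) x /\ True.
    move=> Hv; split=> //.
    have -> : (1 + x) * PSeries (PS_derive v) x = PSeries (PS_derive v) x + PSeries (PS_incr_1 (PS_derive v)) x.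
      by rewrite PSeries_incr_1; ring.
    rewrite -PSeries_plus //; last exact: ex_pseries_incr_1.
    by apply: PSeries_ext => -[|k]; rewrite /PS_plus /PS_incr_1 /PS_derive /plus /= /zero /=; ring.
  split.
    have -> : (w1 * PSeries u1 x - w2 * PSeries u2 x) / (1 + x) = PSeries (PS_derive u1) x; last exact: D1.
    have [H _] := Hmul u1 Y1; rewrite (PSeries_ext (fun k => INR k.+1 * u1 k.+1 + INR k * u1 k) (PS_minus (PS_scal w1 u1) (PS_scal w2 u2))) in H.
      rewrite PSeries_minus in H; [|exact: ex_pseries_scal (Rmult_comm _ _) X1|exact: ex_pseries_scal (Rmult_comm _ _) X2].
      rewrite !PSeries_scal in H; rewrite -H; field; lra.
    by move=> k; rewrite (proj1 (Hrec k)) /PS_minus /PS_plus /PS_opp /PS_scal /plus /opp /scal /= /mult /=; ring.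
  have -> : (w1 * PSeries u2 x + w2 * PSeries u1 x) / (1 + x) = PSeries (PS_derive u2) x; last exact: D2.
  have [H _] := Hmul u2 Y2; rewrite (PSeries_ext (fun k => INR k.+1 * u2 k.+1 + INR k * u2 k) (PS_plus (PS_scal w1 u2) (PS_scal w2 u1))) in H.
    rewrite PSeries_plus in H; [|exact: ex_pseries_scal (Rmult_comm _ _) X2|exact: ex_pseries_scal (Rmult_comm _ _) X1].
    rewrite !PSeries_scal in H; rewrite -H; field; lra.
  by move=> k; rewrite (proj2 (Hrec k)) /PS_plus /PS_scal /plus /scal /= /mult /=; ring.
pose e1 x := exp (- w1 * ln (1 + x)) * cos (w2 * ln (1 + x)).
pose e2 x := - (exp (- w1 * ln (1 + x)) * sin (w2 * ln (1 + x))).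
have HE x : 0 <= x < 1 -> is_derive e1 x (- (w1 * e1 x - w2 * e2 x) / (1 + x)) /\
   is_derive e2 x (- (w1 * e2 x + w2 * e1 x) / (1 + x)).
  by move=> Hx; rewrite /e1 /e2; split; (auto_derive; [lra|field; lra]).
have H0 : PSeries u1 0 = 1 /\ PSeries u2 0 = 0.
  by rewrite !PSeries_0 /u1 /u2 /= .
have Hcst (f f' : R -> R) : (forall x, 0 <= x <= t -> is_derive f x (f' x)) -> (forall x, 0 <= x <= t -> f' x = 0) -> f t = f 0.
  move=> Hd Hz; have [->|Ht0] : t = 0 \/ 0 < t by lra.
    by [].
  have [c [E Hc]] := MVT_cor2 f f' 0 t Ht0 (fun c Hc => proj1 (is_derive_Reals f c (f' c)) (Hd c Hc)).
  by rewrite Hz in E; lra.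
set g1 := PSeries u1 in HD H0 *; set g2 := PSeries u2 in HD H0 *.
have C1 : g1 t * e1 t - g2 t * e2 t = 1.
  rewrite (Hcst (fun x => g1 x * e1 x - g2 x * e2 x)
    (fun x => ((w1 * g1 x - w2 * g2 x) / (1 + x) * e1 x + g1 x * (- (w1 * e1 x - w2 * e2 x) / (1 + x))) -
       ((w1 * g2 x + w2 * g1 x) / (1 + x) * e2 x + g2 x * (- (w1 * e2 x + w2 * e1 x) / (1 + x))))).
  - by rewrite (proj1 H0) (proj2 H0) /e1 Rplus_0_r ln_1 !Rmult_0_r exp_0 cos_0; ring.
  - move=> x Hx; have [D1 D2] := HD x ltac:(lra); have [D3 D4] := HE x ltac:(lra).
    have M1 := is_derive_mult _ _ _ _ _ D1 D3 (fun n m => Rmult_comm n m).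
    have M2 := is_derive_mult _ _ _ _ _ D2 D4 (fun n m => Rmult_comm n m).
    exact: is_derive_minus M1 M2.
  - by move=> x Hx; field; lra.
have C2 : g1 t * e2 t + g2 t * e1 t = 0.
  rewrite (Hcst (fun x => g1 x * e2 x + g2 x * e1 x)
    (fun x => ((w1 * g1 x - w2 * g2 x) / (1 + x) * e2 x + g1 x * (- (w1 * e2 x + w2 * e1 x) / (1 + x))) +
       ((w1 * g2 x + w2 * g1 x) / (1 + x) * e1 x + g2 x * (- (w1 * e1 x - w2 * e2 x) / (1 + x))))).
  - by rewrite (proj1 H0) (proj2 H0) /e2 Rplus_0_r ln_1 !Rmult_0_r exp_0 sin_0; ring.
  - move=> x Hx; have [D1 D2] := HD x ltac:(lra); have [D3 D4] := HE x ltac:(lra).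
    have M1 := is_derive_mult _ _ _ _ _ D1 D4 (fun n m => Rmult_comm n m).
    have M2 := is_derive_mult _ _ _ _ _ D2 D3 (fun n m => Rmult_comm n m).
    exact: is_derive_plus M1 M2.
  - by move=> x Hx; field; lra.
have EE : (e1 t, e2 t) = Rcpow (1 + t) (- w).
  rewrite /Rcpow /Cexp re_scal_r im_scal_r re_opp im_opp -/w1 -/w2 /e1 /e2.
  have -> : - w2 * ln (1 + t) = - (w2 * ln (1 + t)) by ring.
  by rewrite cos_neg sin_neg; f_equal; ring.
have : ((g1 t, g2 t) * (e1 t, e2 t) = 1)%C by rewrite /Cmult /= C1 C2.
rewrite EE Rcpow_opp => H.
by rewrite -(Cmult_1_r (g1 t, g2 t)) -(Cinv_l _ (Rcpow_neq0 (1 + t) w)) Cmult_assoc H Cmult_1_l.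
Qed.

(** * Analytic continuation of the Hurwitz zeta function *)

Definition Yser (a : R) (s : C) : C := Cseries (fun n => Rcpow (INR n + a) (- s)).

Lemma ln_nonneg x : 1 <= x -> 0 <= ln x.
Proof. by move=> Hx; rewrite -ln_1; apply: ln_le; lra. Qed.

Lemma Yser_maj a s0 r : 1 <= a -> 0 < r -> 1 < Re s0 - r ->
  maj (Yser a) s0 r (Series (fun n => exp (- (Re s0 - r) * ln (INR n + a)))) /\
  (forall w, Cmod w <= r -> csums (fun n => Rcpow (INR n + a) (- (s0 + w))) (Yser a (s0 + w))).
Proof.
move=> Ha Hr Hs; apply: maj_sum => //; last by apply: ex_series_power => //; lra.
move=> n; have Hn := pos_INR n; have Hln := ln_nonneg (INR n + a) ltac:(lra).
have -> : exp (- (Re s0 - r) * ln (INR n + a)) = exp (- Re s0 * ln (INR n + a) + r * Rabs (ln (INR n + a))).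
  by rewrite Rabs_pos_eq //; congr exp; ring.
by apply: maj_Rcpow; lra.
Qed.

Lemma Yser_csums a s : 1 <= a -> 1 < Re s -> csums (fun n => Rcpow (INR n + a) (- s)) (Yser a s).
Proof.
move=> Ha Hs; have [_ H] := Yser_maj a s ((Re s - 1) / 2) Ha ltac:(lra) ltac:(lra).
have := H 0; rewrite Cplus_0_r; apply; rewrite Cmod_0; lra.
Qed.

Lemma power_series_le a tau : 1 <= a -> forall j, 1 < tau ->
  Series (fun n => exp (- (tau + INR j) * ln (INR n + a))) <= (/ a) ^ j * Series (fun n => exp (- tau * ln (INR n + a))).
Proof.
move=> Ha j Ht; rewrite -Series_scal_l; apply: Series_le.
  move=> n; split; first by apply: Rlt_le; exact: exp_pos.
  have -> : (/ a) ^ j = exp (- INR j * ln a).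
    rewrite -[/ a]exp_ln; last by apply: Rinv_0_lt_compat; lra.
    rewrite -exp_nat ln_Rinv; last lra.
    by congr exp; ring.
  rewrite -exp_plus; apply: exp_mono.
  have H1 : ln a <= ln (INR n + a) by apply: ln_le; [lra|have := pos_INR n; lra].
  have := pos_INR j; nra.
by apply: ex_series_scal_l; apply: ex_series_power => //; lra.
Qed.

Lemma power_lim0 a d : 0 < a -> 0 < d -> is_lim_seq (fun n => exp (- d * ln (INR n + a))) 0.
Proof.
move=> Ha Hd; apply/is_lim_seq_0_eps => e He.
have [N HN] := nfloor_ex (exp (- ln e / d)) (Rlt_le _ _ (exp_pos _)).
exists N.+1 => n Hn; rewrite Rabs_pos_eq; last by apply: Rlt_le; exact: exp_pos.
rewrite -[X in _ < X](exp_ln e) //; apply: exp_increasing.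
have H1 : exp (- ln e / d) < INR n + a.
  have : INR N.+1 <= INR n by apply: le_INR; lia.
  rewrite S_INR; lra.
have H2 : - ln e / d < ln (INR n + a).
  by rewrite -{1}(ln_exp (- ln e / d)); apply: ln_increasing => //; exact: exp_pos.
have : - ln e < d * ln (INR n + a).
  have -> : - ln e = d * (- ln e / d) by field; lra.
  by apply: Rmult_lt_compat_l.
lra.
Qed.

(** Expand (x + 1)^(1-s) in powers of 1 / x at x = n + a and sum over n: the k-th binomial term
    becomes a multiple of the series at s + k - 1. The condition a >= 2 keeps 1 / x <= 1/2, which
    outweighs the binomial coefficients when the sums are exchanged. *)
Lemma zeta_recursion a s : 2 <= a -> 1 < Re s ->
  csums (fun j => bn j.+1 (1 - s) / INR j.+2 * ((s + INR j.+1 - 1) * Yser a (s + INR j.+1)))%C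
    (Rcpow a (1 - s) - (s - 1) * Yser a s)%C.
Proof.
move=> Ha Hs; set w := (1 - s)%C.
pose x n := INR n + a.
have Hx n : 2 <= x n by rewrite /x; have := pos_INR n; lra.
pose X n j := (bn j.+2 w * Rcpow (x n) (- (s + INR j.+1)))%C.
have Hrow n : csums (X n) (Rcpow (x n + 1) w - Rcpow (x n) w + (s - 1) * Rcpow (x n) (- s))%C.
  have Hxn := Hx n.
  have Ht : 0 <= / x n < 1.
    by split; [apply: Rlt_le; apply: Rinv_0_lt_compat; lra|rewrite -Rinv_1; apply: Rinv_lt_contravar; lra].
  have HxC : RtoC (x n) <> RtoC 0 by move=> /RtoC_inj; lra.
  have B := csums_scal (Rcpow (x n) w) _ _ (binom_series w (/ x n) Ht).
  rewrite -Rcpow_mult in B; [|lra|lra].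
  have E1 : x n * (1 + / x n) = x n + 1 by field; lra.
  rewrite E1 in B.
  have E2 : Rcpow (x n) w = (x n * Rcpow (x n) (- s))%C.
    by rewrite /w -[(1 - s)%C]/(1 + - s)%C Rcpow_plus Rcpow_1; [|lra].
  have -> : (Rcpow (x n + 1) w - Rcpow (x n) w + (s - 1) * Rcpow (x n) (- s) = 
    Rcpow (x n + 1) w - \csum_(k < 2) (Rcpow (x n) w * (bn k w * (/ x n)%R ^ k)))%C.
    rewrite !csumS csum0 /= E2 RtoC_inv; last lra.
    by rewrite /w; field; (repeat split) => //; try exact: C1_nz.
  have := proj1 (csums_ge 2 (fun k => Rcpow (x n) w * (bn k w * (/ x n)%R ^ k))%C
     (Rcpow (x n + 1) w - \csum_(k < 2) (Rcpow (x n) w * (bn k w * (/ x n)%R ^ k)))%C).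
  have -> : (Rcpow (x n + 1) w - \csum_(k < 2) (Rcpow (x n) w * (bn k w * (/ x n)%R ^ k)) +
     \csum_(k < 2) (Rcpow (x n) w * (bn k w * (/ x n)%R ^ k)) = Rcpow (x n + 1) w)%C by ring.
  move=> /(_ B); apply: csums_ext => j.
  rewrite /X addSn addSn add0n.
  suff -> : (Rcpow (x n) (- (s + INR j.+1)) = Rcpow (x n) w * (/ x n)%R ^ j.+2)%C by ring.
  have -> : (- (s + INR j.+1) = w + - INR j.+2)%C.
    by rewrite /w (S_INR j.+1) RtoC_plus; ring.
  rewrite Rcpow_plus Rcpow_opp; congr Cmult.
  have -> : Rcpow (x n) (INR j.+2) = (x n ^ j.+2)%C.
    by rewrite /Rcpow Cexp_nat Cexp_RtoC exp_ln //; lra.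
  by rewrite RtoC_inv ?Cpow_inv //; lra.
pose A n j := Cmod (bn j.+2 w) * (/ 2) ^ j * exp (- (Re s + 1) * ln (x n)).
have HXA n j : Cmod (X n j) <= A n j.
  have Hxn := Hx n.
  rewrite /X /A Cmod_mult Cmod_Rcpow re_opp re_plus re_RtoC Rmult_assoc.
  apply: Rmult_le_compat_l; first exact: Cmod_ge_0.
  have -> : exp (- (Re s + INR j.+1) * ln (x n)) = exp (INR j * - ln (x n)) * exp (- (Re s + 1) * ln (x n)).
    by rewrite -exp_plus S_INR; congr exp; ring.
  apply: Rmult_le_compat_r; first by apply: Rlt_le; exact: exp_pos.
  rewrite exp_nat exp_Ropp exp_ln; last lra.
  apply: pow_incr; split; first by apply: Rlt_le; apply: Rinv_0_lt_compat; lra.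
  by apply: Rinv_le_contravar; lra.
have HK : ex_series (fun j => Cmod (bn j.+2 w) * (/ 2) ^ j).
  have := bn_majorant w (/ 2) ltac:(lra).
  move=> /(ex_series_incr_n _ 2)/(ex_series_scal_l 4); apply: ex_series_ext => j.
  by rewrite /scal /= /mult /=; field.
set K := Series (fun j => Cmod (bn j.+2 w) * (/ 2) ^ j).
have HA n : is_series (A n) (K * exp (- (Re s + 1) * ln (x n))).
  by apply: is_series_scal_r; apply: Series_correct.
have HR : ex_series (fun n => K * exp (- (Re s + 1) * ln (x n))).
  by apply: ex_series_scal_l; apply: ex_series_power; lra.
have [l [H1 [c [H2 [H3 _]]]]] := fubini X _ A _ HXA HA HR Hrow.
have El : l = ((s - 1) * Yser a s - Rcpow a w)%C.
  apply: csums_unique H1 _.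
  have -> : ((s - 1) * Yser a s - Rcpow a w = (0 - Rcpow a w) + (s - 1) * Yser a s)%C by ring.
  apply: csums_plus; last by apply: csums_scal; apply: Yser_csums; lra.
  have L0 : Clim (fun n => Rcpow (x n) w) 0.
    apply: Clim_0_squeeze (power_lim0 a (Re s - 1) ltac:(lra) ltac:(lra)) => n.
    rewrite Cmod_Rcpow; apply: Req_le; congr exp; rewrite /w re_plus re_opp re_RtoC /x; ring.
  apply: Clim_ext (Clim_minus _ _ _ _ L0 (Clim_const (Rcpow a w))) => n.
  have x0 : x 0%nat = a by rewrite /x /= Rplus_0_l.
  have T : \csum_(i < n) (Rcpow (x i) w - Rcpow (x i.+1) w) = (Rcpow a w - Rcpow (x n) w)%C.
    by rewrite (csum_tele n (fun n => Rcpow (x n) w)) x0.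
  have -> : (Rcpow (x n) w - Rcpow a w = - (Rcpow a w - Rcpow (x n) w))%C by ring.
  rewrite -T; have -> : (- (\csum_(i < n) (Rcpow (x i) w - Rcpow (x i.+1) w)) =
     (- (1)) * (\csum_(i < n) (Rcpow (x i) w - Rcpow (x i.+1) w)))%C by ring.
  rewrite -csum_scal; apply: csum_ext => i _.
  have -> : x i.+1 = x i + 1 by rewrite /x S_INR; ring.
  ring.
have Ec j : c j = (bn j.+2 w * Yser a (s + INR j.+1))%C.
  apply: csums_unique (H2 j) _; apply: csums_scal.
  apply: Yser_csums; first lra.
  by rewrite re_plus re_RtoC; have := pos_INR j.+1; lra.
have -> : (Rcpow a w - (s - 1) * Yser a s = - (1) * l)%C by rewrite El; ring.
apply: csums_ext (csums_scal (- (1))%C _ _ H3) => j.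
rewrite Ec bnS; have E : (w + - INR j.+1 = - (s + INR j.+1 - 1))%C by rewrite /w; ring.
rewrite E; field; exact: INR_C.
Qed.

(* (s - 1) zeta(s, a) is a fixed point of this operator, by binomial expansion of the
   telescoping terms (n + a)^{1-s} - (n + a + 1)^{1-s}.  Each application extends the
   domain of analyticity one unit to the left. *)
Definition Fop (a : R) (Z : C -> C) (s : C) : C :=
  (Rcpow a (1 - s) - Cseries (fun j => bn j.+1 (1 - s) / INR j.+2 * Z (s + INR j.+1)))%C.

Fixpoint Zk (a : R) (M : nat) : C -> C :=
  if M is M'.+1 then Fop a (Zk a M') else fun s => ((s - 1) * Yser a s)%C.

Lemma Fop_ext a Z Z' s : (forall j, Z (s + INR j.+1)%C = Z' (s + INR j.+1)%C) ->
  Fop a Z s = Fop a Z' s.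
Proof.
move=> H; rewrite /Fop /Cseries; congr (_ - (_, _))%C; apply: Series_ext => j; by rewrite H.
Qed.

Lemma Zk_series a M s : 2 <= a -> 1 < Re s -> Zk a M s = ((s - 1) * Yser a s)%C.
Proof.
move=> Ha; elim: M s => [//|M IH] s Hs /=.
rewrite (Fop_ext a _ (fun s => (s - 1) * Yser a s)%C); last first.
  by move=> j; apply: IH; rewrite re_plus re_RtoC; have := pos_INR j.+1; lra.
by rewrite /Fop (csums_Cseries _ _ (zeta_recursion a s Ha Hs)); ring.
Qed.

Lemma Zk_stable a M s : 2 <= a -> 1 - INR M < Re s -> Zk a M.+1 s = Zk a M s.
Proof.
move=> Ha; elim: M s => [|M IH] s Hs.
  by rewrite Zk_series //; rewrite /= in Hs; lra.
rewrite -[LHS]/(Fop a (Zk a M.+1) s) -[RHS]/(Fop a (Zk a M) s); apply: Fop_ext => j; apply: IH.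
rewrite re_plus re_RtoC; rewrite S_INR in Hs; have : INR 1 <= INR j.+1 by apply: le_INR; lia.
rewrite /=; lra.
Qed.

Lemma Zk_stable_le a M M' s : 2 <= a -> (M <= M')%nat -> 1 - INR M < Re s -> Zk a M' s = Zk a M s.
Proof.
move=> Ha /subnKC <- Hs; elim: (M' - M)%nat => [|k IH]; first by rewrite addn0.
rewrite addnS Zk_stable // plus_INR; have := pos_INR k; lra.
Qed.

Lemma maj_bn k s0 r : 0 <= r -> maj (fun s => bn k (1 - s)) s0 r (bnB k (Cmod (s0 - 1) + r)).
Proof.
move=> Hr; elim: k => [|k IH].
  by have := maj_const 1 s0 r Hr; rewrite Cmod_1.
have Hk : 0 < INR k.+1 by apply: lt_0_INR; lia.
have HC := INR_C k.
have M1 := maj_mult _ _ _ _ _ _ Hr (maj_mult _ _ _ _ _ _ Hr IH (maj_addc (INR k - 1)%C s0 r Hr)) (maj_const (- / INR k.+1)%C s0 r Hr).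
apply: (maj_ext (fun s => bn k (1 - s) * (s + (INR k - 1)) * - / INR k.+1)%C).
  by move=> w _; rewrite bnS; field.
apply: maj_le M1; rewrite bnBS Cmod_opp Cmod_inv // Cmod_R (Rabs_pos_eq (INR _)); last lra.
apply: Rmult_le_compat_r; first by apply: Rlt_le; apply: Rinv_0_lt_compat.
apply: Rmult_le_compat_l.
  by apply: Rle_trans (Cmod_bn k 0 _ _); rewrite ?Cmod_0; [exact: Cmod_ge_0|have := Cmod_ge_0 (s0 - 1); lra].
have -> : (s0 + (INR k - 1) = (s0 - 1) + INR k)%C by ring.
have := Cmod_triangle (s0 - 1) (INR k); rewrite Cmod_R Rabs_pos_eq; [lra|exact: pos_INR].
Qed.

(** For small j the majorants at s0 + j + 1 are merely known to exist; they are selected by choice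
    and concern finitely many terms. From [J0] on the discs lie in Re s >= 2, where the Dirichlet
    series gives the explicit bound [Bd] of size j 2^-j. *)
Lemma Fop_maj a Z s0 r : 2 <= a -> 0 < r ->
  (forall s, 1 < Re s -> Z s = ((s - 1) * Yser a s)%C) ->
  (forall j, exists B, maj Z (s0 + INR j.+1) r B) ->
  (exists B, maj (Fop a Z) s0 r B) /\
  csums (fun j => bn j.+1 (1 - s0) / INR j.+2 * Z (s0 + INR j.+1))%C
    (Cseries (fun j => bn j.+1 (1 - s0) / INR j.+2 * Z (s0 + INR j.+1))%C).
Proof.
move=> Ha Hr HZ HB.
pose Bc j := proj1_sig (ClassicalEpsilon.constructive_indefinite_description _ (HB j)).
have HBc j : maj Z (s0 + INR j.+1) r (Bc j) := proj2_sig (ClassicalEpsilon.constructive_indefinite_description _ (HB j)).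
set A := Cmod (s0 - 1) + r.
have HA : 0 < A by have := Cmod_ge_0 (s0 - 1); rewrite /A; lra.
have [J0 HJ0] : exists J0 : nat, 1 + r - Re s0 <= INR J0.
  case: (Rle_dec 0 (1 + r - Re s0)) => H.
    by have [N HN] := nfloor_ex _ H; exists N.+1; rewrite S_INR; lra.
  by exists 0%nat; rewrite /=; lra.
pose Y2 := Series (fun n => exp (- 2 * ln (INR n + a))).
have HY2 : 0 <= Y2.
  have Hp n : 0 <= exp (- 2 * ln (INR n + a)) by apply: Rlt_le; exact: exp_pos.
  by have := rsum_le_Series _ 0 Hp (ex_series_power a 2 ltac:(lra) ltac:(lra)); rewrite rsum0.
pose Bd j := (Cmod s0 + r + INR j) * (2 ^ J0 * (/ 2) ^ j * Y2).
have Hd j : (J0 <= j)%nat -> maj Z (s0 + INR j.+1) r (Bd j).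
  move=> Hj; have Hjr : INR J0 <= INR j by apply: le_INR; lia.
  have Hre : Re (s0 + INR j.+1) = Re s0 + INR j + 1 by rewrite re_plus re_RtoC S_INR; ring.
  have Hs : 1 < Re (s0 + INR j.+1) - r by rewrite Hre; lra.
  have [M1 _] := Yser_maj a _ r ltac:(lra) Hr Hs.
  have M2 := maj_mult _ _ _ _ _ _ (Rlt_le _ _ Hr) (maj_addc (- (1))%C (s0 + INR j.+1)%C r (Rlt_le _ _ Hr)) M1.
  apply: (maj_ext (fun s => (s + - (1)) * Yser a s)%C).
    move=> w Hw; rewrite HZ //; rewrite re_plus.
    have := re_le_Cmod w; have := Rle_abs (- Re w); rewrite Rabs_Ropp; lra.
  apply: maj_le M2; apply: Rmult_le_compat.
  - by apply: Rplus_le_le_0_compat; [exact: Cmod_ge_0|lra].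
  - have Hp n : 0 <= exp (- (Re (s0 + INR j.+1) - r) * ln (INR n + a)) by apply: Rlt_le; exact: exp_pos.
    by have := rsum_le_Series _ 0 Hp (ex_series_power a _ ltac:(lra) Hs); rewrite rsum0.
  - have -> : (s0 + INR j.+1 + - (1) = s0 + INR j)%C by rewrite S_INR RtoC_plus; ring.
    have := Cmod_triangle s0 (INR j); rewrite Cmod_R Rabs_pos_eq; [lra|exact: pos_INR].
  have H2 := power_series_le a 2 ltac:(lra) (j - J0) ltac:(lra).
  apply: (Rle_trans _ ((/ a) ^ (j - J0) * Y2)).
    apply: Rle_trans H2; apply: Series_le; last by apply: ex_series_power; [lra|have := pos_INR (j - J0); lra].
    move=> n; split; first by apply: Rlt_le; exact: exp_pos.
    apply: exp_mono; rewrite Hre; apply: Rmult_le_compat_r; first by apply: ln_nonneg; have := pos_INR n; lra.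
    have : INR (j - J0) = INR j - INR J0 by rewrite -minus_INR //; lia.
    lra.
  apply: Rmult_le_compat_r => //.
  have -> : 2 ^ J0 * (/ 2) ^ j = (/ 2) ^ (j - J0).
    have {1}-> : j = (J0 + (j - J0))%nat by lia.
    rewrite pow_add -Rmult_assoc -Rpow_mult_distr Rinv_r; last lra.
    by rewrite pow1 Rmult_1_l.
  apply: pow_incr; split; first by apply: Rlt_le; apply: Rinv_0_lt_compat; lra.
  by apply: Rinv_le_contravar; lra.
pose B j := bnB j.+1 A * / INR j.+2 * (if (j < J0)%nat then Bc j else Bd j).
have Hf j : maj (fun s => bn j.+1 (1 - s) / INR j.+2 * Z (s + INR j.+1))%C s0 r (B j).
  have Hr0 := Rlt_le _ _ Hr.
  apply: maj_mult => //; last by apply: maj_shift; case: ltnP => Hj; [exact: HBc|exact: Hd].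
  have := maj_mult _ _ _ _ _ _ Hr0 (maj_bn j.+1 s0 r Hr0) (maj_const (/ INR j.+2)%C s0 r Hr0).
  rewrite Cmod_inv; last exact: INR_C.
  by rewrite Cmod_R Rabs_pos_eq //; exact: pos_INR.
have HBs : ex_series B.
  apply/(ex_series_incr_n _ J0).
  apply: (ex_series_le_pos _ (fun i => (Cmod s0 + r + 1) * 2 ^ J0 * Y2 * 2 * (bnB (J0 + i).+1 A * (/ 2) ^ (J0 + i).+1))).
    move=> i; rewrite /B ltnNge leq_addr /=.
    set j := (J0 + i)%nat.
    have Hb := bnB_pos j.+1 A HA; have Hj := pos_INR j.
    have H2j : 0 < (/ 2) ^ j by apply: pow_lt; lra.
    have HJ : 0 < 2 ^ J0 by apply: pow_lt; lra.
    have Hj2 : 0 < INR j.+2 by apply: lt_0_INR; lia.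
    have Hcs := Cmod_ge_0 s0.
    have HBd : 0 <= Bd j by apply: Rmult_le_pos; [lra|apply: Rmult_le_pos => //; apply: Rlt_le; apply: Rmult_lt_0_compat].
    split.
      by apply: Rmult_le_pos => //; apply: Rlt_le; apply: Rmult_lt_0_compat => //; apply: Rinv_0_lt_compat.
    have E : / INR j.+2 * Bd j <= (Cmod s0 + r + 1) * (2 ^ J0 * (/ 2) ^ j * Y2).
      rewrite /Bd -Rmult_assoc; apply: Rmult_le_compat_r.
        by apply: Rmult_le_pos => //; apply: Rlt_le; apply: Rmult_lt_0_compat.
      rewrite Rmult_comm; apply/Rle_div_l => //; rewrite !S_INR; nra.
    rewrite -/(bnB j.+1 A) Rmult_assoc.
    have -> : (Cmod s0 + r + 1) * 2 ^ J0 * Y2 * 2 * (bnB j.+1 A * (/ 2) ^ j.+1) =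
       bnB j.+1 A * ((Cmod s0 + r + 1) * (2 ^ J0 * (/ 2) ^ j * Y2)) by rewrite [(/ 2) ^ j.+1]/=; field.
    by apply: Rmult_le_compat_l E; lra.
  apply: ex_series_scal_l.
  have := bnB_series A (/ 2) HA ltac:(lra).
  move=> /(ex_series_incr_n _ J0.+1); apply: ex_series_ext => i.
  by [].
have [M1 M2] := maj_sum _ s0 r B Hr Hf HBs.
split.
  have Hr0 := Rlt_le _ _ Hr.
  have Ma := maj_mult _ _ _ _ _ _ Hr0 (maj_const a s0 r Hr0) (maj_Rcpow a s0 r ltac:(lra) Hr0).
  have Mm := maj_mult _ _ _ _ _ _ Hr0 (maj_const (- (1))%C s0 r Hr0) M1.
  eexists; apply: maj_ext (maj_plus _ _ _ _ _ _ Hr0 Ma Mm) => w _.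
  rewrite /Fop; have -> : (1 - (s0 + w) = 1 + - (s0 + w))%C by [].
  by rewrite Rcpow_plus Rcpow_1; [ring|lra].
by have := M2 0; rewrite Cplus_0_r Cmod_0; apply; lra.
Qed.

Lemma Zk_maj a M s0 r : 2 <= a -> 0 < r -> 1 - INR M < Re s0 - r -> exists B, maj (Zk a M) s0 r B.
Proof.
move=> Ha Hr; elim: M s0 => [|M IH] s0 Hs.
  rewrite /= in Hs; have [M1 _] := Yser_maj a s0 r ltac:(lra) Hr ltac:(lra).
  by eexists; apply: maj_mult M1; [lra|exact: (maj_addc (- (1))%C s0 r (Rlt_le _ _ Hr))].
apply: (proj1 (Fop_maj a (Zk a M) s0 r Ha Hr _ _)).
  by move=> s; exact: Zk_series.
move=> j; apply: IH; rewrite re_plus re_RtoC; rewrite S_INR in Hs.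
have : INR 1 <= INR j.+1 by apply: le_INR; lia.
rewrite /=; lra.
Qed.

(* The entire function (s - 1) zeta(s, a). *)
Definition Zt (a : R) (s : C) : C := Zk a (Z.to_nat (up (1 - Re s))) s.

Lemma Zt_Zk a M s : 2 <= a -> 1 - INR M < Re s -> Zt a s = Zk a M s.
Proof.
move=> Ha HM; rewrite /Zt; set M' := Z.to_nat _.
have HM' : 1 - INR M' < Re s.
  have [H1 _] := archimed (1 - Re s); rewrite /M' INR_IZR_INZ.
  have : IZR (up (1 - Re s)) <= IZR (Z.of_nat (Z.to_nat (up (1 - Re s)))) by apply: IZR_le; lia.
  lra.
case: (leqP M M') => H; first by apply: Zk_stable_le.
by symmetry; apply: Zk_stable_le => //; apply: ltnW.
Qed.

Lemma Zt_series a s : 2 <= a -> 1 < Re s -> Zt a s = ((s - 1) * Yser a s)%C.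
Proof. by move=> Ha Hs; rewrite (Zt_Zk a 0) //=; lra. Qed.

Lemma Zt_maj a s0 r : 2 <= a -> 0 < r -> exists B, maj (Zt a) s0 r B.
Proof.
move=> Ha Hr.
have [M HM] : exists M : nat, 1 - INR M < Re s0 - r.
  case: (Rle_dec 0 (1 + r - Re s0)) => H.
    by have [N HN] := nfloor_ex _ H; exists N.+1; rewrite S_INR; lra.
  by exists 0%nat; rewrite /=; lra.
have [B HB] := Zk_maj a M s0 r Ha Hr HM; exists B.
apply: maj_ext HB => w Hw; symmetry; apply: Zt_Zk => //.
rewrite re_plus; have := re_le_Cmod w; have := Rle_abs (- Re w); rewrite Rabs_Ropp; lra.
Qed.

Lemma Zt_Fop a s : 2 <= a ->
  csums (fun j => bn j.+1 (1 - s) / INR j.+2 * Zt a (s + INR j.+1))%C (Rcpow a (1 - s) - Zt a s)%C.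
Proof.
move=> Ha.
have [_ H] := Fop_maj a (Zt a) s 1 Ha Rlt_0_1 (fun s => Zt_series a s Ha) (fun j => Zt_maj a _ 1 Ha Rlt_0_1).
have [M HM] : exists M : nat, 1 - INR M < Re s.
  case: (Rle_dec 0 (1 - Re s)) => H'.
    by have [N HN] := nfloor_ex _ H'; exists N.+1; rewrite S_INR; lra.
  by exists 0%nat; rewrite /=; lra.
have -> : Zt a s = Fop a (Zt a) s.
  rewrite (Zt_Zk a M.+1) //; last by rewrite S_INR; lra.
  rewrite -[LHS]/(Fop a (Zk a M) s); apply: Fop_ext => j; symmetry; apply: Zt_Zk => //.
  rewrite re_plus re_RtoC; have := pos_INR j.+1; lra.
have -> : (Rcpow a (1 - s) - Fop a (Zt a) s = Cseries (fun j => bn j.+1 (1 - s) / INR j.+2 * Zt a (s + INR j.+1)))%C.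
  by rewrite /Fop; ring.
exact: H.
Qed.

(** * An identity theorem along horizontal lines *)

Lemma csums_terms_bounded a l : csums a l -> exists M, forall n, Cmod (a n) <= M.
Proof.
move=> /Clim_bounded[M HM]; exists (2 * M) => n.
have -> : a n = (\csum_(i < n.+1) a i - \csum_(i < n) a i)%C by rewrite csumS; ring.
apply: Rle_trans (Cmod_triangle _ _) _; rewrite Cmod_opp.
have := HM n; have := HM n.+1; lra.
Qed.

(** Strong induction: once the lower coefficients vanish, division by d^n turns the equation into
    c_n = O(d), and d tends to 0 through positive reals. *)
Lemma pseries_zero (c : nat -> C) r : 0 < r ->
  (forall d : R, 0 < d < r -> csums (fun n => c n * d ^ n)%C 0) -> forall n, c n = RtoC 0.
Proof.
move=> Hr H; elim/ltn_ind => n IH.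
set r0 := r / 2; have Hr0 : 0 < r0 < r by rewrite /r0; lra.
have Hsh d : 0 < d < r -> csums (fun k => c (n + k)%nat * d ^ k)%C 0.
  move=> Hd; have HdC : (RtoC d ^ n)%C <> RtoC 0 by apply: Cpow_nz => /RtoC_inj; lra.
  have E0 : \csum_(i < n) (c i * d ^ i)%C = RtoC 0.
    rewrite (csum_ext _ _ (fun=> RtoC 0)) ?csum_const; first by ring.
    by move=> i Hi; rewrite IH //; ring.
  have H0 : csums (fun k => c k * d ^ k)%C (0 + \csum_(i < n) (c i * d ^ i)%C) by rewrite E0 Cplus_0_l; apply: H.
  have H1 := csums_scal (/ RtoC d ^ n) _ _ (proj1 (csums_ge n _ _) H0).
  rewrite Cmult_0_r in H1; apply: csums_ext H1 => k.
  by rewrite Cpow_add_r; field.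
have [M HM] := csums_terms_bounded _ _ (Hsh r0 Hr0).
have HM0 : 0 <= M by apply: Rle_trans (HM 0%nat); exact: Cmod_ge_0.
have Hb d : 0 < d <= r0 / 2 -> Cmod (c n) <= M * (2 * d / r0).
  move=> Hd; have Hq : 0 <= d / r0 < 1.
    split; first by apply: Rdiv_le_0_compat; lra.
    by apply/Rlt_div_l; lra.
  have Hbd k : Cmod (c (n + k)%nat * d ^ k)%C <= M * (d / r0) ^ k.
    have := HM k; rewrite !Cmod_mult !Cmod_pow !Cmod_R !Rabs_pos_eq; [|lra|lra].
    have Hk0 : 0 < r0 ^ k by apply: pow_lt; lra.
    have Hd0 : 0 <= (d / r0) ^ k by apply: pow_le; lra.
    move=> HMk; have -> : d ^ k = r0 ^ k * (d / r0) ^ k.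
      by rewrite -Rpow_mult_distr; congr pow; field; lra.
    by rewrite -Rmult_assoc; apply: Rmult_le_compat_r.
  have Hg := ex_series_geom_scal M _ Hq.
  have := csums_tail _ _ _ 1 (Hsh d ltac:(lra)) Hbd Hg.
  rewrite csumS csum0 rsumS rsum0 /= addn0 Series_scal_l Series_geom; last by rewrite Rabs_pos_eq; lra.
  have -> : (0 - (0 + c n * 1) = - c n)%C by ring.
  rewrite Cmod_opp => H1; apply: Rle_trans H1 _.
  have -> : M * / (1 - d / r0) - (0 + M * 1) = M * (d / (r0 - d)) by field; lra.
  apply: Rmult_le_compat_l => //.
  have -> : 2 * d / r0 = d * (2 / r0) by field; lra.
  apply: Rmult_le_compat_l; first lra.
  apply/Rle_div_r; first lra.
  have -> : / (r0 - d) * r0 = r0 / (r0 - d) by field; lra.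
  apply/Rle_div_l; lra.
apply: Cmod_eq_0; apply: Rle_antisym; last exact: Cmod_ge_0.
apply: le_epsilon => e He; rewrite Rplus_0_l.
(* Chosen so that 2 M d / r0 <= e; the 1 added to M covers M = 0. *)
set d := Rmin (r0 / 2) (e * r0 / (2 * (M + 1))).
have Hd : 0 < d.
  apply: Rmin_pos; first lra.
  by apply: Rdiv_lt_0_compat; [apply: Rmult_lt_0_compat; lra|lra].
apply: Rle_trans (Hb d (conj Hd (Rmin_l _ _))) _.
have Hd2 : d <= e * r0 / (2 * (M + 1)) by exact: Rmin_r.
apply: (Rle_trans _ (M * (2 * (e * r0 / (2 * (M + 1))) / r0))).
  apply: Rmult_le_compat_l => //; apply: Rmult_le_compat_r; first by apply: Rlt_le; apply: Rinv_0_lt_compat; lra.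
  lra.
have -> : M * (2 * (e * r0 / (2 * (M + 1))) / r0) = e * (M / (M + 1)) by field; lra.
have : M / (M + 1) <= 1 by apply/Rle_div_l; lra.
nra.
Qed.

Lemma is_pseries_csums (a : nat -> C) (w l : C) :
  is_pseries (K := C_AbsRing) (V := C_NormedModule) a w l <-> csums (fun n => a n * w ^ n)%C l.
Proof.
have E n : scal (pow_n (K := C_AbsRing) w n) (a n : C_NormedModule) = (a n * w ^ n)%C.
  have -> : pow_n (K := C_AbsRing) w n = (w ^ n)%C by elim: n => [//|n IH]; rewrite /= IH.
  exact: Cmult_comm.
split=> [/is_series_csums|] H; first by apply: csums_ext H => n; rewrite E.
by apply/is_series_csums; apply: csums_ext H => n; rewrite E.
Qed.

(** A line Im s = t with t <> 0 avoids the pole, which reduces the identity theorem to one real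
    variable: the set of x such that f and g agree to the right of -x cannot have a supremum, since
    there the two Taylor expansions agree on a half-interval and hence coincide. This reaches every
    [chi p k] with k <> 0, as these are not real. *)
Lemma analytic_unique f g : (forall s, s <> RtoC 1 -> analytic_at f s) ->
  (forall s, s <> RtoC 1 -> analytic_at g s) -> (forall s, 1 < Re s -> f s = g s) ->
  forall s, Im s <> 0 -> f s = g s.
Proof.
move=> Hf Hg H1 s Hs; set t := Im s in Hs.
pose E x := forall y, - x <= y -> f (y, t) = g (y, t).
have E2 : E (-2) by move=> y Hy; apply: H1; rewrite /=; lra.
have Emono x x' : x' <= x -> E x -> E x' by move=> Hx HE y Hy; apply: HE; lra.
suff HE : forall x, E x.
  have -> : s = (Re s, t) by rewrite /t; case: (s).
  by apply: (HE (- Re s)); lra.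
apply: NNPP => Hn.
have Hbnd : bound E.
  case/not_all_ex_not: Hn => x0 Hx0; exists x0 => x Hx.
  by apply: Rnot_lt_le => Hlt; apply: Hx0; apply: Emono Hx; lra.
have [l [Hl1 Hl2]] := completeness E Hbnd (ex_intro _ _ E2).
have Hlt y : - l < y -> f (y, t) = g (y, t).
  move=> Hy; apply: NNPP => Hne.
  have : is_upper_bound E (- y).
    move=> x Hx; apply: Rnot_lt_le => Hlt; apply: Hne; apply: Hx; lra.
  move=> /Hl2; lra.
pose s0 : C := (- l, t).
have Hs0 : s0 <> RtoC 1 by move=> [_ H]; apply: Hs.
have [a [ra [Hra Ha]]] := Hf s0 Hs0; have [b [rb [Hrb Hb]]] := Hg s0 Hs0.
set r := Rmin ra rb; have Hr : 0 < r by apply: Rmin_pos.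
have Hra' : r <= ra := Rmin_l _ _; have Hrb' : r <= rb := Rmin_r _ _.
have Hd (d : R) : (((- l + d)%R, t) - s0 = RtoC d)%C.
  by rewrite /s0 /Cminus /Cplus /Copp /RtoC /=; f_equal; ring.
have Hdiff d : Rabs d < r -> csums (fun n => (a n - b n) * d ^ n)%C (f ((- l + d)%R, t) - g ((- l + d)%R, t)).
  move=> Hdr.
  have A1 := Ha ((- l + d)%R, t) ltac:(rewrite Hd Cmod_R; lra).
  have B1 := Hb ((- l + d)%R, t) ltac:(rewrite Hd Cmod_R; lra).
  rewrite Hd in A1 B1; move/is_pseries_csums: A1 => A1; move/is_pseries_csums: B1 => B1.
  by apply: csums_ext (csums_minus _ _ _ _ A1 B1) => n; ring.
have Hz : forall n, (a n - b n)%C = RtoC 0.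
  apply: (pseries_zero _ r Hr) => d Hd0.
  have := Hdiff d ltac:(rewrite Rabs_pos_eq; lra); rewrite Hlt; last lra.
  by rewrite /Cminus Cplus_opp_r.
have HEl : E (l + r / 2).
  move=> y Hy; case: (Rlt_dec (- l) y) => Hyl; first exact: Hlt.
  have H2 := Hdiff (y + l) ltac:(apply: Rabs_def1; lra).
  have Ey : - l + (y + l) = y by ring.
  rewrite Ey in H2; apply/Ceq_minus; apply: csums_unique H2 _.
  apply: csums_ext csums_0 => n; rewrite Hz; ring.
have := Hl1 _ HEl; lra.
Qed.

(* Does not depend on m; letting m grow reads off the value at [chi p k]. *)
Definition Fzeta (al : R) (m : nat) (s : C) : C := (Sz al m s + Zt (INR m + al) s / (s - 1))%C.

Lemma Sz_maj al m s0 r : 0 < al -> 0 <= r -> exists B, maj (Sz al m) s0 r B.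
Proof.
move=> Hal Hr; elim: m => [|m [B IH]].
  exists (Cmod 0); apply: maj_ext (maj_const 0 s0 r Hr) => w _; by rewrite /Sz csum0.
eexists; apply: maj_ext (maj_plus _ _ _ _ _ _ Hr IH (maj_Rcpow (INR m + al) s0 r _ Hr)).
  by move=> w _; rewrite /Sz csumS.
have := pos_INR m; lra.
Qed.

(** The third condition says that [al] is the least positive number n + be', the first base in the
    defining series. The condition m >= 2 brings [INR m + al] into the range a >= 2 of [Zt]. *)
Lemma Fzeta_hurwitz be' al m : 0 < al -> (2 <= m)%nat -> IZR (up (- be')) + be' = al ->
  is_hurwitz_zeta be' (Fzeta al m).
Proof.
move=> Hal Hm Hup.
have Ha : 2 <= INR m + al by have : INR 2 <= INR m by [apply: le_INR; lia]; rewrite /=; lra.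
split.
  move=> s Hs; apply/is_series_csums.
  have Hs1 : (s - 1)%C <> RtoC 0.
    move=> H; have : Re (s - 1) = 0 by rewrite H.
    rewrite /Cminus re_plus re_opp re_RtoC; lra.
  apply: (csums_ext (fun n => Rcpow (INR n + al) (- s))).
    by move=> n; rewrite plus_IZR -INR_IZR_INZ -Hup; congr Rcpow; ring.
  have -> : Fzeta al m s = (Yser (INR m + al) s + \csum_(n < m) Rcpow (INR n + al) (- s))%C.
    by rewrite /Fzeta Zt_series // /Sz; field.
  apply/csums_ge; apply: csums_ext (Yser_csums (INR m + al) s ltac:(lra) Hs) => n.
  by rewrite plus_INR; congr Rcpow; ring.
move=> s Hs.
have Hs1 : 0 < Cmod (s + - (1)) by apply/Cmod_gt_0; exact: Cminus_eq_contra.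
set r := Cmod (s + - (1)) / 2; have Hr : 0 < r by rewrite /r; lra.
have [B1 M1] := Sz_maj al m s r Hal (Rlt_le _ _ Hr).
have [B2 M2] := Zt_maj (INR m + al) s r Ha Hr.
have [B3 M3] := maj_inv (- (1)) s r (Rlt_le _ _ Hr) ltac:(rewrite /r; lra).
exact: maj_analytic Hr (maj_plus _ _ _ _ _ _ (Rlt_le _ _ Hr) M1 (maj_mult _ _ _ _ _ _ (Rlt_le _ _ Hr) M2 M3)).
Qed.

Lemma hurwitz_Fzeta be' al m s : 0 < al -> (2 <= m)%nat -> IZR (up (- be')) + be' = al ->
  Im s <> 0 -> hurwitz_zeta s be' = Fzeta al m s.
Proof.
move=> Hal Hm Hup Hs.
have HF := Fzeta_hurwitz be' al m Hal Hm Hup.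
have HE : is_hurwitz_zeta be' (fun s => hurwitz_zeta s be').
  rewrite /hurwitz_zeta; exact: (ClassicalEpsilon.epsilon_spec _ _ (ex_intro _ _ HF)).
apply: (analytic_unique (fun s => hurwitz_zeta s be') (Fzeta al m)) Hs.
- exact: (proj2 HE).
- exact: (proj2 HF).
move=> z Hz; have /is_series_csums H1 := proj1 HE z Hz; have /is_series_csums H2 := proj1 HF z Hz.
exact: csums_unique H1 H2.
Qed.

(** * Asymptotics of the continuation on the imaginary axis *)

Lemma sum_inv_sqr_le a : 2 <= a ->
  ex_series (fun n => exp (- 2 * ln (INR n + a))) /\ Series (fun n => exp (- 2 * ln (INR n + a))) <= 2 / a.
Proof.
move=> Ha.
have Hx n : 2 <= INR n + a by have := pos_INR n; lra.
have E n : exp (- 2 * ln (INR n + a)) = / (INR n + a) ^ 2.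
  have Hn := Hx n; have -> : - 2 * ln (INR n + a) = - (ln (INR n + a) + ln (INR n + a)) by ring.
  by rewrite exp_Ropp exp_plus exp_ln; [congr Rinv; ring|lra].
apply: ex_series_bounded.
  by move=> n; apply: Rlt_le; exact: exp_pos.
move=> n; apply: (Rle_trans _ (\rsum_(i < n) (/ (INR i + a - 1) - / (INR i.+1 + a - 1)))).
  apply: rsum_le => i _; have Hi := Hx i; rewrite E S_INR.
  have -> : / (INR i + a - 1) - / (INR i + 1 + a - 1) = / ((INR i + a - 1) * (INR i + a)) by field; lra.
  apply: Rinv_le_contravar; nra.
rewrite (rsum_tele n (fun i => / (INR i + a - 1))) Rplus_0_l.
have : 0 < / (INR n + a - 1) by apply: Rinv_0_lt_compat; have := Hx n; lra.
have : / (a - 1) <= 2 / a.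
  apply/Rle_div_r; first lra.
  have -> : / (a - 1) * a = a / (a - 1) by field; lra.
  apply/Rle_div_l; lra.
lra.
Qed.

Lemma tail_bound (D : nat -> R) s l a (c : nat -> C) : 2 <= a -> Re s = 2 ->
  (forall i, Cmod (c i) <= D i) -> ex_series (fun i => D i * (/ 2) ^ i) ->
  csums (fun i => c i * Yser a (s + INR i))%C l -> Cmod l <= 2 * Series (fun i => D i * (/ 2) ^ i) / a.
Proof.
move=> Ha Hs Hc HD Hl.
have [X1 X2] := sum_inv_sqr_le a Ha.
have H2a : 0 < 2 / a by apply: Rdiv_lt_0_compat; lra.
have HY i : Cmod (Yser a (s + INR i)) <= (/ 2) ^ i * (2 / a).
  have Hre : Re (s + INR i) = 2 + INR i by rewrite re_plus re_RtoC Hs.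
  have Hi := pos_INR i.
  have B : Cmod (Yser a (s + INR i)) <= Series (fun n => exp (- (2 + INR i) * ln (INR n + a))).
    apply: csums_le (Yser_csums a (s + INR i) ltac:(lra) ltac:(lra)) _ _; last by apply: ex_series_power; lra.
    by move=> n; rewrite Cmod_Rcpow re_opp Hre; apply: Rle_refl.
  apply: Rle_trans B _; apply: Rle_trans (power_series_le a 2 ltac:(lra) i ltac:(lra)) _.
  apply: Rmult_le_compat => //.
  - by apply: pow_le; apply: Rlt_le; apply: Rinv_0_lt_compat; lra.
  - have Hp n : 0 <= exp (- 2 * ln (INR n + a)) by apply: Rlt_le; exact: exp_pos.
    by have := rsum_le_Series _ 0 Hp X1; rewrite rsum0.
  apply: pow_incr; split; first by apply: Rlt_le; apply: Rinv_0_lt_compat; lra.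
  by apply: Rinv_le_contravar; lra.
have -> : 2 * Series (fun i => D i * (/ 2) ^ i) / a = Series (fun i => (D i * (/ 2) ^ i) * (2 / a)).
  by rewrite Series_scal_r; field; lra.
apply: csums_le Hl _ _; last exact: ex_series_scal_r.
move=> i; rewrite Cmod_mult Rmult_assoc; apply: Rmult_le_compat => //; exact: Cmod_ge_0.
Qed.

(** The factor s + i is absorbed by the denominator i + k + 1, so the growth is that of the binomial
    coefficients. *)
Lemma coef_bound w s k : ex_series (fun i => Cmod (bn (i + k) w / INR (i + k).+1 * (s + INR i)) * (/ 2) ^ i).
Proof.
have HA : 0 < Cmod w + 1 by have := Cmod_ge_0 w; lra.
apply: (ex_series_le_pos _ (fun i => 2 ^ k * (Cmod s + 1) * (bnB (k + i) (Cmod w + 1) * (/ 2) ^ (k + i)))); last first.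
  apply: ex_series_scal_l; have := bnB_series _ (/ 2) HA ltac:(lra).
  by move/(ex_series_incr_n _ k).
move=> i; have Hi : 0 < (/ 2) ^ i by apply: pow_lt; lra.
split; first by apply: Rmult_le_pos; [exact: Cmod_ge_0|lra].
have -> : 2 ^ k * (Cmod s + 1) * (bnB (k + i) (Cmod w + 1) * (/ 2) ^ (k + i)) =
   (Cmod s + 1) * bnB (k + i) (Cmod w + 1) * (/ 2) ^ i.
  rewrite pow_add; have E : 2 ^ k * (/ 2) ^ k = 1 by rewrite -Rpow_mult_distr Rinv_r ?pow1 //; lra.
  transitivity ((2 ^ k * (/ 2) ^ k) * ((Cmod s + 1) * bnB (k + i) (Cmod w + 1) * (/ 2) ^ i)); first ring.
  by rewrite E; ring.
apply: Rmult_le_compat_r; first lra.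
rewrite Cmod_mult Cmod_div; last exact: INR_C.
have Hk : 0 < INR (i + k).+1 by apply: lt_0_INR; lia.
rewrite Cmod_R (Rabs_pos_eq (INR _)); last lra.
have B1 : Cmod (bn (i + k) w) <= bnB (k + i) (Cmod w + 1) by rewrite addnC; apply: Cmod_bn; lra.
have B2 : Cmod (s + INR i) <= (Cmod s + 1) * INR (i + k).+1.
  apply: Rle_trans (Cmod_triangle _ _) _; rewrite Cmod_R Rabs_pos_eq; last exact: pos_INR.
  have := pos_INR i; have := pos_INR k; have := Cmod_ge_0 s; rewrite S_INR plus_INR; nra.
have -> : Cmod (bn (i + k) w) / INR (i + k).+1 * Cmod (s + INR i) = Cmod (bn (i + k) w) * (Cmod (s + INR i) / INR (i + k).+1) by field; lra.
rewrite Rmult_comm; apply: Rmult_le_compat => //.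
- by apply: Rdiv_le_0_compat; [exact: Cmod_ge_0|].
- exact: Cmod_ge_0.
by apply/Rle_div_l.
Qed.

(** First-order Euler-Maclaurin summation from two uses of the fixed-point equation: at s it leaves
    a^(1-s) - (1 - s)/2 times [Zt] at s + 1, and at s + 1 it leaves a^(-s). The remaining terms sit
    at s + 2 and further right, where Re s = 0 makes the Dirichlet series converge, and [tail_bound]
    makes them O(1 / a). *)
Lemma Zt_asymp s : Re s = 0 -> exists K, forall a, 2 <= a ->
  Cmod (Zt a s - (Rcpow a (1 - s) - (1 - s) / 2 * Rcpow a (- s))) <= K / a.
Proof.
move=> Hs.
pose c1 i := (bn (i + 2) (1 - s) / INR (i + 2).+1 * ((s + 1) + INR i))%C.
pose c2 i := (bn (i + 1) (- s) / INR (i + 1).+1 * ((s + 1) + INR i))%C.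
pose K1 := 2 * Series (fun i => Cmod (c1 i) * (/ 2) ^ i).
pose K2 := 2 * Series (fun i => Cmod (c2 i) * (/ 2) ^ i).
exists (K1 + Cmod ((1 - s) / 2) * K2) => a Ha.
have Hre2 : Re (s + 2) = 2 by rewrite re_plus re_RtoC; lra.
have HS1 i : Zt a (s + 2 + INR i) = ((s + 1 + INR i) * Yser a (s + 2 + INR i))%C.
  rewrite Zt_series //; first by congr Cmult; ring.
  by rewrite re_plus Hre2 re_RtoC; have := pos_INR i; lra.
have E2 : Cmod (Rcpow a (- s) - Zt a (s + 1)) <= K2 / a.
  apply: (tail_bound _ (s + 2) _ a c2) => //; [by move=> i; apply: Rle_refl|exact: coef_bound|].
  have := Zt_Fop a (s + 1) Ha; have -> : (1 - (s + 1) = - s)%C by ring.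
  apply: csums_ext => i; rewrite /c2 addn1.
  have -> : (s + 1 + INR i.+1 = s + 2 + INR i)%C by rewrite S_INR RtoC_plus; ring.
  by rewrite HS1; ring.
have E1 : Cmod (Rcpow a (1 - s) - Zt a s - (1 - s) / 2 * Zt a (s + 1)) <= K1 / a.
  apply: (tail_bound _ (s + 2) _ a c1) => //; [by move=> i; apply: Rle_refl|exact: coef_bound|].
  have H0 := Zt_Fop a s Ha.
  have H1 := proj1 (csums_ge 1 _ (Rcpow a (1 - s) - Zt a s - (1 - s) / 2 * Zt a (s + 1))%C).
  apply: csums_ext (H1 (fun j => bn j.+1 (1 - s) / INR j.+2 * Zt a (s + INR j.+1))%C _).
    move=> i; rewrite /c1 add1n addn2.
    have -> : (s + INR i.+2 = s + 2 + INR i)%C by rewrite !S_INR !RtoC_plus; ring.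
    by rewrite HS1; ring.
  rewrite csumS csum0.
  have -> : (Rcpow a (1 - s) - Zt a s - (1 - s) / 2 * Zt a (s + 1) +
    (0 + bn 1 (1 - s) / INR 2 * Zt a (s + INR 1)) = Rcpow a (1 - s) - Zt a s)%C.
    have E : bn 1 (1 - s) = (1 - s)%C by rewrite /=; field; exact: C1_nz.
    have -> : RtoC (INR 2) = RtoC 2 by rewrite /=; congr RtoC; ring.
    have -> : RtoC (INR 1) = RtoC 1 by [].
    by rewrite E; ring.
  exact: H0.
have -> : (Zt a s - (Rcpow a (1 - s) - (1 - s) / 2 * Rcpow a (- s)) =
  - (Rcpow a (1 - s) - Zt a s - (1 - s) / 2 * Zt a (s + 1)) + (1 - s) / 2 * (Rcpow a (- s) - Zt a (s + 1)))%C by ring.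
apply: Rle_trans (Cmod_triangle _ _) _; rewrite Cmod_opp Cmod_mult.
have := Rmult_le_compat_l _ _ _ (Cmod_ge_0 ((1 - s) / 2)) E2.
have -> : (K1 + Cmod ((1 - s) / 2) * K2) / a = K1 / a + Cmod ((1 - s) / 2) * (K2 / a) by field; lra.
lra.
Qed.

(** The Euler-Maclaurin description of zeta(s, al), meant for Re s = 0, where m^(-s) does not decay
    and has to be subtracted as well. The coefficient al - 1/2 results from expanding at m instead
    of m + al. *)
Definition zlim (al : R) (s z : C) : Prop :=
  Clim (fun m => Sz al m.+1 s - Rcpow (INR m.+1) (1 - s) / (1 - s)
                 - (al - 1 / 2)%R * Rcpow (INR m.+1) (- s))%C z.

Lemma Rcpow_1p w : exists K, forall x, 0 <= x <= 1 / 2 ->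
  Cmod (Rcpow (1 + x) w - 1 - w * x) <= K * x ^ 2.
Proof.
have HK : ex_series (fun k => Cmod (bn k.+2 w) * (/ 2) ^ k).
  have := bn_majorant w (/ 2) ltac:(lra).
  move=> /(ex_series_incr_n _ 2)/(ex_series_scal_l 4); apply: ex_series_ext => j.
  by rewrite /scal /= /mult /=; field.
exists (Series (fun k => Cmod (bn k.+2 w) * (/ 2) ^ k)) => x Hx.
have B := binom_series w x ltac:(lra).
have H1 : csums (fun k => bn k.+2 w * x ^ k.+2)%C (Rcpow (1 + x) w - 1 - w * x).
  apply: (proj1 (csums_ge 2 (fun k => bn k w * x ^ k)%C _)).
  suff -> : (Rcpow (1 + x) w - 1 - w * x + \csum_(i < 2) (bn i w * x ^ i) = Rcpow (1 + x) w)%C by [].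
  by rewrite !csumS csum0 /=; field; exact: C1_nz.
rewrite -Series_scal_r; apply: csums_le H1 _ _; last exact: ex_series_scal_r.
move=> k; rewrite Cmod_mult Cmod_pow Cmod_R Rabs_pos_eq; last lra.
rewrite Rmult_assoc; apply: Rmult_le_compat_l; first exact: Cmod_ge_0.
have -> : k.+2 = (k + 2)%nat by lia.
rewrite pow_add; apply: Rmult_le_compat_r; first exact: pow2_ge_0.
apply: pow_incr; lra.
Qed.

Lemma hurwitz_zlim be' al s : 0 < al <= 1 -> IZR (up (- be')) + be' = al ->
  Re s = 0 -> Im s <> 0 -> zlim al s (hurwitz_zeta s be').
Proof.
move=> Hal Hup Hre Him.
have [K0 HK0] := Zt_asymp s Hre.
have [K1 HK1] := Rcpow_1p (1 - s); have [K2 HK2] := Rcpow_1p (- s).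
have Hs1 : (1 - s)%C <> RtoC 0.
  move=> H; apply: Him; have : Im (1 - s) = 0 by rewrite H.
  rewrite /Cminus im_plus im_opp im_RtoC; lra.
pose K := Rabs K1 / Cmod (1 - s) + 1 / 2 * (Cmod s + Rabs K2) + Rabs K0 / Cmod (1 - s).
apply: (Clim_squeeze_loc _ _ (fun m => K / INR m.+1) 1); last exact: is_lim_seq_inv_S.
move=> m Hm; set M := INR m.+1.
have HM : 2 <= M by apply: (le_INR 2); lia.
have HMC : RtoC M <> RtoC 0 by move=> /RtoC_inj; lra.
rewrite (hurwitz_Fzeta be' al m.+1 s) //; [|lra].
rewrite /Fzeta -/M; set a := M + al.
have Ha : 2 <= a by rewrite /a; lra.
set x := al / M.
have Hx : 0 <= x <= 1 / 2.
  by split; [apply: Rdiv_le_0_compat; lra|apply/Rle_div_l; lra].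
have HxM : x <= / M by rewrite /x -(Rmult_1_l (/ M)); apply: Rmult_le_compat_r; [apply: Rlt_le; apply: Rinv_0_lt_compat|]; lra.
have Ea : a = M * (1 + x) by rewrite /a /x; field; lra.
have Eaw w : Rcpow a w = (Rcpow M w * Rcpow (1 + x) w)%C by rewrite Ea Rcpow_mult //; lra.
have EM1 : Rcpow M (1 - s) = (M * Rcpow M (- s))%C.
  by rewrite -[(1 - s)%C]/(1 + - s)%C Rcpow_plus Rcpow_1 //; lra.
have EMm : Cmod (Rcpow M (- s)) = 1.
  by rewrite Cmod_Rcpow re_opp Hre Ropp_0 Rmult_0_l exp_0.
set u := Rcpow M (- s) in EM1 EMm *.
(* The remainders of [Zt_asymp] and of the binomial expansions at x = al / M. In the final error
   [e1] is multiplied by M but is of order M^-2; the other contributions are O(1 / M) as they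
   stand. *)
set e0 := (Zt a s - (Rcpow a (1 - s) - (1 - s) / 2 * Rcpow a (- s)))%C.
have He0 : Cmod e0 <= K0 / a := HK0 a Ha.
set e1 := (Rcpow (1 + x) (1 - s) - 1 - (1 - s) * x)%C.
have He1 : Cmod e1 <= K1 * x ^ 2 := HK1 x Hx.
set e2 := (Rcpow (1 + x) (- s) - 1 - (- s) * x)%C.
have He2 : Cmod e2 <= K2 * x ^ 2 := HK2 x Hx.
have HxC : RtoC al = (x * M)%C by rewrite -RtoC_mult /x; congr RtoC; field; lra.
have Hs1' : (s - 1)%C <> RtoC 0.
  by move=> H; apply: Hs1; have -> : (1 - s = - (s - 1))%C by [ring]; rewrite H; ring.
have -> : (Sz al m.+1 s - Rcpow M (1 - s) / (1 - s) - (al - 1 / 2)%R * u - (Sz al m.+1 s + Zt a s / (s - 1)) =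
   u * M * e1 / (1 - s) + - (1 / 2) * u * ((- s) * x + e2) + e0 / (1 - s))%C.
  have -> : Zt a s = (e0 + (Rcpow a (1 - s) - (1 - s) / 2 * Rcpow a (- s)))%C by rewrite /e0; ring.
  rewrite !Eaw EM1 -/u /e1 /e2 RtoC_minus RtoC_div; last lra.
  rewrite HxC; field; split => //; exact: C1_nz.
have Hcs : 0 < Cmod (1 - s) by apply/Cmod_gt_0.
have HM0 : 0 < / M by apply: Rinv_0_lt_compat; lra.
have Hx2 : x ^ 2 <= / M * / M by rewrite /= Rmult_1_r; apply: Rmult_le_compat; lra.
have Hx2' : M * x ^ 2 <= / M.
  apply: (Rle_trans _ (M * (/ M * / M))); first by apply: Rmult_le_compat_l; lra.
  by apply: Req_le; field; lra.
apply: Rle_trans (Cmod_triangle _ _) _.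
apply: Rle_trans (Rplus_le_compat_r _ _ _ (Cmod_triangle _ _)) _.
have -> : K / M = Rabs K1 / Cmod (1 - s) * / M + 1 / 2 * (Cmod s + Rabs K2) * / M + Rabs K0 / Cmod (1 - s) * / M.
  by rewrite /K; field; lra.
apply: Rplus_le_compat; first apply: Rplus_le_compat.
- rewrite Cmod_div // !Cmod_mult EMm Cmod_R Rabs_pos_eq; last lra.
  have -> : Rabs K1 / Cmod (1 - s) * / M = (Rabs K1 * / M) / Cmod (1 - s) by field; lra.
  apply: Rmult_le_compat_r; first by apply: Rlt_le; apply: Rinv_0_lt_compat.
  rewrite Rmult_1_l; apply: (Rle_trans _ (M * (Rabs K1 * x ^ 2))).
    apply: Rmult_le_compat_l; first lra; apply: Rle_trans He1 _.
    by apply: Rmult_le_compat_r; [exact: pow2_ge_0|exact: Rle_abs].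
  have := Rabs_pos K1; nra.
- rewrite !Cmod_mult EMm Cmod_opp Rmult_1_r.
  have -> : Cmod (1 / 2) = 1 / 2 by rewrite -RtoC_div ?Cmod_R ?Rabs_pos_eq; lra.
  rewrite Rmult_assoc; apply: Rmult_le_compat_l; first lra.
  apply: Rle_trans (Cmod_triangle _ _) _; rewrite Cmod_mult Cmod_opp Cmod_R Rabs_pos_eq; last lra.
  have : Cmod s * x <= Cmod s * / M by apply: Rmult_le_compat_l => //; exact: Cmod_ge_0.
  have : K2 * x ^ 2 <= Rabs K2 * / M.
    apply: (Rle_trans _ (Rabs K2 * x ^ 2)); first by apply: Rmult_le_compat_r; [exact: pow2_ge_0|exact: Rle_abs].
    apply: Rmult_le_compat_l; first exact: Rabs_pos.
    apply: Rle_trans Hx2'; have := pow2_ge_0 x; nra.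
  lra.
rewrite Cmod_div //.
have -> : Rabs K0 / Cmod (1 - s) * / M = (Rabs K0 * / M) / Cmod (1 - s) by field; lra.
apply: Rmult_le_compat_r; first by apply: Rlt_le; apply: Rinv_0_lt_compat.
apply: Rle_trans He0 _; apply: (Rle_trans _ (Rabs K0 * / a)).
  by apply: Rmult_le_compat_r; [apply: Rlt_le; apply: Rinv_0_lt_compat; lra|exact: Rle_abs].
apply: Rmult_le_compat_l; first exact: Rabs_pos.
by apply: Rinv_le_contravar; rewrite /a; lra.
Qed.

(** * Distribution relations and the zeta values of the theorem *)

Lemma Sz_split q m s : (0 < q)%nat ->
  \csum_(j < q) Sz (INR j.+1 / INR q) m s = (Rcpow (INR q) s * Sz 1 (m * q) s)%C.
Proof.
move=> Hq; have HQ : 0 < INR q by apply: lt_0_INR; lia.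
rewrite /Sz csum_block csum_switch -csum_scal; apply: csum_ext => n _.
rewrite -csum_scal; apply: csum_ext => j _.
have Hj : 0 < INR (n * q + j) + 1 by have := pos_INR (n * q + j); lra.
have -> : INR (n * q + j) + 1 = INR q * (INR n + INR j.+1 / INR q).
  by rewrite S_INR plus_INR mult_INR; field; lra.
have Hp : 0 < INR n + INR j.+1 / INR q.
  have : 0 < INR j.+1 / INR q by apply: Rdiv_lt_0_compat => //; apply: lt_0_INR; lia.
  have := pos_INR n; lra.
rewrite Rcpow_mult // Cmult_assoc -Rcpow_plus.
have -> : (s + - s = 0)%C by ring.
by rewrite Rcpow_0 Cmult_1_l.
Qed.

(** The distribution relation for zeta(s, j/q), 1 <= j <= q, is read off from the exact identity
    [Sz_split] by comparing the limits along m and along m q; the identity thus holds directly at s,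
    without a detour through Re s > 1. *)
Lemma zlim_split q s (z : nat -> C) z1 : (0 < q)%nat ->
  (forall j, (j < q)%nat -> zlim (INR j.+1 / INR q) s (z j)) -> zlim 1 s z1 ->
  (1 - s)%C <> RtoC 0 -> \csum_(j < q) z j = (Rcpow (INR q) s * z1)%C.
Proof.
move=> Hq Hz H1 Hs; have HQ : 0 < INR q by apply: lt_0_INR; lia.
pose U j m := (Sz (INR j.+1 / INR q) m.+1 s - Rcpow (INR m.+1) (1 - s) / (1 - s)
                 - (INR j.+1 / INR q - 1 / 2)%R * Rcpow (INR m.+1) (- s))%C.
have L1 : Clim (fun m => \csum_(j < q) U j m) (\csum_(j < q) z j).
  have : forall r, (r <= q)%nat -> Clim (fun m => \csum_(j < r) U j m) (\csum_(j < r) z j).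
    elim=> [_|r IH Hr].
      by rewrite csum0; apply: Clim_ext (Clim_const 0) => m; rewrite csum0.
    rewrite csumS; apply: Clim_ext (Clim_plus _ _ _ _ (IH (ltnW Hr)) (Hz r Hr)) => m.
    by rewrite csumS.
  by apply.
have Hphi m : (m <= m * q + q.-1)%nat by nia.
have L2 := Clim_scal (Rcpow (INR q) s) _ _ (Clim_subseq _ _ _ Hphi H1).
apply: Clim_unique L1 _; apply: Clim_ext L2 => m.
have -> : (m * q + q.-1).+1 = (m.+1 * q)%nat by lia.
have HM : 0 < INR m.+1 by apply: lt_0_INR; lia.
rewrite /U !csum_minus Sz_split // csum_const csum_scalr.
have -> : \csum_(j < q) RtoC (INR j.+1 / INR q - 1 / 2) = RtoC (1 / 2).
  rewrite -RtoC_rsum; congr RtoC.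
  rewrite (rsum_ext _ _ (fun j => / INR q * INR j + (/ INR q - 1 / 2))).
    by rewrite rsum_plus rsum_scal rsum_const rsum_INR; field; lra.
  by move=> j _; rewrite S_INR; field; lra.
have Emul w : Rcpow (INR (m.+1 * q)) w = (Rcpow (INR m.+1) w * Rcpow (INR q) w)%C.
  by rewrite mult_INR Rcpow_mult.
have Eq1 : (Rcpow (INR q) s * Rcpow (INR q) (1 - s) = INR q)%C.
  by rewrite -Rcpow_plus; have -> : (s + (1 - s) = 1)%C by [ring]; rewrite Rcpow_1.
have Eq2 : (Rcpow (INR q) s * Rcpow (INR q) (- s) = 1)%C.
  by rewrite -Rcpow_plus; have -> : (s + - s = 0)%C by [ring]; rewrite Rcpow_0.
have -> : 1 - 1 / 2 = 1 / 2 by field.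
rewrite !Emul.
transitivity (Rcpow (INR q) s * Sz 1 (m.+1 * q) s - Rcpow (INR m.+1) (1 - s) * (Rcpow (INR q) s * Rcpow (INR q) (1 - s)) / (1 - s)
   - (1 / 2)%R * Rcpow (INR m.+1) (- s) * (Rcpow (INR q) s * Rcpow (INR q) (- s)))%C; first by field.
by rewrite Eq1 Eq2; field.
Qed.

Lemma zlim_pJ p al k z : (1 < p)%nat -> k <> 0%Z -> zlim al (chi p k) z ->
  Clim (fun J => Sz al (p ^ J.+1) (chi p k) - INR p * Sz al (p ^ J) (chi p k))%C
    ((1 - INR p) * (z - (1 / 2 - al)%R)).
Proof.
move=> Hp Hk Hz; have HP := INR_p_gt1 p Hp; have HL := ln_p_pos p Hp.
have HpJ J : (J < p ^ J)%nat by have := Nat.pow_gt_lin_r p J ltac:(lia); lia.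
have Hphi J : (J <= (p ^ J).-1)%nat by have := HpJ J; lia.
pose U J := (Sz al (p ^ J) (chi p k) - INR (p ^ J) / (1 - chi p k) - (al - 1 / 2)%R)%C.
have L1 : Clim U z.
  apply: Clim_ext (Clim_subseq _ _ _ Hphi Hz) => J.
  have -> : (p ^ J).-1.+1 = (p ^ J)%nat by have := HpJ J; lia.
  have HpJ0 : 0 < INR (p ^ J) by apply: lt_0_INR; have := HpJ J; lia.
  have E : Rcpow (INR (p ^ J)) (- chi p k) = RtoC 1.
    rewrite Rcpow_chi // pow_INR /logb ln_pow; last lra.
    have -> : - (IZR k * (INR J * ln (INR p) / ln (INR p))) = IZR (- (k * Z.of_nat J)).
      rewrite opp_IZR mult_IZR -INR_IZR_INZ; field; lra.
    exact: ee_Z.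
  rewrite -[(1 - chi p k)%C]/(1 + - chi p k)%C Rcpow_plus Rcpow_1 // E /U; rewrite /Cminus /Cdiv; ring.
have L2 : Clim (fun J => U J.+1) z by apply: (Clim_subseq _ _ (fun J => J.+1)) => // n; lia.
have L3 := Clim_plus _ _ _ _ (Clim_minus _ _ _ _ L2 (Clim_scal (INR p) _ _ L1)) (Clim_const ((1 - INR p) * (al - 1 / 2)%R)%C).
have -> : ((1 - INR p) * (z - (1 / 2 - al)%R) = z - INR p * z + (1 - INR p) * (al - 1 / 2)%R)%C.
  by rewrite !RtoC_minus; ring.
apply: Clim_ext L3 => J; rewrite /U.
have -> : RtoC (INR (p ^ J.+1)) = (INR p * INR (p ^ J))%C by rewrite -RtoC_mult -mult_INR.
rewrite /Cdiv; ring.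
Qed.

Lemma Im_chi p k : (1 < p)%nat -> k <> 0%Z -> Im (chi p k) <> 0.
Proof.
move=> Hp Hk H; apply: (chi_neq0 p k Hp Hk).
have := Re_chi p k Hp; case: (chi p k) H => x y /=; rewrite /Re /Im /= => -> ->; by [].
Qed.

Lemma up_eq x (n : Z) : IZR n - 1 <= x < IZR n -> up x = n.
Proof. by move=> H; symmetry; apply: tech_up; lra. Qed.

Lemma zlim_third p k : (1 < p)%nat -> k <> 0%Z -> zlim (1 / 3) (chi p k) (hurwitz_zeta (chi p k) (1 / 3)).
Proof.
move=> Hp Hk; apply: hurwitz_zlim; [lra| |exact: Re_chi|exact: Im_chi].
by rewrite (up_eq _ 0); lra.
Qed.

(** The least positive element of Z - 1/3 is 2/3, which is how the argument -1/3 meets the kinks at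
    2/3. *)
Lemma zlim_two_third p k : (1 < p)%nat -> k <> 0%Z -> zlim (2 / 3) (chi p k) (hurwitz_zeta (chi p k) (- 1 / 3)).
Proof.
move=> Hp Hk; apply: hurwitz_zlim; [lra| |exact: Re_chi|exact: Im_chi].
by rewrite (up_eq _ 1); lra.
Qed.

Lemma zlim_one p k : (1 < p)%nat -> k <> 0%Z -> zlim 1 (chi p k) (riemann_zeta (chi p k)).
Proof.
move=> Hp Hk; apply: hurwitz_zlim; [lra| |exact: Re_chi|exact: Im_chi].
by rewrite (up_eq _ 0); lra.
Qed.

Lemma one_sub_chi p k : (1 < p)%nat -> k <> 0%Z -> (1 - chi p k)%C <> RtoC 0.
Proof.
move=> Hp Hk H; apply: (Im_chi p k Hp Hk); have : Im (1 - chi p k) = 0 by rewrite H.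
rewrite /Cminus im_plus im_opp im_RtoC; lra.
Qed.

Lemma zeta_thirds p k : (1 < p)%nat -> k <> 0%Z ->
  (hurwitz_zeta (chi p k) (1 / 3) + hurwitz_zeta (chi p k) (- 1 / 3) =
   (Rcpow 3 (chi p k) - 1) * riemann_zeta (chi p k))%C.
Proof.
move=> Hp Hk.
have := zlim_split 3 (chi p k) (fun j => if j is 0%nat then hurwitz_zeta (chi p k) (1 / 3) else
   if j is 1%nat then hurwitz_zeta (chi p k) (- 1 / 3) else riemann_zeta (chi p k)) (riemann_zeta (chi p k)) isT _ (zlim_one p k Hp Hk) (one_sub_chi p k Hp Hk).
rewrite !csumS csum0 Cplus_0_l.
have -> : INR 3 = 3 by rewrite /=; ring.
move=> H; have {}H := H _; rewrite Cmult_plus_distr_r -H; first by ring.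
case=> [|[|[|j]]] // _.
- by have -> : INR 1 / 3 = 1 / 3 by []; exact: zlim_third.
- have -> : INR 2 / 3 = 2 / 3 by rewrite /=; field.
  exact: zlim_two_third.
- have -> : INR 3 / 3 = 1 by rewrite /=; field.
  exact: zlim_one.
Qed.

Lemma zlim_half p k : (1 < p)%nat -> k <> 0%Z ->
  zlim (1 / 2) (chi p k) ((Rcpow 2 (chi p k) - 1) * riemann_zeta (chi p k)).
Proof.
move=> Hp Hk.
have H1 := hurwitz_zlim (1 / 2) (1 / 2) (chi p k) ltac:(lra) ltac:(rewrite (up_eq _ 0); lra) (Re_chi p k Hp) (Im_chi p k Hp Hk).
have := zlim_split 2 (chi p k) (fun j => if j is 0%nat then hurwitz_zeta (chi p k) (1 / 2) else riemann_zeta (chi p k))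
   (riemann_zeta (chi p k)) isT _ (zlim_one p k Hp Hk) (one_sub_chi p k Hp Hk).
rewrite !csumS csum0 Cplus_0_l.
have -> : INR 2 = 2 by rewrite /=; ring.
move=> H; have {}H := H _.
have -> : ((Rcpow 2 (chi p k) - 1) * riemann_zeta (chi p k) = hurwitz_zeta (chi p k) (1 / 2))%C; last exact: H1.
rewrite Cmult_plus_distr_r -H; first by ring.
case=> [|[|j]] // _.
have -> : INR 2 / 2 = 1 by rewrite /=; field.
exact: zlim_one.
Qed.

(** * The Gamma function *)

Definition Gf (x t : R) : R := Rpower t (x - 1) * exp (- t).

Definition igen (f : R -> R) (l : R) : Prop :=
  is_RInt_gen f (at_right 0) (Rbar_locally p_infty) l.

Lemma igen_intro (f : R -> R) (l : R) :
  (forall e, 0 < e -> exists a0 b0, 0 < a0 /\ 0 < b0 /\ forall a b, 0 < a < a0 -> b0 < b ->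
     exists y, is_RInt f a b y /\ Rabs (y - l) < e) -> igen f l.
Proof.
move=> H P [e He]; have [a0 [b0 [Ha0 [Hb0 Hab]]]] := H e (cond_pos e).
apply: (Filter_prod _ _ _ (fun a => 0 < a < a0) (fun b => b0 < b)).
- exists (mkposreal a0 Ha0) => y Hy Hy0; split=> //.
  by move: Hy; rewrite /ball /= /AbsRing_ball /abs /minus /plus /opp /= => /Rabs_def2; lra.
- by exists b0.
move=> a b Ha Hb; have [y [Hy Hye]] := Hab a b Ha Hb.
by exists y; split=> //; apply: He.
Qed.

Lemma igen_elim (f : R -> R) (l : R) : igen f l ->
  forall e, 0 < e -> exists a0 b0, 0 < a0 /\ 0 < b0 /\ forall a b, 0 < a < a0 -> b0 < b ->
     exists y, is_RInt f a b y /\ Rabs (y - l) < e.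
Proof.
move=> H e He.
have [Q W HQ HW HQW] := H _ (locally_ball l (mkposreal e He)).
case: HQ => d Hd; case: HW => M HM.
exists d, (Rmax M 1); split; first exact: cond_pos.
split; first by apply: Rlt_le_trans (Rmax_r _ _); lra.
move=> a b Ha Hb.
have Qa : Q a.
  apply: Hd; last lra.
  by rewrite /ball /= /AbsRing_ball /abs /minus /plus /opp /=; apply: Rabs_def1; lra.
have Wb : W b by apply: HM; apply: Rle_lt_trans (Rmax_l _ _) Hb.
by have [y [Hy1 Hy2]] := HQW a b Qa Wb; exists y.
Qed.

Lemma igen_unique f l l' : igen f l -> igen f l' -> l = l'.
Proof.
by move=> H H'; rewrite -(is_RInt_gen_unique _ _ H) -(is_RInt_gen_unique _ _ H').
Qed.

Lemma igen_scal f k l : igen f l -> igen (fun t => k * f t) (k * l).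
Proof. exact: (is_RInt_gen_scal (Fa := at_right 0) (Fb := Rbar_locally p_infty) f k l). Qed.

Lemma igen_plus f g l l' : igen f l -> igen g l' -> igen (fun t => f t + g t) (l + l').
Proof. exact: (is_RInt_gen_plus (Fa := at_right 0) (Fb := Rbar_locally p_infty) f g l l'). Qed.

Lemma igen_ext f g l : (forall t, f t = g t) -> igen f l -> igen g l.
Proof.
move=> H; apply: is_RInt_gen_ext; exists (fun=> True) (fun=> True); try exact: filter_true.
by move=> a b _ _ t _.
Qed.

Lemma igen_le f g l l' : (forall t, 0 < t -> f t <= g t) -> igen f l -> igen g l' -> l <= l'.
Proof.
move=> Hfg Hf Hg; apply: le_epsilon => e He.
have [a1 [b1 [Ha1 [Hb1 H1]]]] := igen_elim f l Hf (e / 2) ltac:(lra).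
have [a2 [b2 [Ha2 [Hb2 H2]]]] := igen_elim g l' Hg (e / 2) ltac:(lra).
set a := Rmin a1 a2 / 2; set b := Rmax (Rmax b1 b2) a + 1.
have Ha : 0 < Rmin a1 a2 by apply: Rmin_pos.
have Hm1 := Rmin_l a1 a2; have Hm2 := Rmin_r a1 a2.
have Hm3 := Rmax_l b1 b2; have Hm4 := Rmax_r b1 b2.
have Hm5 := Rmax_l (Rmax b1 b2) a; have Hm6 := Rmax_r (Rmax b1 b2) a.
have Hb1' : b1 < b by rewrite /b; lra.
have Hb2' : b2 < b by rewrite /b; lra.
have Hab : a <= b by rewrite /b; lra.
have [y1 [Hy1 Hd1]] := H1 a b ltac:(rewrite /a; lra) Hb1'.
have [y2 [Hy2 Hd2]] := H2 a b ltac:(rewrite /a; lra) Hb2'.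
have Hy : y1 <= y2.
  by apply: is_RInt_le Hab Hy1 Hy2 _ => t Ht; apply: Hfg; rewrite /a in Ht; lra.
move/Rabs_def2: Hd1; move/Rabs_def2: Hd2; lra.
Qed.

Lemma Gf_pos x t : 0 < Gf x t.
Proof. by apply: Rmult_lt_0_compat; exact: exp_pos. Qed.

Lemma Gf_continuous x t : 0 < t -> continuous (Gf x) t.
Proof.
move=> Ht; apply: (ex_derive_continuous (Gf x) t).
by rewrite /Gf /Rpower; auto_derive.
Qed.

Lemma Gf_ex_RInt x a b : 0 < a -> 0 < b -> ex_RInt (Gf x) a b.
Proof.
move=> Ha Hb; apply: ex_RInt_continuous => t Ht; apply: Gf_continuous.
by have : 0 < Rmin a b by [apply: Rmin_pos]; lra.
Qed.

Lemma Rpower_le_1p t x : 0 < t -> 0 <= x <= 1 -> Rpower t x <= 1 + t.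
Proof.
move=> Ht Hx; rewrite /Rpower; have [Ht1|Ht1] : t <= 1 \/ 1 < t by lra.
  have : exp (x * ln t) <= 1; last lra.
  rewrite -exp_0; apply: exp_mono; have : ln t <= 0 by rewrite -ln_1; apply: ln_le.
  nra.
have : exp (x * ln t) <= t; last lra.
rewrite -[X in _ <= X](exp_ln t) //; apply: exp_mono.
have : 0 <= ln t by rewrite -ln_1; apply: ln_le; lra.
nra.
Qed.

(** [F] is an antiderivative of a majorant: the derivative of t^x e^(-t) / x is [Gf x] minus t^x
    e^(-t) / x, and the second summand of [F] contributes (1 + t) e^(-t) / x, which compensates the
    loss because t^x <= 1 + t. *)
Lemma Gf_bound x a b : 0 < x <= 1 -> 0 < a -> a <= b -> RInt (Gf x) a b <= 3 / x.
Proof.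
move=> Hx Ha Hab.
pose F t := Rpower t x * exp (- t) / x - (2 + t) * exp (- t) / x.
pose F' t := Gf x t + (1 + t - Rpower t x) * exp (- t) / x.
have HF t : 0 < t -> is_derive F t (F' t).
  move=> Ht; rewrite /F /F' /Gf /Rpower; auto_derive; first done.
  have -> : exp (x * ln t) = exp ((x - 1) * ln t) * t.
    by rewrite -{3}(exp_ln t) // -exp_plus; congr exp; ring.
  by field; lra.
have Hmin : 0 < Rmin a b by apply: Rmin_pos; lra.
have HI : is_RInt F' a b (F b - F a).
  apply: is_RInt_derive => t Ht; first by apply: HF; lra.
  apply: (ex_derive_continuous F' t).
  rewrite /F' /Gf /Rpower; auto_derive; lra.
apply: (Rle_trans _ (F b - F a)).
  apply: (is_RInt_le (Gf x) F' a b) Hab (RInt_correct _ _ _ (Gf_ex_RInt x a b Ha ltac:(lra))) HI _ => t Ht.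
  have := Rpower_le_1p t x ltac:(lra) ltac:(lra); rewrite /F' => H.
  have : 0 <= (1 + t - Rpower t x) * exp (- t) / x; last lra.
  apply: Rdiv_le_0_compat; last lra.
  by apply: Rmult_le_pos; [lra|apply: Rlt_le; exact: exp_pos].
have E t : F t = (Rpower t x * exp (- t) - (2 + t) * exp (- t)) / x by rewrite /F; field; lra.
rewrite !E.
have Hb0 := exp_pos (- b); have Ha0 := exp_pos (- a).
have H1 := Rpower_le_1p b x ltac:(lra) ltac:(lra).
have H2 : 0 < Rpower a x by exact: exp_pos.
have H3 : (2 + a) * exp (- a) <= 2.
  have := exp_ineq1_le a; have := exp_plus a (- a); rewrite Rplus_opp_r exp_0.
  nra.
have -> : (Rpower b x * exp (- b) - (2 + b) * exp (- b)) / x - (Rpower a x * exp (- a) - (2 + a) * exp (- a)) / x =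
   (Rpower b x * exp (- b) - (2 + b) * exp (- b) - (Rpower a x * exp (- a) - (2 + a) * exp (- a))) / x by field; lra.
apply: Rmult_le_compat_r; first by apply: Rlt_le; apply: Rinv_0_lt_compat; lra.
nra.
Qed.

(** The integrand is positive, so the supremum over compact intervals is the improper integral. *)
Lemma igen_Gf_small x : 0 < x <= 1 -> exists l, igen (Gf x) l.
Proof.
move=> Hx.
pose E y := exists a b, 0 < a /\ a <= b /\ y = RInt (Gf x) a b.
have HE : bound E by exists (3 / x) => y [a [b [Ha [Hab ->]]]]; apply: Gf_bound.
have HE0 : exists y, E y by exists (RInt (Gf x) 1 2), 1, 2; split; [lra|split; [lra|]].
have [l [Hl1 Hl2]] := completeness E HE HE0.
exists l; apply: igen_intro => e He.
have [y [Hy Hye]] : exists y, E y /\ l - e < y.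
  apply: NNPP => H; have : is_upper_bound E (l - e).
    by move=> y Hy; apply: Rnot_lt_le => H1; apply: H; exists y.
  move=> /Hl2; lra.
case: Hy => a0 [b0 [Ha0 [Hab0 Ey]]].
exists a0, b0; split=> //; split; first lra.
move=> a b Ha Hb; exists (RInt (Gf x) a b).
have X u v : 0 < u -> 0 < v -> ex_RInt (Gf x) u v by apply: Gf_ex_RInt.
split; first by apply: RInt_correct; apply: X; lra.
have P u v : 0 < u -> u <= v -> 0 <= RInt (Gf x) u v.
  by move=> Hu Huv; apply: RInt_ge_0 => //; [apply: X; lra|move=> t _; apply: Rlt_le; exact: Gf_pos].
have C1 := RInt_Chasles (Gf x) a a0 b (X a a0 ltac:(lra) ltac:(lra)) (X a0 b ltac:(lra) ltac:(lra)).
have C2 := RInt_Chasles (Gf x) a0 b0 b (X a0 b0 ltac:(lra) ltac:(lra)) (X b0 b ltac:(lra) ltac:(lra)).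
rewrite /plus /= in C1 C2.
have P1 := P a a0 ltac:(lra) ltac:(lra); have P2 := P b0 b ltac:(lra) ltac:(lra).
have U : RInt (Gf x) a b <= l by apply: Hl1; exists a, b; split; [lra|split; [lra|]].
apply: Rabs_def1; lra.
Qed.

Lemma pow_exp_bound n t : 0 <= t -> t ^ n / INR (fact n) <= exp t.
Proof.
move=> Ht; have Hp i : 0 <= t ^ i / INR (fact i).
  by apply: Rdiv_le_0_compat; [apply: pow_le|exact: INR_fact_lt_0].
have := rsum_le_Series _ n.+1 Hp (ex_intro _ _ (is_series_exp t)).
rewrite (is_series_unique _ _ (is_series_exp t)) rsumS.
have := rsum_ge0 n _ (fun i _ => Hp i); lra.
Qed.

Lemma Gf_bdry0 x e : 0 < x -> 0 < e -> exists d, 0 < d /\ forall t, 0 < t < d -> Rpower t x * exp (- t) < e.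
Proof.
move=> Hx He; exists (exp (ln e / x)); split; first exact: exp_pos.
move=> t Ht; apply: (Rle_lt_trans _ (Rpower t x)).
  rewrite -{2}(Rmult_1_r (Rpower t x)); apply: Rmult_le_compat_l; first by apply: Rlt_le; exact: exp_pos.
  by rewrite -exp_0; apply: exp_mono; lra.
rewrite /Rpower -(exp_ln e) //; apply: exp_increasing.
have : ln t < ln e / x by rewrite -(ln_exp (ln e / x)); apply: ln_increasing; lra.
move=> H; have := Rmult_lt_compat_l x _ _ Hx H.
by have -> : x * (ln e / x) = ln e by field; lra.
Qed.

(** The exponential series gives e^t >= t^(n+2) / (n+2)!, one power more than t^(n+1) >= t^x, so a
    factor 1 / t remains. *)
Lemma Gf_bdry_infty x e : 0 < x -> 0 < e -> exists B, 0 < B /\ forall t, B < t -> Rpower t x * exp (- t) < e.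
Proof.
move=> Hx He; have [n Hn] := nfloor_ex x ltac:(lra).
pose k := n.+2; pose Fk := INR (fact k).
have HFk : 0 < Fk by exact: INR_fact_lt_0.
exists (Rmax 1 (Fk / e)); split; first by apply: Rlt_le_trans (Rmax_l _ _); lra.
move=> t Ht; have Ht1 : 1 < t by apply: Rle_lt_trans (Rmax_l _ _) Ht.
have Ht2 : Fk / e < t by apply: Rle_lt_trans (Rmax_r _ _) Ht.
have H1 : Rpower t x <= t ^ n.+1.
  rewrite -Rpower_pow; last lra.
  apply: Rle_Rpower; first lra.
  by rewrite S_INR; lra.
have H2 := pow_exp_bound k t ltac:(lra).
have Htn : 0 < t ^ n.+1 by apply: pow_lt; lra.
have H3 : t ^ n.+1 * exp (- t) <= Fk / t.
  rewrite exp_Ropp; apply: (Rle_trans _ (t ^ n.+1 * / (t ^ k / Fk))).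
    apply: Rmult_le_compat_l; first lra.
    apply: Rinv_le_contravar => //; apply: Rdiv_lt_0_compat => //; apply: pow_lt; lra.
  apply: Req_le; rewrite /k [t ^ n.+2]/= -/(t ^ n.+1); field; lra.
have H4 : Fk / t < e.
  apply/Rlt_div_l; first lra.
  move/Rlt_div_l: Ht2 => /(_ He); lra.
have : Rpower t x * exp (- t) <= t ^ n.+1 * exp (- t).
  by apply: Rmult_le_compat_r => //; apply: Rlt_le; exact: exp_pos.
lra.
Qed.

(** The integrand is the derivative of -t^x e^(-t), which tends to 0 at both ends; this is the
    integration by parts behind the functional equation. *)
Lemma igen_boundary x : 0 < x -> igen (fun t => Gf (x + 1) t - x * Gf x t) 0.
Proof.
move=> Hx; apply: igen_intro => e He.
have [d [Hd Hd']] := Gf_bdry0 x (e / 2) Hx ltac:(lra).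
have [B [HB HB']] := Gf_bdry_infty x (e / 2) Hx ltac:(lra).
exists d, B; split=> //; split=> // a b Ha Hb.
pose F t := - (Rpower t x * exp (- t)).
exists (F b - F a); split.
  have Hmin : 0 < Rmin a b by apply: Rmin_pos; lra.
  apply: (is_RInt_derive F) => t Ht.
    rewrite /F /Gf /Rpower; auto_derive; first lra.
    have -> : exp (x * ln t) = exp ((x - 1) * ln t) * t.
      by rewrite -{3}(exp_ln t); [rewrite -exp_plus; congr exp; ring|lra].
    have -> : exp ((x + 1 - 1) * ln t) = exp ((x - 1) * ln t) * t.
      by rewrite -{3}(exp_ln t); [rewrite -exp_plus; congr exp; ring|lra].
    by field; lra.
  apply: (ex_derive_continuous (fun t => Gf (x + 1) t - x * Gf x t) t).
  rewrite /Gf /Rpower; auto_derive; lra.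
have H1 := Hd' a Ha; have H2 := HB' b Hb.
have P1 : 0 < Rpower a x * exp (- a) by apply: Rmult_lt_0_compat; exact: exp_pos.
have P2 : 0 < Rpower b x * exp (- b) by apply: Rmult_lt_0_compat; exact: exp_pos.
by apply: Rabs_def1; rewrite /F; lra.
Qed.

Lemma igen_Gf_succ x l : 0 < x -> igen (Gf x) l -> igen (Gf (x + 1)) (x * l).
Proof.
move=> Hx Hl.
have := igen_plus _ _ _ _ (igen_boundary x Hx) (igen_scal _ x _ Hl).
by rewrite Rplus_0_l; apply: igen_ext => t; ring.
Qed.

(** Convergence beyond (0, 1] comes from the functional equation, one unit at a time. *)
Lemma igen_Gamma x : 0 < x -> igen (Gf x) (Gamma x).
Proof.
move=> Hx; suff [l Hl] : exists l, igen (Gf x) l.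
  by have -> : Gamma x = l by exact: (is_RInt_gen_unique _ _ Hl).
have H n : forall y, 0 < y <= INR n.+1 -> exists l, igen (Gf y) l.
  elim: n => [|n IH] y Hy; first by apply: igen_Gf_small.
  have [Hy1|Hy1] : y <= 1 \/ 1 < y by lra.
    by apply: igen_Gf_small; lra.
  have [l Hl] := IH (y - 1) ltac:(rewrite S_INR in Hy; lra).
  by exists ((y - 1) * l); have := igen_Gf_succ (y - 1) l ltac:(lra) Hl; have -> : y - 1 + 1 = y by ring.
have [n Hn] := nfloor_ex x ltac:(lra).
by apply: (H n); rewrite S_INR; lra.
Qed.

Lemma Gamma_succ x : 0 < x -> Gamma (x + 1) = x * Gamma x.
Proof.
move=> Hx; apply: igen_unique (igen_Gamma (x + 1) ltac:(lra)) _.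
exact: igen_Gf_succ (igen_Gamma x Hx).
Qed.

Lemma Gamma_pos x : 0 < x -> 0 < Gamma x.
Proof.
move=> Hx; have HG := igen_Gamma x Hx.
have c0 : 0 < RInt (Gf x) 1 2.
  apply: RInt_gt_0; first lra; first by move=> t _; exact: Gf_pos.
  by move=> t Ht; apply: Gf_continuous; lra.
have [a1 [b1 [Ha1 [Hb1 H1]]]] := igen_elim _ _ HG (RInt (Gf x) 1 2) c0.
set a := Rmin a1 1 / 2; set b := Rmax b1 2 + 1.
have Ha : 0 < Rmin a1 1 by apply: Rmin_pos; lra.
have Hm1 := Rmin_l a1 1; have Hm2 := Rmin_r a1 1.
have Hm3 := Rmax_l b1 2; have Hm4 := Rmax_r b1 2.
have [y [Hy Hd]] := H1 a b ltac:(rewrite /a; lra) ltac:(rewrite /b; lra).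
have X u v : 0 < u -> 0 < v -> ex_RInt (Gf x) u v by apply: Gf_ex_RInt.
have P u v : 0 < u -> u <= v -> 0 <= RInt (Gf x) u v.
  by move=> Hu Huv; apply: RInt_ge_0 => //; [apply: X; lra|move=> t _; apply: Rlt_le; exact: Gf_pos].
have Ha0 : 0 < a by rewrite /a; lra.
have Hb0 : 2 < b by rewrite /b; lra.
have Ha2 : a < 1 by rewrite /a; lra.
have C1 := RInt_Chasles (Gf x) a 1 b (X a 1 ltac:(lra) ltac:(lra)) (X 1 b ltac:(lra) ltac:(lra)).
have C2 := RInt_Chasles (Gf x) 1 2 b (X 1 2 ltac:(lra) ltac:(lra)) (X 2 b ltac:(lra) ltac:(lra)).
rewrite /plus /= in C1 C2.
have P1 := P a 1 ltac:(lra) ltac:(lra); have P2 := P 2 b ltac:(lra) ltac:(lra).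
move: Hd; rewrite -(is_RInt_unique _ _ _ _ Hy) => /Rabs_def2; lra.
Qed.

(* The weighted AM-GM inequality [(t/x)^s <= 1 - s + s t/x] replaces log-convexity. *)

Lemma Gamma_Wendel x s : 0 < x -> 0 <= s <= 1 -> Gamma (x + s) <= Rpower x s * Gamma x.
Proof.
move=> Hx Hs; have Hx1 : 0 < x + 1 by lra.
have H1 := igen_scal _ (Rpower x s * (1 - s)) _ (igen_Gamma x Hx).
have H2 := igen_scal _ (Rpower x s * (s / x)) _ (igen_Gamma (x + 1) Hx1).
have H3 := igen_plus _ _ _ _ H1 H2.
apply: (Rle_trans _ (Rpower x s * (1 - s) * Gamma x + Rpower x s * (s / x) * Gamma (x + 1))); last first.
  by rewrite Gamma_succ //; apply: Req_le; field; lra.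
apply: igen_le (igen_Gamma (x + s) ltac:(lra)) H3 => t Ht.
rewrite /Gf.
have Et z : Rpower t (z + 1 - 1) = t * Rpower t (z - 1).
  by have -> : z + 1 - 1 = 1 + (z - 1) by [ring]; rewrite Rpower_plus Rpower_1.
have -> : Rpower t (x + s - 1) = Rpower t s * Rpower t (x - 1).
  by rewrite -Rpower_plus; congr Rpower; ring.
rewrite Et.
set w := Rpower t (x - 1) * exp (- t).
have Hw : 0 < w by apply: Rmult_lt_0_compat; exact: exp_pos.
have -> : Rpower t s * Rpower t (x - 1) * exp (- t) = Rpower t s * w by rewrite /w; ring.
have -> : Rpower x s * (1 - s) * w + Rpower x s * (s / x) * (t * Rpower t (x - 1) * exp (- t)) =
  (Rpower x s * ((1 - s) + s * (t / x))) * w by rewrite /w; field; lra.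
apply: Rmult_le_compat_r; first lra.
set y := ln (t / x).
have Htx : 0 < t / x by apply: Rdiv_lt_0_compat.
have Ey : exp y = t / x by rewrite /y exp_ln.
have Ets : Rpower t s = Rpower x s * exp (s * y).
  rewrite /Rpower -exp_plus /y ln_div //; congr exp; ring.
rewrite Ets -Ey; apply: Rmult_le_compat_l; first by apply: Rlt_le; exact: exp_pos.
(* Two instances of e^z >= 1 + z, at (1 - s) y with weight s and at -s y with weight 1 - s: the
   linear terms cancel. *)
have A1 := exp_ineq1_le ((1 - s) * y); have A2 := exp_ineq1_le (- (s * y)).
have A3 : 1 <= (1 - s) * exp (- (s * y)) + s * exp ((1 - s) * y) by nra.
have A4 := exp_pos (s * y).
have E1 : exp (s * y) * exp (- (s * y)) = 1 by rewrite -exp_plus Rplus_opp_r exp_0.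
have E2 : exp (s * y) * exp ((1 - s) * y) = exp y by rewrite -exp_plus; congr exp; ring.
have -> : 1 - s + s * exp y = exp (s * y) * ((1 - s) * exp (- (s * y)) + s * exp ((1 - s) * y)).
  transitivity ((1 - s) * (exp (s * y) * exp (- (s * y))) + s * (exp (s * y) * exp ((1 - s) * y))); last by ring.
  by rewrite E1 E2; ring.
rewrite -{1}(Rmult_1_r (exp (s * y))); apply: Rmult_le_compat_l; lra.
Qed.

Lemma ln_Gamma_Lam al m : 0 < al -> ln (Gamma (INR m + al)) = ln (Gamma al) + Lam al m.
Proof.
move=> Hal; elim: m => [|m IH]; first by rewrite /Lam rsum0 /= Rplus_0_l; ring.
have Hm := pos_INR m.
rewrite /Lam rsumS -/(Lam al m) S_INR.
have -> : INR m + 1 + al = (INR m + al) + 1 by ring.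
by rewrite Gamma_succ ?ln_mult ?IH; [ring|..]; try lra; apply: Gamma_pos; lra.
Qed.

Lemma ln_shift_lim c d : 0 < c -> 0 < d -> is_lim_seq (fun m => ln (INR m + c) - ln (INR m + d)) 0.
Proof.
suff H a b : 0 < a -> a <= b -> is_lim_seq (fun m => ln (INR m + b) - ln (INR m + a)) 0.
  move=> Hc Hd; have [Hcd|Hcd] : c <= d \/ d <= c by lra.
    apply/is_lim_seq_abs_0; apply: is_lim_seq_ext (proj1 (is_lim_seq_abs_0 _) (H c d Hc Hcd)) => m.
    exact: Rabs_minus_sym.
  exact: H.
move=> Ha Hab; apply/(is_lim_seq_incr_1 (fun m => ln (INR m + b) - ln (INR m + a))).
apply: is_lim_seq_squeeze0 (is_lim_seq_inv_S (b - a)) => m.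
have HM : 0 < INR m.+1 by apply: lt_0_INR; lia.
set M := INR m.+1 in HM *.
split; first by have := ln_le (M + a) (M + b) ltac:(lra) ltac:(lra); lra.
rewrite -ln_div; [|lra|lra].
have -> : (M + b) / (M + a) = 1 + (b - a) / (M + a) by field; lra.
have H0 : 0 <= (b - a) / (M + a) by apply: Rdiv_le_0_compat; lra.
have H1 : ln (1 + (b - a) / (M + a)) <= (b - a) / (M + a).
  rewrite -[X in _ <= X]ln_exp; apply: ln_le; first lra.
  exact: exp_ineq1_le.
apply: Rle_trans H1 _; apply: Rmult_le_compat_l; first lra.
by apply: Rinv_le_contravar; lra.
Qed.

(** [Lam] is a difference of values of ln Gamma, so the claim amounts to ln Gamma(x + s) - ln
    Gamma(x) - s ln x -> 0. Wendel's inequality gives the upper bound from x to x + s and the lower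
    bound from x + s to x + 1. *)
Lemma wst_Gamma al s kap kap' : 0 < al -> 0 < s < 1 ->
  is_lim_seq (wst al) (Finite kap) -> is_lim_seq (wst (al + s)) (Finite kap') ->
  kap' - kap = ln (Gamma al / Gamma (al + s)).
Proof.
move=> Hal Hs Hk Hk'.
have HG1 := Gamma_pos al Hal; have HG2 := Gamma_pos (al + s) ltac:(lra).
pose u m := ln (Gamma (INR m + al + s)) - ln (Gamma (INR m + al)) - s * ln (INR m + al).
have Hu m : Rabs (u m) <= (1 - s) * (ln (INR m + (al + s)) - ln (INR m + al)).
  have Hm := pos_INR m; set x := INR m + al; have Hx : 0 < x by rewrite /x; lra.
  have W1 := Gamma_Wendel x s Hx ltac:(lra).
  have W2 := Gamma_Wendel (x + s) (1 - s) ltac:(lra) ltac:(lra).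
  have Ex : x + s + (1 - s) = x + 1 by ring.
  rewrite Ex Gamma_succ // in W2.
  have P1 := Gamma_pos x Hx; have P2 := Gamma_pos (x + s) ltac:(lra).
  have R1 : 0 < Rpower x s by exact: exp_pos.
  have R2 : 0 < Rpower (x + s) (1 - s) by exact: exp_pos.
  have L1 := ln_le _ _ P2 W1.
  have L2 := ln_le _ _ (Rmult_lt_0_compat _ _ Hx P1) W2.
  rewrite ln_mult // in L1; rewrite !ln_mult // in L2.
  rewrite /Rpower !ln_exp in L1 L2.
  have L3 : ln x <= ln (x + s) by apply: ln_le; lra.
  rewrite /u -/x; have -> : INR m + (al + s) = x + s by rewrite /x; ring.
  by apply: Rabs_le; nra.
have Lu : is_lim_seq u 0.
  apply/is_lim_seq_abs_0; apply: is_lim_seq_squeeze0 (_ : is_lim_seq (fun m => (1 - s) * (ln (INR m + (al + s)) - ln (INR m + al))) 0).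
    by move=> m; split; [exact: Rabs_pos|exact: Hu].
  have := is_lim_seq_scal_l _ (1 - s) _ (ln_shift_lim (al + s) al ltac:(lra) Hal).
  by rewrite /= Rmult_0_r.
have Hinc (v : nat -> R) (l : R) : is_lim_seq v l -> is_lim_seq (fun m => v m.+1) l.
  by move/is_lim_seq_incr_1.
have L2 : is_lim_seq (fun m => s * (ln (INR m.+1 + al) - ln (INR m.+1))) 0.
  have := is_lim_seq_scal_l _ s _ (ln_shift_lim (1 + al) 1 ltac:(lra) ltac:(lra)).
  rewrite /= Rmult_0_r; apply: is_lim_seq_ext => m; rewrite -/(INR m.+1) S_INR; congr (_ * (ln _ - _)); ring.
have L3 := is_lim_seq_minus' _ _ _ _ (Hinc _ _ Hk') (Hinc _ _ Hk).
have L4 : is_lim_seq (fun m => wst (al + s) m.+1 - wst al m.+1) (ln (Gamma al / Gamma (al + s))).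
  have L5 := is_lim_seq_plus' _ _ _ _ (is_lim_seq_plus' _ _ _ _ (Hinc _ _ Lu) L2) (is_lim_seq_const (ln (Gamma al / Gamma (al + s)))).
  rewrite Rplus_0_r Rplus_0_l in L5.
  apply: is_lim_seq_ext L5 => m.
  have E1 := ln_Gamma_Lam al m.+1 Hal; have E2 := ln_Gamma_Lam (al + s) m.+1 ltac:(lra).
  rewrite -Rplus_assoc in E2.
  rewrite /u /wst E1 E2 ln_div //; ring.
have := is_lim_seq_unique _ _ L4; rewrite (is_lim_seq_unique _ _ L3); by case.
Qed.

(** * The valuation of the number of alternating sign matrices *)

(** The contribution of m = p^k in Legendre's formula. Since subtraction is truncated, it is
    supported on the middle third of the residues mod m, with its peak near m / 2. *)
Definition tent (m N : nat) : nat :=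
  minn (N %% m - (m + 1) %/ 3) (m - N %% m - (m + 1) %/ 3).

(** A discrete derivative in r: the slope changes where 3 r + 1 passes m and 2 m and where 2 r and 2
    r + 1 pass m. *)
Lemma tent_step m r : (r < m)%nat ->
  ((3 * r + 1) %/ m + minn (r - (m + 1) %/ 3) (m - r - (m + 1) %/ 3) =
   (2 * r) %/ m + (2 * r + 1) %/ m + minn (r.+1 - (m + 1) %/ 3) (m - r.+1 - (m + 1) %/ 3))%nat.
Proof.
move=> Hr.
have D x q : (q * m <= x)%nat -> (x < q.+1 * m)%nat -> (x %/ m = q)%nat.
  move=> H1 H2; apply/eqP; rewrite eqn_leq leq_divRL ?H1 ?andbT; last by lia.
  by rewrite -ltnS ltn_divLR //; lia.
have D1 : ((3 * r + 1) %/ m = if (3 * r + 1 < m)%nat then 0 else if (3 * r + 1 < 2 * m)%nat then 1 else 2)%nat.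
  by case: ltnP => H1; [apply: D; lia|case: ltnP => H2; apply: D; lia].
have D2 : ((2 * r) %/ m = if (2 * r < m)%nat then 0 else 1)%nat.
  by case: ltnP => H1; apply: D; lia.
have D3 : ((2 * r + 1) %/ m = if (2 * r + 1 < m)%nat then 0 else 1)%nat.
  by case: ltnP => H1; apply: D; lia.
have [c [Hc Ec]] : exists c, ((m + 1) %/ 3 = c)%nat /\ (3 * c <= m + 1 < 3 * c + 3)%nat.
  by exists ((m + 1) %/ 3)%nat; split=> //; lia.
rewrite D1 D2 D3 Hc {D D1 D2 D3 Hc}.
case: (ltnP (3 * r + 1)) => H1.
  have [-> ->] : (minn (r - c) (m - r - c) = 0 /\ minn (r.+1 - c) (m - r.+1 - c) = 0)%nat by split; lia.
  by rewrite !ifT; lia.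
case: (ltnP (3 * r + 1)) => H2; last first.
  have [-> ->] : (minn (r - c) (m - r - c) = 0 /\ minn (r.+1 - c) (m - r.+1 - c) = 0)%nat by split; lia.
  by rewrite !ifN; lia.
case: (ltnP (2 * r)) => H3; last first.
  have [-> ->] : (minn (r - c) (m - r - c) = m - r - c /\ minn (r.+1 - c) (m - r.+1 - c) = m - r.+1 - c)%nat by split; lia.
  by rewrite ifN; lia.
have -> : (minn (r - c) (m - r - c) = r - c)%nat by lia.
case: ltnP => H4.
  have -> : (minn (r.+1 - c) (m - r.+1 - c) = r.+1 - c)%nat by lia.
  by lia.
have -> : (minn (r.+1 - c) (m - r.+1 - c) = m - r.+1 - c)%nat by lia.
by lia.
Qed.

Lemma tent_succ m N : (0 < m)%nat ->
  ((3 * N + 1) %/ m + N %/ m + tent m N = (2 * N) %/ m + (2 * N + 1) %/ m + tent m N.+1)%nat.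
Proof.
move=> Hm; set q := (N %/ m)%nat; set r := (N %% m)%nat.
have Hr : (r < m)%nat by rewrite ltn_mod.
have EN : (N = q * m + r)%nat by apply: divn_eq.
have -> : ((3 * N + 1) %/ m = 3 * q + (3 * r + 1) %/ m)%nat by rewrite -divnMDl //; congr (_ %/ _)%nat; lia.
have -> : ((2 * N) %/ m = 2 * q + (2 * r) %/ m)%nat by rewrite -divnMDl //; congr (_ %/ _)%nat; lia.
have -> : ((2 * N + 1) %/ m = 2 * q + (2 * r + 1) %/ m)%nat by rewrite -divnMDl //; congr (_ %/ _)%nat; lia.
have := tent_step m r Hr.
have -> : tent m N = minn (r - (m + 1) %/ 3) (m - r - (m + 1) %/ 3) by [].
have -> : tent m N.+1 = minn (r.+1 - (m + 1) %/ 3) (m - r.+1 - (m + 1) %/ 3).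
  rewrite /tent; have -> : (N.+1 %% m = r.+1 %% m)%nat by rewrite EN -addnS modnMDl.
  have [H|H] : (r.+1 < m \/ r.+1 = m)%nat by lia.
    by rewrite modn_small.
  by rewrite H modnn; lia.
lia.
Qed.

(** With G n the sum of the floors of i / m for i < n, the sum on the right is G (2 N) - G N. In
    this form both sides are sums with a fixed summand, and [tent_succ] is the induction step. *)
Lemma floor_sum m N : (0 < m)%nat ->
  (\sum_(0 <= j < N) ((3 * j + 1) %/ m) = \sum_(0 <= j < N) ((N + j) %/ m) + tent m N)%nat.
Proof.
move=> Hm; pose G n := (\sum_(0 <= i < n) (i %/ m))%nat.
have GS n : (G n.+1 = G n + n %/ m)%nat by rewrite /G big_nat_recr.
have H : (\sum_(0 <= j < N) ((3 * j + 1) %/ m) + G N = G (2 * N) + tent m N)%nat.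
  elim: N => [|N IH]; first by rewrite /G !big_geq // /tent mod0n sub0n min0n.
  have -> : (2 * N.+1 = (2 * N).+2)%nat by lia.
  rewrite big_nat_recr //= !GS; have := tent_succ m N Hm.
  have -> : (2 * N).+1 = (2 * N + 1)%nat by lia.
  lia.
have : (G (2 * N) = G N + \sum_(0 <= j < N) ((N + j) %/ m))%nat.
  rewrite /G (big_cat_nat _ (n := N)) //=; last by lia.
  congr addn; have -> : (2 * N = N + N)%nat by lia.
  by rewrite -{1}(add0n N) big_addn addnK; apply: eq_big_nat => i _; rewrite addnC.
lia.
Qed.

Lemma logn_fact_bound q n K : prime q -> (n <= K)%nat ->
  logn q n`! = (\sum_(0 <= k < K) (n %/ expn q k.+1))%nat.
Proof.
move=> Hq HnK; rewrite logn_fact // big_add1 /= (big_cat_nat _ (n := n) (p := K)) //=.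
rewrite (_ : (\sum_(n <= k < K) (n %/ expn q k.+1) = 0)%nat) ?addn0 //.
rewrite big_nat_cond; apply: big1 => k /andP[/andP[Hk _] _].
apply: divn_small; apply: leq_ltn_trans Hk _; apply: ltn_trans (ltnSn k) _.
by apply: ltn_expl; exact: prime_gt1.
Qed.

Lemma logn_prod q N (f : nat -> nat) : (forall j, 0 < f j)%nat ->
  logn q (\prod_(j < N) f j) = (\sum_(0 <= j < N) logn q (f j))%nat.
Proof.
move=> Hf; elim: N => [|N IH]; first by rewrite big_ord0 big_geq // logn1.
rewrite big_ord_recr /= big_nat_recr //= lognM ?IH //; apply: prodn_gt0 => j; exact: Hf.
Qed.

Lemma logn_num_den q N : prime q ->
  (logn q (\prod_(j < N) (3 * j + 1)`!) =
   logn q (\prod_(j < N) (N + j)`!) + \sum_(0 <= k < 3 * N) tent (expn q k.+1) N)%nat.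
Proof.
move=> Hq; rewrite (logn_prod q N (fun j => (3 * j + 1)`!)); last by move=> j; exact: fact_gt0.
rewrite (logn_prod q N (fun j => (N + j)`!)); last by move=> j; exact: fact_gt0.
rewrite (eq_big_nat _ _ (F2 := fun j => \sum_(0 <= k < 3 * N) ((3 * j + 1) %/ expn q k.+1))%nat); last first.
  by move=> j /andP[_ Hj]; apply: logn_fact_bound => //; lia.
rewrite [in RHS](eq_big_nat _ _ (F2 := fun j => \sum_(0 <= k < 3 * N) ((N + j) %/ expn q k.+1))%nat); last first.
  by move=> j /andP[_ Hj]; apply: logn_fact_bound => //; lia.
rewrite exchange_big /= [X in (_ = X + _)%nat]exchange_big /= -big_split /=.
apply: eq_big_nat => k _; apply: floor_sum.
by rewrite expn_gt0 prime_gt0.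
Qed.

(** Prime by prime: the difference of the valuations is a sum of tents, hence a natural number. This
    justifies the truncating quotient in [T]. *)
Lemma den_dvd_num N : (\prod_(j < N) (N + j)`! %| \prod_(j < N) (3 * j + 1)`!)%nat.
Proof.
have H0 (f : nat -> nat) : (0 < \prod_(j < N) (f j)`!)%nat.
  by apply: prodn_gt0 => j; exact: fact_gt0.
apply/dvdn_partP; first exact: (H0 (fun j => N + j)%nat).
move=> q; rewrite mem_primes => /andP[Hq _].
rewrite p_part pfactor_dvdn //; last exact: (H0 (fun j => 3 * j + 1)%nat).
by rewrite (logn_num_den q N Hq) leq_addr.
Qed.

Lemma logn_T p N : prime p -> logn p (T N) = (\sum_(0 <= k < 3 * N) tent (expn p k.+1) N)%nat.
Proof.
by move=> Hp; rewrite /T (logn_div p (den_dvd_num N)) (logn_num_den p N Hp) addKn.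
Qed.

(** For m = 6 g + 1 the tent has slopes 1 and -1 with corners at the residues 2 g, 3 g + 1/2 and 4 g
    + 1, so it is a sum of kinks with weights 1, -2, 1. The arguments are shifted so that the
    corners fall there: (N + 1/3) / m = n + 1/3 means N = n m + 2 g, (N - 1/3) / m = n + 2/3 means N
    = n m + 4 g + 1, and N / m = n + 1/2 means N = n m + 3 g + 1/2. *)
Lemma tent_rho g m N : (m = 6 * g + 1)%nat ->
  INR (tent m N) = INR m * (rho (1 / 3) ((INR N + 1 / 3) / INR m) + rho (2 / 3) ((INR N - 1 / 3) / INR m)
     - 2 * rho (1 / 2) (INR N / INR m)).
Proof.
move=> Em; set q := (N %/ m)%nat; set r := (N %% m)%nat.
have Hm : (0 < m)%nat by lia.
have Hr : (r < m)%nat by rewrite ltn_mod.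
have EN : (N = q * m + r)%nat by apply: divn_eq.
have EM : INR m = 6 * INR g + 1 by rewrite Em plus_INR mult_INR /=; ring.
have HG := pos_INR g.
have ENR : INR N = INR q * INR m + INR r by rewrite EN plus_INR mult_INR.
have HM : 0 < INR m by lra.
have Hr0 := pos_INR r.
have HrM : INR r + 1 <= INR m by rewrite -S_INR; apply: le_INR; lia.
have fr1 : frac_part ((INR N + 1 / 3) / INR m - 1 / 3) =
    if (2 * g <= r)%nat then (INR r - 2 * INR g) / INR m else (INR r - 2 * INR g) / INR m + 1.
  case: leqP => H.
    have H' : 2 * INR g <= INR r by have := le_INR _ _ (elimT leP H); rewrite mult_INR /=; lra.
    rewrite -(frac_part_eq (Z.of_nat q) ((INR r - 2 * INR g) / INR m)).
      by rewrite -INR_IZR_INZ ENR; congr frac_part; rewrite EM; field; lra.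
    by split; [apply: Rdiv_le_0_compat|apply/Rlt_div_l]; lra.
  have H' : INR r + 1 <= 2 * INR g by have := le_INR _ _ (elimT leP H); rewrite mult_INR S_INR /=; lra.
  rewrite -(frac_part_eq (Z.of_nat q - 1) ((INR r - 2 * INR g) / INR m + 1)).
    by rewrite minus_IZR -INR_IZR_INZ ENR; congr frac_part; rewrite EM; field; lra.
  have -> : (INR r - 2 * INR g) / INR m + 1 = (INR r - 2 * INR g + INR m) / INR m by field; lra.
  by split; [apply: Rdiv_le_0_compat|apply/Rlt_div_l]; lra.
have fr2 : frac_part ((INR N - 1 / 3) / INR m - 2 / 3) =
    if (4 * g + 1 <= r)%nat then (INR r - (4 * INR g + 1)) / INR m else (INR r - (4 * INR g + 1)) / INR m + 1.
  case: leqP => H.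
    have H' : 4 * INR g + 1 <= INR r by have := le_INR _ _ (elimT leP H); rewrite plus_INR mult_INR /=; lra.
    rewrite -(frac_part_eq (Z.of_nat q) ((INR r - (4 * INR g + 1)) / INR m)).
      by rewrite -INR_IZR_INZ ENR; congr frac_part; rewrite EM; field; lra.
    by split; [apply: Rdiv_le_0_compat|apply/Rlt_div_l]; lra.
  have H' : INR r + 1 <= 4 * INR g + 1 by have := le_INR _ _ (elimT leP H); rewrite S_INR plus_INR mult_INR /=; lra.
  rewrite -(frac_part_eq (Z.of_nat q - 1) ((INR r - (4 * INR g + 1)) / INR m + 1)).
    by rewrite minus_IZR -INR_IZR_INZ ENR; congr frac_part; rewrite EM; field; lra.
  have -> : (INR r - (4 * INR g + 1)) / INR m + 1 = (INR r - (4 * INR g + 1) + INR m) / INR m by field; lra.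
  by split; [apply: Rdiv_le_0_compat|apply/Rlt_div_l]; lra.
have fr3 : frac_part (INR N / INR m - 1 / 2) =
    if (3 * g + 1 <= r)%nat then INR r / INR m - 1 / 2 else INR r / INR m + 1 / 2.
  case: leqP => H.
    have H' : 3 * INR g + 1 <= INR r by have := le_INR _ _ (elimT leP H); rewrite plus_INR mult_INR /=; lra.
    rewrite -(frac_part_eq (Z.of_nat q) (INR r / INR m - 1 / 2)).
      by rewrite -INR_IZR_INZ ENR; congr frac_part; field; lra.
    have -> : INR r / INR m - 1 / 2 = (INR r - INR m / 2) / INR m by field; lra.
    by split; [apply: Rdiv_le_0_compat|apply/Rlt_div_l]; lra.
  have H' : INR r <= 3 * INR g by have := le_INR _ _ (elimT leP H); rewrite S_INR plus_INR mult_INR /=; lra.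
  rewrite -(frac_part_eq (Z.of_nat q - 1) (INR r / INR m + 1 / 2)).
    by rewrite minus_IZR -INR_IZR_INZ ENR; congr frac_part; field; lra.
  have -> : INR r / INR m + 1 / 2 = (INR r + INR m / 2) / INR m by field; lra.
  by split; [apply: Rdiv_le_0_compat|apply/Rlt_div_l]; lra.
rewrite /rho /hh /be /bern fr1 fr2 fr3 {fr1 fr2 fr3}.
have -> : tent m N = minn (r - 2 * g) (4 * g + 1 - r) by rewrite /tent -/r; congr minn; lia.
have minR a b c : (a + b = c)%nat -> INR b = INR c - INR a by move=> <-; rewrite plus_INR; ring.
case: (leqP (2 * g) r) => H1; case: (leqP (4 * g + 1) r) => H2; case: (leqP (3 * g + 1) r) => H3; try lia.
- have -> : minn (r - 2 * g) (4 * g + 1 - r) = 0%nat by lia.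
  by rewrite EM [INR 0]/=; field; lra.
- have -> : INR (minn (r - 2 * g) (4 * g + 1 - r)) = 4 * INR g + 1 - INR r.
    by rewrite (minR r _ (4 * g + 1)%nat) ?plus_INR ?mult_INR /=; [ring|lia].
  by rewrite EM; field; lra.
- have -> : INR (minn (r - 2 * g) (4 * g + 1 - r)) = INR r - 2 * INR g.
    by rewrite (minR (2 * g)%nat _ r) ?mult_INR /=; [ring|lia].
  by rewrite EM; field; lra.
- have -> : minn (r - 2 * g) (4 * g + 1 - r) = 0%nat by lia.
  by rewrite EM [INR 0]/=; field; lra.
Qed.

(** * The exact formula *)

Lemma Cseries_ext a b : (forall n, a n = b n) -> Cseries a = Cseries b.
Proof. by move=> H; rewrite /Cseries; congr pair; apply: Series_ext => n; rewrite H. Qed.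

Lemma fourier_termE a x k : fourier_term a x k = (a k * ee (IZR k * x))%C.
Proof. by rewrite /fourier_term /ee; congr (_ * Cexp _)%C; rewrite RtoC_mult; ring. Qed.

Lemma fourier_periodic a x : fourier a (x + 1) = fourier a x.
Proof.
have H k : fourier_term a (x + 1) k = fourier_term a x k.
  by rewrite !fourier_termE Rmult_plus_distr_l ee_plus Rmult_1_r ee_Z Cmult_1_r.
by rewrite /fourier /Zstar_sum; congr Cplus; apply: Cseries_ext => n; rewrite H.
Qed.

Lemma zmod_halves a : ex_series (zmod a) ->
  ex_series (fun n => Cmod (a (Z.of_nat n.+1))) /\ ex_series (fun n => Cmod (a (- Z.of_nat n.+1)%Z)).
Proof.
move=> H; split; apply: (ex_series_le_pos _ (zmod a)) => // n; rewrite /zmod;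
  have := Cmod_ge_0 (a (Z.of_nat n.+1)); have := Cmod_ge_0 (a (- Z.of_nat n.+1)%Z); lra.
Qed.

Lemma fourier_summable a x : ex_series (zmod a) -> Zstar_summable (fourier_term a x).
Proof.
move=> /zmod_halves [H1 H2]; split.
  by apply: ex_series_ext H1 => n; rewrite fourier_termE Cmod_mul_ee.
by apply: ex_series_ext H2 => n; rewrite fourier_termE Cmod_mul_ee.
Qed.

Lemma fourier_csums a x l : ex_series (zmod a) ->
  csums (zpair (fun k => (a k * ee (IZR k * x))%C)) l -> fourier a x = l.
Proof.
move=> Ha Hl; have [H1 H2] := fourier_summable a x Ha.
have [l1 L1] := csums_abs (fun n => fourier_term a x (Z.of_nat n.+1)) _ (fun n => Rle_refl _) H1.
have [l2 L2] := csums_abs (fun n => fourier_term a x (- Z.of_nat n.+1)%Z) _ (fun n => Rle_refl _) H2.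
rewrite /fourier /Zstar_sum (csums_Cseries _ _ L1) (csums_Cseries _ _ L2).
apply: (csums_unique _ _ _ (csums_plus _ _ _ _ L1 L2)).
by apply: csums_ext Hl => n; rewrite /zpair !fourier_termE.
Qed.

Lemma fourier_bounded a (F : R -> R) : ex_series (zmod a) ->
  (forall u, csums (zpair (fun k => (a k * ee (IZR k * u))%C)) (F u)) ->
  forall u, Rabs (F u) <= Series (zmod a).
Proof.
move=> Ha HF u; rewrite -Cmod_R; apply: (csums_le _ _ _ (HF u)) => // n.
by apply: Rle_trans (zpair_zmod _ n) _; rewrite /zmod !Cmod_mul_ee; lra.
Qed.

(** The weaker exponent 1/2 gives continuity, and for shifts of size 1 / N it gives N times the
    square root of 1 / N, the size wanted for [Psi]. *)
Definition sqrt_holder (F : R -> R) (K : R) : Prop :=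
  0 <= K /\ forall u h, 0 <= h <= 1 / 4 -> Rabs (F (u + h) - F u) <= K * sqrt h.

Lemma dyadic_scale h : 0 < h <= 1 / 4 -> exists j, (/ 2) ^ (j + 3) <= h <= (/ 2) ^ (j + 2).
Proof.
move=> Hh.
have [n Hn] : exists n : nat, (/ 2) ^ (n + 2) <= h.
  have [n Hn] := pow_lt_1_zero (/ 2) (ltac:(rewrite Rabs_pos_eq; lra)) h (proj1 Hh).
  exists n; apply: Rlt_le; apply: Rle_lt_trans (Rle_abs _) _; apply: Hn; lia.
elim: n Hn => [|n IH] Hn; first by exists 0%nat; rewrite /= in Hn *; lra.
have [H|H] := Rle_dec ((/ 2) ^ (n + 2)) h; first exact: IH.
exists n; split; last by lra.
by have -> : (n + 3 = n.+1 + 2)%nat by lia.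
Qed.

Lemma sqrt_holder_of_dyadic F : (exists r C0, 0 < r /\ r ^ 4 = 1 / 2 /\ 0 <= C0 /\
    forall (j : nat) u h, 0 <= h <= (/ 2) ^ (j + 2) -> Rabs (F (u + h) - F u) <= C0 * (r ^ 3) ^ j) ->
  exists K, sqrt_holder F K.
Proof.
(* r^(3j) <= r^(2j) = 2^(-j/2), and 2^-j <= 8 h <= 9 h explains the factor 3. *)
move=> [r [C0 [Hr [Hr4 [HC HF]]]]]; exists (C0 * 3); split; first by lra.
move=> u h Hh; have [H0|H0] : 0 < h \/ h = 0 by lra.
  have [j Hj] := dyadic_scale h (conj H0 (proj2 Hh)).
  apply: Rle_trans (HF j u h _) _; first by lra.
  rewrite Rmult_assoc; apply: Rmult_le_compat_l => //.
  have Hr1 : r <= 1 by apply: Rnot_lt_le => H; have := pow_R1_Rle r 4 (Rlt_le _ _ H); lra.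
  apply: (Rle_trans _ ((r ^ 2) ^ j)); first by apply: pow_incr; split; nra.
  apply: Rsqr_incr_0_var; last by have := sqrt_pos h; lra.
  have -> : Rsqr (3 * sqrt h) = 9 * h by rewrite Rsqr_mult Rsqr_sqrt /Rsqr; lra.
  have -> : Rsqr ((r ^ 2) ^ j) = (/ 2) ^ j.
    by rewrite /Rsqr -Rpow_mult_distr; congr (_ ^ _); lra.
  by move: Hj; rewrite pow_add /=; lra.
by rewrite H0 Rplus_0_r Rminus_diag Rabs_R0 sqrt_0; lra.
Qed.

Lemma sqrt_holder_sym F K : sqrt_holder F K ->
  forall u v, Rabs (v - u) <= 1 / 4 -> Rabs (F v - F u) <= K * sqrt (Rabs (v - u)).
Proof.
move=> [_ HF] u v; have [H|H] := Rle_dec u v.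
  by rewrite (Rabs_pos_eq (v - u)) => [Hh|]; [have := HF u (v - u); rewrite Rplus_minus; apply; lra|lra].
rewrite Rabs_minus_sym (Rabs_minus_sym (F v)) (Rabs_pos_eq (u - v)) => [Hh|]; last by lra.
by have := HF v (u - v); rewrite Rplus_minus; apply; lra.
Qed.

Lemma sqrt_holder_continuous F K x : sqrt_holder F K -> continuous F x.
Proof.
move=> HF; have [HK _] := HF; apply/filterlim_locally => eps.
have Hd : 0 < Rmin (1 / 4) ((eps / (K + 1)) ^ 2).
  by apply: Rmin_pos; [lra|apply: pow_lt; apply: Rdiv_lt_0_compat; [exact: cond_pos|lra]].
exists (mkposreal _ Hd) => y Hy.
have {}Hy : Rabs (y - x) < Rmin (1 / 4) ((eps / (K + 1)) ^ 2) by exact: Hy.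
have Hm1 := Rmin_l (1 / 4) ((eps / (K + 1)) ^ 2); have Hm2 := Rmin_r (1 / 4) ((eps / (K + 1)) ^ 2).
apply: Rle_lt_trans (sqrt_holder_sym F K HF x y _) _; first by lra.
have He : 0 < eps / (K + 1) by apply: Rdiv_lt_0_compat; [exact: cond_pos|lra].
have Hs : sqrt (Rabs (y - x)) < eps / (K + 1).
  rewrite -(sqrt_pow2 (eps / (K + 1))); last by lra.
  by apply: sqrt_lt_1_alt; split; [exact: Rabs_pos|lra].
apply: Rle_lt_trans (_ : _ <= (K + 1) * sqrt (Rabs (y - x))) _.
  by have := sqrt_pos (Rabs (y - x)); nra.
have -> : pos eps = (K + 1) * (eps / (K + 1)) by field; lra.
by apply: Rmult_lt_compat_l; lra.
Qed.

Lemma continuous_RtoC (F : R -> R) x : continuous F x ->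
  continuous (fun y => RtoC (F y) : C_UniformSpace) x.
Proof.
move=> H; apply/filterlim_locally => eps.
have [e He] := proj1 (filterlim_locally _ _) H eps.
by exists e => y Hy; split; [exact: He|exact: ball_center].
Qed.

(** * The valuation as a combination of kink sums *)

Lemma expn_INR q k : INR (expn q k) = INR q ^ k.
Proof. by elim: k => [|k IH] //; rewrite expnS mult_INR IH. Qed.

(** The powers of p are odd and 1 mod 3, so [tent_rho] applies at every level. Levels k >= 3 N
    contribute nothing, as p^(k+1) >= 3 N + 1 puts the arguments where [rho] vanishes; for al = 1/3
    the requirement is exactly N + 1/3 <= (3 N + 1) / 3. *)
Lemma logn_T_Rinf p N : prime p -> p = 1 %[mod 3] -> (0 < N)%nat ->
  INR (logn p (T N)) = Rinf (INR p) (1 / 3) (INR N + 1 / 3) + Rinf (INR p) (2 / 3) (INR N - 1 / 3)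
    - 2 * Rinf (INR p) (1 / 2) (INR N).
Proof.
move=> Hp Hp3 HN; have Hp1 := prime_gt1 Hp.
have HP : 1 < INR p := INR_p_gt1 p Hp1.
have HN1 : 1 <= INR N by have := le_INR _ _ (elimT leP HN).
have Hodd : odd p.
  by case: (even_prime Hp) => // E; move: Hp3; rewrite E.
have Hg k : exists g, (expn p k.+1 = 6 * g + 1)%nat.
  have H2 : (expn p k.+1 %% 3 = 1)%nat by rewrite -modnXm Hp3 modnXm exp1n.
  have H3 : odd (expn p k.+1) by rewrite oddX Hodd orbT.
  exists (expn p k.+1 %/ 6)%nat; lia.
have big k : (3 * N <= k)%nat -> 3 * INR N + 1 <= INR p ^ k.+1.
  move=> Hk; rewrite -expn_INR.
  have : (3 * N + 1 <= expn p k.+1)%nat by have := ltn_expl k.+1 Hp1; lia.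
  by move/leP/le_INR; rewrite plus_INR mult_INR /=; lra.
have fin al X : 0 < al <= 1 -> 0 <= X <= al * (3 * INR N + 1) ->
    Rinf (INR p) al X = \rsum_(k < 3 * N) (INR p ^ k.+1 * rho al (X / INR p ^ k.+1)).
  move=> Hal HX; apply: is_series_unique; apply: is_series_finite => k Hk.
  have HB := big k Hk; rewrite rho_small ?Rmult_0_r //; split.
    by apply: Rdiv_le_0_compat; lra.
  by apply/Rle_div_l; nra.
rewrite !fin; try lra.
rewrite logn_T //.
have -> (f : nat -> nat) n : INR (\sum_(0 <= k < n) f k)%nat = \rsum_(k < n) INR (f k).
  by elim: n => [|n IH]; [rewrite !big_geq|rewrite !big_nat_recr //= plus_INR IH].
elim: (3 * N)%nat => [|n IH]; first by rewrite !big_geq //; ring.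
rewrite !big_nat_recr //= IH; have [g Eg] := Hg n.
rewrite (tent_rho g _ N Eg) !expn_INR /=; ring.
Qed.

Lemma Hinf_const P al X h : 1 < P -> (forall i : nat, hh al (X * P ^ i) = h) ->
  Hinf P al X = h * (P / (P - 1)).
Proof.
move=> HP H; rewrite /Hinf (Series_ext _ (fun i => h * (/ P) ^ i)); last first.
  by move=> i; rewrite H pow_inv Rmult_comm.
rewrite Series_scal_l Series_geom; first by congr Rmult; field; lra.
have H1 : 0 < / P by apply: Rinv_0_lt_compat; lra.
by rewrite Rabs_pos_eq; [rewrite -Rinv_1; apply: Rinv_lt_contravar; lra|lra].
Qed.

Lemma bern_Z k : bern (IZR k) = 0.
Proof. by rewrite /bern -(Rplus_0_r (IZR k)) frac_part_eq; lra. Qed.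

(** Since p^i = 1 mod 3, the numbers (N + 1/3) p^i - 1/3 and (N - 1/3) p^i - 2/3 are integers, so
    [bern] vanishes at every scale and [hh] is constantly [be], equal to -1/9. For al = 1/2 the
    value 1/8 of [bern] at half-integers cancels [be]. *)
Lemma Hinf_values p N : prime p -> p = 1 %[mod 3] ->
  [/\ Hinf (INR p) (1 / 3) (INR N + 1 / 3) = - (1 / 9) * (INR p / (INR p - 1)),
      Hinf (INR p) (2 / 3) (INR N - 1 / 3) = - (1 / 9) * (INR p / (INR p - 1))
    & Hinf (INR p) (1 / 2) (INR N) = 0].
Proof.
move=> Hp Hp3; have Hp1 := prime_gt1 Hp; have HP : 1 < INR p := INR_p_gt1 p Hp1.
have Hg i : exists g, INR p ^ i = 3 * INR g + 1.
  exists (expn p i %/ 3)%nat; rewrite -expn_INR.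
  have H2 : (expn p i %% 3 = 1)%nat by rewrite -modnXm Hp3 modnXm exp1n.
  by rewrite {1}(divn_eq (expn p i) 3) H2 plus_INR mult_INR /=; ring.
split.
- apply: Hinf_const => // i; have [g ->] := Hg i; rewrite /hh.
  have -> : (INR N + 1 / 3) * (3 * INR g + 1) - 1 / 3 = IZR (Z.of_nat (3 * g * N + N + g)).
    by rewrite -INR_IZR_INZ !plus_INR !mult_INR /=; field.
  by rewrite bern_Z /be; field.
- apply: Hinf_const => // i; have [g ->] := Hg i; rewrite /hh.
  have -> : (INR N - 1 / 3) * (3 * INR g + 1) - 2 / 3 = IZR (Z.of_nat (3 * g * N + N) - Z.of_nat (g + 1)).
    by rewrite minus_IZR -!INR_IZR_INZ !plus_INR !mult_INR /=; field.
  by rewrite bern_Z /be; field.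
rewrite (Hinf_const _ _ _ 0) //; first by ring.
move=> i; rewrite -expn_INR -mult_INR INR_IZR_INZ /hh.
have -> : IZR (Z.of_nat (N * expn p i)) - 1 / 2 = IZR (Z.of_nat (N * expn p i) - 1) + 1 / 2.
  by rewrite minus_IZR; field.
by rewrite bern_shift /bern -(Rplus_0_l (1 / 2)) frac_part_eq /be; lra.
Qed.

(** [wst_split] with q = 3 and q = 2 yields k1 + k2 = (ln 3) / 2 and k3 = (ln 2) / 2, because the
    constant k4 of al = 1 occurs on both sides and cancels. This is the source of the main term with
    2 / sqrt 3. *)
Lemma wst_relations : exists k1 k2 k3 : R,
  [/\ is_lim_seq (wst (1 / 3)) k1, is_lim_seq (wst (2 / 3)) k2, is_lim_seq (wst (1 / 2)) k3,
      k1 + k2 - 2 * k3 = - ln (2 / sqrt 3) & k2 - k1 = ln (Gamma (1 / 3) / Gamma (2 / 3))].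
Proof.
have [k1 H1] := wst_cv (1 / 3) ltac:(lra); have [k2 H2] := wst_cv (2 / 3) ltac:(lra).
have [k3 H3] := wst_cv (1 / 2) ltac:(lra); have [k4 H4] := wst_cv 1 ltac:(lra).
exists k1, k2, k3; split=> //; last first.
  have E : 1 / 3 + 1 / 3 = 2 / 3 by field.
  by have := wst_Gamma (1 / 3) (1 / 3) k1 k2; rewrite E; apply=> //; lra.
have S3 : k1 + k2 = ln 3 / 2.
  have := wst_split 3 isT (fun j => if j is 0%nat then k1 else if j is 1%nat then k2 else k4) k4 _ H4.
  rewrite !big_nat_recr // big_geq //= => H.
  have : 0 + k1 + k2 + k4 = k4 + ln (1 + 1 + 1) / 2.
    apply: H; case=> [|[|[|//]]] _ //=.
    - by rewrite (_ : 1 / (1 + 1 + 1) = 1 / 3); [|field].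
    - by rewrite (_ : (1 + 1) / (1 + 1 + 1) = 2 / 3); [|field].
    by rewrite (_ : (1 + 1 + 1) / (1 + 1 + 1) = 1); [|field].
  by rewrite (_ : 1 + 1 + 1 = 3); lra.
have S2 : k3 = ln 2 / 2.
  have := wst_split 2 isT (fun j => if j is 0%nat then k3 else k4) k4 _ H4.
  rewrite !big_nat_recr // big_geq //= => H.
  have : 0 + k3 + k4 = k4 + ln (1 + 1) / 2.
    apply: H; case=> [|[|//]] _ //=.
    by rewrite (_ : (1 + 1) / (1 + 1) = 1); [|field].
  by rewrite (_ : 1 + 1 = 2); lra.
rewrite ln_div; [|lra|by apply: sqrt_lt_R0; lra].
rewrite -(Rpower_sqrt 3); last by lra.
by rewrite /Rpower ln_exp; lra.
Qed.

(** Both bounds come from ln x <= x - 1, applied at the inverse of 1 + t and at 1 + t. *)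
Lemma xlnx_bounds t : -1 < t -> 0 <= (1 + t) * ln (1 + t) - t <= t ^ 2.
Proof.
move=> Ht; have up x : 0 < x -> ln x <= x - 1.
  by move=> Hx; have := exp_ineq1_le (ln x); rewrite exp_ln //; lra.
split; last by have := up (1 + t) ltac:(lra); nra.
have Ht' : 0 < 1 + t by lra.
have := up (/ (1 + t)) (Rinv_0_lt_compat _ Ht'); rewrite ln_Rinv; last by lra.
move=> H; have : (1 + t) * (- ln (1 + t)) <= (1 + t) * (/ (1 + t) - 1) by apply: Rmult_le_compat_l; lra.
have -> : (1 + t) * (/ (1 + t) - 1) = - t by field; lra.
lra.
Qed.

Lemma g_bound p j N : (1 < p)%nat -> j = 1%Z \/ j = (-1)%Z -> (0 < N)%nat ->
  Rabs (g p j N - IZR j / (3 * ln (INR p))) <= / (9 * ln (INR p)) * (1 / INR N).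
Proof.
move=> Hp Hj HN; have HL := ln_p_pos p Hp.
have HN1 : 1 <= INR N by have := le_INR _ _ (elimT leP HN).
have Hj2 : IZR j * IZR j = 1 by case: Hj => ->; lra.
set t := IZR j / (3 * INR N).
have Ht : -1 < t.
  apply: (Rmult_lt_reg_r (3 * INR N)); first by lra.
  have -> : t * (3 * INR N) = IZR j by rewrite /t; field; lra.
  by case: Hj => ->; lra.
have [B1 B2] := xlnx_bounds t Ht.
have -> : g p j N - IZR j / (3 * ln (INR p)) = INR N * ((1 + t) * ln (1 + t) - t) / ln (INR p).
  have Et : IZR j = 3 * INR N * t by rewrite /t; field; lra.
  by rewrite /g /logb -/t Et; field; lra.
have -> : / (9 * ln (INR p)) * (1 / INR N) = INR N * t ^ 2 / ln (INR p).
  have -> : t ^ 2 = IZR j * IZR j / (9 * INR N * INR N) by rewrite /t; field; lra.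
  by rewrite Hj2; field; lra.
have HiL : 0 < / ln (INR p) by apply: Rinv_0_lt_compat.
rewrite Rabs_pos_eq; last by apply: Rmult_le_pos; [apply: Rmult_le_pos|]; lra.
apply: Rmult_le_compat_r; first by lra.
by apply: Rmult_le_compat_l; lra.
Qed.

Lemma fourier_package p al kap z : (1 < p)%nat -> 0 < al <= 1 -> 1 < INR p * al ->
  is_lim_seq (wst al) (Finite kap) -> (forall k, k <> 0%Z -> zlim al (chi p k) (z k)) ->
  ex_series (zmod (fun k => z k / den p k)%C) /\ exists F : R -> R,
    [/\ forall u, csums (zpair (fun k => (z k / den p k * ee (IZR k * u))%C)) (F u),
        exists K, sqrt_holder F K
      & forall X, 0 < X -> Rinf (INR p) al X + Hinf (INR p) al X =
        X * (F (logb p X) + X / (2 * (INR p - 1)) + (1 / 2 - al) * logb p X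
          - kap / ln (INR p) - (1 / 2 - al) * (1 / 2 + 1 / ln (INR p)))].
Proof.
move=> Hp Hal Hpal Hk Hz.
have [|S [F [F1 [F2 F3]]]] := zeta_fourier p al kap z Hp Hal Hpal Hk.
  by move=> k Hk0; apply: zlim_pJ => //; exact: Hz.
by split=> //; exists F; split=> //; exact: sqrt_holder_of_dyadic.
Qed.

Lemma zpair_plus a b u l m :
  csums (zpair (fun k => (a k * ee (IZR k * u))%C)) l ->
  csums (zpair (fun k => (b k * ee (IZR k * u))%C)) m ->
  csums (zpair (fun k => ((a k + b k) * ee (IZR k * u))%C)) (l + m)%C.
Proof.
move=> Ha Hb; apply: csums_ext (csums_plus _ _ _ _ Ha Hb) => n.
by rewrite /zpair; ring.
Qed.

Lemma zpair_scal (s : C) a u l :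
  csums (zpair (fun k => (a k * ee (IZR k * u))%C)) l ->
  csums (zpair (fun k => (s * a k * ee (IZR k * u))%C)) (s * l)%C.
Proof.
move=> Ha; apply: csums_ext (csums_scal s _ _ Ha) => n.
by rewrite /zpair; ring.
Qed.

Lemma zpair_ext_star a b u l : (forall k, k <> 0%Z -> a k = b k) ->
  csums (zpair (fun k => (a k * ee (IZR k * u))%C)) l ->
  csums (zpair (fun k => (b k * ee (IZR k * u))%C)) l.
Proof. by move=> H; apply: csums_ext => n; rewrite /zpair !H //; lia. Qed.

Lemma ex_series_zmod_plus a b : ex_series (zmod a) -> ex_series (zmod b) ->
  ex_series (zmod (fun k => a k + b k)%C).
Proof.
move=> Ha Hb; apply: (ex_series_le_pos _ (fun n => zmod a n + zmod b n)); last exact: ex_series_plus.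
move=> n; split; first exact: zmod_ge0.
rewrite /zmod; have := Cmod_triangle (a (Z.of_nat n.+1)) (b (Z.of_nat n.+1)).
by have := Cmod_triangle (a (- Z.of_nat n.+1)%Z) (b (- Z.of_nat n.+1)%Z); lra.
Qed.

Lemma ex_series_zmod_scal (s : C) a : ex_series (zmod a) ->
  ex_series (zmod (fun k => s * a k)%C).
Proof.
move=> Ha; apply: ex_series_ext (ex_series_scal (Cmod s) _ Ha) => n.
by rewrite /zmod !Cmod_mult /scal /= /mult /=; ring.
Qed.

Lemma ex_series_zmod_ext a b : (forall k, k <> 0%Z -> a k = b k) ->
  ex_series (zmod a) -> ex_series (zmod b).
Proof. by move=> H; apply: ex_series_ext => n; rewrite /zmod !H //; lia. Qed.

(** The numerator of c_k is (3^chi - 1) - 2 (2^chi - 1): the two thirds once each and the half with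
    weight -2, matching [logn_T_Rinf]. *)
Lemma c_split p k : (1 < p)%nat -> k <> 0%Z ->
  (d p 1 k + d p (-1) k + (- 2) * ((Rcpow 2 (chi p k) - 1) * riemann_zeta (chi p k) / den p k))%C = c p k.
Proof.
move=> Hp Hk; have Hd := den_neq0 p k Hp Hk.
have -> : c p k = (((Rcpow 3 (chi p k) - 1) * riemann_zeta (chi p k)
    - 2 * ((Rcpow 2 (chi p k) - 1) * riemann_zeta (chi p k))) / den p k)%C.
  by rewrite /c Cplus_comm Rcpow_plus Rcpow_1; [field|lra].
rewrite -zeta_thirds // /d /= /d_shift; by field.
Qed.

(** The difference of natural logarithms is at most 1 / (2 N), and division by ln p > 1/2 at most
    doubles it. *)
Lemma logb_shift p N s : (1 < p)%nat -> (0 < N)%nat -> Rabs s <= 1 / 3 ->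
  Rabs (logb p (INR N + s) - logb p (INR N)) <= 1 / INR N.
Proof.
move=> Hp HN /Rabs_def2_le Hs; have HN1 : 1 <= INR N by have := le_INR _ _ (elimT leP HN).
have HL : / 2 < ln (INR p).
  apply: Rlt_le_trans ln_lt_2 _; apply: ln_le; first by lra.
  by have := le_INR _ _ (elimT leP Hp).
have up x y : 0 < x -> 0 < y -> ln x - ln y <= (x - y) / y.
  move=> Hx Hy; rewrite -ln_div //; have Hq : 0 < x / y by apply: Rdiv_lt_0_compat.
  have := exp_ineq1_le (ln (x / y)); rewrite exp_ln // => H.
  have -> : (x - y) / y = x / y - 1 by field; lra.
  by lra.
have B : Rabs (ln (INR N + s) - ln (INR N)) <= / (2 * INR N).
  have Hi : 0 < / (2 * INR N) by apply: Rinv_0_lt_compat; lra.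
  apply: Rabs_le; split; last first.
    apply: Rle_trans (up _ _ _ _) _; try lra.
    apply/Rle_div_l; first by lra.
    have -> : / (2 * INR N) * INR N = 1 / 2 by field; lra.
    by lra.
  have : ln (INR N) - ln (INR N + s) <= / (2 * INR N); last by lra.
  apply: Rle_trans (up _ _ _ _) _; try lra.
  apply/Rle_div_l; first by lra.
  apply: (Rmult_le_reg_l (2 * INR N)); first by lra.
  have -> : 2 * INR N * (/ (2 * INR N) * (INR N + s)) = INR N + s by field; lra.
  by nra.
have -> : logb p (INR N + s) - logb p (INR N) = (ln (INR N + s) - ln (INR N)) / ln (INR p).
  by rewrite /logb; field; lra.
rewrite Rabs_div; last by lra.
rewrite (Rabs_pos_eq (ln (INR p))); last by lra.
apply/Rle_div_l; first by lra.
apply: Rle_trans B _.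
have -> : / (2 * INR N) = 1 / INR N * / 2 by field; lra.
apply: Rmult_le_compat_l; last by lra.
by apply: Rdiv_le_0_compat; lra.
Qed.

(** Split as N times the increment of F, plus s times a value of F. The increment is at most K times
    the square root of 1 / N; N >= 4 keeps the shift within the range of [sqrt_holder]. *)
Lemma shifted_term_bound p N s F K M : (1 < p)%nat -> (4 <= N)%nat -> Rabs s <= 1 / 3 ->
  sqrt_holder F K -> (forall u, Rabs (F u) <= M) ->
  Rabs ((INR N + s) * F (logb p (INR N + s)) - INR N * F (logb p (INR N))) <= (K + M) * sqrt (INR N).
Proof.
move=> Hp HN Hs HF HM; have [HK _] := HF.
have HN4 : 4 <= INR N by have := le_INR _ _ (elimT leP HN); rewrite /=; lra.
have HN0 : (0 < N)%nat by lia.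
have HD := logb_shift p N s Hp HN0 Hs.
have HN4' : 1 / INR N <= 1 / 4 by apply/Rle_div_l; lra.
have HS := sqrt_holder_sym F K HF (logb p (INR N)) (logb p (INR N + s)) (Rle_trans _ _ _ HD HN4').
have Hsq : sqrt (Rabs (logb p (INR N + s) - logb p (INR N))) <= sqrt (1 / INR N) by apply: sqrt_le_1_alt.
have Hsq1 : 1 <= sqrt (INR N) by rewrite -sqrt_1; apply: sqrt_le_1_alt; lra.
have EN : INR N * sqrt (1 / INR N) = sqrt (INR N).
  rewrite -{1}(sqrt_sqrt (INR N)); last by lra.
  rewrite Rmult_assoc -sqrt_mult_alt; last by lra.
  by have -> : INR N * (1 / INR N) = 1 by [field; lra]; rewrite sqrt_1 Rmult_1_r.
have -> : (INR N + s) * F (logb p (INR N + s)) - INR N * F (logb p (INR N)) =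
    INR N * (F (logb p (INR N + s)) - F (logb p (INR N))) + s * F (logb p (INR N + s)) by ring.
apply: Rle_trans (Rabs_triang _ _) _; rewrite !Rabs_mult (Rabs_pos_eq (INR N)); last by lra.
have H1 : INR N * Rabs (F (logb p (INR N + s)) - F (logb p (INR N))) <= K * sqrt (INR N).
  rewrite -EN; have -> : K * (INR N * sqrt (1 / INR N)) = INR N * (K * sqrt (1 / INR N)) by ring.
  apply: Rmult_le_compat_l; first by lra.
  by apply: Rle_trans HS _; apply: Rmult_le_compat_l.
have HFM := HM (logb p (INR N + s)).
have := Rabs_pos (F (logb p (INR N + s))); have := Rabs_pos s.
have H2 : Rabs s * Rabs (F (logb p (INR N + s))) <= 1 * M.
  by apply: Rmult_le_compat; try exact: Rabs_pos; lra.
by nra.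
Qed.

(** From N = 3 on the logarithm is at least 1, as e <= 3. *)
Lemma sqrt_le_Rpower_ln N : (3 <= N)%nat -> sqrt (INR N) <= Rpower (INR N) (1 / 2) * ln (INR N).
Proof.
move=> HN; have HN3 : 3 <= INR N by have := le_INR _ _ (elimT leP HN); rewrite /=; lra.
rewrite (_ : 1 / 2 = / 2); last by field.
rewrite Rpower_sqrt; last by lra.
have : 1 <= ln (INR N).
  by rewrite -(ln_exp 1); apply: ln_le; [exact: exp_pos|have := exp_le_3; lra].
by have := sqrt_pos (INR N); nra.
Qed.

(** The difference of the two [g] tends to 2 / (3 ln p), so its sixth cancels 1 / (9 ln p). *)
Lemma f0_lim p : (1 < p)%nat ->
  is_lim_seq (f0 p) (1 / 3 * logb p (Gamma (1 / 3) / Gamma (2 / 3)) + (INR p + 1) / (6 * (INR p - 1)) : R).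
Proof.
move=> Hp; have HL := ln_p_pos p Hp; set l := (_ + _).
have B N : (0 < N)%nat -> Rabs (f0 p N - l) <= / (9 * ln (INR p)) / INR N.
  move=> HN; have H1 := g_bound p 1 N Hp (or_introl erefl) HN.
  have H2 := g_bound p (-1) N Hp (or_intror erefl) HN.
  have HN1 : 1 <= INR N by have := le_INR _ _ (elimT leP HN).
  have -> : f0 p N - l = ((g p 1 N - 1 / (3 * ln (INR p))) - (g p (-1) N - -1 / (3 * ln (INR p)))) / 6.
    by rewrite /f0 /l; set gr := (1 / 3 * _); set q := (_ / (6 * _)); field; lra.
  have E : / (9 * ln (INR p)) * (1 / INR N) = / (9 * ln (INR p)) / INR N by field; lra.
  rewrite E in H1 H2.
  rewrite Rabs_div ?(Rabs_pos_eq 6); try lra.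
  apply/Rle_div_l; first by lra.
  by move/Rabs_def2_le: H1 => H1; move/Rabs_def2_le: H2 => H2; apply: Rabs_le; lra.
apply/is_lim_seq_incr_1.
have H0 := is_lim_seq_inv_S (/ (9 * ln (INR p))).
have HS (e : R) : is_lim_seq (fun n => l + e * (/ (9 * ln (INR p)) / INR n.+1)) l.
  have : is_lim_seq (fun n => l + e * (/ (9 * ln (INR p)) / INR n.+1)) (l + e * 0 : R).
    by apply: is_lim_seq_plus'; [exact: is_lim_seq_const|exact: is_lim_seq_scal_l H0].
  by rewrite Rmult_0_r Rplus_0_r.
apply: (is_lim_seq_le_le _ _ _ _ _ (HS (-1)) (HS 1)) => n.
by have /Rabs_def2_le := B n.+1 isT; lra.
Qed.

Lemma fourier_real a (F : R -> R) : ex_series (zmod a) ->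
  (forall u, csums (zpair (fun k => (a k * ee (IZR k * u))%C)) (F u)) ->
  (forall x, continuous F x) ->
  (forall x, fourier a x = F x) /\ (forall x, continuous (fourier a : R_UniformSpace -> C_UniformSpace) x).
Proof.
move=> Ha HF Hc; have E x : fourier a x = F x by exact: fourier_csums.
split=> // x; apply: (continuous_ext (fun y => RtoC (F y))); first by move=> y; rewrite E.
exact: continuous_RtoC.
Qed.

Theorem theorem1 (p : nat) (p_prime : prime p) (p_mod3 : p = 1 %[mod 3]) :
  (* the closed form of d_{k,0} *)
  (forall k : Z, k <> 0%Z ->
     d p 0 k =
       ((Rcpow 3 (chi p k) - 1) * riemann_zeta (chi p k)
        / (chi p k * (1 + chi p k) * ln (INR p)))%C) /\
  (* the exact formula *)
  (forall N : nat, (0 < N)%nat ->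
     RtoC (INR (logn p (T N))) =
       (RtoC (INR N * logb p (2 / sqrt 3))
        + INR N * Phi p (logb p (INR N))
        + Psi p N
        + RtoC (1 / 9 * logb p (INR N))
        + RtoC (f0 p N))%C) /\
  (* (i) *)
  (forall x : R, Zstar_summable (fourier_term (c p) x)) /\
  (forall x : R, Phi p (x + 1) = Phi p x) /\
  (forall x : R, continuous (Phi p : R_UniformSpace -> C_UniformSpace) x) /\
  (* (ii) *)
  (forall j : Z, j = (-1)%Z \/ j = 0%Z \/ j = 1%Z ->
     (forall x : R, Zstar_summable (fourier_term (d p j) x)) /\
     (forall x : R, psi p j (x + 1) = psi p j x) /\
     (forall x : R, continuous (psi p j : R_UniformSpace -> C_UniformSpace) x)) /\
  bigO (fun N => Cmod (Psi p N)) (fun N => Rpower (INR N) (1 / 2) * ln (INR N)) /\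
  (* (iii) *)
  (forall j : Z, j = 1%Z \/ j = (-1)%Z ->
     bigO (fun N => g p j N - IZR j / (3 * ln (INR p))) (fun N => 1 / INR N)) /\
  is_lim_seq (f0 p)
    (1 / 3 * logb p (Gamma (1 / 3) / Gamma (2 / 3))
     + (INR p + 1) / (6 * (INR p - 1))).
Proof.
have Hp1 := prime_gt1 p_prime; have HP := INR_p_gt1 p Hp1; have HL := ln_p_pos p Hp1.
(* This is the condition 1 < p al for the smallest shift al = 1/3. *)
have HP3 : 3 < INR p.
  have : (4 <= p)%nat by clear -p_mod3 Hp1; move: p_mod3 Hp1; case: p => [|[|[|[|]]]].
  by move/leP/le_INR; rewrite /=; lra.
have [k1 [k2 [k3 [W1 W2 W3 EK EG]]]] := wst_relations.
have [S1 [F1 [C1 [K1 D1] X1]]] := fourier_package p (1 / 3) k1 (fun k => hurwitz_zeta (chi p k) (1 / 3))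
  Hp1 ltac:(lra) ltac:(lra) W1 (fun k Hk => zlim_third p k Hp1 Hk).
have [S2 [F2 [C2 [K2 D2] X2]]] := fourier_package p (2 / 3) k2 (fun k => hurwitz_zeta (chi p k) (-1 / 3))
  Hp1 ltac:(lra) ltac:(lra) W2 (fun k Hk => zlim_two_third p k Hp1 Hk).
have [S3 [F3 [C3 [K3 D3] X3]]] := fourier_package p (1 / 2) k3
  (fun k => (Rcpow 2 (chi p k) - 1) * riemann_zeta (chi p k))%C
  Hp1 ltac:(lra) ltac:(lra) W3 (fun k Hk => zlim_half p k Hp1 Hk).
have N1 x : continuous F1 x by exact: sqrt_holder_continuous D1.
have N2 x : continuous F2 x by exact: sqrt_holder_continuous D2.
have N3 x : continuous F3 x by exact: sqrt_holder_continuous D3.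
have S0 : ex_series (zmod (d p 0)) by exact: ex_series_zmod_plus S1 S2.
have Sc : ex_series (zmod (c p)).
  apply: ex_series_zmod_ext (fun k => c_split p k Hp1) _.
  exact: ex_series_zmod_plus (ex_series_zmod_plus _ _ S1 S2) (ex_series_zmod_scal (- 2)%C _ S3).
have [E1 T1] := fourier_real (d p 1) F1 S1 C1 N1.
have [E2 T2] := fourier_real (d p (-1)) F2 S2 C2 N2.
have [E0 T0] : (forall x, fourier (d p 0) x = (F1 x + F2 x)%R) /\
    (forall x, continuous (fourier (d p 0) : R_UniformSpace -> C_UniformSpace) x).
  apply: fourier_real => // u; last exact: continuous_plus.
  by rewrite RtoC_plus; exact: zpair_plus (C1 u) (C2 u).
have [Ec Tc] : (forall x, fourier (c p) x = (F1 x + F2 x - 2 * F3 x)%R) /\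
    (forall x, continuous (fourier (c p) : R_UniformSpace -> C_UniformSpace) x).
  apply: fourier_real => // u.
    apply: zpair_ext_star (fun k => c_split p k Hp1) _.
    have -> : RtoC (F1 u + F2 u - 2 * F3 u) = (F1 u + F2 u + (- 2) * F3 u)%C.
      by rewrite RtoC_minus RtoC_plus RtoC_mult; ring.
    exact: zpair_plus (zpair_plus _ _ _ _ _ (C1 u) (C2 u)) (zpair_scal _ _ _ _ (C3 u)).
  apply: continuous_minus; first exact: continuous_plus.
  by apply: continuous_scal_r (N3 u).
have EPsi N : Psi p N = RtoC ((INR N + 1 / 3) * F1 (logb p (INR N + 1 / 3))
    + (INR N - 1 / 3) * F2 (logb p (INR N - 1 / 3)) - INR N * (F1 (logb p (INR N)) + F2 (logb p (INR N)))).
  by rewrite /Psi /psi E1 E2 E0 -!RtoC_mult -RtoC_plus -RtoC_minus.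
split.
  by move=> k Hk; rewrite -zeta_thirds // /d /= /d_shift; rewrite -/(den p k); field; exact: den_neq0.
split.
  move=> N HN; have HN1 : 1 <= INR N by have := le_INR _ _ (elimT leP HN).
  rewrite EPsi /Phi Ec -RtoC_mult -!RtoC_plus; congr RtoC.
  have [H1 H2 H3] := Hinf_values p N p_prime p_mod3.
  have {X1} := X1 (INR N + 1 / 3) ltac:(lra); have {X2} := X2 (INR N - 1 / 3) ltac:(lra).
  have {X3} := X3 (INR N) ltac:(lra).
  rewrite H1 H2 H3 => R3 R2 R1.
  (* The two terms (N + 1/3) log_p(N + 1/3) / 6 and -(N - 1/3) log_p(N - 1/3) / 6 are rewritten with
     [g]; the leftover (1/6)(2/3) log_p N is the term with 1/9. *)
  have G1 : g p 1 N = (INR N + 1 / 3) * (logb p (INR N + 1 / 3) - logb p (INR N)).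
    have -> : INR N + 1 / 3 = INR N * (1 + 1 / (3 * INR N)) by field; lra.
    have Hq : 0 < 1 / (3 * INR N) by apply: Rdiv_lt_0_compat; lra.
    by rewrite /g /logb ln_mult; [field|lra|]; lra.
  have G2 : g p (-1) N = (INR N - 1 / 3) * (logb p (INR N - 1 / 3) - logb p (INR N)).
    have -> : INR N - 1 / 3 = INR N * (1 + -1 / (3 * INR N)) by field; lra.
    have Hq : - 1 < -1 / (3 * INR N).
      by apply: (Rmult_lt_reg_r (3 * INR N)); [lra|field_simplify; lra].
    by rewrite /g /logb ln_mult; [field|lra|]; lra.
  rewrite (logn_T_Rinf p N p_prime p_mod3 HN) /f0 G1 G2.
  have -> : logb p (Gamma (1 / 3) / Gamma (2 / 3)) = (k2 - k1) / ln (INR p) by rewrite EG.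
  have -> : logb p (2 / sqrt 3) = - (k1 + k2 - 2 * k3) / ln (INR p) by rewrite EK Ropp_involutive.
  (* Eliminating the three [Rinf] leaves a rational identity. The Stirling constants give N log_p(2
     / sqrt 3) and the Gamma term. The constant (p + 1) / (6 (p - 1)) is 2 p / (9 (p - 1)) from
     [Hinf], plus 1 / (9 (p - 1)) because (N + 1/3)^2 + (N - 1/3)^2 - 2 N^2 = 2/9, minus 1/18; the
     latter and -1 / (9 ln p) come from the terms (1/2 - al) (1/2 + 1 / ln p). *)
  have solve a b e : a + b = e -> a = e - b by lra.
  rewrite (solve _ _ _ R1) (solve _ _ _ R2) (solve _ _ _ R3).
  field; lra.
split; first by move=> x; exact: fourier_summable.
split; first by move=> x; exact: fourier_periodic.
split; first exact: Tc.
split.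
  move=> j Hj; split; first by move=> x; apply: fourier_summable; case: Hj => [->|[->|->]].
  split; first by move=> x; exact: fourier_periodic.
  by case: Hj => [->|[->|->]].
split.
  have M1 := fourier_bounded _ F1 S1 C1; have M2 := fourier_bounded _ F2 S2 C2.
  set m1 := Series _ in M1; set m2 := Series _ in M2.
  have Hm1 : 0 <= m1 by apply: Rle_trans (Rabs_pos _) (M1 0).
  have Hm2 : 0 <= m2 by apply: Rle_trans (Rabs_pos _) (M2 0).
  exists (K1 + m1 + (K2 + m2)), 4%nat => N /leP HN.
  rewrite EPsi Cmod_R Rabs_Rabsolu.
  have Hs1 : Rabs (1 / 3) <= 1 / 3 by rewrite Rabs_pos_eq; lra.
  have Hs2 : Rabs (- (1 / 3)) <= 1 / 3 by rewrite Rabs_Ropp.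
  have B1 := shifted_term_bound p N _ F1 K1 m1 Hp1 HN Hs1 D1 M1.
  have B2 := shifted_term_bound p N _ F2 K2 m2 Hp1 HN Hs2 D2 M2.
  have HB := sqrt_le_Rpower_ln N (ltnW HN).
  have Hsq := sqrt_pos (INR N).
  rewrite (Rabs_pos_eq (Rpower _ _ * _)); last by lra.
  have [HK1 _] := D1; have [HK2 _] := D2.
  apply: (Rle_trans _ ((K1 + m1 + (K2 + m2)) * sqrt (INR N))); last by apply: Rmult_le_compat_l; lra.
  move/Rabs_def2_le: B1 => B1; move/Rabs_def2_le: B2 => B2; rewrite -/(Rminus _ _) in B2.
  by apply: Rabs_le; lra.
split; last exact: f0_lim.
move=> j Hj; exists (/ (9 * ln (INR p))), 1%nat => N /leP HN.
apply: Rle_trans (g_bound p j N Hp1 Hj HN) _; rewrite (Rabs_pos_eq (1 / INR N)); first exact: Rle_refl.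
by apply: Rdiv_le_0_compat; [lra|apply: lt_0_INR; apply/leP].
Qed.
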